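(* Let $k\ge0$, $\mu\in\mathbb C$ with $\mathrm{Re}\,\mu>\mu_0=k(n-1)$, $\lambda\in\mathbb C^n$ with $\mathrm{Re}\,\lambda\ge0$ (componentwise), and $z\in H=\{z\in\mathbb C^n:\mathrm{Re}\,z>0\}$. Then (1) $\displaystyle\int_{\mathbb R_+^n}E(-z,x)\,\mathcal G(\lambda,x)\,\Delta(x)^{\mu-\mu_0-1}\omega(x)\,dx=\Gamma_n(\lambda+\rho+\underline\mu)\,\mathcal G\bigl(\lambda,\tfrac1z\bigr)\,\Delta(z)^{-\mu}$; (2) $\displaystyle\int_{\mathbb R_+^n}J(-z,x)\,\mathcal F(\lambda,x)\,\Delta(x)^{\mu-\mu_0-1}\omega(x)\,dx=\Gamma_n(\lambda+\rho+\underline\mu)\,\mathcal F\bigl(\lambda,\tfrac1z\bigr)\,\Delta(z)^{-\mu}$.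
   Context: Notation: $\langle z,w\rangle=\sum_i z_iw_i$; $\underline s=(s,\dots,s)$; $\mathbb R_+=(0,\infty)$; vector inequalities and $1/z$ componentwise; $s_{ij}$ the transposition of coordinates $i,j$; $\mathcal S_n$ acts by permuting coordinates. Dunkl operators: $T_\xi f(x)=\partial_\xi f(x)+k\sum_{i<j}(\xi_i-\xi_j)\frac{f(x)-f(s_{ij}x)}{x_i-x_j}$. Dunkl kernel $E(\lambda,z)$: unique holomorphic function on $\mathbb C^n\times\mathbb C^n$ with $T_\xi E(\lambda,\cdot)=\langle\lambda,\xi\rangle E(\lambda,\cdot)$ for all $\xi\in\mathbb R^n$, $E(\lambda,0)=1$; $J(\lambda,z)=\frac1{n!}\sum_\sigma E(\lambda,\sigma z)$. $\omega(x)=\prod_{i<j}|x_i-x_j|^{2k}$, $\Delta(z)=\prod_jz_j$, $\Delta(z)^s=\exp(s\sum_j\mathrm{Log}\,z_j)$ for $\mathrm{Re}\,z>0$. $\Gamma_n(\lambda)=d_n(k)\prod_{j=1}^n\Gamma(\lambda_j-k(j-1))$, $d_n(k)=\prod_{j=1}^n\Gamma(1+jk)/\Gamma(1+k)$. Cherednik kernel: $\mathbb R^n_0=\{x:\sum x_i=0\}$, $\mathbb C^n_0=\mathbb R^n_0+i\mathbb R^n_0$, $\pi(z)=z-\frac1n\langle z,\underline1\rangle\underline1$ ($\mathbb C$-linearly extended), $\Omega=\{x\in\mathbb R_0^n:|x_i-x_j|<\pi\ \forall i<j\}$, $V=\Omega+\mathbb R\underline1$, $\rho=-\frac k2(n-1,n-3,\dots,-n+1)$.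 For $\xi\in\mathbb R^n$, $D_\xi f(x)=\partial_\xi f(x)-\langle\rho,\xi\rangle f(x)+k\sum_{i<j}(\xi_j-\xi_i)\frac{f(x)-f(s_{ij}x)}{1-e^{-(x_j-x_i)}}$. It is known (Opdam, Krötz–Opdam) that there is a unique $G_0$ holomorphic on $\mathbb C^n_0\times(\mathbb R_0^n+i\Omega)$ with $D_\xi G_0(\lambda,\cdot)=\langle\lambda,\xi\rangle G_0(\lambda,\cdot)$ for all $\xi\in\mathbb R^n_0$ and $G_0(\lambda,0)=1$. Extended Cherednik kernel: $G(\lambda,z)=e^{\frac1n\langle z,\underline1\rangle\langle\lambda,\underline1\rangle}G_0(\pi(\lambda),\pi(z))$ ($\lambda\in\mathbb C^n$, $z\in\mathbb R^n+iV$); $F(\lambda,z)=\frac1{n!}\sum_\sigma G(\lambda,\sigma z)$. For $z\in H$ with componentwise principal logarithm $\log z$: $\mathcal G(\lambda,z)=G(\lambda,\log z)$, $\mathcal F(\lambda,z)=F(\lambda,\log z)$. *)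

(* Defs.v *)
From mathcomp Require Import all_boot all_order all_algebra all_fingroup.
From mathcomp Require Import all_classical all_reals all_analysis.
From mathcomp Require Export complex.
Set Implicit Arguments. Unset Strict Implicit. Unset Printing Implicit Defensive.
Import Order.TTheory GRing.Theory Num.Theory.
Local Open Scope ring_scope.
Local Open Scope complex_scope.

Section Defs.
Variable R : realType.
Local Notation C := R[i].

Definition cnorm (z : C) : R := Num.sqrt (complex.Re z ^+ 2 + complex.Im z ^+ 2).
Definition toC (x : R) : C := x%:C.
Definition cexp (z : C) : C :=
  (expR (complex.Re z) * cos (complex.Im z)) +i* (expR (complex.Re z) * sin (complex.Im z)).
(* principal logarithm, used only on the right half plane complex.Re z > 0,
   where Arg z = atan (complex.Im z / complex.Re z) *)
Definition cLog (z : C) : C := ln (cnorm z) +i* atan (complex.Im z / complex.Re z).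

Definition Cn (n : nat) := 'I_n -> C.
Definition Rn (n : nat) := 'I_n -> R.
Definition toCn n (x : Rn n) : Cn n := fun i => toC (x i).
Definition cvadd n (u v : Cn n) : Cn n := fun i => u i + v i.
Definition cvscale n (a : C) (v : Cn n) : Cn n := fun i => a * v i.
Definition cvopp n (v : Cn n) : Cn n := fun i => - v i.
Definition cvinv n (v : Cn n) : Cn n := fun i => (v i)^-1.
Definition cvlog n (v : Cn n) : Cn n := fun i => cLog (v i).
Definition cvconst n (s : C) : Cn n := fun _ => s.
Definition cvzero n : Cn n := fun _ => 0.
Definition cdot n (u v : Cn n) : C := \sum_(i < n) u i * v i.
Definition unitv n (j : 'I_n) : Cn n := fun i => if i == j then 1 else 0.
Definition sw n (i j : 'I_n) (v : Cn n) : Cn n := fun l => v (tperm i j l).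
Definition pact n (s : 'S_n) (v : Cn n) : Cn n := fun l => v (s l).

Definition has_dir_deriv n (f : Cn n -> C) (z : Cn n) (xi : Rn n) (L : C) :=
  forall eps : R, 0 < eps -> exists2 delta : R, 0 < delta &
    forall t : R, 0 < `|t| < delta ->
      cnorm ((f (cvadd z (cvscale (toC t) (toCn xi))) - f z) / toC t - L) < eps.

(* A function of (lam, z) in C^n x C^n is holomorphic on the set U (contained
   in the complex affine subspace spanned by directions D, relatively open
   there): it is continuous on U (relative to U) and has complex partial
   derivatives along every direction of D at every point of U.  (Continuous +
   separately holomorphic = holomorphic, Osgood's lemma.) *)
Definition holo2 n (U : Cn n -> Cn n -> Prop) (D : seq (Cn n * Cn n))
    (f : Cn n -> Cn n -> C) :=
  (forall a b, U a b -> forall eps : R, 0 < eps -> exists2 delta : R, 0 < delta &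
     forall a' b', U a' b' -> (forall i, cnorm (a' i - a i) < delta) ->
       (forall i, cnorm (b' i - b i) < delta) -> cnorm (f a' b' - f a b) < eps)
  /\
  (forall a b, U a b -> forall d, d \in D -> exists L : C,
     forall eps : R, 0 < eps -> exists2 delta : R, 0 < delta &
       forall h : C, 0 < cnorm h < delta ->
         cnorm ((f (cvadd a (cvscale h d.1)) (cvadd b (cvscale h d.2)) - f a b) / h
                - L) < eps).

Definition distinct_coords n (z : Cn n) := forall i j : 'I_n, i != j -> z i != z j.

Definition Rdot n (xi : Rn n) (v : Cn n) : C := \sum_(i < n) toC (xi i) * v i.

Definition is_dunkl_kernel n (k : R) (E : Cn n -> Cn n -> C) :=
  holo2 (fun _ _ => True)
    ([seq (unitv j, @cvzero n) | j <- enum 'I_n] ++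
     [seq (@cvzero n, unitv j) | j <- enum 'I_n]) E
  /\ (forall lam, E lam (@cvzero n) = 1)
  /\ (forall (lam : Cn n) (xi : Rn n) (x : Cn n), distinct_coords x ->
        exists L, has_dir_deriv (E lam) x xi L /\
          L + toC k * \sum_(i < n) \sum_(j < n | (i < j)%N)
               toC (xi i - xi j) * (E lam x - E lam (sw i j x)) / (x i - x j)
          = Rdot xi lam * E lam x).

Definition Jker n (E : Cn n -> Cn n -> C) (lam z : Cn n) : C :=
  (n`!%:R)^-1 * \sum_(s : 'S_n) E lam (pact s z).

Definition in_C0 n (z : Cn n) := \sum_(i < n) z i = 0.
Definition in_R0 n (x : Rn n) := \sum_(i < n) x i = 0.
Definition imV n (z : Cn n) := forall i j : 'I_n, (i < j)%N -> `|complex.Im (z i) - complex.Im (z j)| < pi.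
Definition in_tube0 n (z : Cn n) := in_C0 z /\ imV z.

Definition rho n (k : R) : Rn n := fun j => - (k / 2) * ((n.-1)%:R - 2 * (j : nat)%:R).

Definition is_cherednik0 n (k : R) (G0 : Cn n -> Cn n -> C) :=
  holo2 (fun lam z => in_C0 lam /\ in_tube0 z)
    ([seq (cvadd (unitv ij.1) (cvopp (unitv ij.2)), @cvzero n)
        | ij <- [seq (i, j) | i <- enum 'I_n, j <- enum 'I_n]] ++
     [seq (@cvzero n, cvadd (unitv ij.1) (cvopp (unitv ij.2)))
        | ij <- [seq (i, j) | i <- enum 'I_n, j <- enum 'I_n]]) G0
  /\ (forall lam, in_C0 lam -> G0 lam (@cvzero n) = 1)
  /\ (forall (lam : Cn n) (xi : Rn n) (x : Cn n),
        in_C0 lam -> in_R0 xi -> in_tube0 x -> distinct_coords x ->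
        exists L, has_dir_deriv (G0 lam) x xi L /\
          L - Rdot xi (toCn (@rho n k)) * G0 lam x
            + toC k * \sum_(i < n) \sum_(j < n | (i < j)%N)
               toC (xi j - xi i) * (G0 lam x - G0 lam (sw i j x))
                 / (1 - cexp (- (x j - x i)))
          = Rdot xi lam * G0 lam x).

Definition cproj n (z : Cn n) : Cn n :=
  fun i => z i - (n%:R)^-1 * cdot z (@cvconst n 1).

Definition Gker n (G0 : Cn n -> Cn n -> C) (lam z : Cn n) : C :=
  cexp ((n%:R)^-1 * cdot z (@cvconst n 1) * cdot lam (@cvconst n 1))
  * G0 (cproj lam) (cproj z).
Definition Fker n (G0 : Cn n -> Cn n -> C) (lam z : Cn n) : C :=
  (n`!%:R)^-1 * \sum_(s : 'S_n) Gker G0 lam (pact s z).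
Definition calG n G0 (lam z : Cn n) : C := Gker G0 lam (cvlog z).
Definition calF n G0 (lam z : Cn n) : C := Fker G0 lam (cvlog z).

Definition Deltapow n (z : Cn n) (s : C) : C := cexp (s * \sum_(j < n) cLog (z j)).
Definition omega n (k : R) (x : Rn n) : R :=
  \prod_(i < n) \prod_(j < n | (i < j)%N) (`|x i - x j| `^ (2 * k)).

Definition Rpos : set R := `]0, +oo[%classic.

Definition vcons m (t : R) (y : Rn m) : Rn m.+1 :=
  fun i => match unlift ord0 i with None => t | Some j => y j end.

Fixpoint iint_nneg (m : nat) : (Rn m -> \bar R) -> \bar R :=
  match m return (Rn m -> \bar R) -> \bar R with
  | 0 => fun f => f (fun _ => 0)
  | m'.+1 => fun f =>
      (\int[lebesgue_measure]_(t in Rpos) iint_nneg (fun y => f (vcons t y)))%E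
  end.

Fixpoint iint_real (m : nat) : (Rn m -> R) -> R :=
  match m return (Rn m -> R) -> R with
  | 0 => fun f => f (fun _ => 0)
  | m'.+1 => fun f =>
      Rintegral lebesgue_measure Rpos (fun t => iint_real (fun y => f (vcons t y)))
  end.

(* absolute integrability over R_+^n (finite integral of |f|, Tonelli) *)
Definition cintegrable n (f : Rn n -> C) := (iint_nneg (fun x => (cnorm (f x))%:E) < +oo)%E.
Definition cintegral n (f : Rn n -> C) : C :=
  iint_real (fun x => complex.Re (f x)) +i* iint_real (fun x => complex.Im (f x)).

(* Euler's integral, valid for complex.Re s > 0 (the only arguments used below) *)
Definition cGamma (s : C) : C :=
  cintegral (n := 1) (fun x => cexp ((s - 1) * toC (ln (x ord0))) * toC (expR (- x ord0))).
Definition dnk (n : nat) (k : R) : C :=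
  \prod_(j < n) (cGamma (toC (1 + (j.+1)%:R * k)) / cGamma (toC (1 + k))).
Definition Gamma_n n (k : R) (lam : Cn n) : C :=
  dnk n k * \prod_(j < n) cGamma (lam j - toC (k * (j : nat)%:R)).

End Defs.

(* Main.v *)
(* Write g = calG(lam, -) and W = Delta^(a-1) omega with mu = a + k(n-1), where mu may be
   assumed real (absorb i Im(mu) into lam), and let Phi(z) be the integral of E(-z, x) g(x) W(x).

   Integration by parts, applied to the Dunkl equation of E(-z, -) and to the Cherednik
   equation of g, expresses z_l times the integral of x_l E(-z, x) g(x) W(x) through the values
   Phi(s_lj z).  Combined with a first order expansion of E in its spectral variable (a Gronwall
   estimate for the radial Dunkl system), this says that Phi(exp(-zeta)) exp(-mu sum zeta) solves
   the Cherednik system of G(lam, zeta).  By uniqueness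
   Phi(z) = Phi(1) G(lam, -log z) Delta(z)^(-mu).

   Since E(-1, x) = exp(-sum x), the constant Phi(1) = c(a) is the integral of exp(-sum x) g W.
   Integrating by parts against x_0 ... x_(l-1) g gives the quotient c(a+1) / c(a) as a product of
   linear factors.  As N grows, the probability density proportional to exp(-sum x) Delta^(a+N-1) omega
   concentrates, after rescaling by a+N, at (1, ..., 1), where the homogeneous function g is 1;
   comparing with the case n = 1 of the same asymptotics, which is that of the Gamma function,
   evaluates c(a) relative to its value for g = 1.  The latter is computed by induction on n from
   the boundary flux of exp(-sum x) omega through x_0 = 0.  Part (2) is the average of part (1)
   over the symmetric group. *)

Require Import Defs.
From HB Require Import structures.
From mathcomp Require Import all_boot all_order all_algebra all_fingroup.
From mathcomp Require Import all_classical all_reals all_analysis.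
From mathcomp Require Import measurable_realfun complex.
From mathcomp Require Import ring lra zify.
Set Implicit Arguments. Unset Strict Implicit. Unset Printing Implicit Defensive.
Import Order.TTheory GRing.Theory Num.Theory.
Import numFieldNormedType.Exports.
Local Open Scope classical_set_scope.
Local Open Scope ring_scope.

(** The kernels are known only through their equations at points with distinct coordinates, and
    these equations couple the value at x with the values at all s_ij x. Every estimate therefore
    treats the n! values on a permutation orbit as one vector: for k >= 0 the reflection terms are
    dissipative for its Euclidean norm, so their singular coefficients do no harm, and one Gronwall
    inequality yields growth bounds, uniqueness, equivariance and the Taylor expansion in the
    spectral variable. Points with coinciding coordinates are reached by continuity or discarded as
    a null set. Two obstacles shape the integral part. Terms containing 1/(x_l - x_j) are integrable
    only because the weight carries |x_l - x_j|^(2k) and the term itself a factor k; they are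
    dominated, uniformly in x_j, by a function with an explicit primitive. And the integrals of the
    statement are iterated ones, so the measure is built by the same recursion and every section has
    to be dominated. The condition Re lam >= 0 is what gives [calG] at most polynomial growth on the
    positive orthant. *)

Definition vec_display : measure_display. Proof. exact: default_measure_display. Qed.
(* A copy of [Rn], so that the measurable structure below does not leak to all functions on [ordinal n]. *)
Definition vec (R : realType) (n : nat) : Type := Rn R n.

(** * Lebesgue measure on finite real vectors *)

Section VecMeasurable.
Variables (R : realType) (n : nat).
HB.instance Definition _ := Pointed.on (vec R n).
Definition vcoord (i : 'I_n) (x : vec R n) : measurableTypeR R := x i.
Definition vec_measurable : set (set (vec R n)) := g_sigma_preimage vcoord.
Let vec_set0 : vec_measurable set0. Proof. exact: sigma_algebra0. Qed.
Let vec_setC A : vec_measurable A -> vec_measurable (~` A).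
Proof. exact: sigma_algebraC. Qed.
Let vec_bigcup (F : (set (vec R n))^nat) : (forall i, vec_measurable (F i)) ->
  vec_measurable (\bigcup_i (F i)).
Proof. exact: sigma_algebra_bigcup. Qed.
HB.instance Definition _ := @isMeasurable.Build vec_display (vec R n) vec_measurable
  vec_set0 vec_setC vec_bigcup.

Lemma measurable_vcoord (i : 'I_n) : measurable_fun [set: vec R n] (vcoord i).
Proof.
move=> _ Y mY; rewrite setTI; apply: sub_sigma_algebra => /=.
rewrite -bigcup_seq/=; exists i => /=; first by rewrite mem_index_enum.
by exists Y => //; rewrite setTI.
Qed.

Lemma measurable_vecP d (T : measurableType d) (f : T -> vec R n) :
  measurable_fun [set: T] f <->
  forall i, measurable_fun [set: T] (fun t => f t i : measurableTypeR R).
Proof.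
split=> [mf i|mf].
  by apply: (measurableT_comp (measurable_vcoord i) mf).
have H : g_sigma_preimage (fun i => vcoord i \o f) `<=` measurable.
  apply: smallest_sub; first exact: sigma_algebra_measurable.
  rewrite -bigcup_seq; apply: bigcup_sub => i _.
  by move=> A [B mB <-]; exact: mf.
move=> _ A mA; apply: H; rewrite g_sigma_preimage_comp.
by exists A.
Qed.
End VecMeasurable.

Section VecMeasure.
Variable R : realType.
Notation mu := (@lebesgue_measure R).

Definition vjoin n (p : measurableTypeR R * vec R n) : vec R n.+1 := vcons p.1 p.2.
Definition vsplit n (x : vec R n.+1) : measurableTypeR R * vec R n :=
  (x ord0, fun i => x (lift ord0 i)).

Lemma vcons0 n t (y : Rn R n) : vcons t y ord0 = t.
Proof. by rewrite /vcons unlift_none. Qed.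

Lemma vconsS n t (y : Rn R n) i : vcons t y (lift ord0 i) = y i.
Proof. by rewrite /vcons liftK. Qed.

Lemma vcons_eta n (x : Rn R n.+1) : vcons (x ord0) (fun i => x (lift ord0 i)) = x.
Proof.
apply/funext => i; case: (unliftP ord0 i) => [j|] ->; by rewrite ?vcons0 ?vconsS.
Qed.

Lemma vjoinK n : cancel (@vjoin n) (@vsplit n).
Proof.
case=> t y; rewrite /vsplit /vjoin /= vcons0; congr (_, _).
by apply/funext => i; rewrite vconsS.
Qed.

Lemma measurable_vjoin n : measurable_fun setT (@vjoin n).
Proof.
apply/measurable_vecP => i; case: (unliftP ord0 i) => [j|] ->.
- rewrite (_ : (fun _ => _) = vcoord j \o snd); last first.
    by apply/funext => -[t y]; rewrite /vjoin/= vconsS.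
  apply: measurableT_comp => //; exact: measurable_vcoord.
- rewrite (_ : (fun _ => _) = fst); last by apply/funext => -[t y]; rewrite /vjoin/= vcons0.
  exact: measurable_fst.
Qed.

Lemma measurable_vsplit n : measurable_fun setT (@vsplit n).
Proof.
apply: measurable_fun_pair; first exact: measurable_vcoord.
by apply/measurable_vecP => i; exact: measurable_vcoord.
Qed.

Section step.
Variables (n : nat) (nu : {sigma_finite_measure set (vec R n) -> \bar R}).
Definition vstep := pushforward (mu \x nu)%E (@vjoin n).
Let pf := measure_function_pushforward__canonical__measure_function_Measure
  (mu \x nu)%E (@measurable_vjoin n).
Let vstep0 : vstep set0 = 0%E. Proof. exact: (measure0 pf). Qed.
Let vstep_ge0 A : (0 <= vstep A)%E. Proof. exact: (measure_ge0 pf). Qed.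
Let vstep_sigma_additive : semi_sigma_additive vstep.
Proof. exact: (@measure_semi_sigma_additive _ _ _ pf). Qed.
HB.instance Definition _ := isMeasure.Build _ _ _ vstep
  vstep0 vstep_ge0 vstep_sigma_additive.
(** Both exhausting sequences increase, so products with a common index already cover the plane;
    [vsplit] carries them over to vectors. *)
Lemma vstep_sigma_finite : sigma_finite setT vstep.
Proof.
have /sigma_finiteP[F [TF ndF Foo]] := sigma_finiteT mu.
have /sigma_finiteP[G [TG ndG Goo]] := sigma_finiteT nu.
exists (fun i => @vsplit n @^-1` (F i `*` G i)).
  rewrite -preimage_bigcup; apply/seteqP; split => // x _ /=.
  have [i _ Fi] : (\bigcup_i F i) (x ord0) by rewrite -TF.
  have [j _ Gj] : (\bigcup_i G i) (fun i => x (lift ord0 i)) by rewrite -TG.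
  exists (maxn i j) => //; split => /=.
    by move: Fi; exact/subsetPset/ndF/leq_maxl.
  by move: Gj; exact/subsetPset/ndG/leq_maxr.
move=> i; have [mF Fi] := Foo i; have [mG Gi] := Goo i; split.
  rewrite -[X in measurable X]setTI; apply: measurable_vsplit => //.
  exact: measurableX.
rewrite /vstep /pushforward -comp_preimage.
rewrite (_ : _ \o _ = id); last by apply/funext => p; exact: vjoinK.
rewrite preimage_id.
by rewrite product_measure1E// lte_mul_pinfty// ge0_fin_numE.
Qed.
HB.instance Definition _ := Measure_isSigmaFinite.Build _ _ _ vstep vstep_sigma_finite.
End step.

(** The recursion through [vcons] lets Tonelli's theorem peel off coordinates in the order used by
    [iint_nneg] and [iint_real]. *)
Fixpoint vmeas n : {sigma_finite_measure set (vec R n) -> \bar R} :=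
  match n return {sigma_finite_measure set (vec R n) -> \bar R} with
  | 0 => [the {sigma_finite_measure set (vec R 0) -> \bar R} of
            dirac ((fun _ => 0) : vec R 0)]
  | m.+1 => [the {sigma_finite_measure set (vec R m.+1) -> \bar R} of vstep (vmeas m)]
  end.

Definition vpos n : set (vec R n) := [set x | forall i, 0 < x i].

Lemma measurable_vpos n : measurable (@vpos n).
Proof.
rewrite (_ : @vpos n = \bigcap_(i in [set: 'I_n]) (@vcoord R n i) @^-1` `]0, +oo[%classic).
  apply: fin_bigcap_measurable => // i _.
  by rewrite -[X in measurable X]setTI; apply: measurable_vcoord.
apply/seteqP; split => x /=.
  by move=> H i _ /=; rewrite /vcoord in_itv/= H.
by move=> H i; have := H i I; rewrite /= /vcoord in_itv/= andbT.
Qed.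

Lemma vpos_vcons n t (y : vec R n) : vpos (vcons t y) <-> 0 < t /\ vpos y.
Proof.
split=> [H|[t0 y0] i].
  split; first by have := H ord0; rewrite vcons0.
  by move=> i; have := H (lift ord0 i); rewrite vconsS.
by case: (unliftP ord0 i) => [j|] ->; rewrite ?vcons0 ?vconsS.
Qed.

Lemma vmeas0_integral (f : vec R 0 -> \bar R) : (forall x, 0 <= f x)%E ->
  (\int[vmeas 0]_(x in @vpos 0) f x = f (fun _ => 0%R))%E.
Proof.
move=> f0.
have e (x : vec R 0) : x = (fun _ => 0) by apply/funext => -[].
rewrite (_ : @vpos 0 = setT); last by apply/seteqP; split => // x _ [].
rewrite (_ : f = cst (f (fun _ => 0))); last by apply/funext => x; rewrite /= [in LHS](e x).
rewrite integral_cst// [X in (_ * X)%E](_ : _ = 1%E) ?mule1//.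
by rewrite /= /dirac indicE in_setT.
Qed.

Lemma vmeas_tonelliT n (f : vec R n.+1 -> \bar R) : measurable_fun setT f ->
  (forall x, 0 <= f x)%E ->
  (\int[vmeas n.+1]_x f x = \int[mu]_t \int[vmeas n]_y f (vcons t y))%E /\
  (\int[vmeas n.+1]_x f x = \int[vmeas n]_y \int[mu]_t f (vcons t y))%E.
Proof.
move=> mf f0.
have mj := @measurable_vjoin n.
have -> : (\int[vmeas n.+1]_x f x = \int[(mu \x vmeas n)%E]_p f (vjoin p))%E.
  by rewrite [LHS]ge0_integral_pushforward.
have mfj : measurable_fun setT (f \o @vjoin n) by exact: measurableT_comp.
have fj0 p : (0 <= (f \o @vjoin n) p)%E by exact: f0.
by split; [rewrite (fubini_tonelli1 _ mfj fj0)|rewrite (fubini_tonelli2 _ mfj fj0)].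
Qed.

Lemma vmeas_tonelli n (f : vec R n.+1 -> \bar R) : measurable_fun (@vpos n.+1) f ->
  (forall x, vpos x -> 0 <= f x)%E ->
  (\int[vmeas n.+1]_(x in @vpos n.+1) f x =
   \int[mu]_(t in @Rpos R) \int[vmeas n]_(y in @vpos n) f (vcons t y))%E /\
  (\int[vmeas n.+1]_(x in @vpos n.+1) f x =
   \int[vmeas n]_(y in @vpos n) \int[mu]_(t in @Rpos R) f (vcons t y))%E.
Proof.
move=> mf f0.
have mp := @measurable_vpos n.+1.
rewrite integral_mkcond.
have [] := @vmeas_tonelliT n (f \_ (@vpos n.+1)).
- by apply/(measurable_restrictT _ _).1.
- by move=> x; rewrite patchE; case: ifPn => // /set_mem; exact: f0.
have fE t y : (f \_ (@vpos n.+1)) (vcons t y) =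
    if (t \in @Rpos R) && (y \in @vpos n) then f (vcons t y) else 0%E.
  rewrite patchE; congr (if _ then _ else _); apply/idP/andP.
  + by move=> /set_mem /vpos_vcons[t0 y0]; split; apply/mem_set => //=; rewrite /Rpos/= in_itv/= t0.
  + move=> [/set_mem]; rewrite /Rpos/= in_itv/= andbT => t0 /set_mem y0.
    by apply/mem_set/vpos_vcons.
move=> e1 e2; split.
  rewrite e1 [RHS]integral_mkcond; apply: eq_integral => t _.
  rewrite patchE; case: ifPn => tp.
    rewrite [RHS]integral_mkcond; apply: eq_integral => y _.
    by rewrite fE tp /= patchE.
  by rewrite integral0_eq// => y _; rewrite fE (negbTE tp).
rewrite e2 [RHS]integral_mkcond; apply: eq_integral => y _.
rewrite patchE; case: ifPn => yp.
  rewrite [RHS]integral_mkcond; apply: eq_integral => t _.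
  by rewrite fE yp andbT /= patchE.
by rewrite integral0_eq// => t _; rewrite fE (negbTE yp) andbF.
Qed.

End VecMeasure.

(** * Permutations and slices of the positive orthant *)

Section VecPerm.
Variable R : realType.
Notation mu := (@lebesgue_measure R).

Definition vperm n (s : 'S_n) (x : vec R n) : vec R n := fun i => x (s i).

Lemma measurable_vperm n (s : 'S_n) : measurable_fun setT (@vperm n s).
Proof. by apply/measurable_vecP => i; exact: measurable_vcoord. Qed.

Let invariant n (s : 'S_n) := forall f : vec R n -> \bar R,
  measurable_fun setT f -> (forall x, 0 <= f x)%E ->
  (\int[vmeas R n]_x f (vperm s x) = \int[vmeas R n]_x f x)%E.

Lemma vperm_invM n (s t : 'S_n) : invariant s -> invariant t -> invariant (s * t)%g.
Proof.
move=> hs ht f mf f0.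
rewrite -[RHS]hs//.
rewrite -[RHS](ht (f \o vperm s))//=; last first.
  by apply: measurableT_comp => //; exact: measurable_vperm.
apply: eq_integral => x _; congr f.
by apply/funext => i; rewrite /vperm permM.
Qed.

Lemma vperm_inv_lift n (s : 'S_n) : invariant s -> invariant (lift_perm ord0 ord0 s).
Proof.
move=> hs f mf f0.
have mfs : measurable_fun setT (f \o vperm (lift_perm ord0 ord0 s)).
  by apply: measurableT_comp => //; exact: measurable_vperm.
rewrite (vmeas_tonelliT mfs _).1 /=; last by move=> x; exact: f0.
rewrite (vmeas_tonelliT mf f0).1.
apply: eq_integral => t _.
rewrite -[RHS]hs//.
- apply: eq_integral => y _; congr f; apply/funext => i; rewrite /vperm.
  case: (unliftP ord0 i) => [j|] ->; first by rewrite lift_perm_lift !vconsS.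
  by rewrite lift_perm_id !vcons0.
- rewrite (_ : (fun _ => _) = f \o (@vjoin R n \o (fun y => (t, y)))); last first.
    exact/funext.
  apply: measurableT_comp => //; apply: measurableT_comp; first exact: measurable_vjoin.
  exact: measurable_fun_pair.
Qed.

(** With the integral over the remaining coordinates taken innermost, this is Tonelli's theorem for
    the two scalar variables. *)
Lemma vperm_inv_tperm01 n : invariant (tperm (ord0 : 'I_n.+2) (lift ord0 ord0)).
Proof.
set s := tperm _ _ => f mf f0.
have mfs : measurable_fun setT (f \o vperm s).
  by apply: measurableT_comp => //; exact: measurable_vperm.
have ml t (g : vec R n.+2 -> \bar R) : measurable_fun setT g ->
    measurable_fun setT (fun y : vec R n.+1 => g (vcons t y)).
  move=> mg; rewrite (_ : (fun _ => _) = g \o (@vjoin R _ \o (fun y => (t, y)))); last first.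
    exact/funext.
  apply: measurableT_comp => //; apply: measurableT_comp; first exact: measurable_vjoin.
  exact: measurable_fun_pair.
have E2 (g : vec R n.+2 -> \bar R) : measurable_fun setT g -> (forall x, 0 <= g x)%E ->
    (\int[vmeas R n.+2]_x g x =
     \int[mu]_t \int[mu]_u \int[vmeas R n]_y g (vcons t (vcons u y : vec R n.+1)))%E.
  move=> mg g0; rewrite (vmeas_tonelliT mg g0).1.
  apply: eq_integral => t _.
  by rewrite (vmeas_tonelliT (ml t _ mg) _).1.
rewrite (E2 _ mf f0) (E2 _ mfs); last by move=> x; exact: f0.
pose h (p : (measurableTypeR R * measurableTypeR R) * vec R n) :=
  f (vcons p.1.1 (vcons p.1.2 p.2 : vec R n.+1)).
have mh : measurable_fun setT h.
  rewrite (_ : h = f \o (@vjoin R _ \o (fun p => (p.1.1, @vjoin R n (p.1.2, p.2))))); last first.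
    exact/funext.
  apply: measurableT_comp => //; apply: measurableT_comp; first exact: measurable_vjoin.
  apply: measurable_fun_pair; first exact: measurableT_comp.
  apply: measurableT_comp; first exact: measurable_vjoin.
  by apply: measurable_fun_pair => //; exact: measurableT_comp.
have h0 p : (0 <= h p)%E by exact: f0.
have mG : measurable_fun setT (fubini_F (vmeas R n) h).
  exact: measurable_fun_fubini_tonelli_F.
have G0 (p : measurableTypeR R * measurableTypeR R) : (0 <= fubini_F (vmeas R n) h p)%E.
  by apply: integral_ge0 => y _; exact: h0.
transitivity (\int[mu]_t \int[mu]_u fubini_F (vmeas R n) h (u, t))%E.
  apply: eq_integral => t _; apply: eq_integral => u _; apply: eq_integral => y _.
  rewrite /h /=; congr f; apply/funext => i; rewrite /vperm.
  case: (unliftP ord0 i) => [j|] ->; last by rewrite tpermL vconsS !vcons0.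
  case: (unliftP ord0 j) => [l|] ->; last by rewrite tpermR vconsS !vcons0.
  by rewrite tpermD ?vconsS//.
by rewrite -(fubini_tonelli _ mG G0).
Qed.

Lemma vperm_inv_tperm n (i j : 'I_n) : invariant (tperm i j).
Proof.
elim: n i j => [[]//|n IH i j].
have d0 (j' : 'I_n) : invariant (tperm ord0 (lift ord0 j')).
  case: n IH {i j} j' => [_ []//|n IH j'].
  (* Conjugation by this permutation turns the exchange of the first two coordinates into that of 0
     and [lift ord0 j']. *)
  pose c : 'S_n.+2 := lift_perm ord0 ord0 (tperm ord0 j').
  have -> : tperm ord0 (lift ord0 j') = (c^-1 * tperm ord0 (lift ord0 ord0) * c)%g.
    have := tpermJ ord0 (lift ord0 ord0) c.
    by rewrite /c lift_perm_id lift_perm_lift tpermL => <-; rewrite conjgE mulgA.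
  apply: vperm_invM; last exact/vperm_inv_lift/IH.
  apply: vperm_invM; last exact: vperm_inv_tperm01.
  have -> : (c^-1)%g = lift_perm ord0 ord0 (tperm ord0 j').
    by rewrite -[in RHS]tpermV lift_permV.
  exact/vperm_inv_lift/IH.
case: (unliftP ord0 i) => [i'|] ->; case: (unliftP ord0 j) => [j'|] ->.
- have -> : tperm (lift ord0 i') (lift ord0 j') = lift_perm ord0 ord0 (tperm i' j').
    apply/permP => x; case: (unliftP ord0 x) => [x'|] ->.
      rewrite lift_perm_lift; case: (tpermP i' j' x') => [->|->|h1 h2]; rewrite ?tpermL ?tpermR//.
      by rewrite tpermD//; apply/eqP => /lift_inj e; [apply: h1|apply: h2]; rewrite e.
    by rewrite lift_perm_id tpermD// eq_sym neq_lift.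
  exact/vperm_inv_lift/IH.
- by rewrite tpermC; exact: d0.
- exact: d0.
- rewrite tperm1 => f mf f0; apply: eq_integral => x _; congr f.
  by apply/funext => l; rewrite /vperm perm1.
Qed.

Lemma vperm_inv n (s : 'S_n) : invariant s.
Proof.
have [ts -> _] := prod_tpermP s.
elim: ts => [|[i j] ts IH].
  rewrite big_nil => f mf f0; apply: eq_integral => x _; congr f.
  by apply/funext => l; rewrite /vperm perm1.
by rewrite big_cons; apply: vperm_invM => //; exact: vperm_inv_tperm.
Qed.

Lemma vpos_vperm n (s : 'S_n) x : vpos (vperm s x) <-> vpos x.
Proof.
split=> H i; last exact: H.
by have := H (s^-1%g i); rewrite /vperm permKV.
Qed.

Lemma ge0_integral_vperm n (s : 'S_n) (f : vec R n -> \bar R) :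
  measurable_fun (@vpos R n) f -> (forall x, vpos x -> 0 <= f x)%E ->
  (\int[vmeas R n]_(x in @vpos R n) f (vperm s x) = \int[vmeas R n]_(x in @vpos R n) f x)%E.
Proof.
move=> mf f0; rewrite [RHS]integral_mkcond -[RHS](vperm_inv s).
- rewrite integral_mkcond; apply: eq_integral => x _.
  rewrite !patchE; congr (if _ then _ else _).
  apply/idP/idP => /set_mem h; apply/mem_set; first exact/(vpos_vperm s x).2.
  exact/(vpos_vperm s x).1.
- by apply/(measurable_restrictT _ _).1 => //; exact: measurable_vpos.
- by move=> x; rewrite patchE; case: ifPn => // /set_mem; exact: f0.
Qed.

Lemma measurable_vperm_pos n (s : 'S_n) d (T : measurableType d) (f : vec R n -> T) :
  measurable_fun (@vpos R n) f -> measurable_fun (@vpos R n) (f \o vperm s).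
Proof.
move=> mf; apply: (measurable_comp _ _ mf).
- exact: measurable_vpos.
- by move=> _ [x /= xp <-]; apply: (vpos_vperm s x).2.
- by apply: measurable_funTS; exact: measurable_vperm.
Qed.

Lemma integrable_vperm n (s : 'S_n) (f : vec R n -> \bar R) :
  (vmeas R n).-integrable (@vpos R n) f ->
  (vmeas R n).-integrable (@vpos R n) (f \o vperm s).
Proof.
move=> /integrableP[mf fi]; apply/integrableP; split; first exact: measurable_vperm_pos.
have -> : (\int[vmeas R n]_(x in @vpos R n) `|(f \o vperm s) x|)%E =
  (\int[vmeas R n]_(x in @vpos R n) (abse \o f) (vperm s x))%E by [].
rewrite ge0_integral_vperm; [exact: fi|by apply: measurableT_comp|].
by move=> x _; exact: abse_ge0.
Qed.

Lemma integral_vperm n (s : 'S_n) (f : vec R n -> \bar R) :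
  (vmeas R n).-integrable (@vpos R n) f ->
  (\int[vmeas R n]_(x in @vpos R n) f (vperm s x) = \int[vmeas R n]_(x in @vpos R n) f x)%E.
Proof.
move=> fi; have mf := measurable_int _ fi.
rewrite [RHS]integralE [LHS]integralE.
have mfp : measurable_fun (@vpos R n) (f^\+)%E by exact: measurable_funepos.
have mfn : measurable_fun (@vpos R n) (f^\-)%E by exact: measurable_funeneg.
rewrite -(ge0_integral_vperm s mfp); last by [].
rewrite -(ge0_integral_vperm s mfn); last by [].
by rewrite !unlock.
Qed.

End VecPerm.

(** * Iterated integrals, slices in one coordinate, and the diagonals *)

Section VecIntegral.
Variable R : realType.
Notation mu := (@lebesgue_measure R).
Notation vpos n := (@vpos R n).
Notation Rpos := (@Rpos R).

Lemma RposP (t : R) : Rpos t <-> 0 < t.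
Proof. by rewrite /Defs.Rpos /= in_itv/= andbT. Qed.

Lemma measurable_Rpos : measurable Rpos.
Proof. exact: measurable_itv. Qed.

Definition upd n (x : Rn R n) (l : 'I_n) (t : R) : Rn R n := fun i => if i == l then t else x i.

Lemma upd_vcons0 n c (y : Rn R n) t : upd (vcons c y) ord0 t = vcons t y.
Proof.
apply/funext => i; rewrite /upd; case: (unliftP ord0 i) => [j|] ->.
  by rewrite eq_sym (negbTE (neq_lift _ _)) !vconsS.
by rewrite eqxx vcons0.
Qed.

Lemma upd_vconsS n c (y : Rn R n) l t : upd (vcons c y) (lift ord0 l) t = vcons c (upd y l t).
Proof.
apply/funext => i; rewrite /upd; case: (unliftP ord0 i) => [j|] ->.
  by rewrite !vconsS (inj_eq lift_inj).
by rewrite (negbTE (neq_lift _ _)) !vcons0.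
Qed.

Lemma measurable_section n d (T : measurableType d) (f : vec R n.+1 -> T) t : 0 < t ->
  measurable_fun (vpos n.+1) f -> measurable_fun (vpos n) (fun y => f (vcons t y)).
Proof.
move=> t0 mf.
rewrite (_ : (fun _ => _) = f \o (@vjoin R _ \o (fun y => (t, y)))); last exact/funext.
apply: (measurable_comp _ _ mf).
- exact: measurable_vpos.
- by move=> _ [y /= yp <-]; apply: (vpos_vcons t y).2.
- apply: measurable_funTS; apply: measurableT_comp; first exact: measurable_vjoin.
  exact: measurable_fun_pair.
Qed.

(** Only continuity in each variable separately is assumed. Freezing the first coordinate on a grid
    gives functions measurable by induction, and continuity in that coordinate gives convergence as
    the grid is refined. *)
Lemma measurable_vec_sepcont n (f : vec R n -> R) :
  (forall x l, vpos n x -> {for x l, continuous (fun t => f (upd x l t))}) ->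
  measurable_fun (vpos n) f.
Proof.
elim: n f => [|n IH] f fc.
  rewrite (_ : f = cst (f (fun _ => 0))); first exact: measurable_cst.
  by apply/funext => x /=; congr f; apply/funext => -[].
pose r m (t : R) : R := ((Num.truncn (t * m.+1%:R)).+1)%:R / m.+1%:R.
have m0 m : 0 < m.+1%:R :> R by rewrite ltr0n.
have r0 m t : 0 < r m t by rewrite divr_gt0// ltr0n.
have rb m t : 0 < t -> `|t - r m t| <= m.+1%:R^-1.
  move=> t0; have tm0 : 0 <= t * m.+1%:R by rewrite mulr_ge0// ltW.
  have /andP[h1 h2] := truncn_itv tm0.
  rewrite distrC ger0_norm; last by rewrite subr_ge0 ler_pdivlMr// ltW.
  rewrite lerBlDl /r ler_pdivrMr// mulrDl mulVf ?gt_eqF//.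
  by rewrite -natr1 lerD2r.
have rcvg t : 0 < t -> (r ^~ t) @ \oo --> t.
  move=> t0; apply/cvgrPdist_le => e e0; near=> m.
  apply: le_trans (rb m t t0) _; apply: ltW.
  near: m; exact: (near_infty_natSinv_lt (PosNum e0)).
pose h m (x : vec R n.+1) := f (vcons (r m (x ord0)) (fun i => x (lift ord0 i))).
apply: (measurable_fun_cvg (h := h)).
- move=> m _ Y mY.
  rewrite (_ : _ `&` _ = vpos n.+1 `&` \bigcup_k (@vsplit R n @^-1`
     (`[k%:R / m.+1%:R, k.+1%:R / m.+1%:R[ `*`
      (vpos n `&` (fun y => f (vcons (k.+1%:R / m.+1%:R) y)) @^-1` Y)))); last first.
    apply/seteqP; split => x [xp].
      move=> /= hx; split => //; exists (Num.truncn (x ord0 * m.+1%:R)) => //; split => /=.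
        have tm0 : 0 <= x ord0 * m.+1%:R by rewrite mulr_ge0// ltW// xp.
        have /andP[h1 h2] := truncn_itv tm0.
        by rewrite in_itv/= ler_pdivrMr// h1 ltr_pdivlMr.
      by split => // i; exact: xp.
    move=> [k _ [/= kx [xt xY]]]; split => //=; rewrite /h /r.
    suff -> : Num.truncn (x ord0 * m.+1%:R) = k by [].
    move: kx; rewrite in_itv/= ler_pdivrMr// ltr_pdivlMr// => kx.
    by apply/eqP; rewrite truncn_eq // mulr_ge0// ltW// xp.
  apply: measurableI; first exact: measurable_vpos.
  apply: bigcup_measurable => k _.
  rewrite -[X in measurable X]setTI; apply: measurable_vsplit => //.
  apply: measurableX => //; apply: IH => //; last exact: measurable_vpos.
  move=> y l yp.
  have kp : 0 < k.+1%:R / m.+1%:R :> R by rewrite divr_gt0// ltr0n.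
  have := fc (vcons (k.+1%:R / m.+1%:R) y) (lift ord0 l) ((vpos_vcons _ _).2 (conj kp yp)).
  have E : (fun t => f (upd (vcons (k.+1%:R / m.+1%:R) y) (lift ord0 l) t)) =
      (fun t => f (vcons (k.+1%:R / m.+1%:R) (upd y l t))).
    by apply/funext => t; rewrite upd_vconsS.
  by rewrite E vconsS.
- move=> x xp; rewrite /h.
  have := fc x ord0 xp.
  have E : (fun t => f (upd x ord0 t)) = (fun t => f (vcons t (fun i => x (lift ord0 i)))).
    by apply/funext => t; rewrite -{1}(vcons_eta x) upd_vcons0.
  rewrite E => c.
  have := @cvg_comp _ _ _ (r ^~ (x ord0)) (fun t => f (vcons t (fun i => x (lift ord0 i)))) _ _ _ (rcvg _ (xp ord0)) c.
  by rewrite vcons_eta.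
Unshelve. all: by end_near. Qed.

Lemma iint_nnegE n (f : vec R n -> \bar R) : measurable_fun (vpos n) f ->
  (forall x, vpos n x -> 0 <= f x)%E ->
  iint_nneg f = (\int[vmeas R n]_(x in vpos n) f x)%E.
Proof.
elim: n f => [|n IH] f mf f0.
  by rewrite vmeas0_integral// => x; apply: f0; case.
rewrite (vmeas_tonelli mf f0).1 /=; apply: eq_integral => t.
rewrite inE => /RposP t0; rewrite IH//.
  exact: measurable_section.
by move=> y yp; apply: f0; exact/vpos_vcons.
Qed.

Lemma vmeas_fubini n (f : vec R n.+1 -> \bar R) :
  (vmeas R n.+1).-integrable (vpos n.+1) f ->
  (\int[vmeas R n.+1]_(x in vpos n.+1) f x =
   \int[mu]_(t in Rpos) \int[vmeas R n]_(y in vpos n) f (vcons t y))%E /\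
  (\int[vmeas R n.+1]_(x in vpos n.+1) f x =
   \int[vmeas R n]_(y in vpos n) \int[mu]_(t in Rpos) f (vcons t y))%E.
Proof.
move=> fi.
have fi' : (vmeas R n.+1).-integrable setT (f \_ (vpos n.+1)).
  exact: (integrable_mkcond f (@measurable_vpos R n.+1)).1.
have fE t y : (f \_ (vpos n.+1)) (vcons t y) =
    if (t \in Rpos) && (y \in vpos n) then f (vcons t y) else 0%E.
  rewrite patchE; congr (if _ then _ else _); apply/idP/andP.
  + by move=> /set_mem /vpos_vcons[t0 y0]; split; apply/mem_set => //; exact/RposP.
  + by move=> [/set_mem /RposP t0 /set_mem y0]; apply/mem_set/vpos_vcons.
have mj := @measurable_vjoin R n.
have ji : (mu \x vmeas R n)%E.-integrable setT ((f \_ (vpos n.+1)) \o @vjoin R n).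
  move/integrableP: fi' => [mf' fi']; apply/integrableP; split; first exact: measurableT_comp.
  have := @ge0_integral_pushforward _ _ _ _ R _ mj (mu \x vmeas R n)%E setT
    (abse \o (f \_ (vpos n.+1))) measurableT.
  rewrite preimage_setT => <-; [exact: fi'|by apply: measurableT_comp|].
  by move=> x _; exact: abse_ge0.
have E : (\int[vmeas R n.+1]_(x in vpos n.+1) f x =
          \int[(mu \x vmeas R n)%E]_p ((f \_ (vpos n.+1)) \o @vjoin R n) p)%E.
  rewrite integral_mkcond [LHS](integral_pushforward mj)//.
  exact: (measurable_int _ fi').
rewrite E; split.
  rewrite -(integral12_prod_meas1 ji) [RHS]integral_mkcond; apply: eq_integral => t _.
  rewrite patchE; case: ifPn => tp.
    rewrite [RHS]integral_mkcond; apply: eq_integral => y _.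
    by rewrite /= /vjoin /= fE tp /= patchE.
  by rewrite /fubini_F integral0_eq// => y _; rewrite /= /vjoin /= fE (negbTE tp).
rewrite -(integral21_prod_meas1 ji) [RHS]integral_mkcond; apply: eq_integral => y _.
rewrite patchE; case: ifPn => yp.
  rewrite [RHS]integral_mkcond; apply: eq_integral => t _.
  by rewrite /= /vjoin /= fE yp andbT /= patchE.
by rewrite /fubini_G integral0_eq// => t _; rewrite /= /vjoin /= fE (negbTE yp) andbF.
Qed.

Lemma measurable_coord_pos n (i : 'I_n) (u : R -> R) : measurable_fun Rpos u ->
  measurable_fun (vpos n) (fun x => u (x i)).
Proof.
move=> mu'; apply: (@measurable_comp _ _ _ _ _ _ Rpos u (vpos n) (@vcoord R n i) _ _ mu').
- exact: measurable_Rpos.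
- by move=> _ [x xp <-]; apply/RposP; exact: xp.
- by apply: measurable_funTS; exact: measurable_vcoord.
Qed.

Lemma measurable_prod_pos n (u : 'I_n -> R -> R) : (forall i, measurable_fun Rpos (u i)) ->
  measurable_fun (vpos n) (fun x => \prod_(i < n) u i (x i)).
Proof. by move=> mu'; apply: measurable_prod => i _; exact: measurable_coord_pos. Qed.

Lemma integrable_prod_pos n (u : 'I_n -> R -> R) : (forall i, measurable_fun Rpos (u i)) ->
  (forall i t, 0 < t -> 0 <= u i t) -> 
  (forall i, \int[mu]_(t in Rpos) (u i t)%:E < +oo)%E ->
  (vmeas R n).-integrable (vpos n) (fun x => (\prod_(i < n) u i (x i))%:E).
Proof.
move=> mu' u0 ui; apply/integrableP; split.
  by apply/measurable_EFinP; exact: measurable_prod_pos.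
rewrite (eq_integral (fun x : vec R n => (\prod_(i < n) u i (x i))%:E)); last first.
  move=> x /set_mem xp; rewrite gee0_abs// lee_fin; apply: prodr_ge0 => i _.
  exact: u0.
elim: n u mu' u0 ui => [|n IH] u mu' u0 ui.
  rewrite vmeas0_integral; first by rewrite big_ord0 ltry.
  by move=> x; rewrite big_ord0 lee_fin.
rewrite (vmeas_tonelli _ _).1.
- pose c := (\int[vmeas R n]_(y in vpos n) (\prod_(i < n) u (lift ord0 i) (y i))%:E)%E.
  have c0 : (0 <= c)%E.
    apply: integral_ge0 => y yp; rewrite lee_fin; apply: prodr_ge0 => i _; exact: u0.
  have cf : c \is a fin_num.
    rewrite ge0_fin_numE//; apply: (IH (fun i => u (lift ord0 i))) => [i|i t|i];
      [exact: mu'|exact: u0|exact: ui].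
  have -> : (\int[mu]_(t in Rpos)
      \int[vmeas R n]_(y in vpos n) (\prod_(i < n.+1) u i (vcons t y i))%:E =
      \int[mu]_(t in Rpos) ((u ord0 t)%:E * c))%E.
    apply: eq_integral => t /set_mem /RposP t0.
    under eq_integral => y _ do rewrite big_ord_recl vcons0; rewrite /=.
    under eq_integral => y _ do under eq_bigr => i _ do rewrite vconsS.
    rewrite /=; under eq_integral do rewrite EFinM.
    rewrite ge0_integralZl//; last by rewrite lee_fin u0.
    + exact: measurable_vpos.
    + by apply/measurable_EFinP; apply: (measurable_prod_pos (u := fun i => u (lift ord0 i))) => i.
    + by move=> y yp; rewrite lee_fin; apply: prodr_ge0 => i _; exact: u0.
  rewrite ge0_integralZr//.
  + by rewrite muleC lte_mul_pinfty.
  + exact: measurable_Rpos.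
  + by apply/measurable_EFinP; exact: (mu' ord0).
  + by move=> t /RposP t0; rewrite lee_fin u0.
- by apply/measurable_EFinP; exact: measurable_prod_pos.
- by move=> y yp; rewrite lee_fin; apply: prodr_ge0 => i _; exact: u0.
Qed.

Lemma integrable_dominated n (f g : vec R n -> R) : measurable_fun (vpos n) f ->
  (vmeas R n).-integrable (vpos n) (EFin \o g) ->
  (forall x, vpos n x -> `|f x| <= g x) ->
  (vmeas R n).-integrable (vpos n) (EFin \o f).
Proof.
move=> mf gi fg; apply: (le_integrable _ _ _ gi).
- exact: measurable_vpos.
- exact/measurable_EFinP.
- by move=> x xp; rewrite /= lee_fin (le_trans (fg x xp))// ler_norm.
Qed.

(** A product majorant makes every section integrable, not just almost every one, so that no inner
    integral is replaced by the default value of [fine]. *)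
Lemma iint_realE n (f : vec R n -> R) (C : R) (u : R -> R) :
  measurable_fun Rpos u -> (forall t, 0 < t -> 0 <= u t) ->
  (\int[mu]_(t in Rpos) (u t)%:E < +oo)%E ->
  measurable_fun (vpos n) f ->
  (forall x, vpos n x -> `|f x| <= C * \prod_(i < n) u (x i)) ->
  iint_real f = (\int[vmeas R n]_(x in vpos n) f x)%R.
Proof.
move=> mu' u0 ui; elim: n f C => [|n IH] f C mf fC.
  rewrite /= /Rintegral.
  rewrite (_ : vpos 0 = setT); last by apply/seteqP; split => // x _ [].
  rewrite (_ : f = cst (f (fun _ => 0%R))); last first.
    by apply/funext => x; rewrite /=; congr f; apply/funext => -[].
  rewrite (eq_integral (cst (f (fun _ => 0%R))%:E))//.
  rewrite integral_cst// [X in (_ * X)%E](_ : _ = 1%E) ?mule1//.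
  by rewrite /= /dirac indicE in_setT.
have fi : (vmeas R n.+1).-integrable (vpos n.+1) (EFin \o f).
  apply: (integrable_dominated mf _ fC).
  rewrite (_ : EFin \o _ = (fun x => C%:E * (\prod_(i < n.+1) u (x i))%:E)%E); last first.
    by apply/funext => x; rewrite /= EFinM.
  apply: integrableZl; first exact: measurable_vpos.
  exact: (integrable_prod_pos (u := fun _ => u)).
rewrite [RHS]/Rintegral (vmeas_fubini fi).1 /=.
rewrite /Rintegral; congr fine; apply: eq_integral => t /set_mem /RposP t0.
have mft := measurable_section t0 mf.
have fCt y : vpos n y -> `|f (vcons t y)| <= (C * u t) * \prod_(i < n) u (y i).
  move=> yp; have := fC (vcons t y) ((vpos_vcons _ _).2 (conj t0 yp)).
  rewrite big_ord_recl vcons0 mulrA.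
  by under eq_bigr do rewrite vconsS.
rewrite (IH _ (C * u t))// /Rintegral fineK//.
apply: integrable_fin_num; first exact: measurable_vpos.
apply: (integrable_dominated mft _ fCt).
rewrite (_ : EFin \o _ = (fun x => (C * u t)%:E * (\prod_(i < n) u (x i))%:E)%E); last first.
  by apply/funext => x; rewrite /= EFinM.
apply: integrableZl; first exact: measurable_vpos.
exact: (integrable_prod_pos (u := fun _ => u)).
Qed.

Definition vins n (l : 'I_n.+1) (t : R) (y : Rn R n) : Rn R n.+1 :=
  fun i => oapp y t (unlift l i).

Lemma vins_l n l t (y : Rn R n) : vins l t y l = t.
Proof. by rewrite /vins unlift_none. Qed.

Lemma vins_lift n l t (y : Rn R n) i : vins l t y (lift l i) = y i.
Proof. by rewrite /vins liftK. Qed.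

Lemma vinsE n l t (y : Rn R n) : vins l t y = vperm (lift_perm l ord0 1%g) (vcons t y).
Proof.
apply/funext => i; rewrite /vperm; case: (unliftP l i) => [j|] ->.
  by rewrite vins_lift lift_perm_lift perm1 vconsS.
by rewrite vins_l lift_perm_id vcons0.
Qed.

Lemma upd_vins n l (t c : R) (y : Rn R n) : upd (vins l c y) l t = vins l t y.
Proof.
apply/funext => i; rewrite /upd; case: (unliftP l i) => [j|] ->.
  by rewrite eq_sym (negbTE (neq_lift _ _)) !vins_lift.
by rewrite eqxx vins_l.
Qed.

Lemma vpos_vins n l t (y : vec R n) : vpos n.+1 (vins l t y) <-> 0 < t /\ vpos n y.
Proof.
rewrite vinsE; split=> [/vpos_vperm/vpos_vcons//|h].
by apply/vpos_vperm/vpos_vcons.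
Qed.

Lemma vmeas_slice_ge0 n l (f : vec R n.+1 -> \bar R) : measurable_fun (vpos n.+1) f ->
  (forall x, vpos n.+1 x -> 0 <= f x)%E ->
  (\int[vmeas R n.+1]_(x in vpos n.+1) f x =
   \int[vmeas R n]_(y in vpos n) \int[mu]_(t in Rpos) f (vins l t y))%E.
Proof.
move=> mf f0; rewrite -(ge0_integral_vperm (lift_perm l ord0 1%g) mf f0).
rewrite (vmeas_tonelli _ _).2; last 2 first.
- exact: measurable_vperm_pos.
- by move=> x xp; apply: f0; exact/vpos_vperm.
by apply: eq_integral => y _; apply: eq_integral => t _; rewrite vinsE.
Qed.

Lemma vmeas_slice n l (f : vec R n.+1 -> \bar R) :
  (vmeas R n.+1).-integrable (vpos n.+1) f ->
  (\int[vmeas R n.+1]_(x in vpos n.+1) f x =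
   \int[vmeas R n]_(y in vpos n) \int[mu]_(t in Rpos) f (vins l t y))%E.
Proof.
move=> fi; rewrite -(integral_vperm (lift_perm l ord0 1%g) fi).
rewrite (vmeas_fubini (integrable_vperm (lift_perm l ord0 1%g) fi)).2.
by apply: eq_integral => y _; apply: eq_integral => t _; rewrite vinsE.
Qed.

Definition vdistinct n : set (vec R n) := [set x | forall i j, i != j -> x i != x j].

Lemma measurable_diag n (i j : 'I_n) : measurable [set x : vec R n | x i = x j].
Proof.
rewrite (_ : mkset _ = (fun x : vec R n => vcoord i x - vcoord j x) @^-1` [set 0]).
  rewrite -[X in measurable X]setTI.
  have m : measurable_fun setT (fun x : vec R n => vcoord i x - vcoord j x).
    by apply: measurable_funB; exact: measurable_vcoord.
  by apply: m.
apply/seteqP; split => x /=; rewrite /vcoord; first by move=> ->; rewrite subrr.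
by move=> /eqP; rewrite subr_eq0 => /eqP.
Qed.

Lemma vmeas_diag n (i j : 'I_n) : i != j -> vmeas R n [set x | x i = x j] = 0%E.
Proof.
elim: n i j => [[]//|n IH i j ij].
pose D (i j : 'I_n.+1) := [set x : vec R n.+1 | x i = x j].
have iE (i' j' : 'I_n.+1) : vmeas R n.+1 (D i' j') = (\int[vmeas R n.+1]_x (\1_(D i' j') x)%:E)%E.
  by rewrite integral_indic ?setIT//; exact: measurable_diag.
have mi (i' j' : 'I_n.+1) : measurable_fun setT (fun x : vec R n.+1 => (\1_(D i' j') x : R)%:E).
  by apply/measurable_EFinP; apply: measurable_indic; exact: measurable_diag.
have i0 (i' j' : 'I_n.+1) x : (0 <= (\1_(D i' j') x : R)%:E)%E by rewrite lee_fin.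
(* In the direction of the first coordinate the fibres of this diagonal are single points. *)
have d0 j' : vmeas R n.+1 (D ord0 (lift ord0 j')) = 0%E.
  rewrite iE (vmeas_tonelliT (mi _ _) (i0 _ _)).2; apply: integral0_eq => y _.
  transitivity (\int[mu]_t (\1_[set y j'] t)%:E)%E.
    apply: eq_integral => t _; rewrite !indicE; congr ((nat_of_bool _)%:R%:E).
    apply/idP/idP => /set_mem; rewrite /D /= => h; apply/mem_set; rewrite /D /=.
      by move: h; rewrite vcons0 vconsS.
    by rewrite vcons0 vconsS.
  by rewrite integral_indic// setIT; exact: lebesgue_measure_set1.
move: ij; case: (unliftP ord0 i) => [i'|] ->; case: (unliftP ord0 j) => [j'|] -> ij.
- rewrite -/(D _ _) iE (vmeas_tonelliT (mi _ _) (i0 _ _)).1; apply: integral0_eq => t _.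
  rewrite (eq_integral (fun y => (\1_[set y : vec R n | y i' = y j'] y : R)%:E)); last first.
    move=> y _; rewrite !indicE; congr ((nat_of_bool _)%:R%:E).
    apply/idP/idP => /set_mem; rewrite /D /= => h; apply/mem_set; rewrite /D /=.
      by move: h; rewrite !vconsS.
    by rewrite !vconsS.
  rewrite integral_indic//; last exact: measurable_diag.
  by rewrite setIT; apply: IH; rewrite -(inj_eq (@lift_inj _ ord0)).
- rewrite (_ : mkset _ = D ord0 (lift ord0 i')); first exact: d0.
  by apply/seteqP; split => x /=.
- exact: d0.
- by rewrite eqxx in ij.
Qed.

Lemma measurable_vdistinct n : measurable (@vdistinct n).
Proof.
rewrite (_ : @vdistinct n = ~` \bigcup_(p in [set p : 'I_n * 'I_n | p.1 != p.2])
   [set x | x p.1 = x p.2]).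
  apply: measurableC; apply: fin_bigcup_measurable => [|p _]; first exact: finite_finset.
  exact: measurable_diag.
apply/seteqP; split => x /= H.
  by move=> [[i j] /= ij xij]; have := H _ _ ij; rewrite xij eqxx.
move=> i j ij; apply/eqP => xij; apply: H; by exists (i, j).
Qed.

Lemma vmeas_Ndistinct n : vmeas R n (~` @vdistinct n) = 0%E.
Proof.
rewrite (_ : ~` _ = \bigcup_(p in [set p : 'I_n * 'I_n | p.1 != p.2])
   [set x | x p.1 = x p.2]); last first.
  apply/seteqP; split => x /= H; last first.
    by move: H => [[i j] /= ij xij] /(_ _ _ ij); rewrite xij eqxx.
  apply: contrapT => H2; apply: H => i j ij; apply/eqP => xij; apply: H2; by exists (i, j).
apply/eqP; rewrite eq_le measure_ge0 andbT.
(* Subadditivity is applied to a sequence of sets, so the finitely many pairs are indexed by their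
   codes. *)
rewrite (_ : \bigcup_(_ in _) _ = \bigcup_k \bigcup_(p in [set p : 'I_n * 'I_n | p.1 != p.2 /\ pickle p = k])
   [set x | x p.1 = x p.2]); last first.
  apply/seteqP; split => x.
    by move=> [p pp xp]; exists (pickle p) => //; exists p.
  by move=> [k _ [p [pp _] xp]]; exists p.
apply: le_trans.
  apply: (@measure_sigma_subadditive _ _ _ (vmeas R n) _
   (fun k => \bigcup_(p in [set p : 'I_n * 'I_n | p.1 != p.2 /\ pickle p = k]) [set x | x p.1 = x p.2])) => //.
  - move=> k; apply: fin_bigcup_measurable => [|p _]; first exact: finite_finset.
    exact: measurable_diag.
  - apply: bigcup_measurable => k _; apply: fin_bigcup_measurable => [|p _]; first exact: finite_finset.
    exact: measurable_diag.
rewrite eseries0// => k _ _.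
have [[p [pp pk]]|np] := pselect (exists p : 'I_n * 'I_n, p.1 != p.2 /\ pickle p = k).
  rewrite (_ : bigcup _ _ = [set x | x p.1 = x p.2]); first exact: vmeas_diag.
  apply/seteqP; split => x; last by move=> xp; exists p.
  by move=> [q [qq qk] xq]; have -> // : p = q by apply: (pcan_inj pickleK); rewrite pk.
rewrite (_ : bigcup _ _ = set0) ?measure0//.
by apply/seteqP; split => x // [p ph _]; apply: np; exists p.
Qed.

End VecIntegral.

Local Open Scope complex_scope.

(** * Complex-valued functions of a real variable *)

Section ComplexBasics.
Variable R : realType.
Local Notation C := R[i].
Local Notation Re := (@complex.Re R).
Local Notation Im := (@complex.Im R).

Lemma cReD (x y : C) : Re (x + y) = Re x + Re y. Proof. by case: x y => a b [c d]. Qed.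
Lemma cImD (x y : C) : Im (x + y) = Im x + Im y. Proof. by case: x y => a b [c d]. Qed.
Lemma cReN (x : C) : Re (- x) = - Re x. Proof. by case: x. Qed.
Lemma cImN (x : C) : Im (- x) = - Im x. Proof. by case: x. Qed.
Lemma cReM (x y : C) : Re (x * y) = Re x * Re y - Im x * Im y.
Proof. by case: x y => a b [c d]. Qed.
Lemma cImM (x y : C) : Im (x * y) = Re x * Im y + Im x * Re y.
Proof. by case: x y => a b [c d]. Qed.
Lemma cRe_toC (r : R) : Re (toC r) = r. Proof. by []. Qed.
Lemma cIm_toC (r : R) : Im (toC r) = 0. Proof. by []. Qed.
Lemma cRe0 : Re 0 = 0. Proof. by []. Qed.
Lemma cIm0 : Im 0 = 0. Proof. by []. Qed.
Lemma cRe1 : Re 1 = 1. Proof. by []. Qed.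
Lemma cIm1 : Im 1 = 0. Proof. by []. Qed.
Definition cRIE := (cReD, cImD, cReN, cImN, cReM, cImM, cRe_toC, cIm_toC, cRe0, cIm0, cRe1, cIm1).

Lemma cRe_sum I (r : seq I) (P : pred I) (F : I -> C) :
  Re (\sum_(i <- r | P i) F i) = \sum_(i <- r | P i) Re (F i).
Proof. by apply: (big_morph _ cReD). Qed.
Lemma ceq (x y : C) : Re x = Re y -> Im x = Im y -> x = y.
Proof. by case: x y => a b [c d] /= -> ->. Qed.

Lemma toCD (x y : R) : toC (x + y) = toC x + toC y. Proof. exact: rmorphD. Qed.
Lemma toCN (x : R) : toC (- x) = - toC x. Proof. exact: rmorphN. Qed.
Lemma toCB (x y : R) : toC (x - y) = toC x - toC y. Proof. exact: rmorphB. Qed.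
Lemma toCM (x y : R) : toC (x * y) = toC x * toC y. Proof. exact: rmorphM. Qed.
Lemma toC0 : toC (0 : R) = 0. Proof. by []. Qed.
Lemma toC1 : toC (1 : R) = 1. Proof. by []. Qed.
Lemma toCV (x : R) : toC (x^-1) = (toC x)^-1. Proof. exact: fmorphV. Qed.
Lemma toC_eq0 (x : R) : (toC x == 0) = (x == 0).
Proof. by apply/eqP/eqP => [[]//|->]. Qed.
Lemma toC_inj : injective (@toC R). Proof. by move=> x y []. Qed.
Lemma toC_nat n : toC (n%:R : R) = n%:R. Proof. exact: rmorph_nat. Qed.
Lemma toC_sum I (r : seq I) (P : pred I) (F : I -> R) :
  toC (\sum_(i <- r | P i) F i) = \sum_(i <- r | P i) toC (F i).
Proof. exact: rmorph_sum. Qed.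
Lemma toC_prod I (r : seq I) (P : pred I) (F : I -> R) :
  toC (\prod_(i <- r | P i) F i) = \prod_(i <- r | P i) toC (F i).
Proof. exact: rmorph_prod. Qed.

Lemma cnormE (z : C) : `|z| = toC (cnorm z). Proof. by rewrite normc_def. Qed.
Lemma cnorm_ge0 (z : C) : 0 <= cnorm z. Proof. exact: sqrtr_ge0. Qed.
Lemma cnorm_sqr (z : C) : cnorm z ^+ 2 = Re z ^+ 2 + Im z ^+ 2.
Proof. by rewrite sqr_sqrtr// addr_ge0// sqr_ge0. Qed.
Lemma cnormM (x y : C) : cnorm (x * y) = cnorm x * cnorm y.
Proof. by apply: toC_inj; rewrite toCM -!cnormE normrM. Qed.
Lemma cnormD (x y : C) : cnorm (x + y) <= cnorm x + cnorm y.
Proof. by rewrite -(@lecR R) -!/(toC _) toCD -!cnormE ler_normD. Qed.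
Lemma cnormN (x : C) : cnorm (- x) = cnorm x.
Proof. by apply: toC_inj; rewrite -!cnormE normrN. Qed.
Lemma cnormB (x y : C) : cnorm (x - y) <= cnorm x + cnorm y.
Proof. by rewrite -[cnorm y]cnormN cnormD. Qed.
Lemma cnorm_distC (x y : C) : cnorm (x - y) = cnorm (y - x).
Proof. by rewrite -opprB cnormN. Qed.
Lemma cnorm0 : cnorm (0 : C) = 0.
Proof. by apply: toC_inj; rewrite -cnormE normr0. Qed.
Lemma cnorm1 : cnorm (1 : C) = 1.
Proof. by apply: toC_inj; rewrite -cnormE normr1. Qed.
Lemma cnorm_eq0 (z : C) : (cnorm z == 0) = (z == 0).
Proof. by rewrite -toC_eq0 -cnormE normr_eq0. Qed.
Lemma cnorm_gt0 (z : C) : (0 < cnorm z) = (z != 0).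
Proof. by rewrite lt_def cnorm_eq0 cnorm_ge0 andbT. Qed.
Lemma cnorm_toC (x : R) : cnorm (toC x) = `|x|.
Proof. by rewrite /cnorm /= expr0n addr0 sqrtr_sqr. Qed.
Lemma cnormV (z : C) : cnorm (z^-1) = (cnorm z)^-1.
Proof. by apply: toC_inj; rewrite toCV -!cnormE normfV. Qed.
Lemma cnorm_sum I (r : seq I) (P : pred I) (F : I -> C) :
  cnorm (\sum_(i <- r | P i) F i) <= \sum_(i <- r | P i) cnorm (F i).
Proof.
elim/big_rec2: _ => [|i y z _ h]; first by rewrite cnorm0.
by rewrite (le_trans (cnormD _ _))// lerD2l.
Qed.
Lemma Re_le_cnorm (z : C) : `|Re z| <= cnorm z.
Proof.
rewrite -(@ler_pXn2r _ 2) ?nnegrE ?cnorm_ge0// cnorm_sqr real_normK ?num_real//.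
by rewrite lerDl sqr_ge0.
Qed.
Lemma Im_le_cnorm (z : C) : `|Im z| <= cnorm z.
Proof.
rewrite -(@ler_pXn2r _ 2) ?nnegrE ?cnorm_ge0// cnorm_sqr real_normK ?num_real//.
by rewrite lerDr sqr_ge0.
Qed.
Lemma cnorm_le_ReIm (z : C) : cnorm z <= `|Re z| + `|Im z|.
Proof.
rewrite -(@ler_pXn2r _ 2) ?nnegrE ?cnorm_ge0// ?addr_ge0// cnorm_sqr sqrrD.
rewrite !real_normK ?num_real//.
by rewrite lerD2r lerDl mulrn_wge0// mulr_ge0.
Qed.
(** The scalar product of the complex plane as R^2; the derivative of |f|^2 is 2 <f, f'> for it. *)
Definition crip (z w : C) : R := Re z * Re w + Im z * Im w.
Lemma crip_le (z w : C) : crip z w <= cnorm z * cnorm w.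
Proof.
have h : `|crip z w| <= cnorm z * cnorm w.
  rewrite -(@ler_pXn2r _ 2) ?nnegrE ?mulr_ge0 ?cnorm_ge0// exprMn !cnorm_sqr.
  rewrite real_normK ?num_real// /crip -subr_ge0.
  rewrite [leRHS](_ : _ = (Re z * Im w - Im z * Re w) ^+ 2) ?sqr_ge0//; ring.
exact: le_trans (ler_norm _) h.
Qed.
Lemma cripzz z : crip z z = cnorm z ^+ 2.
Proof. by rewrite cnorm_sqr /crip !expr2. Qed.

Lemma cexp0 : cexp (0 : C) = 1.
Proof. by rewrite /cexp /= expR0 cos0 sin0 mul1r mulr0. Qed.
Lemma cexpD (x y : C) : cexp (x + y) = cexp x * cexp y.
Proof.
case: x y => a b [c d]; apply: ceq; rewrite /= expRD ?cosD ?sinD; ring.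
Qed.
Lemma cnorm_cexp (z : C) : cnorm (cexp z) = expR (Re z).
Proof.
rewrite /cnorm /cexp /= !exprMn -mulrDr cos2Dsin2 mulr1 sqrtr_sqr ger0_norm//.
Qed.
Lemma cexp_neq0 (z : C) : cexp z != 0.
Proof. by rewrite -cnorm_gt0 cnorm_cexp expR_gt0. Qed.
Lemma cexpN (z : C) : cexp (- z) = (cexp z)^-1.
Proof.
apply: (mulfI (cexp_neq0 z)); rewrite -cexpD subrr cexp0 mulfV// cexp_neq0//.
Qed.
Lemma cexp_toC (x : R) : cexp (toC x) = toC (expR x).
Proof. by apply: ceq; rewrite /cexp /= ?cos0 ?sin0 ?mulr1 ?mulr0. Qed.
Lemma cexp_sum I (r : seq I) (P : pred I) (F : I -> C) :
  cexp (\sum_(i <- r | P i) F i) = \prod_(i <- r | P i) cexp (F i).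
Proof. by apply: (big_morph _ cexpD cexp0). Qed.

Lemma cLogK (z : C) : 0 < Re z -> cexp (cLog z) = z.
Proof.
move=> z0.
have n0 : 0 < cnorm z.
  by rewrite cnorm_gt0; apply: contraTneq z0 => ->; rewrite ltxx.
rewrite /cexp /cLog /= lnK ?posrE//.
have nE : cnorm z = Re z * Num.sqrt (1 + (Im z / Re z) ^+ 2).
  have -> : cnorm z = Num.sqrt (Re z ^+ 2 * (1 + (Im z / Re z) ^+ 2)).
    by congr Num.sqrt; field; rewrite gt_eqF.
  by rewrite sqrtrM ?sqr_ge0// sqrtr_sqr gtr0_norm.
have s0 : 0 < 1 + (Im z / Re z) ^+ 2 by rewrite ltr_pwDl// sqr_ge0.
have c0 : cos (atan (Im z / Re z)) != 0 by rewrite cos_atan invr_eq0 gt_eqF// sqrtr_gt0.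
have sE : sin (atan (Im z / Re z)) = Im z / Re z * cos (atan (Im z / Re z)).
  by rewrite -{2}(atanK (Im z / Re z)) /tan divfK.
have q0 : Num.sqrt (1 + (Im z / Re z) ^+ 2) != 0 by rewrite gt_eqF// sqrtr_gt0.
rewrite sE cos_atan; apply: ceq => /=; rewrite nE.
  by rewrite mulfK.
by field; rewrite q0 gt_eqF.
Qed.

Lemma Im_cLog (z : C) : `|Im (cLog z)| < pi / 2.
Proof. by rewrite /cLog /= ltr_norml atan_gtNpi2 atan_ltpi2. Qed.

Lemma cLog_toC (x : R) : 0 < x -> cLog (toC x) = toC (ln x).
Proof.
by move=> x0; apply: ceq; rewrite /cLog /= ?mul0r ?atan0// cnorm_toC gtr0_norm.
Qed.

Lemma cLogV (z : C) : 0 < Re z -> cLog (z^-1) = - cLog z.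
Proof.
move=> z0.
have n0 : 0 < Re z ^+ 2 + Im z ^+ 2 by rewrite ltr_pwDl ?exprn_gt0// sqr_ge0.
have vE : z^-1 = (Re z / (Re z ^+ 2 + Im z ^+ 2)) +i* (- (Im z / (Re z ^+ 2 + Im z ^+ 2))).
  by case: z {z0 n0} => a b.
have c0 : 0 < cnorm z.
  by rewrite cnorm_gt0; apply: contraTneq z0 => ->; rewrite ltxx.
apply: ceq; rewrite ?cReN ?cImN /cLog.
  by rewrite [LHS]/= cnormV lnV ?posrE.
rewrite vE /= -atanN; congr atan; field.
by rewrite !gt_eqF.
Qed.

End ComplexBasics.

Section ComplexDerivative.
Variable R : realType.
Local Notation C := R[i].
Local Notation Re := (@complex.Re R).
Local Notation Im := (@complex.Im R).

Definition cderiv (f : R -> C) (t : R) (L : C) :=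
  is_derive t (1 : R) (fun s => Re (f s)) (Re L) /\ is_derive t (1 : R) (fun s => Im (f s)) (Im L).

Lemma is_derive1P (f : R -> R) t d :
  (forall eps : R, 0 < eps -> exists2 delta : R, 0 < delta &
    forall h : R, 0 < `|h| < delta -> `|(f (t + h) - f t) / h - d| < eps) ->
  is_derive t (1 : R) f d.
Proof.
move=> H.
have c : (fun h => h^-1 *: ((f \o shift t) (h *: 1) - f t)) @ 0^' --> d.
  apply/cvgrPdist_lt => e e0; have [dl dl0 hd] := H e e0.
  near=> h; rewrite distrC /= [h *: 1]mulr1 [h + t]addrC [_ *: _]mulrC; apply: hd.
  apply/andP; split.
    by rewrite normr_gt0; near: h; exact: nbhs_dnbhs_neq.
  by near: h; exact: dnbhs0_lt.
by apply: DeriveDef; [apply/cvg_ex; exists d|exact/cvg_lim].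
Unshelve. all: by end_near. Qed.

Lemma cderivP (f : R -> C) t L :
  (forall eps : R, 0 < eps -> exists2 delta : R, 0 < delta &
    forall h : R, 0 < `|h| < delta -> cnorm ((f (t + h) - f t) / toC h - L) < eps) ->
  cderiv f t L.
Proof.
move=> H; split; apply: is_derive1P => e e0; have [d d0 hd] := H e e0; exists d => // h /hd.
  apply: le_lt_trans; apply: le_trans (Re_le_cnorm _).
  by rewrite -toCV !cRIE mulr0 subr0.
apply: le_lt_trans; apply: le_trans (Im_le_cnorm _).
by rewrite -toCV !cRIE mulr0 add0r.
Qed.

Lemma cderiv_unique f t (L L' : C) : cderiv f t L -> cderiv f t L' -> L = L'.
Proof.
move=> [a b] [c d]; apply: ceq.
  by rewrite -(@derive_val _ _ _ _ _ _ _ a) -(@derive_val _ _ _ _ _ _ _ c).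
by rewrite -(@derive_val _ _ _ _ _ _ _ b) -(@derive_val _ _ _ _ _ _ _ d).
Qed.

Lemma cderiv_cst (c : C) t : cderiv (fun _ => c) t 0.
Proof. by split; exact: is_derive_cst. Qed.

Lemma cderivD f g t (L M : C) : cderiv f t L -> cderiv g t M -> cderiv (fun s => f s + g s) t (L + M).
Proof.
move=> [a b] [c d]; split; rewrite cRIE.
  rewrite (_ : (fun s => _) = (fun s => Re (f s)) + (fun s => Re (g s))); last first.
    by apply/funext => s; rewrite cRIE.
  exact: is_deriveD.
rewrite (_ : (fun s => _) = (fun s => Im (f s)) + (fun s => Im (g s))); last first.
  by apply/funext => s; rewrite cRIE.
exact: is_deriveD.
Qed.

Lemma cderivM f g t (L M : C) : cderiv f t L -> cderiv g t M ->
  cderiv (fun s => f s * g s) t (L * g t + f t * M).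
Proof.
move=> [a b] [c d]; split.
  rewrite (_ : (fun s => _) = (fun s => Re (f s)) * (fun s => Re (g s)) -
     (fun s => Im (f s)) * (fun s => Im (g s))); last first.
    by apply/funext => s; rewrite cRIE.
  apply: (is_derive_eq (is_deriveB (is_deriveM a c) (is_deriveM b d))).
  rewrite !cRIE /GRing.scale /=; ring.
rewrite (_ : (fun s => _) = (fun s => Re (f s)) * (fun s => Im (g s)) +
     (fun s => Im (f s)) * (fun s => Re (g s))); last first.
  by apply/funext => s; rewrite cRIE.
apply: (is_derive_eq (is_deriveD (is_deriveM a d) (is_deriveM b c))).
rewrite !cRIE /GRing.scale /=; ring.
Qed.

Lemma cderiv_eq f t (L M : C) : cderiv f t L -> L = M -> cderiv f t M.
Proof. by move=> h <-. Qed.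

Lemma cderivZ (c : C) f t L : cderiv f t L -> cderiv (fun s => c * f s) t (c * L).
Proof. by move=> h; apply: cderiv_eq (cderivM (cderiv_cst c t) h) _; rewrite mul0r add0r. Qed.

Lemma cderivN f t (L : C) : cderiv f t L -> cderiv (fun s => - f s) t (- L).
Proof.
move=> h; have := cderivZ (-1) h; rewrite mulN1r.
by rewrite (_ : (fun s => _) = (fun s => - f s))//; apply/funext => s; rewrite mulN1r.
Qed.

Lemma cderivB f g t (L M : C) : cderiv f t L -> cderiv g t M -> cderiv (fun s => f s - g s) t (L - M).
Proof. by move=> h1 h2; apply: cderivD => //; exact: cderivN. Qed.

Lemma cderiv_sum I (r : seq I) (P : pred I) (f : I -> R -> C) t (L : I -> C) :
  (forall i, P i -> cderiv (f i) t (L i)) ->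
  cderiv (fun s => \sum_(i <- r | P i) f i s) t (\sum_(i <- r | P i) L i).
Proof.
move=> h; elim: r => [|i r IH].
  rewrite big_nil (_ : (fun s => _) = (fun _ => 0)); first exact: cderiv_cst.
  by apply/funext => s; rewrite big_nil.
rewrite big_cons (_ : (fun s => _) = (fun s => if P i then f i s + \sum_(j <- r | P j) f j s
   else \sum_(j <- r | P j) f j s)); last by apply/funext => s; rewrite big_cons.
by case: ifPn => // Pi; apply: cderivD => //; exact: h.
Qed.

Lemma cderiv_real (g : R -> R) t d : is_derive t (1 : R) g d -> cderiv (fun s => toC (g s)) t (toC d).
Proof. by move=> h; split => //=; exact: is_derive_cst. Qed.

Lemma cderiv_id t : cderiv (fun s => toC s) t 1.
Proof. exact: cderiv_real. Qed.

Lemma cderiv_comp f (g : R -> R) t d (L : C) : is_derive t (1 : R) g d -> cderiv f (g t) L ->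
  cderiv (fun s => f (g s)) t (toC d * L).
Proof.
move=> h [a b]; split; rewrite !cRIE mul0r ?subr0 ?addr0.
  have := @is_derive1_comp _ (fun s => Re (f s)) g t _ _ a h.
  by rewrite mulrC.
have := @is_derive1_comp _ (fun s => Im (f s)) g t _ _ b h.
by rewrite mulrC.
Qed.

Lemma cderiv_cexp f t (L : C) : cderiv f t L -> cderiv (fun s => cexp (f s)) t (L * cexp (f t)).
Proof.
move=> [a b].
have e := @is_derive1_comp _ (@expR R) (fun s => Re (f s)) t _ _ (is_derive_expR _) a.
have c := @is_derive1_comp _ (@cos R) (fun s => Im (f s)) t _ _ (is_derive_cos _) b.
have s := @is_derive1_comp _ (@sin R) (fun s => Im (f s)) t _ _ (is_derive_sin _) b.
split.
  rewrite (_ : (fun s => _) = (@expR R \o (fun s => Re (f s))) * (@cos R \o (fun s => Im (f s)))) //.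
  apply: (is_derive_eq (is_deriveM e c)); rewrite cReM /cexp /GRing.scale /=; ring.
rewrite (_ : (fun s => _) = (@expR R \o (fun s => Re (f s))) * (@sin R \o (fun s => Im (f s)))) //.
apply: (is_derive_eq (is_deriveM e s)); rewrite cImM /cexp /GRing.scale /=; ring.
Qed.

Lemma cderiv_shift f t (L : C) : cderiv (fun h => f (t + h)) 0 L -> cderiv f t L.
Proof.
move=> h.
have := @cderiv_comp (fun h => f (t + h)) (fun s => s - t) t 1 L.
rewrite mul1r subrr => /(_ _ h).
rewrite (_ : (fun s => _) = f); last by apply/funext => s; rewrite addrC subrK.
apply; apply: (is_derive_eq (is_deriveB (is_derive_id _ _) (is_derive_cst _ _ _))).
by rewrite subr0.
Qed.

Lemma cderiv_near (f g : R -> C) t (L : C) : (\forall s \near t, f s = g s) ->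
  cderiv f t L -> cderiv g t L.
Proof.
move=> fg [a b]; split.
  by apply: near_eq_is_derive a; apply: filterS fg => s ->.
by apply: near_eq_is_derive b; apply: filterS fg => s ->.
Qed.

Definition ccont (f : R -> C) (t : R) :=
  {for t, continuous (fun s => Re (f s))} /\ {for t, continuous (fun s => Im (f s))}.

Lemma cderiv_cont (f : R -> C) t L : cderiv f t L -> ccont f t.
Proof.
by move=> [a b]; split; apply: differentiable_continuous; apply/derivable1_diffP.
Qed.

Lemma is_derive_cnorm2 (f : R -> C) t L : cderiv f t L ->
  is_derive t (1 : R) (fun s => cnorm (f s) ^+ 2) (2 * crip (f t) L).
Proof.
move=> [a b].
rewrite (_ : (fun s => _) = (fun s => Re (f s)) * (fun s => Re (f s)) + (fun s => Im (f s)) * (fun s => Im (f s))); last first.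
  by apply/funext => s; rewrite cnorm_sqr !expr2.
apply: (is_derive_eq (is_deriveD (is_deriveM a a) (is_deriveM b b))).
rewrite /crip /GRing.scale /=; ring.
Qed.

End ComplexDerivative.

(** * A Gronwall inequality along permutation orbits *)

Section Gronwall.
Variable R : realType.
Local Notation C := R[i].
Local Notation Re := (@complex.Re R).
Local Notation Im := (@complex.Im R).

(** The function exp(-ct) N(t) - D t is nonincreasing by the mean value theorem; the forcing carries
    exp(ct) so that it contributes exactly D. *)
Lemma gronwall (N N' : R -> R) (c D : R) :
  {within `[0, 1], continuous N} ->
  (forall t : R, 0 < t < 1 -> is_derive t (1 : R) N (N' t)) ->
  (forall t : R, 0 < t < 1 -> N' t <= c * N t + D * expR (c * t)) ->
  N 1 <= expR c * (N 0 + D).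
Proof.
move=> cN dN lN.
pose e := (fun t : R => expR (- c * t)).
have de t : is_derive t (1 : R) e (- c * e t).
  have h := @is_derive1_comp _ (@expR R) (fun s => - c * s) t _ _ (is_derive_expR _)
    (is_deriveZ (- c) (is_derive_id t (1 : R))).
  apply: (is_derive_eq h); rewrite /GRing.scale /= mulr1 mulrC //.
pose h := (fun t : R => e t * N t - D * t).
have dh (t : R) : 0 < t < 1 -> is_derive t (1 : R) h (e t * (N' t - c * N t) - D).
  move=> t01.
  have h1 := is_deriveM (de t) (dN t t01).
  have h2 := is_deriveZ D (is_derive_id t (1 : R)).
  apply: (is_derive_eq (is_deriveB h1 h2)); rewrite /GRing.scale /=; ring.
have ch : {within `[0, 1], continuous h}.
  move=> x; apply: cvgB.
    apply: cvgM; last exact: cN.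
    apply: continuous_subspaceT => y.
    by apply: differentiable_continuous; apply/derivable1_diffP; have [] := de y.
  by apply: continuous_subspaceT => y; apply: cvgZr; exact: cvg_id.
have dh' (t : R) : t \in `]0, 1[ -> is_derive t (1 : R) h (e t * (N' t - c * N t) - D).
  by rewrite in_itv/=; exact: dh.
have [s s01 hs] := @MVT R h (fun t => e t * (N' t - c * N t) - D) 0 1 ltr01 dh' ch.
have t01 : 0 < s < 1 by move: s01; rewrite in_itv.
have e0 (t : R) : 0 < e t by exact: expR_gt0.
have hle : h 1 - h 0 <= 0.
  rewrite hs subr0 mulr1 subr_le0.
  have h1 : e s * (N' s - c * N s) <= e s * (D * expR (c * s)).
    by rewrite ler_pM2l ?e0// lerBlDl; exact: lN.
  apply: (le_trans h1).
  by rewrite mulrCA /e -expRD mulNr addNr expR0 mulr1.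
move: hle; rewrite /h /e !mulr1 !mulr0 expR0 mul1r subr0 => hle.
have : expR (- c) * N 1 <= N 0 + D by lra.
by rewrite expRN mulrC ler_pdivrMr ?expR_gt0// mulrC.
Qed.

Lemma is_derive_bigsum I (r : seq I) (f : I -> R -> R) (d : I -> R) (t : R) :
  (forall i, is_derive t (1 : R) (f i) (d i)) ->
  is_derive t (1 : R) (\sum_(i <- r) f i) (\sum_(i <- r) d i).
Proof.
move=> h; elim: r => [|i r IH]; first by rewrite !big_nil; exact: is_derive_cst.
by rewrite !big_cons; exact: is_deriveD.
Qed.

Lemma cripD (z a b : C) : crip z (a + b) = crip z a + crip z b.
Proof. by rewrite /crip !cRIE; ring. Qed.
Lemma cripZ (z a : C) r : crip z (toC r * a) = r * crip z a.
Proof. by rewrite /crip cReM cImM /=; ring. Qed.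
Lemma cripN (z a : C) : crip z (- a) = - crip z a.
Proof. by rewrite /crip !cRIE; ring. Qed.
Lemma crip_mulz (z a : C) : crip z (a * z) = Re a * cnorm z ^+ 2.
Proof. by rewrite cnorm_sqr /crip !cRIE; ring. Qed.
Lemma crip_sum (z : C) I (r : seq I) (P : pred I) (F : I -> C) :
  crip z (\sum_(i <- r | P i) F i) = \sum_(i <- r | P i) crip z (F i).
Proof.
by apply: (big_morph _ (cripD z)); rewrite /crip cRe0 cIm0 !mulr0 addr0.
Qed.
Lemma crip_le2 (z w : C) : 2 * crip z w <= cnorm z ^+ 2 + cnorm w ^+ 2.
Proof.
have := crip_le z w; have := sqr_ge0 (cnorm z - cnorm w); rewrite sqrrB mulr2n; lra.
Qed.

(** Group w with s w and write c', f' for the values at s w. Then c <f, f - f'> + c' <f', f' - f> =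
    (c - c')/2 (|f|^2 - |f'|^2) + (c + c')/2 |f - f'|^2, and the last term is nonnegative. *)
Lemma pair_dissipation n (s : 'S_n) (c : 'S_n -> R) (f : 'S_n -> C) :
  (s * s = 1)%g -> (forall w, 0 <= c w + c (s * w)%g) ->
  \sum_w (c w - c (s * w)%g) / 2 * cnorm (f w) ^+ 2 <=
  \sum_w c w * crip (f w) (f w - f (s * w)%g).
Proof.
move=> ss c0.
have reix (F : 'S_n -> R) : \sum_w F w = \sum_w (F w + F (s * w)%g) / 2.
  rewrite -mulr_suml big_split /= -[X in (_ + X)](_ : \sum_w F w = _); last first.
    rewrite [LHS](reindex_inj (mulgI s)) //.
  by rewrite -mulr2n -(mulr_natr (\sum_w F w)) mulfK// pnatr_eq0.
rewrite (reix (fun w => _)) [leRHS]reix; apply: ler_sum => w _.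
rewrite !mulgA ss mul1g.
have := c0 w.
have := sqr_ge0 (Re (f w) - Re (f (s * w)%g)); have := sqr_ge0 (Im (f w) - Im (f (s * w)%g)).
rewrite !cnorm_sqr /crip !cRIE.
move: (Re (f w)) (Im (f w)) (Re (f _)) (Im (f _)) (c w) (c _) => a b a' b' x y h1 h2 h3.
have := mulr_ge0 h3 (addr_ge0 h1 h2); nra.
Qed.

(** The equations at all points of an orbit form one closed system. The part of the coefficients
    symmetric under the swap is dissipative by [pair_dissipation], and r compensates the
    antisymmetric part. The Dunkl system has r = 0, the Cherednik system has the pairing with
    rho. *)
Lemma orbit_gronwall n (k : R) (f : 'S_n -> R -> C) (A g : 'S_n -> R -> C)
   (c : 'I_n -> 'I_n -> 'S_n -> R -> R) (r : 'S_n -> R) (M d D : R) : 0 <= k ->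
  (forall w (t : R), 0 < t < 1 -> cderiv (f w) t (A w t * f w t + toC (r w) * f w t
     - toC k * (\sum_(i < n) \sum_(j < n | (i < j)%N)
         toC (c i j w t) * (f w t - f (tperm i j * w)%g t)) + g w t)) ->
  (forall w (t : R), 0 <= t <= 1 -> ccont (f w) t) ->
  (forall w (t : R), 0 < t < 1 -> Re (A w t) <= M) ->
  (forall (i j : 'I_n) w (t : R), (i < j)%N -> 0 < t < 1 -> 0 <= c i j w t + c i j (tperm i j * w)%g t) ->
  (forall w (t : R), 0 < t < 1 -> r w = k * (\sum_(i < n) \sum_(j < n | (i < j)%N)
      (c i j w t - c i j (tperm i j * w)%g t) / 2)) ->
  (forall t : R, 0 < t < 1 -> \sum_w 2 * crip (f w t) (g w t) <=
     d * (\sum_w cnorm (f w t) ^+ 2) + D * expR ((2 * M + d) * t)) ->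
  \sum_w cnorm (f w 1) ^+ 2 <= expR (2 * M + d) * (\sum_w cnorm (f w 0) ^+ 2 + D).
Proof.
move=> k0 df cf Ab c0 rE gb.
pose L w t := A w t * f w t + toC (r w) * f w t
     - toC k * (\sum_(i < n) \sum_(j < n | (i < j)%N)
         toC (c i j w t) * (f w t - f (tperm i j * w)%g t)) + g w t.
apply: (@gronwall (fun t => \sum_w cnorm (f w t) ^+ 2) (fun t => \sum_w 2 * crip (f w t) (L w t))).
- apply: continuous_in_subspaceT => t; rewrite inE /= in_itv/= => t01.
  rewrite (_ : (fun t => _) = (\sum_w (fun t => cnorm (f w t) ^+ 2))); last first.
    by apply/funext => s; rewrite fct_sumE.
  apply: (big_ind (fun h : R -> R => {for t, continuous h})).
  + exact: cst_continuous.
  + by move=> x y hx hy; exact: continuousD.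
  + move=> w _; have [c1 c2] := cf w t t01.
    rewrite (_ : (fun t => _) = (fun s => Re (f w s)) * (fun s => Re (f w s)) +
       (fun s => Im (f w s)) * (fun s => Im (f w s))); last first.
      by apply/funext => s; rewrite cnorm_sqr !expr2.
    by apply: continuousD; exact: continuousM.
- move=> t t01; rewrite (_ : (fun t => _) = (\sum_w (fun t => cnorm (f w t) ^+ 2))); last first.
    by apply/funext => s; rewrite fct_sumE.
  apply: is_derive_bigsum => w; apply: is_derive_cnorm2; exact: df.
move=> t t01.
have -> : \sum_w 2 * crip (f w t) (L w t) =
   \sum_w 2 * Re (A w t) * cnorm (f w t) ^+ 2 +
   (\sum_w 2 * r w * cnorm (f w t) ^+ 2 -
   2 * k * \sum_(i < n) \sum_(j < n | (i < j)%N) \sum_w c i j w t * crip (f w t) (f w t - f (tperm i j * w)%g t))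
   + \sum_w 2 * crip (f w t) (g w t).
  rewrite [X in _ - 2 * k * X](_ : _ = \sum_w (\sum_(i < n) \sum_(j < n | (i < j)%N)
      c i j w t * crip (f w t) (f w t - f (tperm i j * w)%g t))); last first.
    rewrite [RHS]exchange_big; apply: eq_bigr => i _; exact: exchange_big.
  rewrite mulr_sumr -sumrB -!big_split /=; apply: eq_bigr => w _.
  rewrite /L !cripD cripN !cripZ crip_sum crip_mulz cripzz.
  have -> : \sum_(i < n) crip (f w t) (\sum_(j < n | (i < j)%N)
        toC (c i j w t) * (f w t - f (tperm i j * w)%g t)) =
      \sum_(i < n) \sum_(j < n | (i < j)%N) c i j w t * crip (f w t) (f w t - f (tperm i j * w)%g t).
    by apply: eq_bigr => i _; rewrite crip_sum; apply: eq_bigr => j _; rewrite cripZ.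
  ring.
have h1 : \sum_w 2 * Re (A w t) * cnorm (f w t) ^+ 2 <= 2 * M * \sum_w cnorm (f w t) ^+ 2.
  rewrite mulr_sumr; apply: ler_sum => w _; rewrite ler_wpM2r ?sqr_ge0//.
  by rewrite ler_pM2l// Ab.
have h2 : \sum_w 2 * r w * cnorm (f w t) ^+ 2 <=
   2 * k * \sum_(i < n) \sum_(j < n | (i < j)%N) \sum_w c i j w t * crip (f w t) (f w t - f (tperm i j * w)%g t).
  have -> : \sum_w 2 * r w * cnorm (f w t) ^+ 2 = 2 * k *
     \sum_(i < n) \sum_(j < n | (i < j)%N) \sum_w (c i j w t - c i j (tperm i j * w)%g t) / 2 * cnorm (f w t) ^+ 2.
    rewrite [X in _ = 2 * k * X](_ : _ = \sum_w (\sum_(i < n) \sum_(j < n | (i < j)%N)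
       (c i j w t - c i j (tperm i j * w)%g t) / 2) * cnorm (f w t) ^+ 2); last first.
      under [RHS]eq_bigr do rewrite mulr_suml.
      rewrite [RHS]exchange_big; apply: eq_bigr => i _.
      under [RHS]eq_bigr do rewrite mulr_suml.
      exact: exchange_big.
    rewrite mulr_sumr; apply: eq_bigr => w _; rewrite (rE w t t01); ring.
  rewrite ler_wpM2l ?mulr_ge0//; apply: ler_sum => i _; apply: ler_sum => j ij.
  apply: pair_dissipation; first exact: tperm2.
  by move=> w; exact: c0.
have := gb t t01; lra.
Qed.

Lemma right_limit_le (F G : R -> R) (e : R) : 0 < e ->
  {for 0, continuous F} -> {for 0, continuous G} ->
  (forall h, 0 < h < e -> F h <= G h) -> F 0 <= G 0.
Proof.
move=> e0 cF gG_const FG.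
have a : F @ 0^'+ --> F 0 by apply: cvg_at_right_filter.
have b : G @ 0^'+ --> G 0 by apply: cvg_at_right_filter.
apply: (ler_cvg_to a b); near=> h; apply: FG; apply/andP; split; near: h.
  exact: nbhs_right_gt.
exact: nbhs_right_lt.
Unshelve. all: by end_near. Qed.

Lemma ccont_near (f : R -> C) t :
  (forall eps : R, 0 < eps -> \forall s \near t, cnorm (f s - f t) < eps) -> ccont f t.
Proof.
move=> H; split; apply/cvgrPdist_lt => e e0; apply: filterS (H e e0) => s hs.
  rewrite -cReN -cReD; apply: le_lt_trans (Re_le_cnorm _) _.
  by rewrite cnorm_distC.
rewrite -cImN -cImD; apply: le_lt_trans (Im_le_cnorm _) _.
by rewrite cnorm_distC.
Qed.

Lemma ccont_cnorm (f : R -> C) t : ccont f t -> {for t, continuous (fun s => cnorm (f s))}.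
Proof.
move=> [a b]; rewrite /cnorm.
apply: (@continuous_comp _ _ _ (fun s => Re (f s) ^+ 2 + Im (f s) ^+ 2) Num.sqrt).
  by apply: continuousD; apply: (@continuous_comp _ _ _ _ (fun x : R => x ^+ 2)) => //; exact: exprn_continuous.
exact: sqrt_continuous.
Qed.

Lemma ccont_cst (c : C) t : ccont (fun _ => c) t.
Proof. by split; exact: cst_continuous. Qed.
Lemma ccontD (f g : R -> C) t : ccont f t -> ccont g t -> ccont (fun s => f s + g s) t.
Proof.
move=> [a b] [c d]; split.
  rewrite (_ : (fun s => _) = (fun s => Re (f s)) + (fun s => Re (g s))); first exact: continuousD.
  by apply/funext => s; rewrite cReD.
rewrite (_ : (fun s => _) = (fun s => Im (f s)) + (fun s => Im (g s))); first exact: continuousD.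
by apply/funext => s; rewrite cImD.
Qed.
Lemma ccontN (f : R -> C) t : ccont f t -> ccont (fun s => - f s) t.
Proof.
move=> [a b]; split.
  rewrite (_ : (fun s => _) = - (fun s => Re (f s))); first exact: continuousN.
  by apply/funext => s; rewrite cReN.
rewrite (_ : (fun s => _) = - (fun s => Im (f s))); first exact: continuousN.
by apply/funext => s; rewrite cImN.
Qed.
Lemma ccontB (f g : R -> C) t : ccont f t -> ccont g t -> ccont (fun s => f s - g s) t.
Proof. by move=> h1 h2; apply: ccontD => //; exact: ccontN. Qed.
Lemma ccontM (f g : R -> C) t : ccont f t -> ccont g t -> ccont (fun s => f s * g s) t.
Proof.
move=> [a b] [c d]; split.
  rewrite (_ : (fun s => _) = (fun s => Re (f s)) * (fun s => Re (g s)) - (fun s => Im (f s)) * (fun s => Im (g s))).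
    by apply: continuousB; exact: continuousM.
  by apply/funext => s; rewrite cReM.
rewrite (_ : (fun s => _) = (fun s => Re (f s)) * (fun s => Im (g s)) + (fun s => Im (f s)) * (fun s => Re (g s))).
  by apply: continuousD; exact: continuousM.
by apply/funext => s; rewrite cImM.
Qed.
Lemma ccont_sum I (r : seq I) (P : pred I) (f : I -> R -> C) t :
  (forall i, P i -> ccont (f i) t) -> ccont (fun s => \sum_(i <- r | P i) f i s) t.
Proof.
move=> h; elim: r => [|i r IH].
  rewrite (_ : (fun s => _) = (fun _ => 0)); first exact: ccont_cst.
  by apply/funext => s; rewrite big_nil.
rewrite (_ : (fun s => _) = (fun s => if P i then f i s + \sum_(j <- r | P j) f j s
   else \sum_(j <- r | P j) f j s)); last by apply/funext => s; rewrite big_cons.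
by case Pi: (P i) => //; apply: ccontD => //; exact: h.
Qed.
Lemma ccont_real (g : R -> R) t : {for t, continuous g} -> ccont (fun s => toC (g s)) t.
Proof. by move=> h; split => //=; exact: cst_continuous. Qed.

Lemma distinct_near n (y : Rn R n) : exists2 e : R, 0 < e &
  forall h, 0 < h < e -> vdistinct (fun i => y i + h * i%:R : R).
Proof.
(* The only h at which the two perturbed coordinates of p can agree; e is the least positive such
   value, capped at 1. *)
pose bad (p : 'I_n * 'I_n) : R := (y p.2 - y p.1) / (p.1%:R - p.2%:R).
pose e := \big[Num.min/1]_(p | 0 < bad p) bad p.
exists e; first by rewrite /e; elim/big_ind: _ => // x z x0 z0; rewrite lt_min x0.
move=> h /andP[h0 he] i j ij; apply/eqP => E.
have dn : (i%:R - j%:R : R) != 0.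
  by rewrite subr_eq0 eqr_nat; apply: contraNneq ij => /ord_inj ->.
have hb : h = bad (i, j).
  rewrite /bad /=; apply: (mulIf dn); rewrite divfK//; lra.
have : e <= bad (i, j) by rewrite /e (bigminD1 (i, j)) -?hb//= ge_min lexx.
by rewrite -hb leNgt he.
Qed.

End Gronwall.

Section PairSum.
Variables (R : realType) (n : nat).
Local Notation C := R[i].

Definition psum (a : 'I_n -> 'I_n -> C) : C := \sum_(i < n) \sum_(j < n | (i < j)%N) a i j.

Lemma eq_psum (a b : 'I_n -> 'I_n -> C) : (forall i j : 'I_n, (i < j)%N -> a i j = b i j) -> psum a = psum b.
Proof. by move=> h; apply: eq_bigr => i _; apply: eq_bigr => j; exact: h. Qed.
Lemma psumD a b : psum (fun i j => a i j + b i j) = psum a + psum b.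
Proof. by rewrite /psum -big_split /=; apply: eq_bigr => i _; rewrite big_split. Qed.
Lemma psumZ c a : psum (fun i j => c * a i j) = c * psum a.
Proof. by rewrite /psum mulr_sumr; apply: eq_bigr => i _; rewrite mulr_sumr. Qed.
Lemma psumN a : psum (fun i j => - a i j) = - psum a.
Proof. by rewrite -mulN1r -psumZ; apply: eq_psum => i j _; rewrite mulN1r. Qed.
Lemma psumB a b : psum (fun i j => a i j - b i j) = psum a - psum b.
Proof. by rewrite psumD psumN. Qed.
Lemma psum0 : psum (fun _ _ => 0) = 0.
Proof. by rewrite /psum big1// => i _; rewrite big1. Qed.

Lemma psum2 a : (forall i j, a i j = a j i) ->
  psum a + psum a = \sum_(i < n) \sum_(j < n | j != i) a i j.
Proof.
move=> sa.
have E : psum a = \sum_(i < n) \sum_(j < n | (j < i)%N) a i j.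
  rewrite /psum (exchange_big_dep xpredT)//=; apply: eq_bigr => i _.
  by apply: eq_bigr => j _; exact: sa.
rewrite {2}E /psum -big_split /=; apply: eq_bigr => i _.
rewrite [RHS](bigID (fun j : 'I_n => (i < j)%N)) /=; congr (_ + _).
  apply: eq_bigl => j; rewrite andbC; case: ltnP => //= ij.
  by rewrite -val_eqE /= gtn_eqF.
by apply: eq_bigl => j; rewrite -leqNgt ltn_neqAle val_eqE.
Qed.

(** A permutation does not respect i < j, so the doubled sums, which run over all ordered pairs, are
    compared. *)
Lemma psum_perm (s : 'S_n) a : (forall i j, a i j = a j i) ->
  psum (fun i j => a (s i) (s j)) = psum a.
Proof.
move=> sa.
have h : psum (fun i j => a (s i) (s j)) *+ 2 = psum a *+ 2.
  rewrite !mulr2n !psum2//.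
  rewrite [RHS](reindex_inj (@perm_inj _ s)); apply: eq_bigr => i _.
  rewrite [RHS](reindex_inj (@perm_inj _ s)); apply: eq_bigl => j.
  by rewrite (inj_eq perm_inj).
by apply: (mulIf (x := 2%:R)); rewrite ?pnatr_eq0// !mulr_natr.
Qed.

End PairSum.

(** * The Dunkl kernel *)

Section RadialSystem.
Variables (R : realType) (n : nat) (k : R).
Hypothesis k0 : 0 <= k.
Local Notation C := R[i].
Local Notation Re := (@complex.Re R).
Local Notation Im := (@complex.Im R).
Local Notation Rn := (Rn R n).
Local Notation Cn := (Cn R n).

Definition rsc (s : R) (y : Rn) : Rn := fun i => s * y i.
Definition vsum (y : Rn) : R := \sum_(i < n) y i.
Definition vsw (i j : 'I_n) (y : Rn) : Rn := vperm (tperm i j) y.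

Lemma rsc1 y : rsc 1 y = y. Proof. by apply/funext => i; rewrite /rsc mul1r. Qed.
Lemma rsc0 y : rsc 0 y = (fun _ => 0). Proof. by apply/funext => i; rewrite /rsc mul0r. Qed.
Lemma rsc_rsc s t y : rsc s (rsc t y) = rsc (s * t) y.
Proof. by apply/funext => i; rewrite /rsc mulrA. Qed.
Lemma vperm_vperm (w v : 'S_n) (y : Rn) : vperm w (vperm v y) = vperm (w * v) y.
Proof. by apply/funext => i; rewrite /vperm permM. Qed.
Lemma vperm1 (y : Rn) : vperm 1 y = y. Proof. by apply/funext => i; rewrite /vperm perm1. Qed.
Lemma vsw_vperm i j (w : 'S_n) y : vsw i j (vperm w y) = vperm (tperm i j * w) y.
Proof. exact: vperm_vperm. Qed.
Lemma vperm_vsw i j (w : 'S_n) y : vperm w (vsw (w i) (w j) y) = vsw i j (vperm w y).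
Proof.
rewrite vsw_vperm /vsw vperm_vperm; congr (vperm _ y); apply/permP => l.
rewrite !permM; case: (tpermP i j l) => [->|->|/eqP hi /eqP hj]; rewrite ?tpermL ?tpermR//.
by rewrite tpermD// eq_sym (inj_eq perm_inj).
Qed.
Lemma vswC i j y : vsw i j y = vsw j i y. Proof. by rewrite /vsw tpermC. Qed.
Lemma vswK i j y : vsw i j (vsw i j y) = y.
Proof. by rewrite /vsw vperm_vperm tperm2 vperm1. Qed.
Lemma vsum_vperm w y : vsum (vperm w y) = vsum y.
Proof. by rewrite /vsum [RHS](reindex_inj (@perm_inj _ w)). Qed.
Lemma vdistinct_vperm w (y : Rn) : vdistinct y -> vdistinct (vperm w y).
Proof. by move=> h i j ij; apply: h; rewrite (inj_eq perm_inj). Qed.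
Lemma vdistinct_rsc t (y : Rn) : t != 0 -> vdistinct y -> vdistinct (rsc t y).
Proof. by move=> t0 h i j ij; rewrite /rsc (inj_eq (mulfI t0)); exact: h. Qed.
Lemma toCn_vperm w (y : Rn) : toCn (vperm w y) = pact w (toCn y). Proof. by []. Qed.
Lemma sw_toCn i j (y : Rn) : sw i j (toCn y) = toCn (vsw i j y). Proof. by []. Qed.

Lemma cdot_pact (w : 'S_n) (u v : Cn) : cdot (pact w u) (pact w v) = cdot u v.
Proof. by rewrite /cdot [RHS](reindex_inj (@perm_inj _ w)). Qed.
Lemma cdotBl (u u' v : Cn) : cdot (fun i => u i - u' i) v = cdot u v - cdot u' v.
Proof. by rewrite /cdot -sumrB; apply: eq_bigr => i _; rewrite mulrBl. Qed.
Lemma cdot_rsc (u : Cn) s (y : Rn) : cdot u (toCn (rsc s y)) = toC s * cdot u (toCn y).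
Proof. by rewrite /cdot mulr_sumr; apply: eq_bigr => i _; rewrite /toCn /rsc toCM; ring. Qed.

Lemma cdot_sw (u : Cn) (i j : 'I_n) (v : Cn) : i != j ->
  cdot u v - cdot u (sw i j v) = (u i - u j) * (v i - v j).
Proof.
move=> ij; rewrite /cdot -sumrB (bigD1 i)//= (bigD1 j) 1?eq_sym//= big1 ?addr0.
  by rewrite /sw tpermL tpermR; ring.
by move=> l /andP[li lj]; rewrite /sw tpermD 1?eq_sym// subrr.
Qed.

Lemma cdot_swl (u : Cn) (i j : 'I_n) (v : Cn) : cdot (sw i j u) v = cdot u (sw i j v).
Proof.
rewrite -(cdot_pact (tperm i j) u); congr (cdot _ _).
by apply/funext => l; rewrite /pact /sw tpermK.
Qed.

(* [radsol lam f g] says that f solves the Dunkl equation in the radial (Euler) direction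
   with spectral parameter lam and forcing term g: there the singular denominators cancel. *)
Definition radsol (lam : Cn) (f g : Rn -> C) := forall y, vdistinct y ->
  cderiv (fun s => f (rsc s y)) 1
    (cdot lam (toCn y) * f y - toC k * psum (fun i j => f y - f (vsw i j y)) + g y).

Lemma radsol_ext lam f g f' g' : f =1 f' -> g =1 g' -> radsol lam f g -> radsol lam f' g'.
Proof. by move=> /funext <- /funext <-. Qed.

Lemma radsolD lam f g f' g' : radsol lam f g -> radsol lam f' g' ->
  radsol lam (fun y => f y + f' y) (fun y => g y + g' y).
Proof.
move=> h h' y yd; apply: cderiv_eq (cderivD (h y yd) (h' y yd)) _.
have -> : psum (fun i j => f y + f' y - (f (vsw i j y) + f' (vsw i j y))) =
    psum (fun i j => f y - f (vsw i j y)) + psum (fun i j => f' y - f' (vsw i j y)).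
  by rewrite -psumD; apply: eq_psum => i j _; ring.
ring.
Qed.

Lemma radsolZ lam c f g : radsol lam f g ->
  radsol lam (fun y => c * f y) (fun y => c * g y).
Proof.
move=> h y yd; apply: cderiv_eq (cderivZ c (h y yd)) _.
rewrite (@eq_psum _ _ (fun i j => c * f y - c * f (vsw i j y)) (fun i j => c * (f y - f (vsw i j y)))); last first.
  by move=> i j _; ring.
rewrite psumZ; ring.
Qed.

Lemma radsolB lam f g f' g' : radsol lam f g -> radsol lam f' g' ->
  radsol lam (fun y => f y - f' y) (fun y => g y - g' y).
Proof.
move=> h h'; apply: radsol_ext (radsolD h (radsolZ (-1) h')) => y; by rewrite mulN1r.
Qed.

Lemma radsol0 lam : radsol lam (fun _ => 0) (fun _ => 0).
Proof.
move=> y _; apply: cderiv_eq (cderiv_cst 0 1) _.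
rewrite (@eq_psum _ _ _ (fun _ _ => 0)) ?psum0; first by rewrite !mulr0 subr0 addr0.
by move=> i j _; rewrite subrr.
Qed.

Lemma radsol_sum lam I (r : seq I) (P : pred I) (f g : I -> Rn -> C) :
  (forall i, P i -> radsol lam (f i) (g i)) ->
  radsol lam (fun y => \sum_(i <- r | P i) f i y) (fun y => \sum_(i <- r | P i) g i y).
Proof.
move=> h; elim: r => [|i r IH].
  by apply: radsol_ext (radsol0 lam) => y; rewrite big_nil.
case Pi : (P i).
  by apply: radsol_ext (radsolD (h i Pi) IH) => y; rewrite big_cons Pi.
by apply: radsol_ext IH => y; rewrite big_cons Pi.
Qed.

Lemma radsol_psum lam (f g : 'I_n -> 'I_n -> Rn -> C) :
  (forall i j : 'I_n, (i < j)%N -> radsol lam (f i j) (g i j)) ->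
  radsol lam (fun y => psum (fun i j => f i j y)) (fun y => psum (fun i j => g i j y)).
Proof. by move=> h; apply: radsol_sum => i _; apply: radsol_sum => j ij; exact: h. Qed.

Lemma radsol_shift lam lam' f g : radsol lam f g ->
  radsol lam' f (fun y => g y + (cdot lam (toCn y) - cdot lam' (toCn y)) * f y).
Proof. by move=> h y yd; apply: cderiv_eq (h y yd) _; ring. Qed.

(** The linear form is homogeneous of degree one in the Euler direction; the pair sum measures its
    failure to be invariant under the swaps, computed by [cdot_sw]. *)
Lemma radsol_dot lam eta f : radsol lam f (fun _ => 0) ->
  radsol lam (fun y => cdot eta (toCn y) * f y)
    (fun y => cdot eta (toCn y) * f y +
       toC k * psum (fun i j => (eta i - eta j) * (toC (y i) - toC (y j)) * f (vsw i j y))).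
Proof.
move=> h y yd.
have d1 : cderiv (fun s => cdot eta (toCn (rsc s y))) 1 (cdot eta (toCn y)).
  rewrite (_ : (fun s => _) = (fun s => cdot eta (toCn y) * toC s)); last first.
    by apply/funext => s; rewrite cdot_rsc mulrC.
  by apply: cderiv_eq (cderivZ _ (cderiv_id 1)) _; rewrite mulr1.
apply: cderiv_eq (cderivM d1 (h y yd)) _; rewrite !rsc1.
rewrite (@eq_psum _ _ (fun i j => cdot eta (toCn y) * f y - cdot eta (toCn (vsw i j y)) * f (vsw i j y))
  (fun i j => cdot eta (toCn y) * (f y - f (vsw i j y)) + (eta i - eta j) * (toC (y i) - toC (y j)) * f (vsw i j y))).
  have E1 := psumZ (cdot eta (toCn y)) (fun i j => f y - f (vsw i j y)).
  have E2 := psumD (fun i j => cdot eta (toCn y) * (f y - f (vsw i j y)))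
    (fun i j => (eta i - eta j) * (toC (y i) - toC (y j)) * f (vsw i j y)).
  rewrite E2 E1; ring.
move=> i j ij; have nij : i != j by rewrite -val_eqE /= ltn_eqF.
rewrite -(cdot_sw eta (toCn y) nij) sw_toCn; ring.
Qed.

Lemma radsol_equi lam f (w : 'S_n) : radsol (pact w lam) f (fun _ => 0) ->
  radsol lam (fun y => f (vperm w y)) (fun _ => 0).
Proof.
move=> h y yd; apply: cderiv_eq (h _ (vdistinct_vperm w yd)) _.
rewrite toCn_vperm cdot_pact; congr (_ - _ * _ + _).
rewrite -[in RHS](psum_perm w); last by move=> i j; rewrite vswC.
by apply: eq_psum => i j _; rewrite vperm_vsw.
Qed.

(** Substituting s/t for s reduces the derivative at t to the one at 1, which is where the factors
    1/t come from. They blow up at 0 but are positive, as [orbit_gronwall] requires. *)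
Lemma radsol_ray lam f g y t : radsol lam f g -> vdistinct y -> 0 < t ->
  cderiv (fun s => f (rsc s y)) t
    (cdot lam (toCn y) * f (rsc t y)
     - toC k * psum (fun i j => toC t^-1 * (f (rsc t y) - f (rsc t (vsw i j y)))) + toC t^-1 * g (rsc t y)).
Proof.
move=> h yd t0; have tn : t != 0 by rewrite gt_eqF.
have h1 := h _ (vdistinct_rsc tn yd).
have e1 : t / t = 1 by rewrite divff.
have dg : is_derive t (1 : R) (fun s => s / t) t^-1.
  rewrite (_ : (fun s => _) = t^-1 *: id); last by apply/funext => s; rewrite mulrC.
  by apply: (is_derive_eq (is_deriveZ t^-1 (is_derive_id t (1 : R)))); rewrite /GRing.scale /= mulr1.
rewrite -e1 in h1.
have := cderiv_comp dg h1.
rewrite (_ : (fun s => _) = (fun s => f (rsc s y))); last first.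
  by apply/funext => s; rewrite rsc_rsc divfK.
move=> h2; apply: cderiv_eq h2 _.
rewrite cdot_rsc psumZ toCV; field.
by rewrite toC_eq0.
Qed.

Definition raycont (f : Rn -> C) := forall y (t : R), ccont (fun s => f (rsc s y)) t.

(** The factor n! is the sum over the orbit at the origin, where all orbit values coincide; the
    factor [expR 1] pays for taking d = 1 in [radsol_bound1]. *)
Definition cn : R := Num.sqrt (expR 1 * n`!%:R).
Lemma cn_sqr : cn ^+ 2 = expR 1 * n`!%:R.
Proof. by rewrite sqr_sqrtr// mulr_ge0// expR_ge0. Qed.
Lemma sum_perm_const (x : R) : \sum_(w : 'S_n) x = n`!%:R * x.
Proof. by rewrite sumr_const mulr_natl; congr (_ *+ _); rewrite -card_Sn; apply: eq_card. Qed.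
Lemma cn_ge0 : 0 <= cn. Proof. exact: sqrtr_ge0. Qed.

(** All orbit points are the origin at time 0, and the orbit contains y at time 1. The coefficient
    1/t is the same at swapped points, so nothing has to be compensated and r = 0. *)
Lemma radsol_bound lam f g y (M d D : R) : raycont f -> radsol lam f g -> vdistinct y ->
  (forall w, Re (cdot lam (toCn (vperm w y))) <= M) ->
  (forall t : R, 0 < t < 1 ->
     \sum_w 2 * crip (f (rsc t (vperm w y))) (toC t^-1 * g (rsc t (vperm w y))) <=
     d * (\sum_(w : 'S_n) cnorm (f (rsc t (vperm w y))) ^+ 2) + D * expR ((2 * M + d) * t)) ->
  cnorm (f y) ^+ 2 <= expR (2 * M + d) * (n`!%:R * cnorm (f (fun _ => 0)) ^+ 2 + D).
Proof.
move=> rf hf yd hM hD.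
refine ((fun h => _) (@orbit_gronwall R n k (fun w t => f (rsc t (vperm w y)))
  (fun w t => cdot lam (toCn (vperm w y))) (fun w t => toC t^-1 * g (rsc t (vperm w y)))
  (fun i j w t => t^-1) (fun _ => 0) M d D k0 _ _ _ _ _ hD)).
- have E0 : \sum_(w : 'S_n) cnorm (f (rsc 0 (vperm w y))) ^+ 2 = n`!%:R * cnorm (f (fun _ => 0)) ^+ 2.
    under eq_bigr do rewrite rsc0.
    by rewrite sum_perm_const.
  move: h; rewrite E0; apply: le_trans.
  rewrite (bigD1 1%g)//= rsc1 vperm1 lerDl; apply: sumr_ge0 => w _; exact: sqr_ge0.
- move=> w t /andP[t0 _]; apply: cderiv_eq (radsol_ray hf (vdistinct_vperm w yd) t0) _.
  rewrite toC0 mul0r addr0; congr (_ - _ * _ + _).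
  by apply: eq_psum => i j _; rewrite vsw_vperm.
- by move=> w t _; exact: rf.
- by move=> w t _.
- by move=> i j w t _ /andP[t0 _]; rewrite addr_ge0// invr_ge0 ltW.
- move=> w t _; rewrite big1 ?mulr0// => i _; rewrite big1// => j _; by rewrite subrr mul0r.
Qed.

Lemma radsol_bound0 lam f y (M : R) : raycont f -> radsol lam f (fun _ => 0) -> vdistinct y ->
  (forall w, Re (cdot lam (toCn (vperm w y))) <= M) ->
  cnorm (f y) <= cn * expR M * cnorm (f (fun _ => 0)).
Proof.
move=> rf hf yd hM.
have h0 (t : R) : 0 < t < 1 ->
     \sum_w 2 * crip (f (rsc t (vperm w y))) (toC t^-1 * 0) <=
     0 * (\sum_(w : 'S_n) cnorm (f (rsc t (vperm w y))) ^+ 2) + 0 * expR ((2 * M + 0) * t).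
  move=> _; rewrite mul0r mul0r addr0 big1// => w _.
  by rewrite mulr0 /crip cRe0 cIm0 !mulr0 addr0 mulr0.
have := radsol_bound rf hf yd hM h0; rewrite addr0 addr0 => h.
rewrite -(@ler_pXn2r _ 2) ?nnegrE ?mulr_ge0 ?cnorm_ge0 ?cn_ge0 ?expR_ge0//.
apply: (le_trans h); rewrite !exprMn -expRM_natr cn_sqr.
rewrite [M * _]mulrC mulrA ler_wpM2r ?sqr_ge0// [leRHS]mulrC ler_wpM2l ?expR_ge0//.
by rewrite ler_peMl// -[leLHS]expR0 ler_expR ler01.
Qed.

(** The inequality 2 <f, g> <= |f|^2 + |g|^2 brings the forcing into Gronwall form with d = 1;
    summing its bound over the orbit gives n! B^2. *)
Lemma radsol_bound1 lam f g y (M B : R) : raycont f -> radsol lam f g -> vdistinct y ->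
  (forall w, Re (cdot lam (toCn (vperm w y))) <= M) ->
  f (fun _ => 0) = 0 -> 0 <= B ->
  (forall (w : 'S_n) t, 0 < t < 1 -> cnorm (toC t^-1 * g (rsc t (vperm w y))) <= B * expR (M * t)) ->
  cnorm (f y) <= cn * expR M * B.
Proof.
move=> rf hf yd hM f00 B0 hB.
have h0 (t : R) : 0 < t < 1 ->
     \sum_w 2 * crip (f (rsc t (vperm w y))) (toC t^-1 * g (rsc t (vperm w y))) <=
     1 * (\sum_(w : 'S_n) cnorm (f (rsc t (vperm w y))) ^+ 2)
       + (n`!%:R * B ^+ 2) * expR ((2 * M + 1) * t).
  move=> t01; rewrite mul1r.
  apply: (@le_trans _ _ (\sum_(w : 'S_n) (cnorm (f (rsc t (vperm w y))) ^+ 2 +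
     cnorm (toC t^-1 * g (rsc t (vperm w y))) ^+ 2))).
    by apply: ler_sum => w _; exact: crip_le2.
  rewrite big_split /= lerD2l.
  apply: (@le_trans _ _ (\sum_(w : 'S_n) (B * expR (M * t)) ^+ 2)).
    apply: ler_sum => w _; rewrite ler_pXn2r ?nnegrE ?cnorm_ge0 ?mulr_ge0 ?expR_ge0//.
    exact: hB.
  rewrite sum_perm_const exprMn mulrA ler_wpM2l ?mulr_ge0 ?sqr_ge0//.
  rewrite -expRM_natr ler_expR; case/andP: t01 => t0 t1; nra.
have := radsol_bound rf hf yd hM h0; rewrite f00 cnorm0 expr0n /= mulr0 add0r => h.
rewrite -(@ler_pXn2r _ 2) ?nnegrE ?mulr_ge0 ?cnorm_ge0 ?cn_ge0 ?expR_ge0//.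
apply: (le_trans h); rewrite !exprMn -expRM_natr cn_sqr.
rewrite expRD [M * _]mulrC mulrA ler_wpM2r ?sqr_ge0//.
by rewrite le_eqVlt; apply/orP; left; apply/eqP; ring.
Qed.

Lemma radsol_unique lam f : raycont f -> radsol lam f (fun _ => 0) -> f (fun _ => 0) = 0 ->
  forall y, vdistinct y -> f y = 0.
Proof.
move=> rf hf f00 y yd.
pose M := \sum_(w : 'S_n) `|Re (cdot lam (toCn (vperm w y)))|.
have hM w : Re (cdot lam (toCn (vperm w y))) <= M.
  by rewrite /M (bigD1 w)//= (le_trans (ler_norm _))// lerDl sumr_ge0.
have := radsol_bound0 rf hf yd hM; rewrite f00 cnorm0 mulr0 => h.
by apply/eqP; rewrite -cnorm_eq0 eq_le h cnorm_ge0.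
Qed.

End RadialSystem.

Section Density.
Variables (R : realType) (n : nat).
Local Notation C := R[i].
Local Notation Re := (@complex.Re R).
Local Notation Im := (@complex.Im R).
Local Notation Rn := (Rn R n).
Local Notation Cn := (Cn R n).

Definition ypert (y : Rn) (h : R) : Rn := fun i => y i + h * i%:R.

Lemma ypert0 y : ypert y 0 = y. Proof. by apply/funext => i; rewrite /ypert mul0r addr0. Qed.

Lemma ypert_cont y i t : {for t, continuous (fun h => ypert y h i)}.
Proof. by apply: continuousD; [exact: cst_continuous|apply: cvgMl; exact: cvg_id]. Qed.

Lemma vpos_ypert y h : 0 <= h -> vpos y -> vpos (ypert y h).
Proof. by move=> h0 yp i; rewrite ltr_pwDl ?yp// mulr_ge0. Qed.

Lemma continuous_bigsum I (r : seq I) (f : I -> R -> R) (t : R) :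
  (forall i, {for t, continuous (f i)}) -> {for t, continuous (fun s => \sum_(i <- r) f i s)}.
Proof.
move=> h; elim: r => [|i r IH].
  rewrite (_ : (fun s => _) = (fun _ => 0)); first exact: cst_continuous.
  by apply/funext => s; rewrite big_nil.
rewrite (_ : (fun s => _) = (f i) + (fun s => \sum_(j <- r) f j s)); first exact: continuousD.
by apply/funext => s; rewrite big_cons.
Qed.

Lemma vsum_ge0 (y : Rn) : vpos y -> 0 <= vsum y.
Proof. by move=> yp; apply: sumr_ge0 => i _; rewrite ltW. Qed.

(** The path [ypert] stays in the positive orthant and has distinct coordinates for small h > 0, so
    bounds proved there pass to the limit. *)
Lemma vpos_dense_bound (f : Rn -> R) (A : R) m (e : R) :
  (forall y, vpos y -> {for 0, continuous (fun h => f (ypert y h))}) ->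
  (forall y, vpos y -> vdistinct y -> f y <= A * vsum y ^+ m * expR (- e * vsum y)) ->
  forall y, vpos y -> f y <= A * vsum y ^+ m * expR (- e * vsum y).
Proof.
move=> fc fd y yp.
have [d d0 hd] := distinct_near y.
have sc : {for 0, continuous (fun h => vsum (ypert y h))}.
  by apply: continuous_bigsum => i; exact: ypert_cont.
have qc : continuous (fun s : R => A * s ^+ m * expR (- e * s)).
  move=> s; apply: (@continuousM _ _ (fun s : R => A * s ^+ m) (fun s => expR (- e * s))).
    by apply: cvgMr; exact: exprn_continuous.
  apply: (@continuous_comp _ _ _ (fun s : R => - e * s) (@expR R)); last exact: continuous_expR.
  by apply: cvgMr; exact: cvg_id.
have gc := continuous_comp sc (qc _).
have := @right_limit_le R _ _ d d0 (fc y yp) gc.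
rewrite /= ypert0; apply => h h0d; apply: fd; last exact: hd.
by apply: vpos_ypert => //; case/andP: h0d => /ltW.
Qed.

Lemma right_limit_eq0 (F : R -> C) (e : R) : 0 < e -> ccont F 0 ->
  (forall h, 0 < h < e -> F h = 0) -> F 0 = 0.
Proof.
move=> e0 cF F0; apply/eqP; rewrite -cnorm_eq0 eq_le cnorm_ge0 andbT.
apply: (@right_limit_le R (fun h => cnorm (F h)) (fun _ => 0) e e0).
- exact: ccont_cnorm.
- exact: cst_continuous.
- by move=> h /F0 ->; rewrite cnorm0.
Qed.

(** In the direction of the l-th unit vector only pairs containing l survive, and antisymmetry of A
    reorients those with l in second place. *)
Lemma psum_delta (A : 'I_n -> 'I_n -> C) (l : 'I_n) : (forall i j, A j i = - A i j) ->
  psum (fun i j => toC ((i == l)%:R - (j == l)%:R) * A i j) = \sum_(j < n | j != l) A l j.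
Proof.
move=> aA.
have h : psum (fun i j => toC ((i == l)%:R - (j == l)%:R) * A i j) *+ 2 = (\sum_(j < n | j != l) A l j) *+ 2.
  rewrite !mulr2n psum2; last by move=> i j; rewrite aA mulrN -mulNr -toCN opprB.
  rewrite (bigD1 l)//=; congr (_ + _).
    by apply: eq_bigr => j /negbTE jl; rewrite eqxx jl subr0 mul1r.
  apply: eq_bigr => i /negbTE il.
  rewrite (bigD1 l) 1?eq_sym ?il//= big1 ?addr0; last first.
    by move=> j /andP[_ /negbTE jl]; rewrite [l == i]eq_sym il jl subrr mul0r.
  by rewrite [l == i]eq_sym il eqxx sub0r toCN toC1 mulN1r aA opprK.
by apply: (mulIf (x := 2%:R)); rewrite ?pnatr_eq0// !mulr_natr.
Qed.

End Density.

(** * Growth, equivariance and spectral expansion of the Dunkl kernel *)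

Section DunklKernel.
Variables (R : realType) (n : nat) (k : R) (E : Cn R n -> Cn R n -> R[i]).
Hypothesis k0 : 0 <= k.
Hypothesis hE : is_dunkl_kernel k E.
Local Notation C := R[i].
Local Notation Re := (@complex.Re R).
Local Notation Im := (@complex.Im R).
Local Notation Rn := (Rn R n).
Local Notation Cn := (Cn R n).
Local Notation cn := (cn R n).
Local Notation radsol := (radsol k).

Definition Er (lam : Cn) (y : Rn) : C := E lam (toCn y).

Lemma Er0 lam : Er lam (fun _ => 0) = 1.
Proof. by rewrite /Er -[RHS](hE.2.1 lam); congr (E _ _); apply/funext. Qed.

Lemma Er_path lam (p : R -> Rn) t : (forall i, {for t, continuous (fun s => p s i)}) ->
  ccont (fun s => Er lam (p s)) t.
Proof.
move=> pc; apply: ccont_near => e e0.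
have [d d0 hd] := hE.1.1 lam (toCn (p t)) I e e0.
have H : \forall s \near t, forall i, `|p t i - p s i| < d.
  by apply: (@filter_forall _ _ (fun i s => `|p t i - p s i| < d) _ (nbhs_filter t)) => i;
     have /cvgrPdist_lt/(_ d d0) := pc i.
apply: filterS H => s hs; apply: hd => //= i; first by rewrite subrr cnorm0.
by rewrite /toCn -toCB cnorm_toC distrC.
Qed.

Lemma Er_raycont lam : raycont (Er lam).
Proof. by move=> y t; apply: Er_path => i; apply: cvgMl; exact: cvg_id. Qed.

Lemma distinct_toCn (y : Rn) : vdistinct y -> distinct_coords (toCn y).
Proof. by move=> h i j ij; rewrite /toCn (inj_eq (@toC_inj R)); exact: h. Qed.

(** Taking the direction y at the point y makes every quotient (xi_i - xi_j)/(x_i - x_j) equal to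
    1. *)
Lemma Er_radsol lam : radsol lam (Er lam) (fun _ => 0).
Proof.
move=> y yd.
have [L [hL eqL]] := hE.2.2 lam y (toCn y) (distinct_toCn yd).
apply: cderiv_shift.
rewrite (_ : (fun h => _) = (fun t => E lam (cvadd (toCn y) (cvscale (toC t) (toCn y))))); last first.
  apply/funext => t; congr (E _ _); apply/funext => i.
  by rewrite /toCn /rsc /cvadd /cvscale mulrDl mul1r toCD toCM.
apply: cderiv_eq (cderivP (L := L) _) _.
  move=> e e0; have [d d0 hd] := hL e e0; exists d => // t ht; rewrite add0r.
  have e00 v : cvadd (toCn y) (cvscale (toC 0) v) = toCn y.
    by apply/funext => i; rewrite /cvadd /cvscale mul0r addr0.
  by rewrite e00; exact: hd.
have -> : L = Rdot y lam * E lam (toCn y) - toC k * psum (fun i j => Er lam y - Er lam (vsw i j y)).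
  rewrite -eqL -/(psum _).
  rewrite (@eq_psum _ _ (fun i j => _) (fun i j => Er lam y - Er lam (vsw i j y))) ?addrK//.
  move=> i j ij; rewrite sw_toCn /toCn -toCB mulrAC divff ?mul1r//.
  by rewrite toC_eq0 subr_eq0; apply: yd; rewrite -val_eqE /= ltn_eqF.
rewrite addr0; congr (_ * _ - _).
by rewrite /Rdot /cdot; apply: eq_bigr => i _; rewrite mulrC.
Qed.

Lemma Er_partial lam y l : vdistinct y ->
  cderiv (fun t => Er lam (upd y l t)) (y l)
    (lam l * Er lam y - toC k * \sum_(j < n | j != l) (Er lam y - Er lam (vsw l j y)) / toC (y l - y j)).
Proof.
move=> yd; pose xi : Rn := fun i => (i == l)%:R.
have [L [hL eqL]] := hE.2.2 lam xi (toCn y) (distinct_toCn yd).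
apply: cderiv_shift.
have pE t : toCn (upd y l (y l + t)) = cvadd (toCn y) (cvscale (toC t) (toCn xi)).
  apply/funext => i; rewrite /toCn /upd /cvadd /cvscale -toCM -toCD /xi.
  by case: eqP => [->|_]; rewrite ?mulr1 ?mulr0 ?addr0.
rewrite (_ : (fun h => _) = (fun t => E lam (cvadd (toCn y) (cvscale (toC t) (toCn xi))))); last first.
  by apply/funext => t; rewrite /Er pE.
apply: cderiv_eq (cderivP (L := L) _) _.
  move=> e e0; have [d d0 hd] := hL e e0; exists d => // t ht; rewrite add0r.
  have e00 v : cvadd (toCn y) (cvscale (toC 0) v) = toCn y.
    by apply/funext => i; rewrite /cvadd /cvscale mul0r addr0.
  by rewrite e00; exact: hd.
have -> : lam l = Rdot xi lam.
  rewrite /Rdot (bigD1 l)//= /xi eqxx mul1r big1 ?addr0// => i /negbTE ->.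
  by rewrite mul0r.
rewrite -[E lam _]/(Er lam y) in eqL.
rewrite -eqL -/(psum _) -(psum_delta l (A := fun i j => (Er lam y - Er lam (vsw i j y)) / toC (y i - y j))).
  rewrite (@eq_psum _ _ (fun i j => toC (xi i - xi j) * _ / _)
    (fun i j => toC ((i == l)%:R - (j == l)%:R) * ((Er lam y - Er lam (vsw i j y)) / toC (y i - y j)))).
    by rewrite addrK.
  by move=> i j _; rewrite sw_toCn /toCn -toCB mulrA.
by move=> i j; rewrite vswC -[y j - y i]opprB toCN invrN mulrN.
Qed.

Lemma Re_cdot_le lam (e : R) (y : Rn) : vpos y -> (forall i, Re (lam i) <= - e) ->
  Re (cdot lam (toCn y)) <= - e * vsum y.
Proof.
move=> yp le; rewrite /cdot cRe_sum /vsum mulr_sumr; apply: ler_sum => i _.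
by rewrite /toCn cReM cIm_toC mulr0 subr0 ler_wpM2r// ltW// yp.
Qed.

Lemma Re_cdot_vperm_le lam (e : R) (y : Rn) (w : 'S_n) : vpos y -> (forall i, Re (lam i) <= - e) ->
  Re (cdot lam (toCn (vperm w y))) <= - e * vsum y.
Proof.
move=> yp le; rewrite -(vsum_vperm w y); apply: Re_cdot_le => //.
by apply/vpos_vperm.
Qed.

Lemma Er_bound lam (e : R) y : vpos y -> (forall i, Re (lam i) <= - e) ->
  cnorm (Er lam y) <= cn * expR (- e * vsum y).
Proof.
move=> yp le.
rewrite -[cn]mulr1 -[1](expr0 (vsum y)).
move: y yp; apply: (vpos_dense_bound (f := fun y => cnorm (Er lam y))).
  by move=> z zp; apply: ccont_cnorm; apply: Er_path => i; exact: ypert_cont.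
move=> z zp zd; rewrite expr0 mulr1.
have := radsol_bound0 k0 (@Er_raycont lam) (@Er_radsol lam) zd (fun w => Re_cdot_vperm_le w zp le).
by rewrite Er0 cnorm1 mulr1.
Qed.

(** Both sides solve the radial system of lam with value 1 at the origin; points with coinciding
    coordinates are reached by a right limit. *)
Lemma Er_equi lam (w : 'S_n) y : Er (pact w lam) (vperm w y) = Er lam y.
Proof.
have [d d0 hd] := distinct_near y.
apply/eqP; rewrite -subr_eq0 -{1 2}(ypert0 y); apply/eqP.
apply: (@right_limit_eq0 R (fun h => Er (pact w lam) (vperm w (ypert y h)) - Er lam (ypert y h)) d d0).
  apply: ccontB; last by apply: Er_path => i; exact: ypert_cont.
  by apply: Er_path => i; exact: ypert_cont.
move=> h /hd; rewrite -/(ypert y h); move: (ypert y h) => z zd.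
apply: (radsol_unique k0 (lam := lam) (f := fun z => Er (pact w lam) (vperm w z) - Er lam z)) => //.
- move=> u t; apply: ccontB; last exact: Er_raycont.
  by apply: Er_path => i; apply: cvgMl; exact: cvg_id.
- apply: radsol_ext (radsolB (radsol_equi (Er_radsol (pact w lam))) (Er_radsol lam)) => // u.
  by rewrite subr0.
- rewrite (_ : vperm w (fun _ => 0) = (fun _ => 0)); last exact/funext.
  by rewrite !Er0 subrr.
Qed.

Lemma Er_swl lam i j y : Er (sw i j lam) y = Er lam (vsw i j y).
Proof.
rewrite -(Er_equi (sw i j lam) (tperm i j)) /vsw; congr (Er _ _).
by apply/funext => l; rewrite /pact /sw tpermK.
Qed.

Lemma cdot_bound (eta : Cn) (H : R) (y : Rn) (w : 'S_n) : vpos y -> (forall i, cnorm (eta i) <= H) ->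
  cnorm (cdot eta (toCn (vperm w y))) <= H * vsum y.
Proof.
move=> yp hH; rewrite -(vsum_vperm w y) /cdot /vsum mulr_sumr.
apply: (le_trans (cnorm_sum _ _ _)); apply: ler_sum => i _.
rewrite cnormM /toCn cnorm_toC gtr0_norm ?ler_wpM2r//; first exact: ltW (yp _).
exact: yp.
Qed.

Lemma vpos_rsc t (y : Rn) : 0 < t -> vpos y -> vpos (rsc t y).
Proof. by move=> t0 yp i; rewrite mulr_gt0. Qed.

Lemma vsum_rsc t (y : Rn) : vsum (rsc t y) = t * vsum y.
Proof. by rewrite /vsum mulr_sumr. Qed.

Section Perturbation.
Variables (lam lam' : Cn) (e H : R).
Hypothesis le : forall i, Re (lam i) <= - e.
Hypothesis le' : forall i, Re (lam' i) <= - e.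
Hypothesis hH : forall i, cnorm (lam' i - lam i) <= H.
Let eta : Cn := fun i => lam' i - lam i.

Lemma Er_diff_radsol : radsol lam (fun y => Er lam' y - Er lam y) (fun y => cdot eta (toCn y) * Er lam' y).
Proof.
apply: radsol_ext (radsolB (radsol_shift lam (Er_radsol lam')) (Er_radsol lam)) => // y.
by rewrite subr0 add0r /eta cdotBl.
Qed.

Lemma Er_lip0 y : vpos y -> vdistinct y ->
  cnorm (Er lam' y - Er lam y) <= cn * expR (- e * vsum y) * (H * vsum y * cn).
Proof.
move=> yp yd.
have S0 := vsum_ge0 yp.
have HS : 0 <= H * vsum y.
  by rewrite (le_trans (cnorm_ge0 _) (cdot_bound 1 yp hH)).
apply: (radsol_bound1 k0 (lam := lam) (f := fun y => Er lam' y - Er lam y)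
   (g := fun y => cdot eta (toCn y) * Er lam' y)) => //.
- by move=> z t; apply: ccontB; exact: Er_raycont.
- exact: Er_diff_radsol.
- by move=> w; exact: Re_cdot_vperm_le.
- by rewrite !Er0 subrr.
- by rewrite mulr_ge0 ?cn_ge0.
- move=> w t /andP[t0 t1]; rewrite cdot_rsc !mulrA -toCM mulVf ?gt_eqF// toC1 mul1r cnormM.
  rewrite -mulrA ler_pM ?cnorm_ge0//; first exact: cdot_bound.
  apply: (le_trans (Er_bound (e := e) _ le')).
    by apply: vpos_rsc => //; apply/vpos_vperm.
  by rewrite vsum_rsc vsum_vperm -mulrA [vsum y * t]mulrC.
Qed.

Lemma Er_lip y : vpos y ->
  cnorm (Er lam' y - Er lam y) <= cn * H * cn * vsum y ^+ 1 * expR (- e * vsum y).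
Proof.
move: y; apply: (vpos_dense_bound (f := fun y => cnorm (Er lam' y - Er lam y))) => [z zp|z zp zd].
  by apply: ccont_cnorm; apply: ccontB; apply: Er_path => i; exact: ypert_cont.
apply: (le_trans (Er_lip0 zp zd)).
by rewrite le_eqVlt; apply/orP; left; apply/eqP; ring.
Qed.

(** The candidate for the first order term in eta: it expresses that E satisfies a Dunkl equation in
    its spectral argument as well. [Er_taylor] confirms it through the radial system. *)
Definition dEr (y : Rn) : C := cdot eta (toCn y) * Er lam y
  - toC k * psum (fun j l => (eta j - eta l) / (lam j - lam l) * (Er lam y - Er (sw j l lam) y)).

Hypothesis ld : distinct_coords lam.

(** Since <lam - s_ij lam, y> = (lam_i - lam_j)(y_i - y_j), the reflection terms in lam cancel the
    pair sum produced by [radsol_dot]. *)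
Lemma dEr_radsol : radsol lam dEr (fun y => cdot eta (toCn y) * Er lam y).
Proof.
have hs (j l : 'I_n) := radsol_shift lam (Er_radsol (sw j l lam)).
have h1 := radsol_dot eta (Er_radsol lam).
have h2 := radsolZ (toC k) (radsol_psum (fun (j l : 'I_n) (_ : (j < l)%N) =>
  radsolZ ((eta j - eta l) / (lam j - lam l)) (radsolB (Er_radsol lam) (hs j l)))).
apply: radsol_ext (radsolB h1 h2) => // y /=.
rewrite -addrA -mulrBr -psumB (@eq_psum _ _ _ (fun _ _ => 0)) ?psum0 ?mulr0 ?addr0//.
move=> i j ij; have nij : i != j by rewrite -val_eqE /= ltn_eqF.
have nl : lam i - lam j != 0 by rewrite subr_eq0; exact: ld.
have := cdot_sw lam (toCn y) nij; rewrite -cdot_swl => hc.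
have -> : cdot (sw i j lam) (toCn y) = cdot lam (toCn y) - (lam i - lam j) * (toCn y i - toCn y j).
  by rewrite -hc; ring.
rewrite Er_swl /toCn; field.
exact: nl.
Qed.

Lemma Er_path_dEr (p : R -> Rn) t : (forall i, {for t, continuous (fun s => p s i)}) ->
  ccont (fun s => dEr (p s)) t.
Proof.
move=> pc; apply: ccontB.
  apply: ccontM; last exact: Er_path.
  apply: ccont_sum => i _; apply: ccontM; first exact: ccont_cst.
  exact: ccont_real.
apply: ccontM; first exact: ccont_cst.
apply: ccont_sum => i _; apply: ccont_sum => j _; apply: ccontM; first exact: ccont_cst.
by apply: ccontB; exact: Er_path.
Qed.

(** The remainder vanishes at the origin and is forced by <eta, y> (E(lam', y) - E(lam, y)), which
    [Er_lip] shows to be of second order in H. *)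
Lemma Er_taylor y : vpos y ->
  cnorm (Er lam' y - Er lam y - dEr y) <= cn * H * cn * H * cn * vsum y ^+ 2 * expR (- e * vsum y).
Proof.
move: y; apply: (vpos_dense_bound (f := fun y => cnorm (Er lam' y - Er lam y - dEr y))) => [z zp|y yp yd].
  apply: ccont_cnorm; apply: ccontB; last by apply: Er_path_dEr => i; exact: ypert_cont.
  by apply: ccontB; apply: Er_path => i; exact: ypert_cont.
have S0 := vsum_ge0 yp.
have HS : 0 <= H * vsum y.
  by rewrite (le_trans (cnorm_ge0 _) (cdot_bound 1 yp hH)).
rewrite [leRHS](_ : _ = cn * expR (- e * vsum y) * (H * vsum y * (cn * (H * vsum y) * cn))); last by ring.
apply: (radsol_bound1 k0 (lam := lam) (f := fun y => Er lam' y - Er lam y - dEr y)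
   (g := fun y => cdot eta (toCn y) * (Er lam' y - Er lam y))) => //.
- move=> z t; have c i : {for t, continuous (fun s => rsc s z i)} by apply: cvgMl; exact: cvg_id.
  by apply: ccontB; [apply: ccontB; exact: Er_raycont|exact: Er_path_dEr].
- by apply: radsol_ext (radsolB Er_diff_radsol dEr_radsol) => // z; rewrite mulrBr.
- by move=> w; exact: Re_cdot_vperm_le.
- rewrite /dEr !Er0 subrr sub0r (_ : toCn _ = (fun _ => 0)); last exact/funext.
  rewrite (@eq_psum _ _ _ (fun _ _ => 0)) ?psum0; last by move=> i j _; rewrite !Er0 subrr mulr0.
  by rewrite /cdot big1 ?mul0r ?mulr0 ?subrr ?oppr0// => i _; rewrite mulr0.
- by rewrite mulr_ge0// mulr_ge0 ?cn_ge0// mulr_ge0 ?cn_ge0.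
- move=> w t /andP[t0 t1]; rewrite cdot_rsc !mulrA -toCM mulVf ?gt_eqF// toC1 mul1r cnormM.
  rewrite -!mulrA mulrA ler_pM ?cnorm_ge0//; first exact: cdot_bound.
  have tp : vpos (rsc t (vperm w y)) by apply: vpos_rsc => //; apply/vpos_vperm.
  apply: (le_trans (Er_lip tp)).
  rewrite vsum_rsc vsum_vperm expr1.
  have -> : - e * (t * vsum y) = - e * vsum y * t by ring.
  rewrite !mulrA ler_wpM2r ?expR_ge0//.
  have -> : cn * H * cn * t * vsum y = (cn * cn) * (H * vsum y) * t by ring.
  have -> : cn * H * vsum y * cn = (cn * cn) * (H * vsum y) by ring.
  by rewrite ler_piMr ?(ltW t1)// mulr_ge0// mulr_ge0// cn_ge0.
Qed.

End Perturbation.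
End DunklKernel.

(** * Uniqueness for the Cherednik system *)

Section MoreComplex.
Variables (R : realType).
Local Notation C := R[i].
Local Notation Re := (@complex.Re R).
Local Notation Im := (@complex.Im R).

Lemma ccont_dist (f : R -> C) t e : 0 < e -> ccont f t -> \forall s \near t, cnorm (f s - f t) < e.
Proof.
move=> e0 [/cvgrPdist_lt a /cvgrPdist_lt b].
have e20 : 0 < e / 2 by rewrite divr_gt0.
near=> s; apply: (le_lt_trans (cnorm_le_ReIm _)); rewrite cReD cImD cReN cImN (splitr e).
rewrite ltrD// distrC; near: s; [exact: a|exact: b].
Unshelve. all: by end_near. Qed.

Lemma ccont_cexp (f : R -> C) t : ccont f t -> ccont (fun s => cexp (f s)) t.
Proof.
move=> [a b].
have ce := continuous_comp a (@continuous_expR R _).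
split.
  apply: (@continuousM _ _ (fun s => expR (Re (f s))) (fun s => cos (Im (f s)))) => //.
  exact: (continuous_comp b (@continuous_cos R _)).
apply: (@continuousM _ _ (fun s => expR (Re (f s))) (fun s => sin (Im (f s)))) => //.
exact: (continuous_comp b (@continuous_sin R _)).
Qed.

(** Bounds the Cherednik denominators from below through real parts alone, hence uniformly along
    imaginary directions. *)
Lemma cnorm_1Bcexp_ge (x : C) : `|1 - expR (Re x)| <= cnorm (1 - cexp x).
Proof.
have a : 1 - expR (Re x) <= cnorm (1 - cexp x).
  rewrite lerBlDr -cnorm_cexp -cnorm1; apply: le_trans (cnormD _ _).
  by rewrite subrK.
have b : expR (Re x) - 1 <= cnorm (1 - cexp x).
  rewrite lerBlDr -cnorm_cexp cnorm_distC.
  by have := cnormD (cexp x - 1) 1; rewrite subrK cnorm1.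
by case: (ger0P (1 - expR (Re x))) => // _; rewrite opprB.
Qed.

Lemma cexp_neq1 (x : C) : Re x != 0 -> 1 - cexp x != 0.
Proof.
move=> x0; rewrite -cnorm_gt0; apply: lt_le_trans (cnorm_1Bcexp_ge x).
by rewrite normr_gt0 subr_eq0 eq_sym -expR0 (inj_eq (@expR_inj R)).
Qed.

End MoreComplex.

Section Rho.
Variables (R : realType) (n : nat) (k : R).
Local Notation C := R[i].

Lemma sum_ord_lt (l : 'I_n) (c : R) : \sum_(i < n | (i < l)%N) c = c * l%:R.
Proof.
by rewrite (big_ord_narrow (ltnW (ltn_ord l))) sumr_const card_ord mulr_natr.
Qed.

(** Reversing the order of the indices changes the sign of rho. *)
Lemma rho_sum0 : \sum_(i < n) @rho R n k i = 0.
Proof.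
have h : \sum_(i < n) @rho R n k i = - \sum_(i < n) @rho R n k i.
  rewrite {1}(reindex_inj rev_ord_inj) /= -sumrN; apply: eq_bigr => i _.
  rewrite /rho /= natrB ?ltn_ord//; case: n i => [[]//|m i] /=.
  rewrite -natr1 -[i.+1%:R]natr1; ring.
lra.
Qed.

(** Written over pairs, the pairing with rho balances the antisymmetric part of the Cherednik
    coefficients in [orbit_gronwall]. *)
Lemma rho_pairs (y : Rn R n) :
  \sum_(i < n) @rho R n k i * y i = k * \sum_(i < n) \sum_(j < n | (i < j)%N) (y j - y i) / 2.
Proof.
have a : \sum_(i < n) \sum_(j < n | (i < j)%N) y j = \sum_(l < n) l%:R * y l.
  rewrite (exchange_big_dep xpredT)//=; apply: eq_bigr => l _.
  by rewrite sum_ord_lt mulrC.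
have b : \sum_(i < n) \sum_(j < n | (i < j)%N) y i = \sum_(l < n) ((n.-1)%:R - l%:R) * y l.
  apply: eq_bigr => l _.
  have := sum_ord_lt (rev_ord l) (y l).
  rewrite (reindex_inj rev_ord_inj) /= => h.
  rewrite (eq_bigl (fun j : 'I_n => (n - j.+1 < n - l.+1)%N)); last first.
    by move=> j; have := ltn_ord j; have := ltn_ord l; move=> *; apply/idP/idP; lia.
  have l1 : (l <= n.-1)%N by have := ltn_ord l; lia.
  by rewrite h (_ : (n - l.+1)%N = (n.-1 - l)%N) ?natrB 1?mulrC//; lia.
have -> : \sum_(i < n) \sum_(j < n | (i < j)%N) (y j - y i) / 2 =
    (\sum_(i < n) \sum_(j < n | (i < j)%N) y j - \sum_(i < n) \sum_(j < n | (i < j)%N) y i) / 2.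
  rewrite -sumrB mulr_suml; apply: eq_bigr => i _; rewrite -sumrB mulr_suml; exact: eq_bigr.
rewrite a b -sumrB mulr_suml mulr_sumr; apply: eq_bigr => i _; by rewrite /rho; field.
Qed.

Lemma psum_delta2 (A : 'I_n -> 'I_n -> C) (l : 'I_n) :
  psum (fun i j => ((j == l)%:R - (i == l)%:R) * A i j) =
  \sum_(i < n | (i < l)%N) A i l - \sum_(j < n | (l < j)%N) A l j.
Proof.
rewrite (@eq_psum _ _ _ (fun i j => (j == l)%:R * A i j - (i == l)%:R * A i j)); last first.
  by move=> i j _; rewrite mulrBl.
rewrite psumB; congr (_ - _).
  rewrite /psum (exchange_big_dep xpredT)//= (bigD1 l)//= [X in _ + X]big1 ?addr0; last first.
    by move=> j /negbTE jl; apply: big1 => i _; rewrite jl mul0r.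
  by apply: eq_bigr => i _; rewrite eqxx mul1r.
rewrite /psum (bigD1 l)//= [X in _ + X]big1 ?addr0; last first.
  by move=> j /negbTE jl; apply: big1 => i _; rewrite jl mul0r.
by apply: eq_bigr => i _; rewrite eqxx mul1r.
Qed.

End Rho.

Section CherednikKernel.
Variables (R : realType) (n : nat) (k : R) (G0 : Cn R n -> Cn R n -> R[i]).
Hypothesis k0 : 0 <= k.
Hypothesis hG : is_cherednik0 k G0.
Local Notation C := R[i].
Local Notation Re := (@complex.Re R).
Local Notation Im := (@complex.Im R).
Local Notation Rn := (Rn R n).
Local Notation Cn := (Cn R n).
Local Notation cn := (cn R n).
Local Notation G := (Gker G0).
Local Notation rhoC := (toCn (@rho R n k)).

Definition csum (z : Cn) : C := \sum_(i < n) z i.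

Lemma cdot1 (z : Cn) : cdot z (cvconst 1) = csum z.
Proof. by rewrite /cdot; apply: eq_bigr => i _; rewrite mulr1. Qed.

(* The right-hand side of the Cherednik eigenvalue equation solved for the derivative
   of f at z in the (possibly complex) direction eta. *)
Definition chrhs (lam : Cn) (f : Cn -> C) (z eta : Cn) : C :=
  (cdot lam eta + cdot rhoC eta) * f z -
  toC k * psum (fun i j => (eta j - eta i) * (f z - f (sw i j z)) / (1 - cexp (- (z j - z i)))).

Definition along (z eta : Cn) (t : R) : Cn := cvadd z (cvscale (toC t) eta).

Definition chdir lam f z eta := cderiv (fun t => f (along z eta t)) 0 (chrhs lam f z eta).

Lemma along0 z eta : along z eta 0 = z.
Proof. by apply/funext => i; rewrite /along /cvadd /cvscale mul0r addr0. Qed.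

Lemma nC_neq0 (i : 'I_n) : n%:R != 0 :> C.
Proof. by rewrite pnatr_eq0 -lt0n; case: n i => [[]|]. Qed.

Lemma cprojE (z : Cn) i : cproj z i = z i - n%:R^-1 * csum z.
Proof. by rewrite /cproj cdot1. Qed.

Lemma csum_cst (c : C) : csum (fun _ => c) = n%:R * c.
Proof. by rewrite /csum sumr_const card_ord mulr_natl. Qed.

Lemma csumD (u v : Cn) : csum (fun i => u i + v i) = csum u + csum v.
Proof. exact: big_split. Qed.

Lemma csum_n0 (z : Cn) : n = 0%N -> csum z = 0.
Proof. by move=> n0; rewrite /csum big1// => i; have := ltn_ord i; rewrite {2}n0. Qed.

Lemma csumZ c (u : Cn) : csum (cvscale c u) = c * csum u.
Proof. by rewrite /csum mulr_sumr. Qed.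

Lemma csum_cproj (z : Cn) : csum (cproj z) = 0.
Proof.
have [n0|n0] := eqVneq n 0%N; first exact: csum_n0.
rewrite (_ : cproj z = (fun i => z i + - (n%:R^-1 * csum z))); last first.
  by apply/funext => i; rewrite cprojE.
by rewrite csumD csum_cst mulrN mulrA mulfV ?mul1r ?subrr// pnatr_eq0.
Qed.

Lemma cproj_diff (z : Cn) i j : cproj z i - cproj z j = z i - z j.
Proof. by rewrite !cprojE; ring. Qed.

Lemma csum_sw i j (z : Cn) : csum (sw i j z) = csum z.
Proof. by rewrite /csum [RHS](reindex_inj (@perm_inj _ (tperm i j))). Qed.

Lemma cproj_sw i j (z : Cn) : cproj (sw i j z) = sw i j (cproj z).
Proof. by apply/funext => l; rewrite /sw !cprojE csum_sw. Qed.

Lemma imV_cproj (z : Cn) : imV z -> imV (cproj z).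
Proof.
by move=> h i j ij; rewrite -cImN -cImD cproj_diff cImD cImN; exact: h.
Qed.

Lemma distinct_cproj (z : Cn) : distinct_coords z -> distinct_coords (cproj z).
Proof. by move=> h i j ij; rewrite -subr_eq0 cproj_diff subr_eq0; exact: h. Qed.

Lemma csum_along z eta t : csum (along z eta t) = csum z + toC t * csum eta.
Proof. by rewrite /csum /along /cvadd /cvscale big_split mulr_sumr. Qed.

Lemma cproj_along z eta t : cproj (along z eta t) = along (cproj z) (cproj eta) t.
Proof.
apply/funext => i; rewrite !cprojE csum_along /along /cvadd /cvscale !cprojE; ring.
Qed.

Lemma GkerE lam z : G lam z = cexp (n%:R^-1 * csum z * csum lam) * G0 (cproj lam) (cproj z).
Proof. by rewrite /Gker !cdot1. Qed.

Lemma G_at0 lam z : (forall i, z i = 0) -> G lam z = 1.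
Proof.
move=> z0; have s0 : csum z = 0 by rewrite /csum big1.
rewrite GkerE s0 mulr0 mul0r cexp0 mul1r (_ : cproj z = @cvzero R n); last first.
  by apply/funext => i; rewrite cprojE s0 z0 mulr0 subrr.
by apply: hG.2.1; exact: csum_cproj.
Qed.

Lemma G_homog lam z (s : C) : G lam (fun i => z i + s) = cexp (s * csum lam) * G lam z.
Proof.
rewrite !GkerE.
have -> : cproj (fun i => z i + s) = cproj z.
  apply/funext => i; rewrite !cprojE csumD csum_cst mulrDr mulrA mulVf ?(nC_neq0 i)//; ring.
rewrite mulrA -cexpD; congr (cexp _ * _).
have [n0|n0] := eqVneq n 0%N; first by rewrite !csum_n0// !mulr0 addr0.
rewrite csumD csum_cst mulrDr mulrA mulVf ?pnatr_eq0//; ring.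
Qed.

(** G0 is continuous only relative to its tube, so nearby points of the path have to be kept inside;
    the condition on imaginary parts is open. *)
Lemma G_path lam (p : R -> Cn) t : (forall i, ccont (fun s => p s i) t) -> imV (p t) ->
  ccont (fun s => G lam (p s)) t.
Proof.
move=> pc pv.
have cs : ccont (fun s => csum (p s)) t by apply: ccont_sum => i _.
have cp i : ccont (fun s => cproj (p s) i) t.
  rewrite (_ : (fun s => _) = (fun s => p s i - n%:R^-1 * csum (p s))); last first.
    by apply/funext => s; rewrite cprojE.
  by apply: ccontB => //; apply: ccontM => //; exact: ccont_cst.
rewrite (_ : (fun s => _) = (fun s => cexp (n%:R^-1 * csum (p s) * csum lam) * G0 (cproj lam) (cproj (p s)))); last first.
  by apply/funext => s; rewrite GkerE.
apply: ccontM.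
  apply: ccont_cexp; apply: ccontM; last exact: ccont_cst.
  by apply: ccontM => //; exact: ccont_cst.
have near_v : \forall s \near t, forall i j : 'I_n, (i < j)%N -> `|Im (p s i) - Im (p s j)| < pi.
  have hij (ij : 'I_n * 'I_n) : \forall s \near t, (ij.1 < ij.2)%N -> `|Im (p s ij.1) - Im (p s ij.2)| < pi.
    case: ij => i j /=; case: (boolP (i < j)%N) => ij; last by apply: (@filterE _ (nbhs t) (nbhs_filter t)).
    have c : {for t, continuous (fun s => `|Im (p s i) - Im (p s j)|)}.
      apply: (@continuous_comp _ _ _ (fun s => Im (p s i) - Im (p s j)) (fun x => `|x|)).
        by apply: continuousB; have [] := pc i; have [] := pc j.
      exact: norm_continuous.
    have h := cvgr_lt _ c _ (pv i j ij).
    by apply: (@filterS _ (nbhs t) (nbhs_filter t) _ _ _ (h (nbhs_filter t))) => s hs _.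
  have := @filter_forall _ _ _ _ (nbhs_filter t) hij.
  by apply: filterS => s h i j; exact: (h (i, j)).
apply: ccont_near => e e0.
have U : in_C0 (cproj lam) /\ in_tube0 (cproj (p t)).
  by split; [exact: csum_cproj|split; [exact: csum_cproj|exact: imV_cproj]].
have [d d0 hd] := hG.1.1 _ _ U e e0.
have H : \forall s \near t, forall i, cnorm (cproj (p s) i - cproj (p t) i) < d.
  apply: (@filter_forall _ _ (fun i s => cnorm (cproj (p s) i - cproj (p t) i) < d) _ (nbhs_filter t)) => i.
  exact: ccont_dist.
near=> s; apply: hd.
- by split; [exact: csum_cproj|split; [exact: csum_cproj|apply: imV_cproj; near: s]].
- by move=> i; rewrite subrr cnorm0.
- by near: s.
Unshelve. all: by end_near. Qed.

Lemma cderiv_expfactor lam z eta :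
  cderiv (fun t => cexp (n%:R^-1 * csum (along z eta t) * csum lam)) 0
    (n%:R^-1 * csum eta * csum lam * cexp (n%:R^-1 * csum z * csum lam)).
Proof.
rewrite (_ : (fun t => _) = (fun t => cexp (n%:R^-1 * csum z * csum lam + n%:R^-1 * csum eta * csum lam * toC t))); last first.
  by apply/funext => t; rewrite csum_along; congr cexp; ring.
have h : cderiv (fun t => n%:R^-1 * csum z * csum lam + n%:R^-1 * csum eta * csum lam * toC t) 0 (n%:R^-1 * csum eta * csum lam).
  apply: cderiv_eq (cderivD (cderiv_cst _ _) (cderivZ _ (cderiv_id 0))) _.
  by rewrite add0r mulr1.
by apply: cderiv_eq (cderiv_cexp h) _; rewrite toC0 mulr0 addr0.
Qed.

(* From G0 on the hyperplane to G: the central factor contributes the derivative along (1,...,1). *)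
Lemma chdir_lift lam z eta (L : C) :
  cderiv (fun t => G0 (cproj lam) (along (cproj z) (cproj eta) t)) 0 L ->
  L = (cdot (cproj lam) (cproj eta) + cdot rhoC (cproj eta)) * G0 (cproj lam) (cproj z) -
    toC k * psum (fun i j => (cproj eta j - cproj eta i) * (G0 (cproj lam) (cproj z) - G0 (cproj lam) (sw i j (cproj z)))
       / (1 - cexp (- (cproj z j - cproj z i)))) ->
  chdir lam (G lam) z eta.
Proof.
move=> hL LE; rewrite /chdir.
rewrite (_ : (fun t => _) = (fun t => cexp (n%:R^-1 * csum (along z eta t) * csum lam) *
   G0 (cproj lam) (along (cproj z) (cproj eta) t))); last first.
  by apply/funext => t; rewrite GkerE cproj_along.
apply: cderiv_eq (cderivM (cderiv_expfactor lam z eta) hL) _.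
rewrite !along0 /chrhs LE.
set e := cexp _.
have -> : psum (fun i j => (eta j - eta i) * (G lam z - G lam (sw i j z)) / (1 - cexp (- (z j - z i)))) =
  e * psum (fun i j => (cproj eta j - cproj eta i) * (G0 (cproj lam) (cproj z) - G0 (cproj lam) (sw i j (cproj z)))
       / (1 - cexp (- (cproj z j - cproj z i)))).
  rewrite -psumZ; apply: eq_psum => i j _; rewrite !cproj_diff !GkerE csum_sw cproj_sw -/e; ring.
rewrite GkerE -/e.
have -> : cdot (cproj lam) (cproj eta) = cdot lam eta - n%:R^-1 * csum eta * csum lam.
  have h1 (u v : Cn) : cdot u (cproj v) = cdot u v - n%:R^-1 * csum v * csum u.
    rewrite /cdot /csum [_ * _ * \sum_(i < n) _]mulr_sumr -sumrB; apply: eq_bigr => i _.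
    by rewrite cprojE /csum; ring.
  rewrite h1 csum_cproj mulr0 subr0.
  have h2 (u v : Cn) : cdot u v = cdot v u by apply: eq_bigr => i _; rewrite mulrC.
  by rewrite h2 h1 [cdot eta lam]h2; ring.
have -> : cdot rhoC (cproj eta) = cdot rhoC eta.
  rewrite /cdot; under eq_bigr do rewrite cprojE mulrBr.
  by rewrite sumrB -mulr_suml -toC_sum rho_sum0 toC0 mul0r subr0.
ring.
Qed.

Lemma toCn_rproj (xi : Rn) : toCn (fun i => xi i - n%:R^-1 * \sum_(j < n) xi j : R) = cproj (toCn xi).
Proof.
apply/funext => i; rewrite cprojE /toCn toCB toCM toCV toC_nat; congr (_ - _ * _).
exact: toC_sum.
Qed.

Lemma in_tube_cproj (z : Cn) : imV z -> in_tube0 (cproj z).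
Proof. by move=> h; split; [exact: csum_cproj|exact: imV_cproj]. Qed.

Lemma chdir_G_real_aux lam z (xi : Rn) : imV z -> distinct_coords z ->
  exists2 L, cderiv (fun t => G0 (cproj lam) (along (cproj z) (cproj (toCn xi)) t)) 0 L &
  L = (cdot (cproj lam) (cproj (toCn xi)) + cdot rhoC (cproj (toCn xi))) * G0 (cproj lam) (cproj z) -
    toC k * psum (fun i j => (cproj (toCn xi) j - cproj (toCn xi) i) * (G0 (cproj lam) (cproj z) - G0 (cproj lam) (sw i j (cproj z)))
       / (1 - cexp (- (cproj z j - cproj z i)))).
Proof.
move=> zv zd; pose xi0 : Rn := fun i => xi i - n%:R^-1 * \sum_(j < n) xi j.
have xi00 : in_R0 xi0.
  apply: toC_inj; rewrite toC_sum -[LHS]/(csum (toCn xi0)) toCn_rproj csum_cproj //.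
have [L [hL eqL]] := hG.2.2 (cproj lam) xi0 (cproj z) (csum_cproj lam) xi00 (in_tube_cproj zv) (distinct_cproj zd).
rewrite -toCn_rproj -/xi0; exists L.
  apply: cderivP => e e0; have [d d0 hd] := hL e e0; exists d => // t ht.
  by rewrite add0r along0; exact: hd.
have dE (u : Cn) : Rdot xi0 u = cdot u (toCn xi0) by apply: eq_bigr => i _; rewrite mulrC.
rewrite !dE in eqL.
have -> : psum (fun i j => (toCn xi0 j - toCn xi0 i) * (G0 (cproj lam) (cproj z) - G0 (cproj lam) (sw i j (cproj z)))
       / (1 - cexp (- (cproj z j - cproj z i)))) =
  \sum_(i < n) \sum_(j < n | (i < j)%N) toC (xi0 j - xi0 i) * (G0 (cproj lam) (cproj z) - G0 (cproj lam) (sw i j (cproj z)))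
       / (1 - cexp (- (cproj z j - cproj z i))).
  by apply: eq_psum => i j _; rewrite /toCn toCB.
rewrite mulrDl -eqL; ring.
Qed.

Lemma chdir_G_real lam z (xi : Rn) : imV z -> distinct_coords z -> chdir lam (G lam) z (toCn xi).
Proof. by move=> zv zd; have [L hL LE] := chdir_G_real_aux lam xi zv zd; exact: chdir_lift hL LE. Qed.

(** Complex differentiability along e_p - e_q forces the derivative along i (e_p - e_q) to be i
    times the real one, and the Cherednik equation gives the latter. *)
Lemma chdir_G_imag lam z (p q : 'I_n) : imV z -> distinct_coords z -> p != q ->
  chdir lam (G lam) z (cvscale 'i (toCn (fun i => (i == p)%:R - (i == q)%:R))).
Proof.
move=> zv zd pq; set xi : Rn := fun i => (i == p)%:R - (i == q)%:R.
have xiE : toCn xi = cvadd (unitv R p) (cvopp (unitv R q)).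
  apply/funext => i; rewrite /toCn /xi /cvadd /cvopp /unitv toCB.
  by case: (i == p); case: (i == q).
have sxi : csum (toCn xi) = 0.
  rewrite /csum -toC_sum /xi sumrB (bigD1 p)//= eqxx big1 ?addr0; last by move=> i /negbTE ->.
  by rewrite (bigD1 q)//= eqxx big1 ?addr0 ?subrr// => i /negbTE ->.
have pxi : cproj (toCn xi) = toCn xi.
  by apply/funext => i; rewrite cprojE sxi mulr0 subr0.
have pixi : cproj (cvscale 'i (toCn xi)) = cvscale 'i (toCn xi).
  by apply/funext => i; rewrite cprojE csumZ sxi !mulr0 subr0.
have [L hL LE] := chdir_G_real_aux lam xi zv zd.
have U : in_C0 (cproj lam) /\ in_tube0 (cproj z).
  by split; [exact: csum_cproj|exact: in_tube_cproj].
have dD : (@cvzero R n, toCn xi) \in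
    ([seq (cvadd (unitv R ij.1) (cvopp (unitv R ij.2)), @cvzero R n)
        | ij <- [seq (i, j) | i <- enum 'I_n, j <- enum 'I_n]] ++
     [seq (@cvzero R n, cvadd (unitv R ij.1) (cvopp (unitv R ij.2)))
        | ij <- [seq (i, j) | i <- enum 'I_n, j <- enum 'I_n]]).
  rewrite mem_cat; apply/orP; right; rewrite xiE; apply/mapP; exists (p, q) => //.
  by apply/allpairsP; exists (p, q); rewrite !mem_enum.
have [L' hL'] := hG.1.2 _ _ U _ dD; rewrite /= in hL'.
have lamE h : cvadd (cproj lam) (cvscale h (@cvzero R n)) = cproj lam.
  by apply/funext => i; rewrite /cvadd /cvscale mulr0 addr0.
have hr : cderiv (fun t => G0 (cproj lam) (along (cproj z) (cproj (toCn xi)) t)) 0 L'.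
  apply: cderivP => e e0; have [d d0 hd] := hL' e e0; exists d => // t ht.
  have := hd (toC t); rewrite cnorm_toC lamE => /(_ ht).
  by rewrite add0r along0 pxi.
have LL : L' = L := cderiv_unique hr hL.
have hi : cderiv (fun t => G0 (cproj lam) (along (cproj z) (cproj (cvscale 'i (toCn xi))) t)) 0 ('i * L).
  apply: cderivP => e e0; have [d d0 hd] := hL' e e0; exists d => // t ht.
  have ti : cnorm (toC t * 'i) = `|t|.
    by rewrite cnormM cnorm_toC [cnorm 'i]/cnorm /= expr0n /= add0r expr1n sqrtr1 mulr1.
  have := hd (toC t * 'i); rewrite ti lamE => /(_ ht).
  have aE : along (cproj z) (cvscale 'i (toCn xi)) t = cvadd (cproj z) (cvscale (toC t * 'i) (toCn xi)).
    by apply/funext => i; rewrite /along /cvadd /cvscale mulrA.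
  rewrite add0r along0 pixi aE LL.
  set A := G0 _ _ - _.
  have i0 : 'i != 0 :> C by rewrite eq_complex /= oner_eq0 andbF.
  have t0 : toC t != 0 by rewrite toC_eq0 -normr_gt0; case/andP: ht.
  have -> : A / toC t - 'i * L = 'i * (A / (toC t * 'i) - L) by field; rewrite i0.
  by rewrite cnormM [cnorm 'i]/cnorm /= expr0n /= add0r expr1n sqrtr1 mul1r.
apply: chdir_lift hi _; rewrite LE pixi pxi.
have cZ (u v : Cn) : cdot u (cvscale 'i v) = 'i * cdot u v.
  by rewrite /cdot mulr_sumr; apply: eq_bigr => i _; rewrite /cvscale mulrCA.
rewrite !cZ.
have -> : psum (fun i j => (cvscale 'i (toCn xi) j - cvscale 'i (toCn xi) i) * (G0 (cproj lam) (cproj z) - G0 (cproj lam) (sw i j (cproj z)))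
       / (1 - cexp (- (cproj z j - cproj z i)))) =
  'i * psum (fun i j => (toCn xi j - toCn xi i) * (G0 (cproj lam) (cproj z) - G0 (cproj lam) (sw i j (cproj z)))
       / (1 - cexp (- (cproj z j - cproj z i)))).
  by rewrite -psumZ; apply: eq_psum => i j _; rewrite /cvscale -mulrBr !mulrA.
by rewrite mulrBr mulrDl mulrDr !mulrA mulrDl -!mulrA [toC k * ('i * _)]mulrCA.
Qed.

(** Along the diagonal the projection [cproj] is constant and only the exponential factor moves. *)
Lemma chdir_G_imag1 lam z : chdir lam (G lam) z (cvscale 'i (toCn (fun _ => 1))).
Proof.
rewrite (_ : cvscale _ _ = (fun _ => 'i)); last by apply/funext => i; rewrite /cvscale mulr1.
have p0 : cproj (fun _ => 'i) = @cvzero R n.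
  apply/funext => i; by rewrite cprojE csum_cst mulrA mulVf ?mul1r ?subrr ?(nC_neq0 i).
apply: (chdir_lift (L := 0)).
  rewrite p0 (_ : (fun t => _) = (fun _ => G0 (cproj lam) (cproj z))); first exact: cderiv_cst.
  apply/funext => t; congr (G0 _ _); apply/funext => i.
  by rewrite /along /cvadd /cvscale mulr0 addr0.
rewrite p0.
have c0 (u : Cn) : cdot u (@cvzero R n) = 0 by rewrite /cdot big1// => i _; rewrite mulr0.
rewrite !c0 addr0 mul0r (@eq_psum _ _ _ (fun _ _ => 0)) ?psum0 ?mulr0 ?subrr//.
by move=> i j _; rewrite subrr !mul0r.
Qed.

End CherednikKernel.

Section CherednikSolutions.
Variables (R : realType) (n : nat) (k : R).
Hypothesis k0 : 0 <= k.
Local Notation C := R[i].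
Local Notation Re := (@complex.Re R).
Local Notation Im := (@complex.Im R).
Local Notation Rn := (Rn R n).
Local Notation Cn := (Cn R n).
Local Notation rhoC := (toCn (@rho R n k)).
Local Notation chdir := (@chdir R n k).
Local Notation chrhs := (@chrhs R n k).

(** Contains the logarithms of the right half plane and lies in the domain of G, because differences
    of imaginary parts stay below [pi]. *)
Definition box (z : Cn) := forall i, `|Im (z i)| < pi / 2.
(** Distinct real parts keep 1 - exp(-(z_j - z_i)) nonzero whatever the imaginary parts are. *)
Definition redistinct (z : Cn) := vdistinct (fun i => Re (z i)).

(* The directions i xi in which the Cherednik equation is assumed: differences of unit
   vectors and the diagonal, since G0 is only known to be holomorphic along the former. *)
Definition idir (xi : Rn) :=
  (exists p q, p != q /\ xi = (fun i => (i == p)%:R - (i == q)%:R)) \/ xi = (fun _ => 1).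

Definition chsol (lam : Cn) (f : Cn -> C) :=
  [/\ forall (p : R -> Cn) t, (forall i, ccont (fun s => p s i) t) -> box (p t) -> ccont (fun s => f (p s)) t,
      forall z xi, box z -> redistinct z -> chdir lam f z (toCn xi)
    & forall z xi, box z -> redistinct z -> idir xi -> chdir lam f z (cvscale 'i (toCn xi))].

Lemma box_imV z : box z -> imV z.
Proof.
move=> h i j _; apply: (le_lt_trans (ler_normB _ _)).
by have := h i; have := h j; lra.
Qed.

Lemma box_toCn (y : Rn) : box (toCn y).
Proof. by move=> i; rewrite /= normr0 divr_gt0// pi_gt0. Qed.

Lemma redistinct_distinct z : redistinct z -> distinct_coords z.
Proof. by move=> h i j ij; apply: contra_neq (h i j ij) => ->. Qed.

Lemma box_pact (w : 'S_n) z : box z -> box (pact w z). Proof. by move=> h i; exact: h. Qed.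
Lemma redistinct_pact (w : 'S_n) z : redistinct z -> redistinct (pact w z).
Proof. by move=> h i j ij; apply: h; rewrite (inj_eq perm_inj). Qed.

Lemma along_along (z eta : Cn) s t : along (along z eta s) eta t = along z eta (s + t).
Proof. by apply/funext => i; rewrite /along /cvadd /cvscale toCD mulrDl addrA. Qed.
Lemma sw_pact i j (w : 'S_n) (z : Cn) : sw i j (pact w z) = pact (tperm i j * w) z.
Proof. by apply/funext => l; rewrite /sw /pact permM. Qed.
Lemma idir_vperm (w : 'S_n) xi : idir xi -> idir (vperm w xi).
Proof.
case=> [[p [q [pq ->]]]|->]; [left|by right].
exists (w^-1 p)%g, (w^-1 q)%g; split; first by rewrite (inj_eq perm_inj).
by apply/funext => i; rewrite /vperm -!(can2_eq (permK w) (permKV w)).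
Qed.

Lemma chdir_line lam f z eta (c t : R) : chdir lam f (along z eta (c * t)) eta ->
  cderiv (fun s => f (along z eta (c * s))) t (toC c * chrhs lam f (along z eta (c * t)) eta).
Proof.
move=> h.
have dg : is_derive t (1 : R) (fun s => c * (s - t)) c.
  have h1 := is_deriveZ c (is_deriveB (is_derive_id t (1 : R)) (is_derive_cst t t (1 : R))).
  by apply: (is_derive_eq h1); rewrite subr0 /GRing.scale /= mulr1.
have g0 : c * (t - t) = 0 by rewrite subrr mulr0.
rewrite /chdir -g0 in h.
have := cderiv_comp dg h.
rewrite (_ : (fun s => f _) = (fun s => f (along z eta (c * s))))//.
by apply/funext => s; rewrite along_along; congr (f (along _ _ _)); ring.
Qed.

Lemma Im_along0 (y : Rn) t i : `|Im (along (@cvzero R n) (toCn y) t i)| < pi / 2.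
Proof. by rewrite /along /cvadd /cvscale !cRIE /= mulr0 mul0r !addr0 normr0 divr_gt0// pi_gt0. Qed.

Section Segment.
Variables (lam : Cn) (f : Cn -> C) (z : Cn) (xi : Rn) (c : R).
Hypothesis hf : chsol lam f.
Hypothesis zb : box z.
Hypothesis zd : redistinct z.
Hypothesis hxi : idir xi.
Let eta := cvscale 'i (toCn xi).
Hypothesis zb' : box (along z eta c).

Lemma Im_along t i : Im (along z eta t i) = Im (z i) + t * xi i.
Proof. by rewrite /along /cvadd /cvscale !cRIE /=; ring. Qed.
Lemma Re_along t i : Re (along z eta t i) = Re (z i).
Proof. by rewrite /along /cvadd /cvscale !cRIE /= !(mul0r, mulr0, subr0, addr0). Qed.

Lemma box_segment (t : R) : 0 <= t <= 1 -> box (along z eta (c * t)).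
Proof.
move=> /andP[t0 t1] i; rewrite Im_along.
have := zb i; have := zb' i; rewrite Im_along !ltr_norml => /andP[a b] /andP[a' b'].
have -> : Im (z i) + c * t * xi i = (1 - t) * Im (z i) + t * (Im (z i) + c * xi i) by ring.
have [t1'|t1'] := eqVneq t 1; first by rewrite t1' subrr mul0r add0r mul1r a b.
have t1s : 0 < 1 - t by rewrite subr_gt0 lt_neqAle t1'.
by apply/andP; split; nra.
Qed.

Lemma redistinct_along t : redistinct (along z eta t).
Proof. by move=> i j ij; rewrite !Re_along; exact: zd. Qed.

Let phi (w : 'S_n) (t : R) : C := f (pact w (along z eta (c * t))).

Lemma segment_deriv w (t : R) : 0 <= t <= 1 -> cderiv (phi w) t
  (toC c * chrhs lam f (pact w (along z eta (c * t))) (pact w eta)).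
Proof.
move=> t01; case: hf => _ _ h; apply: (@chdir_line lam f (pact w z) (pact w eta) c t).
apply: (h (pact w (along z eta (c * t))) (vperm w xi)).
- exact: box_pact (box_segment t01).
- exact: redistinct_pact (redistinct_along _).
- exact: idir_vperm.
Qed.

Lemma finite_bound (I : finType) (F : I -> R) : exists2 B, 0 <= B & forall i, F i <= B.
Proof.
exists (\sum_i `|F i|); first exact: sumr_ge0.
by move=> i; rewrite (bigD1 i)//= (le_trans (ler_norm _))// lerDl sumr_ge0.
Qed.

(** Imaginary moves leave the real parts unchanged, and with them the lower bounds on the
    denominators. As the orbit is finite, one constant d serves the whole segment. *)
Lemma segment_bound : exists2 d, 0 <= d & forall w (t m : R), 0 <= m -> (forall v, cnorm (phi v t) <= m) ->
  cnorm (toC c * chrhs lam f (pact w (along z eta (c * t))) (pact w eta)) <= d * m.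
Proof.
have [A A0 hA] := finite_bound (fun w : 'S_n => cnorm (cdot lam (pact w eta) + cdot rhoC (pact w eta))).
have [B B0 hB] := finite_bound (fun wij : 'S_n * ('I_n * 'I_n) =>
   cnorm (pact wij.1 eta wij.2.2 - pact wij.1 eta wij.2.1) /
     `|1 - expR (- (Re (z (wij.1 wij.2.2)) - Re (z (wij.1 wij.2.1))))|).
exists (`|c| * (A + k * \sum_(i < n) \sum_(j < n | (i < j)%N) (B * 2))).
  rewrite mulr_ge0// addr_ge0// mulr_ge0// sumr_ge0// => i _; rewrite sumr_ge0// => j _.
  by rewrite mulr_ge0.
move=> w t m m0 hm.
rewrite cnormM cnorm_toC -mulrA ler_wpM2l// /chrhs [leRHS]mulrDl.
apply: (le_trans (cnormB _ _)); apply: lerD.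
  by rewrite cnormM ler_pM ?cnorm_ge0//; first [exact: hA|exact: hm].
rewrite cnormM cnorm_toC ger0_norm// -mulrA ler_wpM2l// mulr_suml.
apply: (le_trans (cnorm_sum _ _ _)); apply: ler_sum => i _; rewrite mulr_suml.
apply: (le_trans (cnorm_sum _ _ _)); apply: ler_sum => j ij.
have nij : w i != w j by rewrite (inj_eq perm_inj) -val_eqE /= ltn_eqF.
rewrite !cnormM cnormV sw_pact mulrAC -[leRHS]mulrA; apply: ler_pM.
- by rewrite mulr_ge0 ?cnorm_ge0// invr_ge0 cnorm_ge0.
- exact: cnorm_ge0.
- apply: le_trans (hB (w, (i, j))) => /=.
  rewrite ler_wpM2l ?cnorm_ge0// lef_pV2 ?posrE.
  + apply: le_trans (cnorm_1Bcexp_ge _); rewrite cReN cReD cReN /pact !Re_along//.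
  + rewrite cnorm_gt0 cexp_neq1// cReN cReD cReN /pact !Re_along oppr_eq0 subr_eq0.
    by apply: zd; rewrite eq_sym.
  + rewrite normr_gt0 subr_eq0 eq_sym -expR0 (inj_eq (@expR_inj R)) oppr_eq0 subr_eq0.
    by apply: zd; rewrite eq_sym.
- apply: (le_trans (cnormB _ _)).
  have := hm w; have := hm (tperm i j * w)%g; rewrite /phi; lra.
Qed.

Lemma segment_zero : (forall w, f (pact w z) = 0) -> forall w, f (pact w (along z eta c)) = 0.
Proof.
move=> fz w; have [d d0 hd] := segment_bound.
have N0 t : 0 <= \sum_v cnorm (phi v t) ^+ 2 by apply: sumr_ge0 => v _; exact: sqr_ge0.
have phi_le v t : cnorm (phi v t) ^+ 2 <= \sum_v cnorm (phi v t) ^+ 2.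
  by rewrite (bigD1 v)//= lerDl sumr_ge0// => u _; exact: sqr_ge0.
(* The system is regular along an imaginary segment, so its whole right-hand side is entered as
   forcing, with k and the reflection coefficients set to 0. *)
refine ((fun h => _) (@orbit_gronwall R n 0 phi (fun _ _ => 0)
  (fun w t => toC c * chrhs lam f (pact w (along z eta (c * t))) (pact w eta))
  (fun _ _ _ _ => 0) (fun _ => 0) 0 (2 * d * n`!%:R) 0 (lexx 0) _ _ _ _ _ _)).
- move: h; rewrite (_ : \sum_(w0 : 'S_n) cnorm (phi w0 0) ^+ 2 = 0); last first.
    by rewrite big1// => v _; rewrite /phi mulr0 along0 fz cnorm0 expr0n.
  rewrite addr0 mulr0 => h.
  have := le_trans (phi_le w 1) h; rewrite /phi mulr1 => h2.
  by apply/eqP; rewrite -cnorm_eq0 -sqrf_eq0 eq_le h2 sqr_ge0.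
- move=> v t /andP[t0 t1]; apply: cderiv_eq (@segment_deriv v t _) _; first by rewrite !ltW.
  by rewrite toC0 !mul0r subr0 !add0r.
- by move=> v t t01; exact: cderiv_cont (segment_deriv v t01).
- by move=> v t _; rewrite cRe0.
- by move=> i j v t _ _; rewrite addr0.
- by move=> v t _; rewrite mul0r.
- move=> t _; rewrite mul0r addr0.
  set m := Num.sqrt (\sum_v cnorm (phi v t) ^+ 2).
  have m2 : m ^+ 2 = \sum_v cnorm (phi v t) ^+ 2 by rewrite sqr_sqrtr.
  have hm v : cnorm (phi v t) <= m.
    by rewrite -(@ler_pXn2r _ 2) ?nnegrE ?cnorm_ge0 ?sqrtr_ge0// m2.
  rewrite -m2.
  apply: (@le_trans _ _ (\sum_(v : 'S_n) 2 * (d * m ^+ 2))); last first.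
    by rewrite sum_perm_const le_eqVlt; apply/orP; left; apply/eqP; ring.
  apply: ler_sum => v _; rewrite ler_wpM2l//.
  apply: (le_trans (crip_le _ _)).
  rewrite [leRHS](_ : _ = m * (d * m)); last by rewrite expr2; ring.
  apply: ler_pM; rewrite ?cnorm_ge0//; apply: hd => //; exact: sqrtr_ge0.
Qed.

End Segment.

(** The coefficient c = d/(1 - exp(-td)) becomes c' = c - d at the swapped point. Hence c - c' = d
    is balanced by rho through [rho_pairs], and c + c' = d (1 + exp(-td))/(1 - exp(-td)) is
    nonnegative for either sign of d. *)
Lemma chsol_ray_bound lam f (xi : Rn) (M : R) : chsol lam f -> vdistinct xi ->
  (forall w, Re (cdot lam (toCn (vperm w xi))) <= M) ->
  cnorm (f (toCn xi)) ^+ 2 <= expR (2 * M) * (n`!%:R * cnorm (f (@cvzero R n)) ^+ 2).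
Proof.
move=> [fc fd _] xd hM.
pose d (i j : 'I_n) (w : 'S_n) : R := xi (w j) - xi (w i).
have dsw i j w : d i j (tperm i j * w)%g = - d i j w by rewrite /d !permM tpermL tpermR opprB.
have dn (i j : 'I_n) w : (i < j)%N -> d i j w != 0.
  by move=> ij; rewrite subr_eq0; apply: xd; rewrite (inj_eq perm_inj) -val_eqE /= gtn_eqF.
have en (t x : R) : 0 < t -> x != 0 -> 1 - expR (- (t * x)) != 0.
  move=> t0 x0; rewrite subr_eq0 eq_sym -expR0 (inj_eq (@expR_inj R)) oppr_eq0; apply: mulf_neq0 => //; by rewrite (gt_eqF t0).
have cE (i j : 'I_n) w (t : R) : (i < j)%N -> 0 < t ->
    d i j (tperm i j * w)%g / (1 - expR (- (t * d i j (tperm i j * w)%g))) =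
    d i j w / (1 - expR (- (t * d i j w))) - d i j w.
  move=> ij t0; rewrite dsw mulrN opprK; have := en t _ t0 (dn i j w ij).
  have e1 := expRN (- (t * d i j w)); rewrite opprK in e1; rewrite e1.
  have := lt0r_neq0 (expR_gt0 (- (t * d i j w))).
  move: (expR _) => e en0 e1n.
  have e2n : 1 - e^-1 != 0.
    by apply: contra_neq e1n => h; have -> : 1 - e = - e * (1 - e^-1) by [field]; rewrite h mulr0.
  by field; rewrite en0 e1n /= -opprB oppr_eq0.
refine ((fun h => _) (@orbit_gronwall R n k (fun w t => f (along (@cvzero R n) (toCn (vperm w xi)) (1 * t)))
  (fun w t => cdot lam (toCn (vperm w xi))) (fun w t => 0)
  (fun i j w t => d i j w / (1 - expR (- (t * d i j w)))) (fun w => \sum_(i < n) @rho R n k i * vperm w xi i)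
  M 0 0 k0 _ _ _ _ _ _)).
- have a1 (y : Rn) t : along (@cvzero R n) (toCn y) t = toCn (rsc t y).
    by apply/funext => i; rewrite /along /cvadd /cvscale /toCn /rsc add0r toCM.
  move: h; under [X in _ <= _ * (X + _)]eq_bigr do rewrite mulr0 along0.
  rewrite !addr0 sum_perm_const; apply: le_trans.
  rewrite (bigD1 1%g)//= a1 mulr1 rsc1 vperm1 lerDl; apply: sumr_ge0 => w _; exact: sqr_ge0.
- move=> w t /andP[t0 t1].
  have a1 : along (@cvzero R n) (toCn (vperm w xi)) (1 * t) = toCn (rsc t (vperm w xi)).
    by apply/funext => i; rewrite /along /cvadd /cvscale /toCn /rsc add0r mul1r toCM.
  apply: cderiv_eq (chdir_line (c := 1) (t := t) (z := @cvzero R n) (eta := toCn (vperm w xi)) _) _.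
    rewrite a1; apply: fd; first exact: box_toCn.
    by apply: vdistinct_rsc; [rewrite gt_eqF|exact: vdistinct_vperm].
  rewrite toC1 mul1r addr0 /chrhs mulrDl; congr (_ + _ - _ * _).
    congr (_ * _); rewrite /cdot toC_sum; apply: eq_bigr => i _; by rewrite -toCM.
  apply: eq_psum => i j ij; rewrite toCM toCV.
  have a2 : along (@cvzero R n) (toCn (vperm (tperm i j * w) xi)) (1 * t) = sw i j (toCn (rsc t (vperm w xi))).
    by rewrite sw_toCn -[vsw i j _]/(rsc t (vsw i j (vperm w xi))) vsw_vperm; apply/funext => l; rewrite /along /cvadd /cvscale /toCn /rsc add0r mul1r toCM.
  rewrite a1 a2 mulrAC; congr (_ / _ * _).
    by rewrite /toCn -toCB.
  by rewrite /toCn /rsc -!toCB -mulrBr -toCN cexp_toC -toC1 -toCB.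
- move=> w t _; apply: fc; last by rewrite mul1r; move=> i; rewrite Im_along0.
  move=> i; apply: ccontD; first exact: ccont_cst.
  by apply: ccontM; [rewrite (_ : (fun s => _) = @toC R); [apply: cderiv_cont (cderiv_id t)|apply/funext => s; rewrite mul1r]|exact: ccont_cst].
- by move=> w t _; exact: hM.
- move=> i j w t ij /andP[t0 t1]; rewrite cE// addrA -mulr2n -mulr_natr subr_ge0.
  set D := d i j w; have D0 : D != 0 by exact: dn.
  have Den := en t D t0 D0.
  case: (ltgtP D 0) => [Ds|Ds|/eqP]; last by rewrite (negbTE D0).
    have e1 : 1 < expR (- (t * D)) by rewrite expR_gt1; nra.
    rewrite -subr_ge0 (_ : _ - D = D * ((1 + expR (- (t * D))) / (1 - expR (- (t * D))))); last by field; rewrite subr_eq0 lt_eqF.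
    apply: mulr_le0; first exact: ltW.
    apply: mulr_ge0_le0; last by rewrite invr_le0 subr_le0 ltW.
    by rewrite addr_ge0 ?expR_ge0.
  have e1 : expR (- (t * D)) < 1 by rewrite expR_lt1; nra.
  rewrite -subr_ge0 (_ : _ - D = D * ((1 + expR (- (t * D))) / (1 - expR (- (t * D))))); last by field; rewrite subr_eq0 gt_eqF.
  apply: mulr_ge0; first exact: ltW.
  apply: divr_ge0; last by rewrite subr_ge0 ltW.
  by rewrite addr_ge0 ?expR_ge0.
- move=> w t /andP[t0 t1]; rewrite rho_pairs; congr (_ * _); apply: eq_bigr => i _; apply: eq_bigr => j ij.
  by rewrite cE//; congr (_ / _); rewrite /d /vperm; ring.
- by move=> t _; rewrite !mul0r addr0 big1// => w _; rewrite /crip cRe0 cIm0 !mulr0 addr0 mulr0.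
Qed.

Definition mkC (x b : Rn) : Cn := fun i => x i +i* b i.

(** The directions e_p - e_q preserve the sum of the imaginary parts. One entry below its target is
    raised and one above is lowered until one of them is right; this lowers the number of wrong
    entries. *)
Lemma transport_step lam f (x a b : Rn) : chsol lam f -> vdistinct x ->
  (forall i, `|a i| < pi / 2) -> (forall i, `|b i| < pi / 2) ->
  \sum_(i < n) a i = \sum_(i < n) b i ->
  (forall w, f (pact w (mkC x a)) = 0) -> forall w, f (pact w (mkC x b)) = 0.
Proof.
move=> hf xd; have [m] := ubnP #|[pred i | a i != b i]|.
elim: m a => // m IH a ham ab bb sab fa.
have [E|/eqP N] := eqVneq a b; first by rewrite -E.
have sab0 : \sum_(i < n) (b i - a i) = 0 by rewrite sumrB sab subrr.
have [p hp] : exists p, a p < b p.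
  apply/existsP; apply: contra_notT N => /existsPn h; apply/funext => i.
  have h' j : true -> 0 <= a j - b j by rewrite subr_ge0 leNgt; move=> _; exact: h.
  have s0 : \sum_(i < n) (a i - b i) = 0 by rewrite sumrB sab subrr.
  have := psumr_eq0P h' s0; move=> /(_ i isT)/eqP; by rewrite subr_eq0 => /eqP.
have [q hq] : exists q, b q < a q.
  apply/existsP; apply: contra_notT N => /existsPn h; apply/funext => i.
  have h' j : true -> 0 <= b j - a j by rewrite subr_ge0 leNgt; move=> _; exact: h.
  by have := psumr_eq0P h' sab0; move=> /(_ i isT)/eqP; rewrite subr_eq0 => /eqP.
have pq : p != q by apply: contraTneq hp => ->; rewrite -leNgt ltW.
pose c := Num.min (b p - a p) (a q - b q).
have c0 : 0 < c by rewrite lt_min !subr_gt0 hp hq.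
have cp : c <= b p - a p by rewrite ge_min lexx.
have cq : c <= a q - b q by rewrite ge_min lexx orbT.
pose xi : Rn := fun i => (i == p)%:R - (i == q)%:R.
pose a' : Rn := fun i => a i + c * xi i.
have a'p : a' p = a p + c by rewrite /a' /xi eqxx (negbTE pq) subr0 mulr1.
have a'q : a' q = a q - c by rewrite /a' /xi eqxx eq_sym (negbTE pq) sub0r mulrN1.
have a'o i : i != p -> i != q -> a' i = a i.
  by rewrite /a' /xi => /negbTE -> /negbTE ->; rewrite subrr mulr0 addr0.
have a'b i : `|a' i| < pi / 2.
  have [->|ip] := eqVneq i p.
    by have := ab p; have := bb p; rewrite a'p !ltr_norml => /andP[? ?] /andP[? ?]; apply/andP; split; lra.
  have [->|iq] := eqVneq i q.
    by have := ab q; have := bb q; rewrite a'q !ltr_norml => /andP[? ?] /andP[? ?]; apply/andP; split; lra.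
  by rewrite a'o.
have zE : along (mkC x a) (cvscale 'i (toCn xi)) c = mkC x a'.
  by apply/funext => i; apply: ceq; rewrite ?Im_along ?Re_along.
apply: (IH a') => //.
- move: ham; rewrite ltnS => ham; apply: leq_trans ham; apply: proper_card.
  rewrite properE; apply/andP; split.
    apply/fintype.subsetP => i; rewrite !inE.
    have [->|ip] := eqVneq i p; first by rewrite (lt_eqF hp).
    have [->|iq] := eqVneq i q; first by rewrite (gt_eqF hq).
    by rewrite a'o.
  apply/fintype.subsetPn; case: (leP (b p - a p) (a q - b q)) => h.
    by exists p; rewrite inE; [rewrite (lt_eqF hp)|rewrite a'p /c min_l// addrC subrK eqxx].
  by exists q; rewrite inE; [rewrite (gt_eqF hq)|rewrite a'q /c min_r ?(ltW h)// opprB addrC subrK eqxx].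
- have sxi : \sum_(i < n) xi i = 0.
    rewrite sumrB (bigD1 p)//= eqxx big1 ?addr0; last by move=> i /negbTE ->.
    by rewrite (bigD1 q)//= eqxx big1 ?addr0 ?subrr// => i /negbTE ->.
  by rewrite -sab /a' big_split /= -mulr_sumr sxi mulr0 addr0.
- rewrite -zE; apply: (segment_zero hf (xi := xi)) => //.
  + by left; exists p, q.
  + by rewrite zE.
Qed.

(** A diagonal move brings all imaginary parts to their mean [m], which lies in the box by
    convexity; moves of zero sum do the rest. *)
Lemma mkC_zero lam f (x b : Rn) : chsol lam f -> vdistinct x -> (forall i, `|b i| < pi / 2) ->
  (forall w, f (toCn (vperm w x)) = 0) -> f (mkC x b) = 0.
Proof.
move=> hf xd bb f0.
pose m : R := n%:R^-1 * \sum_(i < n) b i.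
have mE (i : 'I_n) : n%:R * m = \sum_(i < n) b i.
  rewrite /m mulrA mulfV ?mul1r// pnatr_eq0 -lt0n; exact: leq_ltn_trans (ltn_ord i).
have npos (i : 'I_n) : (0 : R) < n%:R by rewrite ltr0n; exact: leq_ltn_trans (ltn_ord i).
have mb (i : 'I_n) : `|m| < pi / 2.
  have h1 (s : R) : s = 1 \/ s = -1 -> s * m < pi / 2.
    move=> hs; rewrite -(ltr_pM2l (npos i)) mulrCA mE // -subr_gt0.
    have -> : n%:R * (pi / 2) - s * \sum_(i < n) b i = \sum_(i < n) (pi / 2 - s * b i) :> R.
      by rewrite sumrB sumr_const card_ord mulr_natl -mulr_sumr.
    have hp j : 0 < pi / 2 - s * b j.
      by have := bb j; rewrite ltr_norml => /andP[? ?]; clear mE npos; case: hs => ->; lra.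
    by rewrite (bigD1 i)//= ltr_pwDl// sumr_ge0// => j _; exact: ltW.
  by have := h1 1 (or_introl erefl); have := h1 (-1) (or_intror erefl); rewrite ltr_norml => *; clear h1 mE npos; apply/andP; split; lra.
suff : forall w, f (pact w (mkC x b)) = 0.
  move=> /(_ 1%g); rewrite (_ : pact 1 _ = mkC x b)//; by apply/funext => i; rewrite /pact perm1.
apply: (@transport_step lam f x (fun _ => m)) => //.
  have [n0|n0] := posnP n; first by rewrite !big1// => i _; have := ltn_ord i; rewrite {2}n0.
  by rewrite sumr_const card_ord -mulr_natl (mE (Ordinal n0)).
have zE : along (toCn x) (cvscale 'i (toCn (fun _ => 1))) m = mkC x (fun _ => m).
  by apply/funext => i; apply: ceq; rewrite ?Im_along ?Re_along //= add0r mulr1.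
rewrite -zE; apply: (segment_zero hf) => //.
- exact: box_toCn.
- by right.
- by rewrite zE => i; exact: mb.
Qed.

(** The zero at the origin spreads along real rays by [chsol_ray_bound], then in imaginary
    directions, and finally by right limits to points with coinciding real parts. *)
Lemma chsol_zero lam f z : chsol lam f -> f (@cvzero R n) = 0 -> box z -> f z = 0.
Proof.
move=> hf f0 zb.
have fr (x : Rn) : vdistinct x -> f (toCn x) = 0.
  move=> xd; have [M M0 hM] := finite_bound (fun w : 'S_n => Re (cdot lam (toCn (vperm w x)))).
  have := chsol_ray_bound hf xd hM; rewrite f0 cnorm0 expr0n /= !mulr0 => h.
  by apply/eqP; rewrite -cnorm_eq0 -sqrf_eq0 eq_le h sqr_ge0.
pose p (h : R) : Cn := mkC (ypert (fun i => Re (z i)) h) (fun i => Im (z i)).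
have [d d0 hd] := distinct_near (fun i => Re (z i)).
have p0 : p 0 = z by apply/funext => i; apply: ceq => //=; rewrite /ypert mul0r addr0.
rewrite -p0; apply: (@right_limit_eq0 R (fun h => f (p h)) d d0).
  case: hf => fc _ _; apply: fc; last by rewrite p0.
  by move=> i; split => /=; [exact: ypert_cont|exact: cst_continuous].
move=> h /hd hd'; apply: (mkC_zero hf) => // w; apply: fr; exact: vdistinct_vperm.
Qed.

Lemma chrhsB lam f g (c : C) z eta :
  chrhs lam (fun z => f z - c * g z) z eta = chrhs lam f z eta - c * chrhs lam g z eta.
Proof.
rewrite /chrhs mulrBr.
have -> : psum (fun i j => (eta j - eta i) * (f z - c * g z - (f (sw i j z) - c * g (sw i j z))) / (1 - cexp (- (z j - z i)))) =
   psum (fun i j => (eta j - eta i) * (f z - f (sw i j z)) / (1 - cexp (- (z j - z i)))) -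
   c * psum (fun i j => (eta j - eta i) * (g z - g (sw i j z)) / (1 - cexp (- (z j - z i)))).
  by rewrite -psumZ -psumB; apply: eq_psum => i j _; rewrite mulrA -mulrBl mulrA; congr (_ * _); ring.
ring.
Qed.

Lemma chsol_unique lam f g z : chsol lam f -> chsol lam g -> g (@cvzero R n) = 1 -> box z ->
  f z = f (@cvzero R n) * g z.
Proof.
move=> hf hg g0 zb; apply/eqP; rewrite -subr_eq0; apply/eqP.
apply: (@chsol_zero lam (fun z => f z - f (@cvzero R n) * g z)) => //; last by rewrite g0 mulr1 subrr.
have [fc fr fi] := hf; have [gc gr gi] := hg.
split=> [p t pc pb|u xi ub ud|u xi ub ud xa].
- by apply: ccontB; [exact: fc|apply: ccontM; [exact: ccont_cst|exact: gc]].
- by apply: cderiv_eq (cderivB (fr u xi ub ud) (cderivZ _ (gr u xi ub ud))) _; rewrite -chrhsB.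
- by apply: cderiv_eq (cderivB (fi u xi ub ud xa) (cderivZ _ (gi u xi ub ud xa))) _; rewrite -chrhsB.
Qed.

End CherednikSolutions.

Lemma chsol_G (R : realType) (n : nat) (k : R) (G0 : Cn R n -> Cn R n -> R[i]) lam :
  is_cherednik0 k G0 -> chsol k lam (Gker G0 lam).
Proof.
move=> hG; split=> [p t pc pb|z xi zb zd|z xi zb zd].
- by apply: (G_path hG) => //; exact: box_imV.
- by apply: chdir_G_real => //; [exact: box_imV|exact: redistinct_distinct].
- case=> [[p [q [pq ->]]]|->]; last exact: chdir_G_imag1.
  by apply: chdir_G_imag => //; [exact: box_imV|exact: redistinct_distinct].
Qed.

(** * The Cherednik kernel on the positive orthant *)

Section DunklForm.
Variables (R : realType) (n : nat) (k : R).
Local Notation C := R[i].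
Local Notation Rn := (Rn R n).

(* [dform l f h] says that x_l T_l f = h on regular points of the positive orthant. *)
Definition dform (l : 'I_n) (f h : Rn -> C) := forall x, vpos x -> vdistinct x ->
  cderiv (fun t => f (upd x l t)) (x l)
    (h x / toC (x l) - toC k * \sum_(j < n | j != l) (f x - f (vsw l j x)) / toC (x l - x j)).

Lemma dform_Er (E : Cn R n -> Cn R n -> C) (lam : Cn R n) l : is_dunkl_kernel k E ->
  dform l (Er E lam) (fun x => lam l * toC (x l) * Er E lam x).
Proof.
move=> hE x xp xd; apply: cderiv_eq (Er_partial hE lam l xd) _; congr (_ - _).
by rewrite mulrAC mulfK// toC_eq0 gt_eqF// xp.
Qed.

End DunklForm.

Section CherednikReal.
Variables (R : realType) (n : nat) (k : R) (G0 : Cn R n -> Cn R n -> R[i]).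
Hypothesis k0 : 0 <= k.
Hypothesis hG : is_cherednik0 k G0.
Variable lam : Cn R n.
Local Notation C := R[i].
Local Notation Re := (@complex.Re R).
Local Notation Im := (@complex.Im R).
Local Notation Rn := (Rn R n).
Local Notation Cn := (Cn R n).

Definition vln (x : Rn) : Rn := fun i => ln (x i).
Definition gG (x : Rn) : C := Gker G0 lam (toCn (vln x)).

Lemma calG_gG x : vpos x -> calG G0 lam (toCn x) = gG x.
Proof.
move=> xp; rewrite /calG /gG; congr (Gker _ _ _); apply/funext => i.
by rewrite /cvlog /toCn cLog_toC// xp.
Qed.

Lemma gG_path (p : R -> Rn) t : vpos (p t) -> (forall i, {for t, continuous (fun s => p s i)}) ->
  ccont (fun s => gG (p s)) t.
Proof.
move=> pp pc; apply: (G_path hG); last by apply: box_imV; exact: box_toCn.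
move=> i; apply: ccont_real.
by apply: (@continuous_comp _ _ _ (fun s => p s i) (@ln R)) => //; apply: continuous_ln; exact: pp.
Qed.

Lemma vdistinct_vln x : vpos x -> vdistinct x -> vdistinct (vln x).
Proof.
move=> xp xd i j ij; apply: contra_neq (xd i j ij) => /ln_inj; apply; rewrite posrE; exact: xp.
Qed.

Lemma le_vsum (x : Rn) i : vpos x -> x i <= vsum x.
Proof. by move=> xp; rewrite /vsum (bigD1 i)//= lerDl sumr_ge0// => j _; rewrite ltW// xp. Qed.

Lemma powln_le (d : R) (m : nat) (S : R) : 0 <= S -> 0 <= d <= m%:R -> expR (d * ln S) <= 1 + S ^+ m.
Proof.
move=> S0 /andP[d0 dm]; have [S1|S1] := leP S 1.
  apply: (@le_trans _ _ 1); last by rewrite lerDl exprn_ge0.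
  by rewrite -expR0 ler_expR mulr_ge0_le0// ln_le0.
have Sp : 0 < S by exact: lt_trans S1.
apply: (@le_trans _ _ (S ^+ m)); last by rewrite lerDr.
rewrite -[in leRHS](lnK Sp) -expRM_natl ler_expR; apply: ler_wpM2r => //; exact: ln_ge0 (ltW S1).
Qed.

Hypothesis lam0 : forall i, 0 <= Re (lam i).

Definition gG_const : R := Num.sqrt n`!%:R.

(** Because Re lam >= 0 and every x_i is at most [vsum x], the real part of <lam, w ln x> is at most
    d ln (vsum x) for every w; the ray bound then gives a power of [vsum x]. *)
Lemma gG_bound : exists m : nat, forall x, vpos x -> cnorm (gG x) <= gG_const * (1 + vsum x ^+ m).
Proof.
pose d := \sum_(i < n) Re (lam i).
have d0 : 0 <= d by apply: sumr_ge0.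
have [m hm] : exists m : nat, d <= m%:R.
  by exists (Num.bound d); apply/ltW; exact: archi_boundP.
have G00 : Gker G0 lam (@cvzero R n) = 1 by apply: (G_at0 hG).
exists m.
have main x : vpos x -> vdistinct x -> cnorm (gG x) <= gG_const * (1 + vsum x ^+ m).
  move=> xp xd.
  have hM w : Re (cdot lam (toCn (vperm w (vln x)))) <= d * ln (vsum x).
    rewrite /cdot cRe_sum mulr_suml; apply: ler_sum => i _.
    rewrite /toCn cReM cIm_toC mulr0 subr0 ler_wpM2l// cRe_toC /vperm /vln.
    have xw := xp (w i); have xs := le_vsum (w i) xp.
    by rewrite ler_ln// posrE// (lt_le_trans xw).
  have := chsol_ray_bound k0 (chsol_G lam hG) (vdistinct_vln xp xd) hM.
  rewrite G00 cnorm1 expr1n mulr1 => h.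
  apply: (@le_trans _ _ (gG_const * expR (d * ln (vsum x)))); last first.
    rewrite ler_wpM2l ?sqrtr_ge0//; apply: powln_le; first exact: vsum_ge0.
    by apply/andP.
  rewrite -(@ler_pXn2r _ 2) ?nnegrE ?mulr_ge0 ?cnorm_ge0 ?sqrtr_ge0 ?expR_ge0//.
  by rewrite exprMn [gG_const ^+ 2]sqr_sqrtr// [leRHS]mulrC -expRM_natl.
move=> x xp; have [e e0 he] := distinct_near x.
have := @right_limit_le R (fun h => cnorm (gG (ypert x h))) (fun h => gG_const * (1 + vsum (ypert x h) ^+ m)) e e0.
rewrite ypert0; apply.
- by apply: ccont_cnorm; apply: gG_path => [|i]; [rewrite ypert0|exact: ypert_cont].
- apply: cvgMr; apply: cvgD; first exact: cvg_cst.
  apply: (@continuous_comp _ _ _ (fun h => vsum (ypert x h)) (fun s => s ^+ m)); last exact: exprn_continuous.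
  by apply: continuous_bigsum => i; exact: ypert_cont.
- move=> h h0e; apply: main; last exact: he.
  by apply: vpos_ypert => //; case/andP: h0e => /ltW.
Qed.

Lemma gG_homog (r : R) x : 0 < r -> vpos x -> gG (rsc r x) = cexp (toC (ln r) * csum lam) * gG x.
Proof.
move=> r0 xp; rewrite /gG -G_homog; congr (Gker _ _ _); apply/funext => i.
by rewrite /toCn /vln /rsc lnM ?posrE// ?toCD 1?addrC// xp.
Qed.

Definition gG_dunkl (l : 'I_n) (x : Rn) : C :=
  (lam l + toC (@rho R n k l)) * gG x + toC k * \sum_(j < n | (l < j)%N) (gG x - gG (vsw l j x)).

(** With x = exp y the Cherednik coefficient becomes x_j/(x_j - x_i). When l comes first it equals 1
    - x_l/(x_l - x_j): a Dunkl coefficient and a regular term, which [gG_dunkl] collects. *)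
Lemma dform_gG l : dform k l gG (gG_dunkl l).
Proof.
move=> x xp xd.
pose dl : Rn := fun i => (i == l)%:R.
have [_ fd _] := chsol_G lam hG.
have := fd (toCn (vln x)) dl (@box_toCn _ _ _) (vdistinct_vln xp xd).
rewrite /chdir => h.
have xl0 : toC (x l) != 0 by rewrite toC_eq0 gt_eqF// xp.
have dg : is_derive (x l) (1 : R) (fun s => ln s - ln (x l)) (x l)^-1.
  have h1 := is_deriveB (is_derive1_ln (xp l)) (is_derive_cst (ln (x l)) (x l) (1 : R)).
  by apply: (is_derive_eq h1); rewrite subr0.
have g0 : ln (x l) - ln (x l) = 0 by rewrite subrr.
rewrite -g0 in h; have := cderiv_comp dg h.
rewrite (_ : (fun s => _) = (fun t => gG (upd x l t))); last first.
  apply/funext => t; rewrite /gG; congr (Gker _ _ _); apply/funext => i.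
  rewrite /along /cvadd /cvscale /toCn /vln /upd /dl -toCM -toCD; congr toC.
  by case: eqP => [->|_]; rewrite ?mulr1 ?mulr0 ?addr0// addrC subrK.
move=> h2; apply: cderiv_eq h2 _.
rewrite /chrhs -/(gG x).
have c1 (u : Cn) : cdot u (toCn dl) = u l.
  rewrite /cdot (bigD1 l)//= /toCn /dl eqxx mulr1 big1 ?addr0// => i /negbTE ->.
  by rewrite mulr0.
rewrite !c1.
pose A i j := (gG x - gG (vsw i j x)) * toC (x j) / toC (x j - x i).
rewrite (@eq_psum _ _ _ (fun i j => ((j == l)%:R - (i == l)%:R) * A i j)); last first.
  move=> i j ij; rewrite -mulrA; congr (_ * _).
    by rewrite /toCn /dl !toC_nat.
  rewrite sw_toCn /A -mulrA; congr (_ * _).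
  have xj0 : x j != 0 by rewrite gt_eqF// xp.
  have ji : x j - x i != 0 by rewrite subr_eq0; apply: xd; rewrite -val_eqE /= gtn_eqF.
  rewrite /toCn -toCB -toCN cexp_toC opprB /vln expRB !lnK ?posrE ?xp// -toC1 -toCB.
  have -> : (1 - x i / x j) = (x j - x i) / x j by field.
  by rewrite toCM invfM toCV invrK mulrC.
rewrite psum_delta2 /gG_dunkl mulrDl.
have aE i : x l - x i != 0 -> A i l = toC (x l) * ((gG x - gG (vsw l i x)) / toC (x l - x i)).
  by move=> _; rewrite /A vswC; ring.
have lE j : toC (x l - x j) != 0 -> A l j = gG x - gG (vsw l j x) - toC (x l) * ((gG x - gG (vsw l j x)) / toC (x l - x j)).
  move=> lj; rewrite /A.
  have -> : toC (x j) = toC (x l) - toC (x l - x j) by rewrite -toCB; congr toC; ring.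
  have -> : toC (x j - x l) = - toC (x l - x j) by rewrite -toCN opprB.
  by move: (toC (x l - x j)) lj => d d0; field.
have nz (i : 'I_n) : i != l -> x l - x i != 0 by move=> il; rewrite subr_eq0; apply: xd; rewrite eq_sym.
rewrite (eq_bigr (fun i : 'I_n => toC (x l) * ((gG x - gG (vsw l i x)) / toC (x l - x i)))); last first.
  by move=> i il; apply/aE/nz; rewrite -val_eqE /= ltn_eqF.
rewrite [\sum_(j < n | (l < j)%N) A l j](eq_bigr (fun j => gG x - gG (vsw l j x) - toC (x l) * ((gG x - gG (vsw l j x)) / toC (x l - x j)))); last first.
  by move=> i il; apply: lE; rewrite toC_eq0; apply: nz; rewrite -val_eqE /= gtn_eqF.
rewrite [\sum_(j < n | j != l) _](bigID (fun j : 'I_n => (j < l)%N)) /=.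
rewrite [\sum_(i < n | (i != l) && (i < l)%N) _](eq_bigl (fun j : 'I_n => (j < l)%N)); last first.
  by move=> j; rewrite andbC; case: ltnP => //= jl; rewrite -val_eqE /= ltn_eqF.
rewrite [\sum_(i < n | (i != l) && ~~ (i < l)%N) _](eq_bigl (fun j : 'I_n => (l < j)%N)); last first.
  by move=> j; rewrite -leqNgt [RHS]ltn_neqAle eq_sym val_eqE.
rewrite sumrB -!mulr_sumr toCV.
by field.
Qed.

End CherednikReal.

(** * Integrals on the half line *)

Section Calculus.
Variable R : realType.
Local Notation mu := (@lebesgue_measure R).
Local Notation Rpos := (@Rpos R).

(** An exceptional point inside the interval is removed by cutting there; continuity glues the
    pieces. *)
Lemma cst_off_finite (G : R -> R) (s : seq R) (a b : R) : a <= b ->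
  {within `[a, b], continuous G} ->
  (forall t : R, a < t < b -> t \notin s -> is_derive t (1 : R) G 0) -> G a = G b.
Proof.
elim: s a b => [|c s IH] a b ab gG_const dG.
  move: ab; rewrite le_eqVlt => /predU1P[->//|ab].
  have [|c _] := MVT ab (f := G) (df := fun=> 0) _ gG_const.
    by move=> x; rewrite in_itv /= => xab; exact: dG.
  by rewrite mul0r => /eqP; rewrite subr_eq0 => /eqP.
have sub (x y : R) : a <= x -> y <= b -> {within `[x, y], continuous G}.
  move=> ax yb; apply: continuous_subspaceW gG_const => z /=; rewrite !in_itv /= => /andP[xz zy].
  by rewrite (le_trans ax xz) (le_trans zy yb).
have [/andP[ac cb]|nc] := boolP (a < c < b).
  transitivity (G c).
  apply: (IH a c (ltW ac)).
  - by apply: sub => //; exact: ltW.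
  - move=> t /andP[at_ tc] ts; apply: dG; first by rewrite at_ (lt_trans tc cb).
    by rewrite in_cons negb_or ts andbT lt_eqF.
  apply: (IH c b (ltW cb)); first by apply: sub => //; exact: ltW.
  move=> t /andP[ct tb] ts; apply: dG; first by rewrite (lt_trans ac ct) tb.
  by rewrite in_cons negb_or ts andbT gt_eqF.
apply: IH => // t tab ts; apply: dG => //.
by rewrite in_cons negb_or ts andbT; apply: contraNneq nc => <-.
Qed.

(** The indefinite integral of f and F have the same derivative off the exceptional points, so
    [cst_off_finite] applies to their difference. *)
Lemma FTC_off_finite (F f : R -> R) (s : seq R) (a b : R) : 0 < a -> a < b ->
  (forall t : R, 0 < t -> {for t, continuous F}) ->
  (forall t : R, 0 < t -> t \notin s -> is_derive t (1 : R) F (f t)) ->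
  (forall t : R, 0 < t -> t \notin s -> {for t, continuous f}) ->
  mu.-integrable `[a, b] (EFin \o f) ->
  Rintegral mu `[a, b] f = F b - F a.
Proof.
move=> a0 ab cF dF cf fi.
pose P x := \int[mu]_(t in [set` `[a, x]]) f t.
have Pa : P a = 0 by rewrite /P set_itv1 Rintegral_set1.
have cP : {within `[a, b], continuous P} := parameterized_integral_continuous (ltW ab) fi.
suff : (fun x => P x - F x) a = (fun x => P x - F x) b.
  by rewrite Pa /P => h; move/eqP: h; rewrite sub0r eq_sym subr_eq addrC => /eqP.
apply: (@cst_off_finite (fun x => P x - F x) s a b) => //; first exact: ltW.
  have cF' : {within `[a, b], continuous F}.
    apply: continuous_in_subspaceT => y /set_mem /=.
    by rewrite in_itv /= => /andP[ay _]; apply: cF; exact: lt_le_trans ay.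
  by move=> x; exact: (cvgB (cP x) (cF' x)).
move=> t /andP[at_ tb] ts.
have t0 := lt_trans a0 at_.
have [dP Pt] := continuous_FTC1_closed tb fi at_ (cf t t0 ts).
have dP' : is_derive t (1 : R) P (f t).
  apply: DeriveDef; first exact: dP.
  by rewrite -derive1E; exact: Pt.
by apply: (is_derive_eq (is_deriveB dP' (dF t t0 ts))); rewrite subrr.
Qed.

(** Compact intervals exhaust the half line and dominated convergence passes to the limit. In the
    applications [s] lists the coordinates of y, where t makes two coordinates coincide. *)
Lemma FTC_pos (F f : R -> R) (s : seq R) (A B : R) :
  (forall t : R, 0 < t -> {for t, continuous F}) ->
  (forall t : R, 0 < t -> t \notin s -> is_derive t (1 : R) F (f t)) ->
  (forall t : R, 0 < t -> t \notin s -> {for t, continuous f}) ->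
  mu.-integrable Rpos (EFin \o f) ->
  F @ 0^'+ --> A -> F @ +oo --> B ->
  Rintegral mu Rpos f = B - A.
Proof.
move=> cF dF cf fi FA FB.
pose a (m : nat) : R := m.+1%:R^-1.
(* Starting at 2 keeps a m < b m also for m = 0. *)
pose b (m : nat) : R := m.+2%:R.
have a0 m : 0 < a m by rewrite invr_gt0.
have ab m : a m < b m.
  by apply: (@le_lt_trans _ _ 1); rewrite /a /b ?invf_le1// ?ler1n// ltr1n.
have sub m : `[a m, b m]%classic `<=` Rpos.
  by move=> t; rewrite /Rpos /= !in_itv /= andbT => /andP[+ _]; apply: lt_le_trans.
have mR : measurable Rpos by exact: measurable_itv.
have fim m : mu.-integrable `[a m, b m] (EFin \o f).
  by apply: integrableS fi => //; exact: measurable_itv.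
have eqm m : Rintegral mu `[a m, b m] f = F (b m) - F (a m) by exact: (FTC_off_finite (s := s)).
have a_cvg : a @ \oo --> (0 : R) by exact: cvg_harmonic.
have b_cvg : b @ \oo --> +oo.
  apply/cvgryPge => M; near=> m.
  apply: (@le_trans _ _ m%:R); last by rewrite ler_nat; lia.
  by near: m; exact: nbhs_infty_ger.
have lim1 : (fun m => F (b m) - F (a m)) @ \oo --> B - A.
  apply: cvgB; first by move/cvg_pinftyP : FB; apply.
  by move/cvg_at_rightP : FA; apply.
have mf : measurable_fun Rpos (EFin \o f) by case/integrableP: fi.
pose f_ m t : \bar R := ((EFin \o f) \_ `[a m, b m]) t.
have fE m : (\int[mu]_(t in Rpos) f_ m t = (Rintegral mu `[a m, b m] f)%:E)%E.
  rewrite /Rintegral fineK; last by apply: integrable_fin_num => //; exact: measurable_itv.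
  by rewrite -integral_mkcondr (setIidr (@sub m)).
have lim2 : (fun m => \int[mu]_(t in Rpos) f_ m t)%E @ \oo --> (\int[mu]_(t in Rpos) (EFin \o f) t)%E.
  have [] // := @dominated_convergence _ _ _ mu Rpos mR f_ (EFin \o f) (abse \o (EFin \o f)) _ mf _ _ _.
  - move=> m; have mi : measurable `[a m, b m] by exact: measurable_itv.
    refine ((measurable_restrict (EFin \o f) mi mR).1 _).
    by apply: measurable_funS mf => //; apply: subIsetl.
  - apply: aeW => t; rewrite /Rpos /= in_itv /= andbT => t0.
    apply: cvg_near_cst; near=> m.
    rewrite /f_ patchE mem_set//= in_itv /=; apply/andP; split.
      by apply: ltW; near: m; exact: (cvgr_lt _ a_cvg _ t0).
    by near: m; move/cvgryPge: b_cvg; apply.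
  - exact: integrable_abse.
  - apply: aeW => t m _; rewrite /f_ patchE; case: ifP => // _.
    by rewrite -[point]/(0%E : \bar R) abse0 /= lee_fin.
have lim3 : (fun m => F (b m) - F (a m)) @ \oo --> Rintegral mu Rpos f.
  rewrite (_ : (fun m => _) = fine \o (fun m => \int[mu]_(t in Rpos) f_ m t)%E); last first.
    by apply/funext => m /=; rewrite fE -eqm.
  by move: lim2; rewrite -[X in _ --> X](@fineK R) ?integrable_fin_num// => /fine_cvgP[].
exact: (cvg_unique _ lim3 lim1).
Unshelve. all: by end_near. Qed.

End Calculus.

(** * Explicit integrable majorants on the half line *)

Section Dominators.
Variable R : realType.
Local Notation mu := (@lebesgue_measure R).
Local Notation Rpos := (@Rpos R).

(** This is w^(a-1) (1+w)^(-a-1), comparable to w^(a-1) at 0 and integrable at infinity; its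
    primitive [Udom] is (w/(1+w))^a / a, which is bounded by 1/a. *)
Definition udom (a w : R) : R := expR ((a - 1) * ln w - (a + 1) * ln (1 + w)).
Definition Udom (a w : R) : R := expR (a * (ln w - ln (1 + w))) / a.

Lemma udom_ge0 a w : 0 <= udom a w. Proof. exact: expR_ge0. Qed.

Lemma is_derive_ln1D (w : R) : 0 < w -> is_derive w (1 : R) (fun s => ln (1 + s)) (1 + w)^-1.
Proof.
move=> w0; have w1 : 0 < 1 + w by rewrite addr_gt0.
have d1 : is_derive w (1 : R) (fun s : R => 1 + s) 1.
  by apply: (is_derive_eq (is_deriveD (is_derive_cst (1 : R) w (1 : R)) (is_derive_id w (1 : R)))); rewrite add0r.
by apply: (is_derive_eq (@is_derive1_comp _ (@ln R) (fun s => 1 + s) w _ _ (is_derive1_ln w1) d1)); rewrite mulr1.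
Qed.

Lemma Udom_deriv (a w : R) : 0 < a -> 0 < w -> is_derive w (1 : R) (Udom a) (udom a w).
Proof.
move=> a0 w0; have w1 : 0 < 1 + w by rewrite addr_gt0.
have d2 := is_deriveZ a (is_deriveB (is_derive1_ln w0) (is_derive_ln1D w0)).
have d3 := @is_derive1_comp _ (@expR R) _ w _ _ (is_derive_expR _) d2.
have d4 := is_deriveZ a^-1 d3.
have -> : Udom a = (a^-1 *: (@expR R \o (a *: ((@ln R) - (fun s => ln (1 + s)))))).
  by apply/funext => s; rewrite /Udom mulrC.
apply: (is_derive_eq d4); rewrite /GRing.scale /= /udom.
have -> : (a - 1) * ln w - (a + 1) * ln (1 + w) = a * (ln w - ln (1 + w)) - ln w - ln (1 + w) by ring.
rewrite !expRD !expRN !lnK ?posrE// /GRing.scale /=.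
by field; rewrite !gt_eqF.
Qed.

Lemma Udom_bound (a w : R) : 0 < a -> 0 < w -> 0 <= Udom a w <= a^-1.
Proof.
move=> a0 w0; rewrite /Udom mulr_ge0 ?expR_ge0 ?invr_ge0 ?(ltW a0)//=.
rewrite ler_piMl ?invr_ge0 ?(ltW a0)// -expR0 ler_expR mulr_ge0_le0 ?(ltW a0)//.
by rewrite subr_le0 ler_ln ?posrE ?addr_gt0// lerDr.
Qed.

Lemma udom_cont (a w : R) : 0 < w -> {for w, continuous (udom a)}.
Proof.
move=> w0; have w1 : 0 < 1 + w by rewrite addr_gt0.
apply: (@continuous_comp _ _ _ (fun w => (a - 1) * ln w - (a + 1) * ln (1 + w)) (@expR R)); last exact: continuous_expR.
apply: continuousB; apply: cvgMr; first exact: continuous_ln.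
apply: (@continuous_comp R R R (fun w : R => 1 + w) (@ln R)); last exact: continuous_ln.
by apply: continuousD; [exact: cst_continuous|exact: cvg_id].
Qed.

Lemma measurable_cont_pos (f : R -> R) : (forall t : R, 0 < t -> {for t, continuous f}) ->
  measurable_fun Rpos f.
Proof.
move=> cf; apply: open_continuous_measurable_fun; first exact: interval_open.
by move=> t; rewrite /Rpos inE /= in_itv /= andbT; exact: cf.
Qed.

(* A nonnegative function with a bounded primitive is integrable, by exhaustion of the
   (possibly singular) domain with compact intervals. *)
Lemma bounded_primitive (a b : nat -> R) (F f : R -> R) (B : R) :
  (forall m, a m.+1 <= a m) -> (forall m, b m <= b m.+1) ->
  (forall m (t : R), a m <= t <= b m -> {for t, continuous f}) ->
  (forall m (t : R), a m <= t <= b m -> is_derive t (1 : R) F (f t)) ->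
  (forall m (t : R), a m <= t <= b m -> `|F t| <= B) ->
  (forall t, 0 <= f t) -> 0 <= B ->
  (\int[mu]_(t in \bigcup_m `[a m, b m]%classic) (f t)%:E <= (B + B)%:E)%E.
Proof.
move=> am bm cf dF FB f0 B0.
have mf m : measurable_fun `[a m, b m] (EFin \o f).
  apply/measurable_EFinP; apply: subspace_continuous_measurable_fun; first exact: measurable_itv.
  by apply: continuous_in_subspaceT => t /set_mem /=; rewrite in_itv /=; exact: cf.
have nd : nondecreasing_seq (fun m => `[a m, b m]%classic).
  apply/nondecreasing_seqP => m; apply/subsetPset => t /=; rewrite !in_itv /= => /andP[h1 h2].
  by rewrite (le_trans (am m) h1) (le_trans h2 (bm m)).
have := @ge0_nondecreasing_set_cvg_integral _ (measurableTypeR R) R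
   (fun m => `[a m, b m]%classic) (EFin \o f) (@lebesgue_measure R) nd
   (fun m => measurable_itv _) mf (fun m t _ => f0 t).
move=> h; rewrite -(cvg_lim _ h)//; apply: lime_le; first exact: cvgP h.
apply: nearW => m; rewrite /comp.
have [ab|ba] := ltP (a m) (b m); last first.
  have [E|N] := eqVneq (a m) (b m).
    by rewrite E set_itv1 integral_set1 lee_fin addr_ge0.
  by rewrite set_itv_ge ?bnd_simp -?ltNge ?lt_neqAle 1?eq_sym ?N// integral_set0 lee_fin addr_ge0.
rewrite (@continuous_FTC2 _ f F)//.
- rewrite -EFinB lee_fin.
  have h1 := FB m (b m); have h2 := FB m (a m); rewrite !lexx !(ltW ab) in h1 h2.
  have := h1 isT; have := h2 isT; rewrite !ler_norml => /andP[? ?] /andP[? ?]; lra.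
- by apply: continuous_in_subspaceT => t /set_mem /=; rewrite in_itv /=; exact: cf.
- have cF t : a m <= t <= b m -> {for t, continuous F}.
    move=> /dF [dFt _]; apply/differentiable_continuous/derivable1_diffP; exact: dFt.
  split.
  + by move=> t; rewrite in_itv /= => /andP[/ltW h1 /ltW h2]; have [] := dF m t; rewrite ?h1 ?h2.
  + by apply: cvg_at_right_filter; apply: cF; rewrite lexx ltW.
  + by apply: cvg_at_left_filter; apply: cF; rewrite lexx ltW.
- move=> t; rewrite in_itv /= => /andP[/ltW h1 /ltW h2]; rewrite derive1E.
  by have [] // := dF m t; rewrite h1 h2.
Qed.

Lemma invS_le m : (m.+2%:R^-1 : R) <= m.+1%:R^-1.
Proof. by rewrite lef_pV2 ?posrE// ler_nat. Qed.

Lemma invS_near (t : R) : 0 < t -> exists m0, forall m, (m0 <= m)%N -> m.+1%:R^-1 <= t.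
Proof.
move=> t0; have [m0 hm] : exists m0 : nat, t^-1 <= m0%:R.
  by exists (Num.bound t^-1); apply/ltW/archi_boundP; rewrite invr_ge0 ltW.
exists m0 => m hmm; rewrite -[leRHS]invrK lef_pV2 ?posrE ?invr_gt0//.
by rewrite (le_trans hm)// ler_nat; lia.
Qed.

Lemma udom_int a : 0 < a -> (\int[mu]_(t in Rpos) (udom a t)%:E < +oo)%E.
Proof.
move=> a0.
have -> : Rpos = \bigcup_m `[(m.+1%:R^-1 : R), m.+1%:R]%classic.
  apply/seteqP; split => t; rewrite /Rpos /= in_itv /= andbT.
    move=> t0; have [m1 h1] := invS_near t0.
    have [m2 h2] : exists m2 : nat, t <= m2%:R by exists (Num.bound t); apply/ltW/archi_boundP/ltW.
    exists (maxn m1 m2) => //=; rewrite in_itv /= h1 ?leq_maxl//=.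
    by rewrite (le_trans h2)// ler_nat; lia.
  by move=> [m _ /=]; rewrite in_itv /= => /andP[h _]; apply: lt_le_trans h; rewrite invr_gt0.
have pos m (t : R) : m.+1%:R^-1 <= t <= m.+1%:R -> 0 < t.
  by move=> /andP[h _]; apply: lt_le_trans h; rewrite invr_gt0.
apply: le_lt_trans (@bounded_primitive _ _ (Udom a) (udom a) a^-1 _ _ _ _ _ _ _) _.
- exact: invS_le.
- by move=> m; rewrite ler_nat.
- by move=> m t /pos t0; exact: udom_cont.
- by move=> m t /pos t0; exact: Udom_deriv.
- by move=> m t /pos t0; have /andP[h1 h2] := Udom_bound a0 t0; rewrite ger0_norm.
- exact: udom_ge0.
- by rewrite invr_ge0 ltW.
- exact: ltry.
Qed.

Lemma measurable_udom_dist (a p : R) : measurable_fun setT (fun t : R => udom a `|t - p|).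
Proof.
have mln : measurable_fun setT (@ln R) by exact: measurable_ln.
have md : measurable_fun setT (fun t : R => `|t - p|).
  by apply: measurableT_comp => //; apply: measurable_funB.
rewrite (_ : (fun t : R => _) = (fun t : R => expR ((a - 1) * ln `|t - p| - (a + 1) * ln (1 + `|t - p|)))) //.
apply: measurableT_comp => //; apply: measurable_funB; apply: measurable_funM => //; apply: measurableT_comp => //.
exact: measurable_funD.
Qed.

(** The sign [s] tells on which side of the singularity p the intervals lie. *)
Lemma udom_side (a p s : R) (u v : nat -> R) : 0 < a -> s * s = 1 ->
  (forall m, u m.+1 <= u m) -> (forall m, v m <= v m.+1) ->
  (forall m (t : R), u m <= t <= v m -> 0 < s * (t - p)) ->
  (\int[mu]_(t in \bigcup_m `[u m, v m]%classic) (udom a `|t - p|)%:E <= (a^-1 + a^-1)%:E)%E.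
Proof.
move=> a0 ss um vm pos.
have s1 : `|s| = 1 by apply/eqP; rewrite -sqr_norm_eq1 expr2 ss.
have -> : (\int[mu]_(t in \bigcup_m `[u m, v m]%classic) (udom a `|t - p|)%:E =
  \int[mu]_(t in \bigcup_m `[u m, v m]%classic) (udom a (s * (t - p)))%:E)%E.
  apply: eq_integral => t /set_mem [m _ /=]; rewrite in_itv /= => /pos t0.
  by congr ((udom a _)%:E); rewrite -[LHS]mul1r -s1 -normrM gtr0_norm.
have ds (t : R) : is_derive t (1 : R) (fun r => s * (r - p)) s.
  have h := is_deriveZ s (is_deriveB (is_derive_id t (1 : R)) (is_derive_cst p t (1 : R))).
  by apply: (is_derive_eq h); rewrite subr0 /GRing.scale /= mulr1.
apply: (@bounded_primitive _ _ (fun t => s * Udom a (s * (t - p))) (fun t => udom a (s * (t - p))) a^-1).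
- exact: um.
- exact: vm.
- move=> m t /pos t0.
  apply: (@continuous_comp R R R (fun t : R => s * (t - p)) (udom a)); last exact: udom_cont.
  by apply: cvgMr; apply: cvgB; [exact: cvg_id|exact: cvg_cst].
- move=> m t /pos t0.
  have h := is_deriveZ s (@is_derive1_comp _ (Udom a) _ t _ _ (Udom_deriv a0 t0) (ds t)).
  by apply: (is_derive_eq h); rewrite /GRing.scale /= mulrCA ss mulr1.
- move=> m t /pos t0; have /andP[h1 h2] := Udom_bound a0 t0.
  by rewrite normrM s1 mul1r ger0_norm.
- by move=> t; exact: udom_ge0.
- by rewrite invr_ge0 ltW.
Qed.

(** Each side of p contributes at most 2/a. The bound is independent of p, so that x_l can be
    integrated first with x_j as a parameter. *)
Lemma udom_dist_int (a p : R) : 0 < a -> (\int[mu]_(t in Rpos) (udom a `|t - p|)%:E <= (4 / a)%:E)%E.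
Proof.
move=> a0.
pose A1 := \bigcup_m `[p + (m.+1%:R^-1 : R), p + m.+1%:R]%classic.
pose A2 := \bigcup_m `[p - (m.+1%:R : R), p - m.+1%:R^-1]%classic.
have mA1 : measurable A1 by apply: bigcup_measurable => m _; exact: measurable_itv.
have mA2 : measurable A2 by apply: bigcup_measurable => m _; exact: measurable_itv.
have inv0 m : 0 < (m.+1%:R^-1 : R) by rewrite invr_gt0.
have pos1 m (t : R) : p + m.+1%:R^-1 <= t <= p + m.+1%:R -> 0 < 1 * (t - p).
  by move: (m.+1%:R^-1) (inv0 m) => i i0 /andP[h _]; lra.
have pos2 m (t : R) : p - m.+1%:R <= t <= p - m.+1%:R^-1 -> 0 < -1 * (t - p).
  by move: (m.+1%:R^-1) (inv0 m) => i i0 /andP[_ h]; lra.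
have i1 : (\int[mu]_(t in A1) (udom a `|t - p|)%:E <= (a^-1 + a^-1)%:E)%E.
  apply: (udom_side a0 _ _ _ pos1) => [|m|m]; first by rewrite mulr1.
    by rewrite lerD2l invS_le.
  by rewrite lerD2l ler_nat.
have i2 : (\int[mu]_(t in A2) (udom a `|t - p|)%:E <= (a^-1 + a^-1)%:E)%E.
  apply: (udom_side a0 _ _ _ pos2) => [|m|m]; first by rewrite mulrNN mulr1.
    by rewrite lerD2l lerN2 ler_nat.
  by rewrite lerD2l lerN2 invS_le.
have near1 (r : R) : 0 < r -> exists m : nat, m.+1%:R^-1 <= r <= m.+1%:R.
  move=> r0; have [m1 h1] := invS_near r0.
  have [m2 h2] : exists m2 : nat, r <= m2%:R by exists (Num.bound r); apply/ltW/archi_boundP/ltW.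
  exists (maxn m1 m2); rewrite h1 ?leq_maxl//=.
  by rewrite (le_trans h2)// ler_nat; lia.
have sub : Rpos `<=` A1 `|` (A2 `|` [set p]).
  move=> t _; case: (ltgtP t p) => tp.
  - right; left; have [m /andP[h1 h2]] : exists m : nat, m.+1%:R^-1 <= p - t <= m.+1%:R by apply: near1; rewrite subr_gt0.
    by exists m => //=; rewrite in_itv /= lerBlDr -lerBlDl h2 lerBrDr -lerBrDl.
  - left; have [m /andP[h1 h2]] : exists m : nat, m.+1%:R^-1 <= t - p <= m.+1%:R by apply: near1; rewrite subr_gt0.
    by exists m => //=; rewrite in_itv /= -lerBrDl h1 -lerBlDl.
  - by right; right.
have mf (D : set R) : measurable D -> measurable_fun D (fun t : R => (udom a `|t - p|)%:E).
  by move=> mD; apply/measurable_EFinP; apply: (measurable_funS _ (@subsetT _ D)) => //; exact: measurable_udom_dist.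
have f0 (D : set R) (t : R) : D t -> (0 <= (udom a `|t - p|)%:E)%E by move=> _; rewrite lee_fin udom_ge0.
have mA : measurable (A2 `|` [set p]) by apply: measurableU.
apply: (@le_trans _ _ (\int[mu]_(t in A1 `|` (A2 `|` [set p])) (udom a `|t - p|)%:E)%E).
  apply: ge0_subset_integral => //; [exact: measurable_itv|exact: measurableU|apply: mf; exact: measurableU|exact: f0].
have d1 : [disjoint A1 & A2 `|` [set p]].
  apply/disj_set2P; apply/seteqP; split => // t [[m _ /=]]; rewrite in_itv /= => /pos1 h1 [[m2 _ /=]|/= tp].
    by rewrite in_itv /= => /pos2; lra.
  by move: h1; rewrite tp; lra.
have d2 : [disjoint A2 & [set p]].
  apply/disj_set2P; apply/seteqP; split => // t [[m _ /=]]; rewrite in_itv /= => /pos2 h1 /= tp.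
  by move: h1; rewrite tp; lra.
rewrite ge0_integral_setU//; [|exact: mf (measurableU _ _ _ _)|exact: f0].
rewrite ge0_integral_setU//; [|exact: mf (measurableU _ _ _ _)|exact: f0].
rewrite integral_set1 adde0.
have -> : 4 / a = a^-1 + a^-1 + (a^-1 + a^-1) by ring.
by rewrite EFinD leeD.
Qed.

(** The Taylor term of order m+1 of the exponential dominates S^(m+1), and S^m <= 1 + S^(m+1). *)
Lemma poly_exp_bound (m : nat) (e : R) : 0 < e -> exists2 B, 0 < B &
  forall S, 0 <= S -> 1 + S ^+ m <= B * expR (e * S).
Proof.
move=> e0; exists (1 + m.+1`!%:R / e ^+ m.+1 + m.+1`!%:R / e ^+ m.+1 + 1) => [|S S0].
  by rewrite !ltr_wpDr// !(divr_ge0, addr_ge0)// exprn_ge0// ltW.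
have h := expR_ge1Dxn m (mulr_ge0 (ltW e0) S0).
have ep : 0 < e ^+ m.+1 by rewrite exprn_gt0.
have fp : (0 : R) < m.+1`!%:R by rewrite ltr0n fact_gt0.
have E1 : 1 <= expR (e * S) by rewrite -[leLHS]expR0 ler_expR mulr_ge0// ltW.
have h2 : S ^+ m.+1 <= m.+1`!%:R / e ^+ m.+1 * expR (e * S).
  rewrite -ler_pdivrMl ?divr_gt0// invf_div mulrAC -exprMn.
  by apply: le_trans h; rewrite lerDr.
have h3 : S ^+ m <= 1 + S ^+ m.+1.
  have [S1|S1] := leP S 1; first by rewrite (@le_trans _ _ 1) ?exprn_ile1// lerDl exprn_ge0.
  by rewrite (@le_trans _ _ (S ^+ m.+1)) ?lerDr// ler_eXn2l// ltW.
have q0 : 0 <= m.+1`!%:R / e ^+ m.+1 by rewrite divr_ge0 ?ltW.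
nra.
Qed.

Lemma exp_udom_bound (a e : R) : 0 < a -> 0 < e -> exists2 B, 0 < B &
  forall t, 0 < t -> expR ((a - 1) * ln t) * expR (- e * t) <= B * udom a t.
Proof.
(* At this c the tangent line of the logarithm has the slope that bounds (a+1) ln (1+t) by e t plus
   a constant. *)
move=> a0 e0; pose c := (a + 1) / e.
have a1 : 0 < a + 1 by rewrite addr_gt0.
have c0 : 0 < c by rewrite divr_gt0.
exists (expR ((a + 1) * (ln c - 1) + e)) => [|t t0]; first exact: expR_gt0.
rewrite /udom -!expRD ler_expR.
have h : ln (1 + t) <= ln c + (1 + t) / c - 1.
  have t1 : 0 < 1 + t by rewrite addr_gt0.
  have yc : 0 < (1 + t) / c by rewrite divr_gt0.
  rewrite -{1}(divfK (lt0r_neq0 c0) (1 + t)) lnM ?posrE// addrC -addrA lerD2l.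
  have := @le_ln1Dx R ((1 + t) / c - 1); rewrite addrCA subrr addr0; apply.
  by rewrite ltrBrDl addrN.
have ce : (a + 1) * ((1 + t) / c) = e * (1 + t) by rewrite /c; field; rewrite !gt_eqF.
have := ler_wpM2l (ltW a1) h.
rewrite mulrBr mulrDr ce; lra.
Qed.

End Dominators.

(** * Integrability against the weight *)

Section FunctionClasses.
Variables (R : realType) (n : nat).
Local Notation C := R[i].
Local Notation Re := (@complex.Re R).
Local Notation Im := (@complex.Im R).
Local Notation Rn := (Rn R n).
Local Notation Cn := (Cn R n).

(** Continuity in each coordinate is enough for measurability, by [measurable_vec_sepcont], and for
    integration by parts in one variable. *)
Definition sepcont (f : Rn -> C) := forall (x : Rn) l, vpos x -> ccont (fun t => f (upd x l t)) (x l).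

Definition polybd (f : Rn -> C) := exists (A : R) m, 0 <= A /\
  forall x : Rn, vpos x -> cnorm (f x) <= A * (1 + vsum x ^+ m).

Definition expbd (f : Rn -> C) := exists (A e : R), [/\ 0 <= A, 0 < e &
  forall x : Rn, vpos x -> cnorm (f x) <= A * expR (- e * vsum x)].

Lemma upd_id (x : Rn) l : upd x l (x l) = x.
Proof. by apply/funext => i; rewrite /upd; case: eqP => [->|]. Qed.

Lemma upd_vperm (w : 'S_n) (x : Rn) l t : vperm w (upd x l t) = upd (vperm w x) ((w^-1)%g l) t.
Proof. by apply/funext => i; rewrite /vperm /upd (can2_eq (permK w) (permKV w)). Qed.

Lemma sepcont_vperm (w : 'S_n) f : sepcont f -> sepcont (fun x => f (vperm w x)).
Proof.
move=> h x l xp; have xp' : vpos (vperm w x) by apply/vpos_vperm.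
have := h _ ((w^-1)%g l) xp'; rewrite /vperm permKV => h2.
by rewrite (_ : (fun t => _) = (fun t => f (upd (vperm w x) ((w^-1)%g l) t)))//; apply/funext => t; rewrite -upd_vperm.
Qed.

Lemma sepcont_cst c : sepcont (fun _ => c). Proof. by move=> x l _; exact: ccont_cst. Qed.
Lemma sepcontD f g : sepcont f -> sepcont g -> sepcont (fun x => f x + g x).
Proof. by move=> h1 h2 x l xp; apply: ccontD; [exact: h1|exact: h2]. Qed.
Lemma sepcontM f g : sepcont f -> sepcont g -> sepcont (fun x => f x * g x).
Proof. by move=> h1 h2 x l xp; apply: ccontM; [exact: h1|exact: h2]. Qed.
Lemma sepcontZ c f : sepcont f -> sepcont (fun x => c * f x).
Proof. by move=> h; apply: sepcontM => //; exact: sepcont_cst. Qed.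
Lemma sepcontB f g : sepcont f -> sepcont g -> sepcont (fun x => f x - g x).
Proof. by move=> h1 h2 x l xp; apply: ccontB; [exact: h1|exact: h2]. Qed.
Lemma sepcont_sum I (r : seq I) (P : pred I) (F : I -> Rn -> C) :
  (forall i, P i -> sepcont (F i)) -> sepcont (fun x => \sum_(i <- r | P i) F i x).
Proof. by move=> h x l xp; apply: ccont_sum => i Pi; exact: h. Qed.
Lemma sepcont_prod I (r : seq I) (P : pred I) (F : I -> Rn -> C) :
  (forall i, P i -> sepcont (F i)) -> sepcont (fun x => \prod_(i <- r | P i) F i x).
Proof.
move=> h; elim: r => [|i r IH].
  rewrite (_ : (fun x => _) = (fun _ => 1)); first exact: sepcont_cst.
  by apply/funext => x; rewrite big_nil.
rewrite (_ : (fun x => _) = (fun x => (if P i then F i x else 1) * \prod_(j <- r | P j) F j x)); last first.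
  by apply/funext => x; rewrite big_cons; case: (P i) => //; rewrite mul1r.
by apply: sepcontM => //; case Pi: (P i); [exact: h|exact: sepcont_cst].
Qed.

Lemma upd_cont (x : Rn) l i (t : R) : {for t, continuous (fun s => upd x l s i)}.
Proof. by rewrite /upd; case: (i == l); [exact: cvg_id|exact: cst_continuous]. Qed.

Lemma sepcont_coord (l : 'I_n) : sepcont (fun x => toC (x l)).
Proof. by move=> x i _; apply: ccont_real; exact: upd_cont. Qed.

Lemma polybd_cst c : polybd (fun _ => c).
Proof.
by exists (cnorm c), 0%N; split; [exact: cnorm_ge0|move=> x _; rewrite ler_peMr ?cnorm_ge0// expr0; lra].
Qed.

Lemma pow_le_pow (S : R) m m' : 0 <= S -> (m <= m')%N -> S ^+ m <= 1 + S ^+ m'.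
Proof.
move=> S0 mm; have [S1|S1] := leP S 1.
  by rewrite (@le_trans _ _ 1) ?exprn_ile1// lerDl exprn_ge0.
by rewrite (@le_trans _ _ (S ^+ m')) ?lerDr// ler_weXn2l// ltW.
Qed.

Lemma polybdD f g : polybd f -> polybd g -> polybd (fun x => f x + g x).
Proof.
move=> [A [m [A0 hf]]] [B [p [B0 hg]]]; exists (2 * (A + B)), (maxn m p); split.
  by rewrite mulr_ge0// addr_ge0.
move=> x xp; have S0 := vsum_ge0 xp.
apply: (le_trans (cnormD _ _)); have := hf x xp; have := hg x xp.
have := pow_le_pow S0 (leq_maxl m p); have := pow_le_pow S0 (leq_maxr m p).
have := exprn_ge0 m S0; have := exprn_ge0 p S0; have := exprn_ge0 (maxn m p) S0.
move: (cnorm _) (cnorm _) (vsum x ^+ _) (vsum x ^+ _) (vsum x ^+ _) => u v Sm Sp Sq; nra.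
Qed.

Lemma polybdM f g : polybd f -> polybd g -> polybd (fun x => f x * g x).
Proof.
move=> [A [m [A0 hf]]] [B [p [B0 hg]]]; exists (4 * (A * B)), (m + p)%N; split.
  by rewrite !mulr_ge0.
move=> x xp; have S0 := vsum_ge0 xp.
rewrite cnormM; apply: (@le_trans _ _ ((A * (1 + vsum x ^+ m)) * (B * (1 + vsum x ^+ p)))).
  by rewrite ler_pM ?cnorm_ge0//; [exact: hf|exact: hg].
rewrite mulrACA (_ : 4 * (A * B) * _ = A * B * (4 * (1 + vsum x ^+ (m + p)))); last by ring.
rewrite ler_wpM2l ?mulr_ge0//.
have := pow_le_pow S0 (leq_addr p m); have := pow_le_pow S0 (leq_addl m p).
have := exprn_ge0 (m + p) S0.
rewrite mulrDl mul1r mulrDr mulr1 -exprD; lra.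
Qed.

Lemma polybdZ c f : polybd f -> polybd (fun x => c * f x).
Proof. by move=> h; apply: polybdM => //; exact: polybd_cst. Qed.
Lemma polybd_sum I (r : seq I) (P : pred I) (F : I -> Rn -> C) :
  (forall i, P i -> polybd (F i)) -> polybd (fun x => \sum_(i <- r | P i) F i x).
Proof.
move=> h; elim: r => [|i r IH].
  rewrite (_ : (fun x => _) = (fun _ => 0)); first exact: polybd_cst.
  by apply/funext => x; rewrite big_nil.
rewrite (_ : (fun x => _) = (fun x => (if P i then F i x else 0) + \sum_(j <- r | P j) F j x)); last first.
  by apply/funext => x; rewrite big_cons; case: (P i) => //; rewrite add0r.
by apply: polybdD => //; case Pi: (P i); [exact: h|exact: polybd_cst].
Qed.
Lemma polybd_prod I (r : seq I) (P : pred I) (F : I -> Rn -> C) :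
  (forall i, P i -> polybd (F i)) -> polybd (fun x => \prod_(i <- r | P i) F i x).
Proof.
move=> h; elim: r => [|i r IH].
  rewrite (_ : (fun x => _) = (fun _ => 1)); first exact: polybd_cst.
  by apply/funext => x; rewrite big_nil.
rewrite (_ : (fun x => _) = (fun x => (if P i then F i x else 1) * \prod_(j <- r | P j) F j x)); last first.
  by apply/funext => x; rewrite big_cons; case: (P i) => //; rewrite mul1r.
by apply: polybdM => //; case Pi: (P i); [exact: h|exact: polybd_cst].
Qed.
Lemma polybd_vperm (w : 'S_n) f : polybd f -> polybd (fun x => f (vperm w x)).
Proof.
move=> [A [m [A0 h]]]; exists A, m; split=> // x xp.
by rewrite -(vsum_vperm w x); apply: h; apply/vpos_vperm.
Qed.
Lemma polybd_coord (l : 'I_n) : polybd (fun x => toC (x l)).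
Proof.
exists 1, 1%N; split=> // x xp; rewrite mul1r expr1 cnorm_toC gtr0_norm; last exact: xp.
by have := le_vsum l xp; lra.
Qed.

Lemma expbd_vperm (w : 'S_n) f : expbd f -> expbd (fun x => f (vperm w x)).
Proof.
move=> [A [e [A0 e0 h]]]; exists A, e; split=> // x xp.
by rewrite -(vsum_vperm w x); apply: h; apply/vpos_vperm.
Qed.

Lemma expbdM f g : expbd f -> polybd g -> expbd (fun x => f x * g x).
Proof.
move=> [A [e [A0 e0 hf]]] [B [m [B0 hg]]].
have e20 : 0 < e / 2 by rewrite divr_gt0.
have [D D0 hD] := poly_exp_bound m e20.
exists (A * (B * D)), (e / 2); split=> //; first by rewrite !mulr_ge0// ltW.
move=> x xp; rewrite cnormM.
apply: (@le_trans _ _ ((A * expR (- e * vsum x)) * (B * (D * expR (e / 2 * vsum x))))).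
  rewrite ler_pM ?cnorm_ge0//; first exact: hf.
  by apply: (le_trans (hg x xp)); rewrite ler_wpM2l// hD// vsum_ge0.
rewrite le_eqVlt; apply/orP; left; apply/eqP.
have -> : - (e / 2) * vsum x = - e * vsum x + e / 2 * vsum x by field.
rewrite expRD; ring.
Qed.

Lemma expbdZ c f : expbd f -> expbd (fun x => c * f x).
Proof.
move=> h; have := expbdM h (polybd_cst c); congr expbd.
by apply/funext => x; rewrite mulrC.
Qed.

End FunctionClasses.

Section PowerContinuity.
Variable R : realType.

Lemma near_neq (t c : R) : t != c -> \forall s \near t, s != c.
Proof.
move=> tc; have : {for t, continuous (fun s : R => s - c)}.
  by apply: continuousB; [exact: cvg_id|exact: cst_continuous].
move=> h; have tc0 : t - c != 0 by rewrite subr_eq0.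
near=> s; rewrite -subr_eq0; near: s; exact: (cvgr_neq0 _ h tc0).
Unshelve. all: by end_near. Qed.

Lemma cont_abs_powR (p c : R) : 0 <= p -> {for c, continuous (fun s : R => `|s| `^ p)}.
Proof.
rewrite le_eqVlt => /predU1P[<-|p0].
  rewrite (_ : (fun s => _) = (fun _ => 1)); first exact: cst_continuous.
  by apply/funext => s; rewrite powRr0.
have [->|c0] := eqVneq c 0.
  apply/cvgrPdist_lt => e e0; rewrite normr0 powR0 ?gt_eqF//.
  have d0 : 0 < expR (ln e / p) by exact: expR_gt0.
  near=> s; have hs : `|s| < expR (ln e / p) by near: s; exact: (@nbhs0_lt R R _ d0).
  rewrite sub0r normrN ger0_norm ?powR_ge0//.
  rewrite /powR; case: eqP => [_|/eqP s0]; first by rewrite gt_eqF.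
  rewrite -[ltRHS](@lnK R e)// ltr_expR mulrC -ltr_pdivlMr//.
  by rewrite -ltr_expR lnK ?posrE// lt0r s0 normr_ge0.
have : {for c, continuous (fun s : R => expR (p * ln `|s|))}.
  apply: (@continuous_comp _ _ _ (fun s : R => p * ln `|s|) (@expR R)); last exact: continuous_expR.
  apply: cvgMr; apply: (@continuous_comp _ _ _ (fun s : R => `|s|) (@ln R)); first exact: norm_continuous.
  by apply: continuous_ln; rewrite normr_gt0.
move=> h; have E : expR (p * ln `|c|) = `|c| `^ p by rewrite /powR normr_eq0 (negbTE c0).
have nr : \forall s \near c, expR (p * ln `|s|) = `|s| `^ p.
  by apply: filterS (near_neq c0) => s s0; rewrite /powR normr_eq0 (negbTE s0).
apply/cvgrPdist_lt => e e0; have /cvgrPdist_lt/(_ e e0) := h; rewrite E => h2.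
by apply: filterS2 nr h2 => s <-.
Unshelve. all: by end_near. Qed.

(** Writing ln |r| as half of ln (r^2) avoids a case distinction on the sign of r. *)
Lemma is_derive_ln_norm (s : R) : s != 0 -> is_derive s (1 : R) (fun r : R => ln `|r|) s^-1.
Proof.
move=> s0.
rewrite (_ : (fun r => _) = 2^-1 *: ((@ln R) \o (fun r => r * r))); last first.
  apply/funext => r; rewrite /= -[RHS]/(2^-1 * ln (r * r)).
  have [->|r0] := eqVneq r 0; first by rewrite normr0 mulr0 ln0// mulr0.
  by rewrite -expr2 -real_normK ?num_real// expr2 lnM ?posrE ?normr_gt0//; field.
have s2 : 0 < s * s by rewrite -expr2 exprn_even_gt0.
have d := @is_derive1_comp _ (@ln R) (fun r => r * r) s _ _ (is_derive1_ln s2) (is_deriveM (is_derive_id s (1 : R)) (is_derive_id s (1 : R))).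
apply: (is_derive_eq (is_deriveZ 2^-1 d)); rewrite /GRing.scale /=.
by field.
Qed.

End PowerContinuity.

Section Weight.
Variables (R : realType) (n : nat) (k : R).
Hypothesis k0 : 0 <= k.
Local Notation C := R[i].
Local Notation Rn := (Rn R n).

Definition pairC (l j : 'I_n) (x : Rn) : C := toC (`|x l - x j| `^ (2 * k)).

Lemma double_k_ge0 : 0 <= 2 * k. Proof. by rewrite mulr_ge0. Qed.

Lemma sepcont_pair l j : sepcont (pairC l j).
Proof.
move=> x i _; apply: ccont_real.
apply: (@continuous_comp _ _ _ (fun t => upd x i t l - upd x i t j) (fun s : R => `|s| `^ (2 * k))); last first.
  exact: cont_abs_powR double_k_ge0.
by apply: continuousB; exact: upd_cont.
Qed.

Lemma powR_poly (p w : R) : 0 <= p -> 0 <= w -> w `^ p <= 1 + w ^+ (Num.bound p).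
Proof.
move=> p0 w0; rewrite /powR; case: eqP => [_|/eqP wn].
  apply: (@le_trans _ _ 1); last by rewrite lerDl exprn_ge0.
  by rewrite lern1; case: (p == 0).
by apply: powln_le => //; rewrite p0 ltW// archi_boundP.
Qed.

Lemma dist_le_vsum (x : Rn) l j : vpos x -> `|x l - x j| <= vsum x.
Proof.
move=> xp; have := le_vsum l xp; have := le_vsum j xp; have := xp l; have := xp j.
by rewrite ler_norml => *; apply/andP; split; lra.
Qed.

Lemma polybd_pair l j : polybd (pairC l j).
Proof.
exists 1, (Num.bound (2 * k)); split=> // x xp.
rewrite mul1r cnorm_toC ger0_norm ?powR_ge0//.
apply: (le_trans (powR_poly double_k_ge0 (normr_ge0 _))); rewrite lerD2l.
by apply: lerXn2r; rewrite ?nnegrE ?vsum_ge0//; exact: dist_le_vsum.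
Qed.

Lemma omegaE (x : Rn) : toC (omega k x) = \prod_(i < n) \prod_(j < n | (i < j)%N) pairC i j x.
Proof. by rewrite toC_prod; apply: eq_bigr => i _; rewrite toC_prod. Qed.

Lemma sepcont_omega : sepcont (fun x : Rn => toC (omega k x)).
Proof.
rewrite (_ : (fun x => _) = (fun x => \prod_(i < n) \prod_(j < n | (i < j)%N) pairC i j x)); last first.
  by apply/funext => x; rewrite omegaE.
by apply: sepcont_prod => i _; apply: sepcont_prod => j _; exact: sepcont_pair.
Qed.

Lemma polybd_omega : polybd (fun x : Rn => toC (omega k x)).
Proof.
rewrite (_ : (fun x => _) = (fun x => \prod_(i < n) \prod_(j < n | (i < j)%N) pairC i j x)); last first.
  by apply/funext => x; rewrite omegaE.
by apply: polybd_prod => i _; apply: polybd_prod => j _; exact: polybd_pair.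
Qed.

Lemma omega_ge0 (x : Rn) : 0 <= omega k x.
Proof. by apply: prodr_ge0 => i _; apply: prodr_ge0 => j _; exact: powR_ge0. Qed.

(** The isolated factor |x_l - x_j|^(2k) is what tames a denominator x_l - x_j. *)
Lemma omega_split l j : l != j -> exists2 r : Rn -> C, polybd r &
  forall x, toC (omega k x) = pairC l j x * r x.
Proof.
wlog lj : l j / (l < j)%N.
  move=> H lnj; case: (ltngtP l j) => h; first exact: H.
    have nj : j != l by rewrite eq_sym.
    have [r rp hr] := H j l h nj.
    by exists r => // x; rewrite hr /pairC distrC.
  by move: lnj; rewrite -val_eqE /= h eqxx.
move=> _.
exists (fun x => \prod_(p : 'I_n * 'I_n | (p.1 < p.2)%N && (p != (l, j))) pairC p.1 p.2 x).
  by apply: polybd_prod => p _; exact: polybd_pair.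
move=> x; rewrite omegaE pair_big_dep /=.
by rewrite (bigD1 (l, j))//=.
Qed.

(** The square of omega is a product over all ordered pairs, hence visibly invariant, and omega is
    nonnegative. *)
Lemma omega_vperm (w : 'S_n) (x : Rn) : omega k (vperm w x) = omega k x.
Proof.
have E (y : Rn) : omega k y ^+ 2 = \prod_(i < n) \prod_(j < n | j != i) (`|y i - y j| `^ (2 * k)).
  rewrite expr2 {1}/omega.
  have -> : omega k y = \prod_(i < n) \prod_(j < n | (j < i)%N) (`|y i - y j| `^ (2 * k)).
    rewrite /omega (exchange_big_dep xpredT)//=; apply: eq_bigr => i _.
    by apply: eq_bigr => j _; rewrite distrC.
  rewrite -big_split /=; apply: eq_bigr => i _.
  rewrite [RHS](bigID (fun j : 'I_n => (i < j)%N)) /=; congr (_ * _).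
    apply: eq_bigl => j; rewrite andbC; case: ltnP => //= ij.
    by rewrite -val_eqE /= gtn_eqF.
  by apply: eq_bigl => j; rewrite -leqNgt ltn_neqAle val_eqE.
apply/eqP; rewrite -(@eqrXn2 _ 2) ?omega_ge0// !E; apply/eqP.
rewrite [RHS](reindex_inj (@perm_inj _ w)); apply: eq_bigr => i _.
rewrite [RHS](reindex_inj (@perm_inj _ w)); apply: eq_bigl => j.
by rewrite (inj_eq perm_inj).
Qed.

Variable a : R.

(** The weight Delta^(a-1) omega, with the power written through logarithms so that changes of
    exponent are additions inside [expR]. *)
Definition Wr (x : Rn) : R := expR ((a - 1) * \sum_(i < n) ln (x i)) * omega k x.

Lemma Wr_ge0 x : 0 <= Wr x. Proof. by rewrite mulr_ge0 ?expR_ge0 ?omega_ge0. Qed.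

Lemma Wr_vperm (w : 'S_n) x : Wr (vperm w x) = Wr x.
Proof.
rewrite /Wr omega_vperm; congr (expR (_ * _) * _).
by rewrite [RHS](reindex_inj (@perm_inj _ w)).
Qed.

Lemma sepcont_expln : sepcont (fun x : Rn => toC (expR ((a - 1) * \sum_(i < n) ln (x i)))).
Proof.
move=> x l xp; apply: ccont_real.
apply: (@continuous_comp _ _ _ (fun t => (a - 1) * \sum_(i < n) ln (upd x l t i)) (@expR R)); last exact: continuous_expR.
apply: cvgMr; apply: continuous_bigsum => i.
apply: (@continuous_comp _ _ _ (fun t => upd x l t i) (@ln R)); first exact: upd_cont.
by apply: continuous_ln; rewrite upd_id; exact: xp.
Qed.

Lemma sepcont_Wr : sepcont (fun x => toC (Wr x)).
Proof.
rewrite (_ : (fun x => _) = (fun x => toC (expR ((a - 1) * \sum_(i < n) ln (x i))) * toC (omega k x))); last first.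
  by apply/funext => x; rewrite -toCM.
by apply: sepcontM; [exact: sepcont_expln|exact: sepcont_omega].
Qed.

Lemma expR_sumln (b : R) (x : Rn) : expR (b * \sum_(i < n) ln (x i)) = \prod_(i < n) expR (b * ln (x i)).
Proof. by rewrite mulr_sumr expR_sum. Qed.

(** Near a point with distinct coordinates the weight is the exponential of the function L below, so
    this is a logarithmic derivative. *)
Lemma Wr_deriv (x : Rn) l : vpos x -> vdistinct x ->
  cderiv (fun t => toC (Wr (upd x l t))) (x l)
    (toC (Wr x) * (toC (a - 1) / toC (x l) + toC (2 * k) * \sum_(j < n | j != l) (toC (x l - x j))^-1)).
Proof.
move=> xp xd.
pose L (y : Rn) : C := toC ((a - 1) * \sum_(i < n) ln (y i)) + toC (2 * k) * psum (fun i j => toC (ln `|y i - y j|)).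
have LE (y : Rn) : vdistinct y -> toC (Wr y) = cexp (L y).
  move=> yd; rewrite /L cexpD cexp_toC /Wr toCM; congr (_ * _).
  rewrite /psum omegaE mulr_sumr cexp_sum; apply: eq_bigr => i _; rewrite mulr_sumr cexp_sum; apply: eq_bigr => j ij.
  rewrite -toCM cexp_toC /pairC /powR normr_eq0 subr_eq0 (negbTE (yd _ _ _))//.
  by rewrite -val_eqE /= ltn_eqF.
have near_d : \forall t \near x l, vdistinct (upd x l t).
  have hj (j : 'I_n) : \forall t \near x l, j != l -> t != x j.
    have [->|jl] := eqVneq j l; first exact: (@filterE _ (nbhs (x l)) (nbhs_filter _)).
    have lj : x l != x j by apply: xd; rewrite eq_sym.
    by apply: filterS (near_neq lj) => t ht _.
  have := @filter_forall _ _ _ _ (nbhs_filter (x l)) hj.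
  apply: filterS => t ht i j ij; rewrite /upd.
  case: (eqVneq i l) => il; case: (eqVneq j l) => jl.
  - by move: ij; rewrite il jl eqxx.
  - exact: ht.
  - by rewrite eq_sym; exact: ht.
  - exact: xd.
apply: (@cderiv_near _ (fun t => cexp (L (upd x l t)))).
  by apply: filterS near_d => t td; rewrite LE.
have du i : is_derive (x l) (1 : R) (fun t => upd x l t i) (i == l)%:R.
  by rewrite /upd; case: (i == l); [exact: is_derive_id|exact: is_derive_cst].
have d1 : cderiv (fun t => toC ((a - 1) * \sum_(i < n) ln (upd x l t i))) (x l) (toC (a - 1) / toC (x l)).
  rewrite (_ : (fun t => _) = (fun t => toC (a - 1) * \sum_(i < n) toC (ln (upd x l t i)))); last first.
    by apply/funext => t; rewrite toCM toC_sum.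
  apply: cderiv_eq (cderivZ _ (@cderiv_sum _ _ _ _ _ _ (fun i => toC ((i == l)%:R * (x i)^-1)) _)) _.
    move=> i _; apply: cderiv_real.
    have hp : 0 < upd x l (x l) i by rewrite upd_id; exact: xp.
    by apply: (is_derive_eq (@is_derive1_comp _ (@ln R) _ (x l) _ _ (is_derive1_ln hp) (du i))); rewrite upd_id mulrC.
  congr (_ * _); rewrite (bigD1 l)//= eqxx mul1r toCV big1 ?addr0// => i /negbTE ->.
  by rewrite mul0r.
have d2 : cderiv (fun t => psum (fun i j => toC (ln `|upd x l t i - upd x l t j|))) (x l)
    (\sum_(j < n | j != l) (toC (x l - x j))^-1).
  rewrite -(psum_delta l (A := fun i j => (toC (x i - x j))^-1)); last first.
    by move=> i j; rewrite -[x j - x i]opprB toCN invrN.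
  apply: cderiv_sum => i _; apply: cderiv_sum => j ij; rewrite -toCV -toCM; apply: cderiv_real.
  have dd := is_deriveB (du i) (du j).
  have ne : x i - x j != 0 by rewrite subr_eq0; apply: xd; rewrite -val_eqE /= ltn_eqF.
  have dl (s : R) := @is_derive_ln_norm R s.
  have ne' : upd x l (x l) i - upd x l (x l) j != 0 by rewrite upd_id.
  by apply: (is_derive_eq (@is_derive1_comp _ (fun r => ln `|r|) _ (x l) _ _ (dl _ ne') dd)); rewrite upd_id mulrC.
apply: cderiv_eq (cderiv_cexp (cderivD d1 (cderivZ _ d2))) _.
by rewrite upd_id -LE// mulrC.
Qed.

End Weight.

Section ComplexIntegral.
Variables (R : realType) (n : nat).
Local Notation C := R[i].
Local Notation Re := (@complex.Re R).
Local Notation Im := (@complex.Im R).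
Local Notation Rn := (vec R n).
Local Notation M := (vmeas R n).
Local Notation D := (@vpos R n).

Definition rint (f : Rn -> R) : Prop := M.-integrable D (EFin \o f).
Definition rI (f : Rn -> R) : R := Rintegral M D f.
Definition ci (f : Rn -> C) := rint (fun x => Re (f x)) /\ rint (fun x => Im (f x)).
Definition cI (f : Rn -> C) : C := rI (fun x => Re (f x)) +i* rI (fun x => Im (f x)).

Let mD : measurable D := @measurable_vpos R n.

Lemma rintD f g : rint f -> rint g -> rint (fun x => f x + g x).
Proof. by move=> h1 h2; have := integrableD mD h1 h2. Qed.
Lemma rintZ c f : rint f -> rint (fun x => c * f x).
Proof. by move=> h; have := integrableZl mD c h. Qed.
Lemma rI_D f g : rint f -> rint g -> rI (fun x => f x + g x) = rI f + rI g.
Proof. by move=> h1 h2; exact: RintegralD. Qed.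
Lemma rI_Z c f : rint f -> rI (fun x => c * f x) = c * rI f.
Proof. by move=> h; exact: RintegralZl. Qed.
Lemma rint_eq f g : (forall x, D x -> f x = g x) -> rint f -> rint g.
Proof.
by move=> h; apply: eq_integrable => // x /set_mem xD /=; rewrite h.
Qed.
Lemma rI_eq f g : (forall x, D x -> f x = g x) -> rI f = rI g.
Proof. by move=> h; apply: eq_Rintegral => x /set_mem xD; exact: h. Qed.

Lemma ci_eq f g : (forall x, D x -> f x = g x) -> ci f -> ci g.
Proof. by move=> h [h1 h2]; split; [apply: rint_eq h1|apply: rint_eq h2] => x xD; rewrite h. Qed.
Lemma cI_eq f g : (forall x, D x -> f x = g x) -> cI f = cI g.
Proof. by move=> h; congr (_ +i* _); apply: rI_eq => x xD; rewrite h. Qed.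

Lemma ciD f g : ci f -> ci g -> ci (fun x => f x + g x).
Proof.
move=> [a b] [c d]; split; [apply: rint_eq (rintD a c)|apply: rint_eq (rintD b d)] => x _.
  by rewrite cReD.
by rewrite cImD.
Qed.
Lemma cI_D f g : ci f -> ci g -> cI (fun x => f x + g x) = cI f + cI g.
Proof.
move=> [a b] [c d]; apply: ceq; rewrite ?cReD ?cImD /= -rI_D//; apply: rI_eq => x _.
  by rewrite cReD.
by rewrite cImD.
Qed.
Lemma ciZ c f : ci f -> ci (fun x => c * f x).
Proof.
move=> [a b]; split.
  apply: rint_eq (rintD (rintZ (Re c) a) (rintZ (- Im c) b)) => x _.
  by rewrite cReM mulNr.
apply: rint_eq (rintD (rintZ (Re c) b) (rintZ (Im c) a)) => x _.
by rewrite cImM.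
Qed.
Lemma cI_Z c f : ci f -> cI (fun x => c * f x) = c * cI f.
Proof.
move=> [a b]; apply: ceq; rewrite ?cReM ?cImM /=.
  rewrite -mulNr -!rI_Z// -rI_D; [|exact: rintZ|exact: rintZ].
  by apply: rI_eq => x _; rewrite cReM mulNr.
rewrite -!rI_Z// -rI_D; [|exact: rintZ|exact: rintZ].
by apply: rI_eq => x _; rewrite cImM.
Qed.
Lemma ciN f : ci f -> ci (fun x => - f x).
Proof. by move=> h; apply: ci_eq (ciZ (-1) h) => x _; rewrite mulN1r. Qed.
Lemma cI_N f : ci f -> cI (fun x => - f x) = - cI f.
Proof. by move=> h; rewrite -mulN1r -cI_Z//; apply: cI_eq => x _; rewrite mulN1r. Qed.
Lemma ciB f g : ci f -> ci g -> ci (fun x => f x - g x).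
Proof. by move=> h1 h2; apply: ciD => //; exact: ciN. Qed.
Lemma cI_B f g : ci f -> ci g -> cI (fun x => f x - g x) = cI f - cI g.
Proof. by move=> h1 h2; rewrite cI_D ?cI_N//; exact: ciN. Qed.
Lemma ci0 : ci (fun _ => 0).
Proof. by split; apply: integrable0. Qed.
Lemma cI0 : cI (fun _ => 0) = 0.
Proof.
transitivity (0 * cI (fun _ => 0)); last by rewrite mul0r.
by rewrite -cI_Z; [apply: cI_eq => x _; rewrite mulr0|exact: ci0].
Qed.
Lemma ci_sum I (r : seq I) (P : pred I) (F : I -> Rn -> C) :
  (forall i, P i -> ci (F i)) -> ci (fun x => \sum_(i <- r | P i) F i x).
Proof.
move=> h; elim: r => [|i r IH].
  by apply: ci_eq ci0 => x _; rewrite big_nil.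
case Pi: (P i); last by apply: ci_eq IH => x _; rewrite big_cons Pi.
by apply: ci_eq (ciD (h i Pi) IH) => x _; rewrite big_cons Pi.
Qed.
Lemma cI_sum I (r : seq I) (P : pred I) (F : I -> Rn -> C) :
  (forall i, P i -> ci (F i)) ->
  cI (fun x => \sum_(i <- r | P i) F i x) = \sum_(i <- r | P i) cI (F i).
Proof.
move=> h; elim: r => [|i r IH].
  by rewrite big_nil -[RHS]cI0; apply: cI_eq => x _; rewrite big_nil.
rewrite big_cons -IH; case Pi: (P i).
  rewrite -cI_D; [|exact: h|exact: ci_sum].
  by apply: cI_eq => x _; rewrite big_cons Pi.
by apply: cI_eq => x _; rewrite big_cons Pi.
Qed.

Lemma ci_vperm (w : 'S_n) f : ci f -> ci (fun x => f (vperm w x)).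
Proof. by move=> [a b]; split; [exact: (integrable_vperm w a)|exact: (integrable_vperm w b)]. Qed.
Lemma cI_vperm (w : 'S_n) f : ci f -> cI (fun x => f (vperm w x)) = cI f.
Proof.
move=> [a b]; apply: ceq; rewrite /= /rI /Rintegral; congr fine.
  exact: (integral_vperm w a).
exact: (integral_vperm w b).
Qed.

Definition cmeas (f : Rn -> C) :=
  measurable_fun D (fun x => Re (f x)) /\ measurable_fun D (fun x => Im (f x)).

Lemma ci_meas f : ci f -> cmeas f.
Proof.
by move=> [/integrableP[a _] /integrableP[b _]]; split; apply/measurable_EFinP.
Qed.

Lemma cI_ae f g : ci f -> ci g -> (forall x, D x -> vdistinct x -> f x = g x) -> cI f = cI g.
Proof.
move=> fi gi h; have [fm1 fm2] := ci_meas fi; have [gm1 gm2] := ci_meas gi.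
have ae (P : Rn -> Prop) : (forall x, D x -> vdistinct x -> P x) -> {ae M, forall x, D x -> P x}.
  move=> hP; exists (~` @vdistinct R n); split.
  - by apply: measurableC; exact: measurable_vdistinct.
  - exact: vmeas_Ndistinct.
  - by move=> x /= nP xd; apply: nP => xD; exact: hP.
apply: ceq; rewrite /= /rI /Rintegral; congr fine; apply: ae_eq_integral => //.
- exact/measurable_EFinP.
- exact/measurable_EFinP.
- by apply: ae => x xD xd /=; rewrite h.
- exact/measurable_EFinP.
- exact/measurable_EFinP.
- by apply: ae => x xD xd /=; rewrite h.
Qed.

Lemma ci_dom f g : cmeas f -> rint g -> (forall x, D x -> cnorm (f x) <= g x) -> ci f.
Proof.
move=> [a b] gi h; split; apply: (integrable_dominated (g := g)) => // x xD; apply: le_trans (h x xD).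
  exact: Re_le_cnorm.
exact: Im_le_cnorm.
Qed.

Lemma rI_le f g : rint f -> rint g -> (forall x, D x -> f x <= g x) -> rI f <= rI g.
Proof. by move=> fi gi h; apply: le_Rintegral. Qed.

(** The factor 2 comes from bounding real and imaginary parts separately. *)
Lemma cI_norm f g : ci f -> rint g -> (forall x, D x -> cnorm (f x) <= g x) ->
  cnorm (cI f) <= 2 * rI g.
Proof.
move=> [a b] gi h; apply: (le_trans (cnorm_le_ReIm _)); rewrite mulr_natl mulr2n /=.
have main u : rint u -> (forall x, D x -> `|u x| <= g x) -> `|rI u| <= rI g.
  move=> ui hu; rewrite ler_norml; apply/andP; split.
    rewrite -mulN1r -rI_Z//; apply: rI_le => //; first exact: rintZ.
    by move=> x /hu; rewrite ler_norml mulN1r => /andP[].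
  by apply: rI_le => // x /hu; apply: le_trans; exact: ler_norm.
apply: lerD; apply: main => // x xD; apply: le_trans (h x xD).
  exact: Re_le_cnorm.
exact: Im_le_cnorm.
Qed.

Lemma cmeas_sepcont f : sepcont f -> cmeas f.
Proof.
by move=> h; split; apply: measurable_vec_sepcont => x l xp; have [] := h x l xp.
Qed.

Lemma cmeasM f g : cmeas f -> cmeas g -> cmeas (fun x => f x * g x).
Proof.
move=> [a b] [c d]; split.
  rewrite (_ : (fun x => _) = (fun x => Re (f x) * Re (g x) - Im (f x) * Im (g x))); last first.
    by apply/funext => x; rewrite cReM.
  by apply: measurable_funB; exact: measurable_funM.
rewrite (_ : (fun x => _) = (fun x => Re (f x) * Im (g x) + Im (f x) * Re (g x))); last first.
  by apply/funext => x; rewrite cImM.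
by apply: measurable_funD; exact: measurable_funM.
Qed.

Lemma cmeas_real u : measurable_fun D u -> cmeas (fun x => toC (u x)).
Proof. by move=> h; split. Qed.

Lemma measurable_inv (E : set R) : measurable E -> measurable_fun E (fun s : R => s^-1).
Proof.
(* This expression of 1/s through measurable functions also takes the value 0 at s = 0, as the
   inverse does. *)
move=> mE; rewrite (_ : (fun s => _) = (fun s => s * expR (- 2 * ln `|s|))); last first.
  apply/funext => s; have [->|s0] := eqVneq s 0; first by rewrite invr0 mul0r.
  have ns : 0 < `|s| by rewrite normr_gt0.
  rewrite mulNr expRN mulr_natl mulr2n expRD lnK ?posrE// -expr2 real_normK ?num_real//.
  by field.
have mln : measurable_fun setT (@ln R) by exact: measurable_ln.
apply: (measurable_funS _ (@subsetT _ E)) => //.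
apply: measurable_funM => //; apply: measurableT_comp => //.
by apply: measurable_funM => //; apply: measurableT_comp => //; exact: measurableT_comp.
Qed.

Lemma measurable_coordD (l : 'I_n) : measurable_fun D (fun x => x l).
Proof. by apply: (@measurable_coord_pos R n l id). Qed.

Lemma cmeas_invdiff (l j : 'I_n) : cmeas (fun x => (toC (x l - x j))^-1).
Proof.
rewrite (_ : (fun x => _) = (fun x => toC ((x l - x j)^-1))); last by apply/funext => x; rewrite toCV.
apply: cmeas_real.
apply: (@measurable_comp _ _ _ _ _ _ setT (fun s : R => s^-1) _ (fun x : Rn => x l - x j)) => //.
  exact: measurable_inv.
by apply: measurable_funB; exact: measurable_coordD.
Qed.

End ComplexIntegral.

Section Domination.
Variables (R : realType) (n : nat) (k a : R).
Hypothesis k0 : 0 <= k.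
Hypothesis a0 : 0 < a.
Local Notation C := R[i].
Local Notation Rn := (vec R n).
Local Notation D := (@vpos R n).

Lemma rint_udom : rint (fun x : Rn => \prod_(i < n) udom a (x i)).
Proof.
apply: (@integrable_prod_pos R n (fun _ => udom a)) => [i|i t t0|i].
- by apply: measurable_cont_pos => t t0; exact: udom_cont.
- exact: udom_ge0.
- exact: udom_int.
Qed.

Lemma exp_prod (e : R) (x : Rn) : expR (- e * vsum x) = \prod_(i < n) expR (- e * x i).
Proof. by rewrite mulr_sumr expR_sum. Qed.

Lemma Wr_dom f : expbd f -> exists2 A, 0 <= A &
  forall x : Rn, D x -> cnorm (f x * toC (Wr k a x)) <= A * \prod_(i < n) udom a (x i).
Proof.
move=> fe; have [A [e [A0 e0 hA]]] := expbdM fe (@polybd_omega R n k k0).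
have [B B0 hB] := exp_udom_bound a0 e0.
exists (A * B ^+ n); first by rewrite mulr_ge0// exprn_ge0// ltW.
move=> x xp; rewrite /Wr toCM mulrCA cnormM cnorm_toC ger0_norm ?expR_ge0//.
apply: (@le_trans _ _ (expR ((a - 1) * \sum_(i < n) ln (x i)) * (A * expR (- e * vsum x)))).
  by rewrite ler_wpM2l ?expR_ge0//; exact: hA.
rewrite expR_sumln exp_prod mulrCA -big_split /= -mulrA ler_wpM2l//.
have -> : B ^+ n = \prod_(i < n) B by rewrite prodr_const card_ord.
rewrite -big_split /=; apply: ler_prod => i _.
by rewrite mulr_ge0 ?expR_ge0//= hB//; exact: xp.
Qed.

Lemma ci_good f : sepcont f -> expbd f -> ci (fun x : Rn => f x * toC (Wr k a x)).
Proof.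
move=> fs fe; have [A A0 hA] := Wr_dom fe.
apply: (ci_dom _ (rintZ A rint_udom)) => //.
by apply: cmeas_sepcont; apply: sepcontM => //; exact: sepcont_Wr.
Qed.

End Domination.

Lemma measurable_slice_ge0 (R : realType) m (l : 'I_m.+1) (f : vec R m.+1 -> \bar R) :
  measurable_fun (@vpos R m.+1) f -> (forall x, vpos x -> 0 <= f x)%E ->
  measurable_fun (@vpos R m) (fun y => \int[@lebesgue_measure R]_(t in @Rpos R) f (vins l t y))%E.
Proof.
move=> mf f0; pose f' := f \_ (@vpos R m.+1).
have mf' : measurable_fun setT f' by apply/(measurable_restrictT _ _).1 => //; exact: measurable_vpos.
have f'0 x : (0 <= f' x)%E by rewrite /f' patchE; case: ifPn => // /set_mem; exact: f0.
pose h (p : R * vec R m) : \bar R := f' (vperm (lift_perm l ord0 1%g) (vjoin p)).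
have mh : measurable_fun setT h.
  apply: (measurableT_comp mf'); apply: measurableT_comp; first exact: measurable_vperm.
  exact: measurable_vjoin.
have h0 p : (0 <= h p)%E by exact: f'0.
have := @measurable_fun_fubini_tonelli_G _ _ _ _ _ (@lebesgue_measure R) h mh h0.
move=> mG; apply: (eq_measurable_fun (fubini_G (@lebesgue_measure R) h)); last exact: measurable_funTS.
move=> y /set_mem yp; rewrite /fubini_G [RHS]integral_mkcond; apply: eq_integral => t _.
rewrite /h /f' -[vjoin _]/(vcons t y) -vinsE !patchE.
case: ifPn => [/set_mem/vpos_vins[t0 _]|nv]; first by rewrite mem_set//; apply/RposP.
case: ifPn => // /set_mem/RposP t0; case/negP: nv; apply/mem_set.
by apply/vpos_vins.
Qed.

Section SingularDomination.
Variables (R : realType) (m : nat) (k a : R).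
Hypothesis k0 : 0 <= k.
Hypothesis a0 : 0 < a.
Local Notation n := m.+1.
Local Notation Rn := (vec R n).
Local Notation D := (@vpos R n).

(** This is k |x_l - x_j|^(2k-1) off the diagonal. The factor k makes it vanish in the case k = 0,
    where the power itself is not integrable. *)
Definition sing (l j : 'I_n) (x : Rn) : R := k * expR ((2 * k - 1) * ln `|x l - x j|).
Definition sdom (l j : 'I_n) (x : Rn) : R := k * udom (2 * k) `|x l - x j| * \prod_(i < n | i != l) udom a (x i).

(** The slice in x_l is integrated first: by [udom_dist_int] the singular factor contributes at most
    4/(2k), whatever x_j is. *)
Lemma rint_sdom (l j : 'I_n) : j != l -> rint (sdom l j).
Proof.
move=> jl.
have [kz|kn] := eqVneq k 0.
  apply: (rint_eq (f := fun _ => 0)); last exact: integrable0.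
  by move=> x _; rewrite /sdom kz !mul0r.
have kp : 0 < k by rewrite lt_neqAle eq_sym kn.
have k2 : 0 < 2 * k by rewrite mulr_gt0.
have mu1 : measurable_fun D (fun x : Rn => \prod_(i < n | i != l) udom a (x i)).
  rewrite (_ : (fun x => _) = (fun x : Rn => \prod_(i < n) (if i != l then udom a (x i) else 1))); last first.
    by apply/funext => x; rewrite big_mkcond.
  apply: (@measurable_prod_pos R n (fun i t => if i != l then udom a t else 1)) => i.
  by case: (i != l) => //; apply: measurable_cont_pos => t t0; exact: udom_cont.
have mu2 : measurable_fun D (fun x : Rn => udom (2 * k) `|x l - x j|).
  apply: (@measurable_comp _ _ _ _ _ _ setT (fun s : R => udom (2 * k) `|s|) _ (fun x : Rn => x l - x j)) => //.
    have := @measurable_udom_dist R (2 * k) 0; congr (measurable_fun _ _).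
    by apply/funext => s; rewrite subr0.
  by apply: measurable_funB; exact: measurable_coordD.
have ms : measurable_fun D (sdom l j).
  by apply: measurable_funM => //; apply: measurable_funM.
have s0 x : 0 <= sdom l j x.
  by rewrite /sdom !mulr_ge0 ?udom_ge0// prodr_ge0// => i _; exact: udom_ge0.
apply/integrableP; split; first exact/measurable_EFinP.
under eq_integral do rewrite /= ger0_norm//.
rewrite (@vmeas_slice_ge0 R m l (fun x => (sdom l j x)%:E)); [|exact/measurable_EFinP|by move=> x _; rewrite lee_fin].
have [j' jE] : exists j', j = lift l j' by case: (unliftP l j) jl => [j' ->|->]; [exists j'|rewrite eqxx].
have sl (y : vec R m) t : sdom l j (vins l t y) = (k * \prod_(i < m) udom a (y i)) * udom (2 * k) `|t - y j'|.
  rewrite /sdom vins_l jE vins_lift mulrAC; congr (_ * _ * _).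
  rewrite (reindex_omap (lift l) (unlift l)) /=; last by move=> i il; case: unliftP il => [j'' ->|->] //; rewrite eqxx.
  apply: eq_big => [i|i _]; last by rewrite vins_lift.
  by rewrite liftK eqxx andbT eq_sym neq_lift.
have pk (y : vec R m) : 0 <= k * \prod_(i < m) udom a (y i).
  by rewrite mulr_ge0// prodr_ge0// => i _; exact: udom_ge0.
have fi := @rint_udom R m a a0.
apply: (@le_lt_trans _ _ (\int[vmeas R m]_(y in @vpos R m) ((4 / (2 * k))%:E * ((k * \prod_(i < m) udom a (y i))%:E)))%E).
  apply: ge0_le_integral => //.
  - exact: measurable_vpos.
  - by move=> y _; apply: integral_ge0 => t _; rewrite lee_fin.
  - by apply: (@measurable_slice_ge0 R m l (fun x => (sdom l j x)%:E)); [exact/measurable_EFinP|move=> x _; rewrite lee_fin].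
  - by apply: measurable_funeM; have /integrableP[] := rintZ k fi.
  - move=> y yp; under eq_integral do rewrite sl EFinM.
    rewrite ge0_integralZl//.
    + by rewrite muleC lee_wpmul2r ?lee_fin// udom_dist_int.
    + exact: measurable_Rpos.
    + apply/measurable_EFinP; apply: (measurable_funS _ (@subsetT _ (@Rpos R))) => //.
      exact: measurable_udom_dist.
    + by move=> t _; rewrite lee_fin udom_ge0.
    + by rewrite lee_fin.
rewrite ge0_integralZl//.
- rewrite lte_mul_pinfty ?lee_fin ?divr_ge0 ?(ltW k2)//.
  have /integrableP[_] := rintZ k fi; apply: le_lt_trans.
  rewrite le_eqVlt; apply/orP; left; apply/eqP; apply: eq_integral => y _.
  by rewrite /= ger0_norm.
- exact: measurable_vpos.
- by have /integrableP[] := rintZ k fi.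
- by move=> y _; rewrite lee_fin.
- by rewrite lee_fin divr_ge0// ltW.
Qed.

(** The decay exp(-e vsum x) is split into three. One third pays for the factor (1 + |x_l -
    x_j|)^(2k+1) lost in passing to [udom], one for the growth in x_l and the majorants of the other
    coordinates, and the last is bounded by 1. *)
Lemma ci_sing (f : Rn -> R[i]) (l j : 'I_n) (A e b : R) : j != l -> 0 <= A -> 0 < e -> 0 <= b ->
  cmeas f ->
  (forall x, D x -> cnorm (f x) <= A * expR (- e * vsum x) * sing l j x *
     expR ((a - 1) * \sum_(i < n | i != l) ln (x i)) * expR (b * ln (x l))) ->
  ci f.
Proof.
move=> jl A0 e0 b0 fm hf.
have e30 : 0 < e / 3 by rewrite divr_gt0.
have [B B0 hB] := exp_udom_bound a0 e30.
have [B2 B20 hB2] : exists2 B2, 0 < B2 & forall t, 0 < t -> expR (b * ln t) * expR (- (e / 3) * t) <= B2.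
  have [B2 B20 hB2] := poly_exp_bound (Num.bound b) e30.
  exists B2 => // t t0; rewrite mulNr expRN ler_pdivrMr ?expR_gt0//.
  apply: le_trans (hB2 t (ltW t0)); apply: powln_le; first exact: ltW.
  by rewrite b0 ltW// archi_boundP.
have [B3 B30 hB3] := poly_exp_bound (Num.bound (2 * k + 1)) e30.
have k2 : 0 <= 2 * k + 1 by rewrite addr_ge0// mulr_ge0.
pose c := A * (B3 * expR (e / 3)) * B2 * B ^+ m.
apply: (ci_dom fm (rintZ c (rint_sdom jl))) => x xp.
apply: (le_trans (hf x xp)).
have S0 : 0 <= vsum x by exact: vsum_ge0.
have d0 : 0 <= `|x l - x j| by [].
have h1 : sing l j x <= k * udom (2 * k) `|x l - x j| * (B3 * expR (e / 3) * expR (e / 3 * vsum x)).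
  rewrite /sing /udom -[leRHS]mulrA ler_wpM2l// expRD -[leRHS]mulrA ler_peMr ?expR_ge0//.
  rewrite expRN mulrC ler_pdivlMr ?expR_gt0// mul1r.
  apply: (@le_trans _ _ (expR ((2 * k + 1) * ln (1 + vsum x)))).
    rewrite ler_expR ler_wpM2l// ler_ln ?posrE ?ltr_wpDr//.
    by rewrite lerD2l dist_le_vsum.
  apply: (@le_trans _ _ (1 + (1 + vsum x) ^+ Num.bound (2 * k + 1))).
    by apply: powln_le; [rewrite addr_ge0|rewrite k2 ltW// archi_boundP].
  apply: (le_trans (hB3 _ _)); first by rewrite addr_ge0.
  by rewrite mulrDr mulr1 expRD mulrA.
have h2 : expR (- (e / 3) * vsum x) * expR ((a - 1) * \sum_(i < n | i != l) ln (x i)) * expR (b * ln (x l)) <=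
    B2 * (B ^+ m * \prod_(i < n | i != l) udom a (x i)).
  rewrite exp_prod (bigD1 l)//= mulr_sumr expR_sum.
  set el := expR (_ * x l); set Y := expR (b * _); set X := \prod_(i < n | _) _; set Z := \prod_(i < n | _) _.
  rewrite [leLHS](_ : _ = (Y * el) * (Z * X)); last by ring.
  apply: ler_pM; rewrite ?mulr_ge0 ?expR_ge0 ?prodr_ge0// => *; rewrite ?expR_ge0//.
  - by apply: hB2; exact: xp.
  - have -> : B ^+ m = \prod_(i < n | i != l) B.
      rewrite prodr_const (_ : #|_| = m)//; transitivity #|predC1 l|; last by rewrite cardC1 card_ord.
      by apply: eq_card => i; rewrite !inE.
    rewrite -!big_split /=; apply: ler_prod => i _.
    by rewrite mulr_ge0 ?expR_ge0//= hB//; exact: xp.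
have -> : expR (- e * vsum x) = expR (- (e / 3) * vsum x) * expR (- (e / 3) * vsum x) * expR (- (e / 3) * vsum x).
  by rewrite -!expRD; congr expR; field.
have s0 : 0 <= sing l j x by rewrite mulr_ge0 ?expR_ge0.
have E1 : expR (- (e / 3) * vsum x) <= 1 by rewrite -[leRHS]expR0 ler_expR mulNr oppr_le0 mulr_ge0// ?(ltW e30).
have E2 : expR (- (e / 3) * vsum x) * expR (e / 3 * vsum x) = 1 by rewrite -expRD mulNr addNr expR0.
set X := expR ((a - 1) * _); set Y := expR (b * _); rewrite -/X -/Y in h2.
set E := expR (- (e / 3) * vsum x); rewrite -/E in h2 E1 E2; set F := expR (e / 3 * vsum x); rewrite -/F in E2 h1.
pose s1 := k * udom (2 * k) `|x l - x j|; rewrite -/s1 in h1.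
have E0 : 0 <= E by exact: expR_ge0.
have h3 : E * sing l j x <= s1 * (B3 * expR (e / 3)).
  apply: (le_trans (ler_wpM2l E0 h1)); rewrite [leLHS](_ : _ = s1 * (B3 * expR (e / 3)) * (E * F)); last by ring.
  by rewrite E2 mulr1.
have s10 : 0 <= s1 by rewrite mulr_ge0 ?udom_ge0.
have B3p : 0 <= B3 * expR (e / 3) by rewrite mulr_ge0 ?expR_ge0// ltW.
have XY0 : 0 <= E * X * Y by rewrite !mulr_ge0 ?expR_ge0.
rewrite [leLHS](_ : _ = A * (E * (E * sing l j x)) * (E * X * Y)); last by ring.
rewrite [leRHS](_ : _ = A * (1 * (s1 * (B3 * expR (e / 3)))) * (B2 * (B ^+ m * \prod_(i < n | i != l) udom a (x i)))); last by rewrite /c /sdom -/s1; ring.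
apply: ler_pM => //; first by rewrite !mulr_ge0.
by rewrite ler_wpM2l// ler_pM// mulr_ge0.
Qed.

End SingularDomination.

(** * Integration by parts *)

Section OneVariableLimits.
Variable R : realType.

(** The majorant t udom a t = t^a (1+t)^(-a-1) tends to 0 at both ends because a > 0. *)
Lemma dominated_limits (F : R -> R) (c a : R) : 0 < a -> 0 <= c ->
  (forall t, 0 < t -> `|F t| <= c * (t * udom a t)) ->
  F @ 0^'+ --> (0 : R) /\ F @ +oo --> (0 : R).
Proof.
move=> a0 c0 hF.
have uE (t : R) : 0 < t -> t * udom a t = expR (a * ln t - (a + 1) * ln (1 + t)).
  move=> t0; rewrite /udom -{1}(lnK (t0 : t \is Num.pos)) -expRD; congr expR; ring.
have c1 : 0 < c + 1 by rewrite ltr_wpDl.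
split; apply/cvgrPdist_lt => e e0; have d0 : 0 < e / (c + 1) by rewrite divr_gt0.
  have r0 : 0 < expR (ln (e / (c + 1)) / a) by exact: expR_gt0.
  near=> t; have t0 : 0 < t by near: t; exact: nbhs_right_gt.
  have tr : t < expR (ln (e / (c + 1)) / a) by near: t; exact: nbhs_right_lt.
  rewrite sub0r normrN; apply: (le_lt_trans (hF t t0)); rewrite uE//.
  have h : expR (a * ln t - (a + 1) * ln (1 + t)) <= e / (c + 1).
    rewrite -[leRHS](@lnK R)// ler_expR.
    have h1 : a * ln t <= ln (e / (c + 1)).
      by rewrite mulrC -ler_pdivlMr// -ler_expR lnK// ltW.
    have h2 : 0 <= (a + 1) * ln (1 + t) by rewrite mulr_ge0 ?addr_ge0 ?(ltW a0)// ln_ge0// lerDl ltW.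
    lra.
  apply: (le_lt_trans (ler_wpM2l c0 h)); rewrite mulrA ltr_pdivrMr// mulrC ltr_pM2l// ltrDl//.
near=> t; have t1 : 1 < t by near: t; exact: nbhs_pinfty_gt.
have te : (c + 1) / e < t by near: t; apply: nbhs_pinfty_gt; rewrite num_real.
have t0 : 0 < t by exact: lt_trans t1.
rewrite sub0r normrN; apply: (le_lt_trans (hF t t0)); rewrite uE//.
have h : expR (a * ln t - (a + 1) * ln (1 + t)) <= t^-1.
  rewrite -[t^-1](@lnK R) ?posrE ?invr_gt0// ler_expR lnV ?posrE//.
  have h1 : ln t <= ln (1 + t) by rewrite ler_ln ?posrE ?addr_gt0// lerDr.
  nra.
apply: (le_lt_trans (ler_wpM2l c0 h)); rewrite ltr_pdivrMr//.
by move: te; rewrite ltr_pdivrMr// mulrC; lra.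
Unshelve. all: by end_near. Qed.

Lemma ccontV_real (f : R -> R) t : {for t, continuous f} -> f t != 0 -> ccont (fun s => (toC (f s))^-1) t.
Proof.
move=> cf f0; rewrite (_ : (fun s => _) = (fun s => toC (f s)^-1)); last first.
  by apply/funext => s; rewrite toCV.
by apply: ccont_real; exact: continuousV.
Qed.

End OneVariableLimits.

Section Slices.
Variables (R : realType) (m : nat) (l : 'I_m.+1).
Local Notation mu := (@lebesgue_measure R).
Local Notation Rpos := (@Rpos R).

(** Slices are integrable only for almost every y, and the y with coinciding coordinates form a null
    set, so the identity is asked only of the remaining y. *)
Lemma slice_eq (u : vec R m.+1 -> R) (v : vec R m -> R) : rint u -> measurable_fun (@vpos R m) v ->
  (forall y, vpos y -> vdistinct y -> mu.-integrable Rpos (fun t => (u (vins l t y))%:E) ->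
     Rintegral mu Rpos (fun t => u (vins l t y)) = v y) ->
  rI u = rI v.
Proof.
move=> ui mv uv; have /integrableP[mu' ui'] := ui.
rewrite /rI /Rintegral; congr fine.
rewrite (@vmeas_slice R m l (EFin \o u) ui).
pose phi y := (\int[mu]_(t in Rpos) `|(EFin \o u) (vins l t y)|)%E.
have mabs : measurable_fun (@vpos R m.+1) (fun x => `|(EFin \o u) x|)%E.
  exact: measurableT_comp.
have mphi : measurable_fun (@vpos R m) phi.
  exact: (@measurable_slice_ge0 R m l (fun x => `|(EFin \o u) x|)%E).
have phii : (vmeas R m).-integrable (@vpos R m) phi.
  apply/integrableP; split => //.
  under eq_integral do rewrite gee0_abs ?integral_ge0//.
  by rewrite -(@vmeas_slice_ge0 R m l (fun x => `|(EFin \o u) x|)%E).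
have [N [mN N0 subN]] := integrable_ae (@measurable_vpos R m) phii.
have mslice y : vpos y -> measurable_fun Rpos (fun t => (u (vins l t y))%:E).
  move=> yp; apply: (measurable_comp (@measurable_vpos R m.+1) _ mu').
    by move=> _ [t /RposP t0 <-]; apply/vpos_vins.
  rewrite (_ : (fun t => vins l t y) = vperm (lift_perm l ord0 1%g) \o (@vjoin R m \o (fun t => (t, y)))); last first.
    by apply/funext => t /=; rewrite vinsE.
  apply: measurable_funTS; apply: measurableT_comp; first exact: measurable_vperm.
  apply: measurableT_comp; first exact: measurable_vjoin.
  exact: measurable_fun_pair.
apply: ae_eq_integral => //.
- exact: measurable_vpos.
- pose p1 (y : vec R m) : \bar R := (\int[mu]_(t in Rpos) ((EFin \o u)^\+%E (vins l t y)))%E.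
  pose p2 (y : vec R m) : \bar R := (\int[mu]_(t in Rpos) ((EFin \o u)^\-%E (vins l t y)))%E.
  have m1 : measurable_fun (@vpos R m) p1.
    apply: measurable_slice_ge0 => //; exact: measurable_funepos.
  have m2 : measurable_fun (@vpos R m) p2.
    apply: measurable_slice_ge0 => //; exact: measurable_funeneg.
  rewrite [X in measurable_fun _ X](_ : _ = (fun y => p1 y - p2 y)%E); first exact: emeasurable_funB.
  apply/funext => y; rewrite /= /p1 /p2 [LHS]integralE.
  by congr (_ - _)%E; apply: eq_integral => t _; rewrite ?funeposE ?funenegE.
- exact/measurable_EFinP.
exists (N `|` ~` @vdistinct R m); split.
- by apply: measurableU => //; apply: measurableC; exact: measurable_vdistinct.
- by apply: null_set_setU => //; [apply: measurableC; exact: measurable_vdistinct|exact: vmeas_Ndistinct].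
- move=> y /= ny; apply: contrapT => /not_orP[nN nd]; apply: ny => yp.
  have yd : vdistinct y by apply: contrapT.
  have fin : phi y \is a fin_num.
    by apply: contrapT => nf; apply: nN; apply: subN => /= /(_ yp).
  have si : mu.-integrable Rpos (fun t => (u (vins l t y))%:E).
    apply/integrableP; split; first exact: mslice.
    by rewrite -/(phi y) -ge0_fin_numE// /phi integral_ge0.
  rewrite -(uv y yp yd si) /Rintegral fineK//; apply: integrable_fin_num => //.
  exact: measurable_Rpos.
Qed.

End Slices.

Section SingularTerm.
Variables (R : realType) (m : nat) (k a c : R) (l j : 'I_m.+1).
Hypothesis k0 : 0 <= k.
Hypothesis a0 : 0 < a.
Hypothesis ca : 0 <= c + (a - 1).
Hypothesis jl : j != l.
Local Notation n := m.+1.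
Local Notation Rn := (vec R n).
Local Notation D := (@vpos R n).

(** The power c of x_l is a parameter because the term occurs with c = 1 in the integration by parts
    and with c = 0, a = 1 in the boundary flux. The condition c + (a - 1) >= 0 excludes a
    singularity at x_l = 0. *)
Definition sterm (q : Rn -> R[i]) (x : Rn) : R[i] :=
  toC k * (toC (expR (c * ln (x l))) / toC (x l - x j) * q x * toC (Wr k a x)).

Lemma measurable_expln : measurable_fun D (fun x : Rn => expR (c * ln (x l))).
Proof.
apply: (@measurable_coord_pos R n l (fun t => expR (c * ln t))).
apply: measurable_cont_pos => t t0.
apply: (@continuous_comp R R R (fun t : R => c * ln t) (@expR R)); last exact: continuous_expR.
by apply: cvgMr; exact: continuous_ln.
Qed.

Lemma ci_sterm q : sepcont q -> expbd q -> ci (sterm q).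
Proof.
move=> qs qe.
have lj : l != j by rewrite eq_sym.
have [r rp hr] := @omega_split R n k k0 l j lj.
have [A [e [A0 e0 hA]]] := expbdM qe rp.
apply: (@ci_sing R m k a k0 a0 _ l j A e (c + (a - 1))) => //.
  apply: cmeasM; first by apply: cmeas_real; exact: measurable_cst.
  apply: cmeasM; last by apply: cmeas_sepcont; exact: sepcont_Wr.
  apply: cmeasM; last exact: cmeas_sepcont.
  by apply: cmeasM; [apply: cmeas_real; exact: measurable_expln|exact: cmeas_invdiff].
move=> x xp; rewrite /sterm /Wr toCM hr.
have -> : toC k * (toC (expR (c * ln (x l))) / toC (x l - x j) * q x *
     (toC (expR ((a - 1) * \sum_(i < n) ln (x i))) * (pairC k l j x * r x))) =
  (toC k * (pairC k l j x / toC (x l - x j))) * (toC (expR (c * ln (x l))) *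
     toC (expR ((a - 1) * \sum_(i < n) ln (x i)))) * (q x * r x) by ring.
have eE : expR (c * ln (x l)) * expR ((a - 1) * \sum_(i < n) ln (x i)) =
    expR ((c + (a - 1)) * ln (x l)) * expR ((a - 1) * \sum_(i < n | i != l) ln (x i)).
  by rewrite (bigD1 l)//= -!expRD; congr expR; ring.
rewrite -[toC (expR (c * _)) * _]toCM eE !cnormM.
rewrite [cnorm (toC k)]cnorm_toC [cnorm (toC (expR _ * _))]cnorm_toC [`|k|]ger0_norm// [`|expR _ * _|]ger0_norm; last first.
  by rewrite mulr_ge0 ?expR_ge0.
have h1 : k * (cnorm (pairC k l j x) * cnorm (toC (x l - x j))^-1) <= sing k l j x.
  rewrite /sing ler_wpM2l// cnormV /pairC !cnorm_toC ger0_norm ?powR_ge0//.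
  have [E|N] := eqVneq (x l - x j) 0; first by rewrite E normr0 invr0 mulr0 expR_ge0.
  have nn : 0 < `|x l - x j| by rewrite normr_gt0.
  rewrite /powR gt_eqF// mulrBl mul1r expRB lnK//.
rewrite [leRHS](_ : _ = sing k l j x * (expR ((c + (a - 1)) * ln (x l)) * expR ((a - 1) * \sum_(i < n | i != l) ln (x i))) * (A * expR (- e * vsum x))); last by ring.
apply: ler_pM => //; rewrite ?mulr_ge0 ?cnorm_ge0 ?expR_ge0//.
  by rewrite ler_wpM2r// mulr_ge0// expR_ge0.
by rewrite -cnormM; exact: hA.
Qed.

End SingularTerm.

Section SymmetrizedTerm.
Variables (R : realType) (m : nat) (k a : R) (l j : 'I_m.+1).
Hypothesis k0 : 0 <= k.
Hypothesis a0 : 0 < a.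
Hypothesis jl : j != l.
Local Notation n := m.+1.
Local Notation Rn := (vec R n).
Local Notation D := (@vpos R n).
Local Notation W x := (toC (Wr k a x)).

Variables (K f : Rn -> R[i]).
Hypothesis sK : sepcont K.
Hypothesis eK : expbd K.
Hypothesis sf : sepcont f.
Hypothesis pf : polybd f.

Let s : 'S_n := tperm l j.
Definition dterm (x : Rn) : R[i] :=
  toC k * (toC (x l) / toC (x l - x j) * (K (vsw l j x) * f x + K x * f (vsw l j x)) * W x).

Lemma expbd_swap : expbd (fun x => K (vsw l j x) * f x) /\ expbd (fun x => K x * f (vsw l j x)).
Proof.
split; apply: expbdM => //; first exact: (expbd_vperm s).
exact: (polybd_vperm s).
Qed.

Lemma ci_dterm : ci dterm.
Proof.
have ca : 0 <= 1 + (a - 1) by rewrite addrC subrK ltW.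
have [e1 e2] := expbd_swap.
have s1 : sepcont (fun x => K (vsw l j x) * f x) by apply: sepcontM => //; exact: (sepcont_vperm s).
have s2 : sepcont (fun x => K x * f (vsw l j x)) by apply: sepcontM => //; exact: (sepcont_vperm s).
apply: ci_eq (ciD (ci_sterm k0 a0 ca jl s1 e1) (ci_sterm k0 a0 ca jl s2 e2)) => x xp.
rewrite /sterm /dterm mul1r lnK ?posrE; last exact: xp.
by ring.
Qed.

(* x_l/(x_l - x_j) + x_j/(x_j - x_l) = 1: averaging over the swap removes the singularity. *)
Lemma cI_dterm : cI dterm = toC k * cI (fun x => K x * f (vsw l j x) * W x).
Proof.
have [e1 e2] := expbd_swap.
have i1 : ci (fun x => K (vsw l j x) * f x * W x).
  by apply: ci_good => //; apply: sepcontM => //; exact: (sepcont_vperm s).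
have i2 : ci (fun x => K x * f (vsw l j x) * W x).
  by apply: ci_good => //; apply: sepcontM => //; exact: (sepcont_vperm s).
have E1 : cI (fun x => K (vsw l j x) * f x * W x) = cI (fun x => K x * f (vsw l j x) * W x).
  rewrite -(cI_vperm s i1); apply: cI_eq => x xp.
  by rewrite -[vperm s x]/(vsw l j x) vswK /vsw Wr_vperm.
have E2 : cI dterm + cI dterm = toC k * (cI (fun x => K (vsw l j x) * f x * W x) + cI (fun x => K x * f (vsw l j x) * W x)).
  rewrite -{2}(cI_vperm s ci_dterm) -cI_D; [|exact: ci_dterm|exact: (ci_vperm s ci_dterm)].
  rewrite -cI_D// -cI_Z; last exact: ciD.
  apply: cI_ae.
  - by apply: ciD; [exact: ci_dterm|exact: (ci_vperm s ci_dterm)].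
  - by apply: ciZ; exact: ciD.
  move=> x xp xd; have Ws : Wr k a (vsw l j x) = Wr k a x by exact: Wr_vperm.
  rewrite /dterm -[vperm s x]/(vsw l j x) vswK Ws.
  have -> : vsw l j x l = x j by rewrite /vsw /vperm tpermL.
  have -> : vsw l j x j = x l by rewrite /vsw /vperm tpermR.
  have d0 : toC (x l - x j) != 0 by rewrite toC_eq0 subr_eq0; apply: xd; rewrite eq_sym.
  have -> : toC (x j - x l) = - toC (x l - x j) by rewrite -toCN opprB.
  have -> : toC (x l) = toC (x j) + toC (x l - x j) by rewrite -toCD addrC subrK.
  move: (toC (x l - x j)) d0 (toC (x j)) (toC k) (K _) (K _) (f _) (f _) (W x) => d d0 *.
  by field.
rewrite E1 -!mulr2n mulrnAr in E2.
by apply: (mulIf (x := 2%:R)); rewrite ?pnatr_eq0// !mulr_natr E2.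
Qed.

End SymmetrizedTerm.

Section IntegrationByParts.
Variables (R : realType) (m : nat) (k a : R) (l : 'I_m.+1).
Hypothesis k0 : 0 <= k.
Hypothesis a0 : 0 < a.
Local Notation n := m.+1.
Local Notation C := R[i].
Local Notation Re := (@complex.Re R).
Local Notation Im := (@complex.Im R).
Local Notation Rn := (vec R n).
Local Notation D := (@vpos R n).
Local Notation W x := (toC (Wr k a x)).
Local Notation mu := (@lebesgue_measure R).

Variables (K f h : Rn -> C) (z : C).
Hypothesis sK : sepcont K.
Hypothesis eK : expbd K.
Hypothesis sf : sepcont f.
Hypothesis pf : polybd f.
Hypothesis sh : sepcont h.
Hypothesis ph : polybd h.
Hypothesis dK : dform k l K (fun x => z * toC (x l) * K x).
Hypothesis df : dform k l f h.

Let Q x : C := toC (x l) * (K x * f x) * W x.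
Let dQ x : C := toC a * (K x * f x * W x) + z * (toC (x l) * (K x * f x) * W x) + K x * h x * W x
  + \sum_(j < n | j != l) dterm k a l j K f x.

(** The unreflected parts of the two Dunkl equations contribute -2k times the sum of 1/(x_l - x_j),
    which cancels the logarithmic derivative of omega. Only values at swapped points keep a
    denominator, and these form [dterm]. The coefficient a is 1 from the factor x_l plus a - 1 from
    the weight. *)
Lemma flux_deriv x : D x -> vdistinct x -> cderiv (fun t => Q (upd x l t)) (x l) (dQ x).
Proof.
move=> xp xd.
have d0 : cderiv (fun t => toC (upd x l t l)) (x l) 1.
  by rewrite (_ : (fun t => _) = @toC R); [exact: cderiv_id|apply/funext => t; rewrite /upd eqxx].
refine (cderiv_eq (f := fun t => Q (upd x l t)) (cderivM (cderivM d0 (cderivM (dK xp xd) (df xp xd))) (Wr_deriv k a l xp xd)) _).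
rewrite !upd_id /dQ /dterm.
have xl0 : toC (x l) != 0 by rewrite toC_eq0 gt_eqF// xp.
pose S := \sum_(j < n | j != l) (toC (x l - x j))^-1.
pose SK := \sum_(j < n | j != l) K (vsw l j x) / toC (x l - x j).
pose Sf := \sum_(j < n | j != l) f (vsw l j x) / toC (x l - x j).
have exp_vsum (g : Rn -> C) : \sum_(j < n | j != l) (g x - g (vsw l j x)) / toC (x l - x j) =
    g x * S - \sum_(j < n | j != l) g (vsw l j x) / toC (x l - x j).
  by rewrite /S mulr_sumr -sumrB; apply: eq_bigr => j _; rewrite mulrBl.
rewrite !exp_vsum -/SK -/Sf -/S.
have -> : \sum_(j < n | j != l) toC k * (toC (x l) / toC (x l - x j) * (K (vsw l j x) * f x + K x * f (vsw l j x)) * W x)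
   = toC k * toC (x l) * W x * (SK * f x + K x * Sf).
  rewrite /SK /Sf mulr_suml mulr_sumr -big_split mulr_sumr /=; apply: eq_bigr => j _; ring.
rewrite toCB toCM toC1 [toC 2](toC_nat R 2).
clear exp_vsum; move: S SK Sf (toC k) (toC a) (W x) (K x) (f x) (h x) (toC (x l)) xl0 => S SK Sf k' a' w K' f' h' x' x0.
by field.
Qed.

Let iKf : ci (fun x => K x * f x * W x).
Proof. by apply: ci_good => //; [exact: sepcontM|exact: expbdM]. Qed.
Let ixKf : ci (fun x => toC (x l) * (K x * f x) * W x).
Proof.
apply: ci_good => //; first by apply: sepcontM; [exact: sepcont_coord|exact: sepcontM].
rewrite (_ : (fun x => _) = (fun x => K x * (f x * toC (x l)))); last by apply/funext => x; ring.
by apply: expbdM => //; apply: polybdM => //; exact: polybd_coord.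
Qed.
Let iKh : ci (fun x => K x * h x * W x).
Proof. by apply: ci_good => //; [exact: sepcontM|exact: expbdM]. Qed.

Lemma ci_dQ : ci dQ.
Proof.
apply: ciD; last by apply: ci_sum => j jl; exact: ci_dterm.
by apply: ciD => //; apply: ciD; exact: ciZ.
Qed.

Lemma ccont_dQ x : D x -> vdistinct x -> ccont (fun t => dQ (upd x l t)) (x l).
Proof.
move=> xp xd.
have sW := sepcont_Wr k0 a (n := n).
have sx := @sepcont_coord R n l.
have cs (u : Rn -> C) : sepcont u -> ccont (fun t => u (upd x l t)) (x l) by move=> h1; exact: h1.
apply: ccontD.
  have : sepcont (fun x => toC a * (K x * f x * W x) + z * (toC (x l) * (K x * f x) * W x) + K x * h x * W x).
    have s1 := sepcontM sK sf.
    apply: sepcontD; last by apply: sepcontM => //; exact: sepcontM.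
    apply: sepcontD; apply: sepcontZ; apply: sepcontM => //.
    exact: sepcontM.
  exact: cs.
apply: ccont_sum => j jl; apply: ccontM; first exact: ccont_cst.
apply: ccontM; last exact: (cs (fun x => W x) sW).
apply: ccontM.
  apply: ccontM; first exact: (cs (fun x => toC (x l)) sx).
  apply: ccontV_real.
    by apply: continuousB; exact: upd_cont.
  by rewrite upd_id subr_eq0; apply: xd; rewrite eq_sym.
have h1 : sepcont (fun x => K (vsw l j x) * f x) by apply: sepcontM => //; exact: (sepcont_vperm (tperm l j)).
have h2 : sepcont (fun x => K x * f (vsw l j x)) by apply: sepcontM => //; exact: (sepcont_vperm (tperm l j)).
by apply: ccontD; [exact: (cs _ h1)|exact: (cs _ h2)].
Qed.

Lemma sepcont_Q : sepcont Q.
Proof.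
apply: sepcontM; last exact: sepcont_Wr.
by apply: sepcontM; [exact: sepcont_coord|exact: sepcontM].
Qed.

Lemma Q_dom : exists2 A, 0 <= A & forall (y : vec R m) t, vpos y -> 0 < t ->
  cnorm (Q (vins l t y)) <= A * (\prod_(i < m) udom a (y i)) * (t * udom a t).
Proof.
have [A A0 hA] := Wr_dom k0 a0 (expbdM eK pf).
exists A => // y t yp t0.
have xp : D (vins l t y) by apply/vpos_vins.
rewrite /Q -mulrA cnormM cnorm_toC vins_l gtr0_norm//.
apply: (le_trans (ler_wpM2l (ltW t0) (hA _ xp))).
rewrite (bigD1 l)//= vins_l (reindex_omap (lift l) (unlift l)) /=; last first.
  by move=> i il; case: unliftP il => [j'' ->|->] //; rewrite eqxx.
rewrite [X in A * (_ * X)](eq_big xpredT (fun i => udom a (y i))); first last.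
- by move=> i _; rewrite vins_lift.
- by move=> i; rewrite liftK eqxx andbT eq_sym neq_lift.
by rewrite le_eqVlt; apply/orP; left; apply/eqP; ring.
Qed.

Lemma vdistinct_vins (y : vec R m) t : vdistinct y -> t \notin [seq y i | i <- enum 'I_m] -> vdistinct (vins l t y).
Proof.
move=> yd ty.
have tn i : t != y i by apply: contraNneq ty => ->; apply/mapP; exists i => //; rewrite mem_enum.
move=> i j; case: (unliftP l i) => [i' ->|->]; case: (unliftP l j) => [j' ->|->]; rewrite ?vins_l ?vins_lift//.
- by rewrite (inj_eq lift_inj); exact: yd.
- by move=> _; rewrite eq_sym.
- by rewrite eqxx.
Qed.

(* The flux Q vanishes on the coordinate hyperplane (a > 0) and at infinity. *)
Lemma slice_flux_zero (p : C -> R) (y : vec R m) : (p = Re \/ p = Im) -> vpos y -> vdistinct y ->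
  mu.-integrable (@Rpos R) (fun t => (p (dQ (vins l t y)))%:E) ->
  Rintegral mu (@Rpos R) (fun t => p (dQ (vins l t y))) = 0.
Proof.
move=> hp yp yd ii.
have [A A0 hA] := Q_dom.
have pc (u : R -> C) t : ccont u t -> {for t, continuous (fun s => p (u s))} by case: hp => -> [].
have pd (u : R -> C) t (L : C) : cderiv u t L -> is_derive t (1 : R) (fun s => p (u s)) (p L) by case: hp => -> [].
have pn (w : C) : `|p w| <= cnorm w by case: hp => ->; [exact: Re_le_cnorm|exact: Im_le_cnorm].
have P0 : 0 <= \prod_(i < m) udom a (y i) by apply: prodr_ge0 => i _; exact: udom_ge0.
have [|F0 Foo] := @dominated_limits R (fun t => p (Q (vins l t y))) _ a a0 (mulr_ge0 A0 P0) _.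
  by move=> t t0; apply: (le_trans (pn _)); exact: hA.
have vE (u : Rn -> C) t : (fun s => u (vins l s y)) = (fun s => u (upd (vins l t y) l s)).
  by apply/funext => s; rewrite upd_vins.
rewrite -[RHS](subrr (0 : R)).
apply: (@FTC_pos R (fun t => p (Q (vins l t y))) (fun t => p (dQ (vins l t y))) [seq y i | i <- enum 'I_m] 0 0) => //.
- move=> t t0; apply: (pc (fun s => Q (vins l s y))); rewrite (vE Q t).
  by have := @sepcont_Q (vins l t y) l; rewrite vins_l; apply; apply/vpos_vins.
- move=> t t0 ts; apply: (pd (fun s => Q (vins l s y))); rewrite (vE Q t).
  have := @flux_deriv (vins l t y); rewrite vins_l; apply; first by apply/vpos_vins.
  exact: vdistinct_vins.
- move=> t t0 ts; apply: (pc (fun s => dQ (vins l s y))); rewrite (vE dQ t).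
  have := @ccont_dQ (vins l t y); rewrite vins_l; apply; first by apply/vpos_vins.
  exact: vdistinct_vins.
Qed.

Lemma cI_dQ : cI dQ = 0.
Proof.
have [i1 i2] := ci_dQ.
have r0 : rI (fun _ : vec R m => 0 : R) = 0 by rewrite /rI /Rintegral integral0.
apply: ceq => /=.
  rewrite (slice_eq (l := l) i1 (v := fun _ => 0)) ?r0//.
  by move=> y yp yd ii; apply: (slice_flux_zero (p := Re)) => //; left.
rewrite (slice_eq (l := l) i2 (v := fun _ => 0)) ?r0//.
by move=> y yp yd ii; apply: (slice_flux_zero (p := Im)) => //; right.
Qed.

(** The flux has no boundary values, so its derivative integrates to zero, and [cI_dterm] turns the
    singular terms into regular integrals. *)
Lemma ibp : - z * cI (fun x => toC (x l) * (K x * f x) * W x) =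
  cI (fun x => K x * h x * W x) + toC a * cI (fun x => K x * f x * W x) +
  toC k * \sum_(j < n | j != l) cI (fun x => K x * f (vsw l j x) * W x).
Proof.
have := cI_dQ; rewrite /dQ cI_D; last 2 first.
- by apply: ciD => //; apply: ciD; exact: ciZ.
- by apply: ci_sum => j jl; exact: ci_dterm.
rewrite cI_sum; last by move=> j jl; exact: ci_dterm.
rewrite !cI_D ?cI_Z//; [|exact: ciZ|exact: ciZ|by apply: ciD; exact: ciZ].
rewrite (eq_bigr (fun j => toC k * cI (fun x => K x * f (vsw l j x) * W x))); last first.
  by move=> j jl; rewrite cI_dterm.
have e (A B X S a' z' k' : C) : a' * B + z' * A + X + k' * S = 0 -> - z' * A = X + a' * B + k' * S.
  by move=> h0; apply/eqP; rewrite -subr_eq0 -oppr_eq0; apply/eqP; rewrite -[RHS]h0; ring.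
by rewrite -mulr_sumr; exact: e.
Qed.

End IntegrationByParts.

(** * The Laplace transform of the Cherednik kernel *)

Section QuadraticRemainder.
Variable R : realType.
Local Notation C := R[i].

Lemma cderiv_quadratic n (z : R -> Cn R n) (dz : Cn R n) (r : R -> C) (A : R) : 0 <= A ->
  (forall i, cderiv (fun t => z t i) 0 (dz i)) -> r 0 = 0 ->
  (\forall t \near (0 : R), cnorm (r t) <= A * \sum_(i < n) cnorm (z t i - z 0 i) ^+ 2) ->
  cderiv r 0 0.
Proof.
move=> A0 hz r0 hr.
pose u t := \sum_(i < n) cnorm (z t i - z 0 i) ^+ 2.
have u0 : u 0 = 0 by rewrite /u big1// => i _; rewrite subrr cnorm0 expr0n.
have du : is_derive (0 : R) (1 : R) u 0.
  have d i : is_derive (0 : R) (1 : R) (fun t => cnorm (z t i - z 0 i) ^+ 2) 0.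
    apply: (is_derive_eq (is_derive_cnorm2 (cderivB (hz i) (cderiv_cst (z 0 i) 0)))).
    by rewrite subrr /crip cRe0 cIm0 !mul0r addr0 mulr0.
  rewrite (_ : u = \sum_(i < n) (fun t => cnorm (z t i - z 0 i) ^+ 2)); last first.
    by apply/funext => t; rewrite fct_sumE.
  have := is_derive_bigsum (index_enum 'I_n) d; congr (is_derive _ _ _ _).
  by rewrite big1.
apply: cderivP => e e0.
have A1 : 0 < A + 1 by rewrite ltr_wpDl.
have d0 : 0 < e / (A + 1) by rewrite divr_gt0.
have [h1 h2] := du.
have h3 : (fun h : R => h^-1 *: (u (h *: (1 : R) + 0) - u 0)) @ 0^' --> (0 : R).
  by rewrite -[X in _ --> X]h2; exact: h1.
have /cvgr0Pnorm_lt/(_ _ d0) := h3.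
rewrite near_withinE => /nbhs_ballP[d1 /= d10 hd1].
have /nbhs_ballP[d2 /= d20 hd2] := hr.
exists (Num.min d1 d2); first by rewrite lt_min d10.
move=> h /andP[h00 hm]; move: hm; rewrite lt_min => /andP[hm1 hm2].
have hn0 : h != 0 by rewrite -normr_gt0.
rewrite add0r r0 !subr0 cnormM cnormV cnorm_toC.
have b1 : cnorm (r h) <= A * u h by apply: hd2; rewrite /ball/= sub0r normrN.
have b2 : `|h^-1 *: (u (h *: (1 : R) + 0) - u 0)| < e / (A + 1).
  by apply: hd1 => //; rewrite /ball/= sub0r normrN.
move: b2; rewrite addr0 u0 subr0 -[h *: 1]/(h * 1) mulr1 -[_ *: _]/(h^-1 * u h) normrM normfV.
have u_ge0 : 0 <= u h by apply: sumr_ge0 => i _; exact: sqr_ge0.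
rewrite (ger0_norm u_ge0) ltr_pdivlMr// => b2.
apply: le_lt_trans b2; rewrite [leRHS](_ : _ = ((A + 1) * u h) / `|h|); last by ring.
by rewrite ler_wpM2r ?invr_ge0//; apply: (le_trans b1); rewrite ler_wpM2r// lerDl.
Qed.

End QuadraticRemainder.

Section LaplaceTransform.
Variables (R : realType) (m : nat) (k a : R) (E G0 : Cn R m.+1 -> Cn R m.+1 -> R[i]).
Hypothesis k0 : 0 <= k.
Hypothesis a0 : 0 < a.
Hypothesis hE : is_dunkl_kernel k E.
Hypothesis hG : is_cherednik0 k G0.
Variable lam : Cn R m.+1.
Local Notation C := R[i].
Local Notation Re := (@complex.Re R).
Local Notation Im := (@complex.Im R).
Hypothesis lam0 : forall i, 0 <= Re (lam i).
Local Notation n := m.+1.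
Local Notation Rn := (vec R n).
Local Notation Cn := (Cn R n).
Local Notation D := (@vpos R n).
Local Notation W x := (toC (Wr k a x)).
Local Notation g := (gG G0 lam).
Local Notation K z := (Er E (cvopp z)).
Local Notation cn := (cn R n).

Local Opaque Er gG Wr vsum.

Definition Phi (z : Cn) : C := cI (fun x => K z x * g x * W x).
Definition PhiX (l : 'I_n) (z : Cn) : C := cI (fun x => toC (x l) * (K z x * g x) * W x).

Lemma sepcont_g : sepcont g.
Proof.
move=> x l xp; apply: (gG_path hG); first by rewrite upd_id.
by move=> i; exact: upd_cont.
Qed.

Lemma polybd_g : polybd g.
Proof.
have [p hp] := gG_bound k0 hG lam0.
by exists (gG_const R n), p; split=> //; exact: sqrtr_ge0.
Qed.

Lemma sepcont_Er z : sepcont (Er E z).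
Proof. by move=> x l xp; apply: (Er_path hE) => i; exact: upd_cont. Qed.

Lemma re_min (z : Cn) : (forall i, 0 < Re (z i)) -> exists2 e, 0 < e & forall i, e <= Re (z i).
Proof.
move=> z0; exists (\big[Num.min/1]_i Re (z i)).
  by elim/big_ind: _ => // x y x0 y0; rewrite lt_min x0.
by move=> i; rewrite (bigminD1 i)//= ge_min lexx.
Qed.

Lemma expbd_K z : (forall i, 0 < Re (z i)) -> expbd (K z).
Proof.
move=> /re_min[e e0 he]; exists cn, e; split=> //; first exact: cn_ge0.
by move=> x xp; apply: (Er_bound k0 hE) => // i; rewrite /cvopp cReN lerN2.
Qed.

Lemma ci_Kf z f : (forall i, 0 < Re (z i)) -> sepcont f -> polybd f -> ci (fun x => K z x * f x * W x).
Proof.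
move=> z0 sf pf; apply: ci_good => //; first by apply: sepcontM => //; exact: sepcont_Er.
by apply: expbdM => //; exact: expbd_K.
Qed.

Lemma K_sw z (l j : 'I_n) x : K (sw l j z) x = K z (vsw l j x).
Proof. by rewrite -(Er_swl k0 hE). Qed.

Lemma cI_K_swap z (l j : 'I_n) : (forall i, 0 < Re (z i)) -> sepcont g ->
  cI (fun x => K z x * g (vsw l j x) * W x) = Phi (sw l j z).
Proof.
move=> z0 sg; have h := ci_Kf z0 (sepcont_vperm (tperm l j) sepcont_g) (polybd_vperm (tperm l j) polybd_g).
rewrite -(cI_vperm (tperm l j) h); apply: cI_eq => x xp.
by rewrite -/(vsw l j x) -/(vsw l j (vsw l j x)) vswK K_sw /vsw Wr_vperm.
Qed.

(** Equivariance of E moves each swap in the argument of g to a swap of z, which closes the relation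
    of [ibp] on the values of [Phi]. *)
Lemma PhiX_eq z l : (forall i, 0 < Re (z i)) -> z l * PhiX l z =
  (lam l + toC (@rho R n k l) + toC a) * Phi z
  + toC k * \sum_(j < n | (l < j)%N) (Phi z - Phi (sw l j z))
  + toC k * \sum_(j < n | j != l) Phi (sw l j z).
Proof.
move=> z0.
have sw_s j := sepcont_vperm (tperm l j) sepcont_g.
have sw_p j := polybd_vperm (tperm l j) polybd_g.
have sh : sepcont (gG_dunkl k G0 lam l).
  apply: sepcontD; first by apply: sepcontZ; exact: sepcont_g.
  apply: sepcontZ; apply: sepcont_sum => j _; apply: sepcontB; [exact: sepcont_g|exact: sw_s].
have pB (f h : Defs.Rn R n -> C) : polybd f -> polybd h -> polybd (fun x => f x - h x).
  move=> pf ph; have := polybdD pf (polybdZ (-1) ph); congr polybd.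
  by apply/funext => x; rewrite mulN1r.
have ph : polybd (gG_dunkl k G0 lam l).
  apply: polybdD; first by apply: polybdZ; exact: polybd_g.
  apply: polybdZ; apply: polybd_sum => j _; apply: pB; [exact: polybd_g|exact: sw_p].
rewrite -[z l]opprK -[- z l]/(cvopp z l).
rewrite (ibp k0 a0 (sepcont_Er (cvopp z)) (expbd_K z0) sepcont_g polybd_g sh ph (dform_Er (cvopp z) l hE) (dform_gG hG lam l)).
rewrite (eq_bigr (fun j => Phi (sw l j z))); last by move=> j _; rewrite (cI_K_swap l j z0 sepcont_g).
congr (_ + _).
have i0 : ci (fun x => K z x * g x * W x) := ci_Kf z0 sepcont_g polybd_g.
have is_ j : ci (fun x => K z x * g (vsw l j x) * W x) := ci_Kf z0 (sw_s j) (sw_p j).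
rewrite [X in _ = _ + toC k * X](eq_bigr (fun j => cI (fun x => K z x * g x * W x - K z x * g (vsw l j x) * W x))); last first.
  by move=> j _; rewrite (cI_B i0 (is_ j)) (cI_K_swap l j z0 sepcont_g).
rewrite -cI_sum; last by move=> j _; exact: ciB.
rewrite mulrDl addrAC; congr (_ + _).
rewrite -!cI_Z//; last by apply: ci_sum => j _; exact: ciB.
rewrite -cI_D; last 2 first.
- exact: ciZ.
- by apply: ciZ; apply: ci_sum => j _; exact: ciB.
apply: cI_eq => x xp; rewrite /gG_dunkl mulrDr mulrDl; congr (_ + _).
  by rewrite mulrCA !mulrA.
rewrite [K z x * (_ * _)]mulrCA -[LHS]mulrA; congr (toC k * _).
rewrite big_distrr big_distrl; apply: eq_bigr => j _ /=.
by rewrite mulrBr mulrBl.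
Qed.

Definition majorant (e : R) (p q : nat) (x : Rn) : R :=
  expR (- e * vsum x) * (vsum x ^+ p * (1 + vsum x ^+ q)) * Wr k a x.

Lemma rint_majorant e p q : 0 < e -> rint (majorant e p q).
Proof.
move=> e0.
have sS : sepcont (fun x : Rn => toC (vsum x)).
  rewrite (_ : (fun x => _) = (fun x : Rn => \sum_(i < n) toC (x i))); last first.
    by apply/funext => x; rewrite toC_sum.
  by apply: sepcont_sum => i _; exact: sepcont_coord.
have pS : polybd (fun x : Rn => toC (vsum x)).
  rewrite (_ : (fun x => _) = (fun x : Rn => \sum_(i < n) toC (x i))); last first.
    by apply/funext => x; rewrite toC_sum.
  by apply: polybd_sum => i _; exact: polybd_coord.
have sX q' : sepcont (fun x : Rn => toC (vsum x) ^+ q').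
  elim: q' => [|q' IH]; first by rewrite (_ : (fun x => _) = (fun _ => 1)); [exact: sepcont_cst|apply/funext].
  rewrite (_ : (fun x => _) = (fun x : Rn => toC (vsum x) * toC (vsum x) ^+ q')); first exact: sepcontM.
  by apply/funext => x; rewrite exprS.
have pX q' : polybd (fun x : Rn => toC (vsum x) ^+ q').
  elim: q' => [|q' IH]; first by rewrite (_ : (fun x => _) = (fun _ => 1)); [exact: polybd_cst|apply/funext].
  rewrite (_ : (fun x => _) = (fun x : Rn => toC (vsum x) * toC (vsum x) ^+ q')); first exact: polybdM.
  by apply/funext => x; rewrite exprS.
pose f (x : Rn) := toC (expR (- e * vsum x)) * (toC (vsum x) ^+ p * (1 + toC (vsum x) ^+ q)).
have sf : sepcont f.
  apply: sepcontM; last by apply: sepcontM => //; apply: sepcontD => //; exact: sepcont_cst.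
  move=> x l xp; apply: ccont_real.
  apply: (@continuous_comp R R R (fun t : R => - e * vsum (upd x l t)) (@expR R)); last exact: continuous_expR.
  by apply: cvgMr; apply: continuous_bigsum => i; exact: upd_cont.
have ef : expbd f.
  apply: expbdM; last by apply: polybdM => //; apply: polybdD => //; exact: polybd_cst.
  exists 1, e; split=> // x xp; by rewrite mul1r cnorm_toC ger0_norm ?expR_ge0.
have [h _] := ci_good k0 a0 sf ef; apply: rint_eq h => x xp.
rewrite /f /majorant -toC1 -!(rmorphXn (@real_complex R)) -[real_complex R]/(@toC R).
by rewrite -toCD -!toCM.
Qed.

(** A depends only on e and p, so the first and second order bounds on the kernel pass to the
    integrals uniformly in z. *)
Lemma Phi_pert (e : R) (p : nat) : 0 < e -> exists2 A, 0 <= A & forall (u : Rn -> C) (c : R), 0 <= c ->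
  ci (fun x => u x * g x * W x) ->
  (forall x, D x -> cnorm (u x) <= c * vsum x ^+ p * expR (- e * vsum x)) ->
  cnorm (cI (fun x => u x * g x * W x)) <= A * c.
Proof.
move=> e0; have [B [q [B0 hB]]] := polybd_g.
have iM := rint_majorant p q e0.
have rM0 : 0 <= rI (majorant e p q).
  apply: Rintegral_ge0 => x xp; have S0 := vsum_ge0 xp.
  apply: mulr_ge0; last exact: Wr_ge0.
  by apply: mulr_ge0; [exact: expR_ge0|rewrite mulr_ge0 ?addr_ge0 ?exprn_ge0].
exists (2 * (B * rI (majorant e p q))); first by rewrite !mulr_ge0.
move=> u c c0 iu hu.
have := cI_norm iu (rintZ (c * B) iM); rewrite rI_Z// => h.
rewrite [leRHS](_ : _ = 2 * (c * B * rI (majorant e p q))); last by ring.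
apply: h => x xp; rewrite [cnorm (_ * _)]cnormM [cnorm (u x * _)]cnormM cnorm_toC [`|Wr k a x|]ger0_norm ?Wr_ge0//.
rewrite /majorant [leRHS]mulrA ler_wpM2r ?Wr_ge0//.
rewrite [leRHS](_ : _ = (c * vsum x ^+ p * expR (- e * vsum x)) * (B * (1 + vsum x ^+ q))); last by ring.
by rewrite ler_pM ?cnorm_ge0//; [exact: hu|exact: hB].
Qed.

End LaplaceTransform.

Lemma psum_offdiag (R : realType) n (b : 'I_n -> 'I_n -> R[i]) :
  \sum_(i < n) \sum_(j < n | j != i) b i j = psum (fun i j => b i j + b j i).
Proof.
have E : psum (fun i j => b j i) = \sum_(i < n) \sum_(j < n | (j < i)%N) b i j.
  by rewrite /psum (exchange_big_dep xpredT).
rewrite psumD E /psum -big_split /=; apply: eq_bigr => i _.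
rewrite [LHS](bigID (fun j : 'I_n => (i < j)%N)) /=; congr (_ + _).
  apply: eq_bigl => j; rewrite andbC; case: ltnP => //= ij.
  by rewrite -val_eqE /= gtn_eqF.
by apply: eq_bigl => j; rewrite -leqNgt ltn_neqAle val_eqE.
Qed.

Section LaplaceChar.
Variables (R : realType) (m : nat) (k a : R) (E G0 : Cn R m.+1 -> Cn R m.+1 -> R[i]).
Hypothesis k0 : 0 <= k.
Hypothesis a0 : 0 < a.
Hypothesis hE : is_dunkl_kernel k E.
Hypothesis hG : is_cherednik0 k G0.
Variable lam : Cn R m.+1.
Local Notation C := R[i].
Local Notation Re := (@complex.Re R).
Local Notation Im := (@complex.Im R).
Hypothesis lam0 : forall i, 0 <= Re (lam i).
Local Notation n := m.+1.
Local Notation Rn := (vec R n).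
Local Notation Cn := (Cn R n).
Local Notation D := (@vpos R n).
Local Notation W x := (toC (Wr k a x)).
Local Notation g := (gG G0 lam).
Local Notation K z := (Er E (cvopp z)).
Local Notation cn := (cn R n).
Local Notation Phi := (Phi k a E G0 lam).
Local Notation PhiX := (PhiX k a E G0 lam).
Local Opaque Er gG Wr vsum.

Let ciK z : (forall i, 0 < Re (z i)) -> ci (fun x => K z x * g x * W x).
Proof. by move=> z0; exact: (ci_Kf k0 a0 hE z0 (sepcont_g hG lam) (polybd_g k0 hG lam0)). Qed.

Lemma Phi_lip (e : R) : 0 < e -> exists2 A, 0 <= A & forall (z z' : Cn) (H : R), 0 <= H ->
  (forall i, e <= Re (z i)) -> (forall i, e <= Re (z' i)) -> (forall i, cnorm (z' i - z i) <= H) ->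
  cnorm (Phi z' - Phi z) <= A * H.
Proof.
move=> e0; have [A A0 hA] := Phi_pert k0 a0 hG lam0 1 e0.
exists (A * (cn * cn)); first by rewrite !mulr_ge0 ?cn_ge0.
move=> z z' H H0 hz hz' hH.
have z0 i : 0 < Re (z i) := lt_le_trans e0 (hz i).
have z0' i : 0 < Re (z' i) := lt_le_trans e0 (hz' i).
have E1 : Phi z' - Phi z = cI (fun x => (K z' x - K z x) * g x * W x).
  rewrite -cI_B; [|exact: ciK|exact: ciK].
  by apply: cI_eq => x _; rewrite !mulrBl.
have i1 : ci (fun x => (K z' x - K z x) * g x * W x).
  apply: ci_eq (ciB (ciK z0') (ciK z0)) => x _; by rewrite !mulrBl.
rewrite E1 -mulrA; apply: hA => //; first by rewrite !mulr_ge0 ?cn_ge0.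
move=> x xp.
rewrite [leRHS](_ : _ = cn * H * cn * vsum x ^+ 1 * expR (- e * vsum x)); last by ring.
apply: (Er_lip k0 hE) => // i; rewrite /cvopp ?cReN ?lerN2//.
by rewrite opprK addrC cnorm_distC.
Qed.

(** The integral of [dEr] at -z in the direction -eta against g W; the two signs cancel in the
    quotients (eta_i - eta_j)/(z_i - z_j). *)
Definition dPhi (z eta : Cn) : C := - (\sum_(l < n) eta l * PhiX l z)
  - toC k * psum (fun i j => (eta i - eta j) / (z i - z j) * (Phi z - Phi (sw i j z))).

Lemma ci_PhiX l z : (forall i, 0 < Re (z i)) -> ci (fun x => toC (x l) * (K z x * g x) * W x).
Proof.
move=> z0; have sg := sepcontM (@sepcont_coord R n l) (sepcont_g hG lam).
have pg := polybdM (@polybd_coord R n l) (polybd_g k0 hG lam0).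
by apply: ci_eq (ci_Kf k0 a0 hE z0 sg pg) => x _; rewrite mulrCA.
Qed.

Lemma dPhi_cI z z' : (forall i, 0 < Re (z i)) ->
  let f := fun x => dEr k E (cvopp z) (cvopp z') x * g x * W x in
  ci f /\ cI f = dPhi z (fun i => z' i - z i).
Proof.
move=> z0 f.
have z0s i j l : 0 < Re (sw i j z l) by exact: z0.
pose f1 x := \sum_(l < n) (z' l - z l) * (toC (x l) * (K z x * g x) * W x).
pose f2 i j x := (z' i - z i - (z' j - z j)) / (z i - z j) * (K z x * g x * W x - K (sw i j z) x * g x * W x).
pose f3 x := \sum_(i < n) \sum_(j < n | (i < j)%N) f2 i j x.
have i2 i j : ci (f2 i j) by apply: ciZ; apply: ciB; apply: ciK => // l; exact: z0s.
have i3' (i : 'I_n) : ci (fun x => \sum_(j < n | (i < j)%N) f2 i j x) by apply: ci_sum => j _; exact: i2.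
have i3 : ci f3 by apply: ci_sum => i _; exact: i3'.
have i1' l : ci (fun x => (z' l - z l) * (toC (x l) * (K z x * g x) * W x)) by apply: ciZ; exact: ci_PhiX.
have i1 : ci f1 by apply: ci_sum => l _; exact: i1'.
have ff x : f x = - f1 x - toC k * f3 x.
  rewrite /f /dEr mulrBl mulrBl; congr (_ - _).
    rewrite /f1 /cdot -sumrN !big_distrl; apply: eq_bigr => l _ /=.
    by rewrite /cvopp /toCn; ring.
  rewrite -mulrA -mulrA; congr (toC k * _).
  rewrite /psum /f3 big_distrl; apply: eq_bigr => i _ /=; rewrite big_distrl; apply: eq_bigr => j _ /=.
  have -> : cvopp z i - cvopp z j = - (z i - z j) by rewrite /cvopp; ring.
  rewrite /f2 -[Er E (sw i j (cvopp z)) x]/(K (sw i j z) x) invrN /cvopp.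
  move: (z i - z j)^-1 (Er _ _ _) (Er _ _ _) => q s1 s2; ring.
have i4 : ci (fun x => toC k * f3 x) by exact: ciZ.
split; first by apply: ci_eq (ciB (ciN i1) i4) => x _; rewrite ff.
have -> : cI f = cI (fun x => - f1 x - toC k * f3 x) by apply: cI_eq => x _; exact: ff.
rewrite cI_B//; last exact: ciN.
rewrite cI_N// cI_Z// /f1 cI_sum//; rewrite /dPhi; congr (- _ - _ * _).
  by apply: eq_bigr => l _; rewrite cI_Z//; exact: ci_PhiX.
rewrite /f3 cI_sum//; apply: eq_bigr => i _; rewrite cI_sum//; apply: eq_bigr => j _.
rewrite /f2 cI_Z; last by apply: ciB; apply: ciK => // l; exact: z0s.
by rewrite cI_B//; apply: ciK => // l; exact: z0s.
Qed.

Lemma Phi_taylor (e : R) : 0 < e -> exists2 A, 0 <= A & forall (z z' : Cn) (H : R), 0 <= H ->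
  distinct_coords z ->
  (forall i, e <= Re (z i)) -> (forall i, e <= Re (z' i)) -> (forall i, cnorm (z' i - z i) <= H) ->
  cnorm (Phi z' - Phi z - dPhi z (fun i => z' i - z i)) <= A * H ^+ 2.
Proof.
move=> e0; have [A A0 hA] := Phi_pert k0 a0 hG lam0 2 e0.
exists (A * (cn * cn * cn)); first by rewrite !mulr_ge0 ?cn_ge0.
move=> z z' H H0 zd hz hz' hH.
have z0 i : 0 < Re (z i) := lt_le_trans e0 (hz i).
have z0' i : 0 < Re (z' i) := lt_le_trans e0 (hz' i).
have [i1 E1] := dPhi_cI z' z0; rewrite -E1.
have i2 := ciB (ciK z0') (ciK z0).
have -> : Phi z' - Phi z = cI (fun x => K z' x * g x * W x - K z x * g x * W x).
  by rewrite cI_B//; exact: ciK.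
rewrite -cI_B//.
rewrite (@cI_eq _ _ _ (fun x => (K z' x - K z x - dEr k E (cvopp z) (cvopp z') x) * g x * W x)); last first.
  by move=> x _; rewrite !mulrBl.
rewrite -mulrA; apply: hA => //; first by rewrite !mulr_ge0 ?cn_ge0 ?exprn_ge0.
  by apply: ci_eq (ciB i2 i1) => x _; rewrite !mulrBl.
move=> x xp.
rewrite [leRHS](_ : _ = cn * H * cn * H * cn * vsum x ^+ 2 * expR (- e * vsum x)); last by ring.
apply: (Er_taylor k0 hE) => // i; rewrite /cvopp ?cReN ?lerN2//.
  by rewrite opprK addrC cnorm_distC.
by move=> j ij; rewrite (inj_eq (@oppr_inj _)); exact: zd.
Qed.

Definition expN (zeta : Cn) : Cn := fun i => cexp (- zeta i).
(** The relation a = mu - mu0 solved for mu, with m = n - 1. *)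
Definition mu_of_weight : R := a + k * m%:R.
(** For z = exp(-zeta) the second factor is Delta(z)^mu, and log (1/z), at which the Cherednik
    kernel is to be evaluated, becomes zeta. *)
Definition Psi (zeta : Cn) : C := Phi (expN zeta) * cexp (- (toC mu_of_weight * csum zeta)).

Lemma expN_Re zeta : box zeta -> forall i, 0 < Re (expN zeta i).
Proof.
move=> zb i; have := zb i; rewrite ltr_norml => /andP[h1 h2].
rewrite /expN /cexp /= cImN cosN mulr_gt0 ?expR_gt0//.
by apply: cos_gt0_pihalf; apply/andP.
Qed.

Lemma expN_sw i j zeta : expN (sw i j zeta) = sw i j (expN zeta).
Proof. by []. Qed.

Lemma expN_distinct zeta : redistinct zeta -> distinct_coords (expN zeta).
Proof.
move=> zd i j ij; apply/eqP => e.
have /eqP := congr1 (@cnorm R) e; rewrite !cnorm_cexp !cReN (inj_eq (@expR_inj R)) eqr_opp => h.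
by have := zd i j ij; rewrite h.
Qed.

Lemma near_Re_ge (z : R -> Cn) (t : R) : (forall i, ccont (fun s => z s i) t) -> (forall i, 0 < Re (z t i)) ->
  exists2 e : R, 0 < e & (forall i, e <= Re (z t i)) /\ \forall s \near t, forall i, e <= Re (z s i).
Proof.
move=> cz z0; have [e e0 he] := re_min z0.
have e2 : 0 < e / 2 by rewrite divr_gt0.
exists (e / 2) => //; split; first by move=> i; apply: le_trans (he i); rewrite ler_pdivrMr// ler_peMr ?ltW// ltrDl.
suff H i : \forall s \near t, e / 2 <= Re (z s i) by exact: (@filter_forall _ _ (fun i s => e / 2 <= Re (z s i)) _ (nbhs_filter t) H).
apply: filterS (ccont_dist e2 (cz i)) => s hs.
have h1 := Re_le_cnorm (z s i - z t i); have h2 := he i.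
have h3 : - (Re (z s i) - Re (z t i)) <= `|Re (z s i - z t i)| by rewrite -cReN -cReD -normrN ler_norm.
by lra.
Qed.

Lemma Psi_path (p : R -> Cn) t : (forall i, ccont (fun s => p s i) t) -> box (p t) -> ccont (fun s => Psi (p s)) t.
Proof.
move=> cp pb; apply: ccontM; last first.
  by apply: ccont_cexp; apply: ccontN; apply: ccontM; [exact: ccont_cst|apply: ccont_sum => i _].
have cz i : ccont (fun s => expN (p s) i) t by apply: ccont_cexp; exact: ccontN.
have [e e0 [he hs]] := near_Re_ge cz (expN_Re pb).
have [A A0 hA] := Phi_lip e0.
pose u s := \sum_(i < n) cnorm (expN (p s) i - expN (p t) i).
have cu : {for t, continuous (fun s => A * u s)}.
  apply: cvgMr; apply: continuous_bigsum => i; apply: ccont_cnorm; apply: ccontB => //; exact: ccont_cst.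
have ut : u t = 0 by rewrite /u big1// => i _; rewrite subrr cnorm0.
apply: ccont_near => d d0.
have hu : \forall s \near t, A * u s < d by apply: (cvgr_lt _ cu); rewrite ut mulr0.
apply: filterS2 hs hu => s h1 h2; apply: le_lt_trans h2; apply: hA => //.
  by apply: sumr_ge0 => i _; exact: cnorm_ge0.
by move=> i; rewrite /u (bigD1 i)//= lerDl sumr_ge0// => j _; exact: cnorm_ge0.
Qed.

Lemma cderiv_dPhi z (v : R -> Cn) (dv : Cn) t : (forall i, cderiv (fun s => v s i) t (dv i)) ->
  cderiv (fun s => dPhi z (v s)) t (dPhi z dv).
Proof.
move=> hv; apply: cderivB.
  apply: cderivN; apply: cderiv_sum => l _.
  by apply: cderiv_eq (cderivM (hv l) (cderiv_cst _ _)) _; rewrite mulr0 addr0.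
apply: cderivZ; apply: cderiv_sum => i _; apply: cderiv_sum => j _.
apply: cderiv_eq (cderivM (cderivM (cderivB (hv i) (hv j)) (cderiv_cst _ _)) (cderiv_cst _ _)) _.
by rewrite !mulr0 !addr0.
Qed.

(** The Taylor bound, uniform near z 0, replaces differentiation under the integral sign. *)
Lemma Phi_cderiv (z : R -> Cn) (dz : Cn) : (forall i, cderiv (fun s => z s i) 0 (dz i)) ->
  (forall i, 0 < Re (z 0 i)) -> distinct_coords (z 0) -> cderiv (fun s => Phi (z s)) 0 (dPhi (z 0) dz).
Proof.
move=> hz z0 zd.
have [e e0 [he hs]] := near_Re_ge (fun i => cderiv_cont (hz i)) z0.
have [A A0 hA] := Phi_taylor e0.
pose r s := Phi (z s) - Phi (z 0) - dPhi (z 0) (fun i => z s i - z 0 i).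
have d0 : dPhi (z 0) (fun i => z 0 i - z 0 i) = 0.
  rewrite /dPhi big1; last by move=> l _; rewrite subrr mul0r.
  rewrite /psum big1 ?mulr0 ?oppr0 ?addr0// => i _; rewrite big1// => j _.
  by rewrite !subrr !mul0r.
have hr : cderiv r 0 0.
  apply: (cderiv_quadratic A0 hz); first by rewrite /r subrr d0 subrr.
  apply: filterS hs => s hs.
  have S0 : 0 <= \sum_(i < n) cnorm (z s i - z 0 i) ^+ 2 by apply: sumr_ge0 => i _; exact: sqr_ge0.
  rewrite -[X in A * X](sqr_sqrtr S0); apply: hA => //.
  move=> i; rewrite -[leLHS]ger0_norm ?cnorm_ge0// -sqrtr_sqr ler_wsqrtr// (bigD1 i)//= lerDl.
  by apply: sumr_ge0 => j _; exact: sqr_ge0.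
have hd : cderiv (fun s => dPhi (z 0) (fun i => z s i - z 0 i)) 0 (dPhi (z 0) dz).
  apply: cderiv_dPhi => i; apply: cderiv_eq (cderivB (hz i) (cderiv_cst _ _)) _; by rewrite subr0.
have H := cderivD (cderivD (cderiv_cst (Phi (z 0)) 0) hd) hr.
rewrite (_ : (fun s => _) = (fun s => Phi (z 0) + dPhi (z 0) (fun i => z s i - z 0 i) + r s)); last first.
  by apply/funext => s; rewrite /r; ring.
by apply: cderiv_eq H _; rewrite add0r addr0.
Qed.

(** [PhiX_eq] is summed over l with weights eta_l. The unreflected part of the pairs j != l yields k
    m csum eta and so completes a to mu; the other pair terms combine into the denominators 1 -
    z_j/z_i. *)
Lemma dPhi_cherednik (z eta : Cn) : (forall i, 0 < Re (z i)) -> distinct_coords z ->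
  dPhi z (fun i => - eta i * z i) =
  (cdot lam eta + cdot (toCn (@rho R n k)) eta + toC mu_of_weight * csum eta) * Phi z
  - toC k * psum (fun i j => (eta j - eta i) * (Phi z - Phi (sw i j z)) / (1 - z j / z i)).
Proof.
move=> z0 zd.
pose P i j := Phi z - Phi (sw i j z).
have Ps i j : P i j = P j i by rewrite /P /sw tpermC.
have e1 : \sum_(l < n) (- eta l * z l) * PhiX l z = - \sum_(l < n) eta l * (z l * PhiX l z).
  by rewrite -sumrN; apply: eq_bigr => l _; rewrite !mulNr mulrA.
have e2 : \sum_(l < n) eta l * (z l * PhiX l z) =
   (cdot lam eta + cdot (toCn (@rho R n k)) eta + toC a * csum eta) * Phi z
   + toC k * psum (fun i j => eta i * P i j)
   + toC k * \sum_(l < n) \sum_(j < n | j != l) eta l * (Phi z - P l j).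
  rewrite /cdot /csum /psum [toC a * _]big_distrr -!big_split /= big_distrl !big_distrr -!big_split /=.
  apply: eq_bigr => l _; rewrite (PhiX_eq k0 a0 hE hG lam0)// -!big_distrr /=.
  rewrite [\sum_(j < n | j != l) (Phi z - P l j)](eq_bigr (fun j => Phi (sw l j z))); last first.
    by move=> j _; rewrite /P opprB addrC subrK.
  by rewrite /toCn /P; ring.
have e3 : \sum_(l < n) \sum_(j < n | j != l) eta l * (Phi z - P l j) =
   m%:R * csum eta * Phi z - psum (fun i j => (eta i + eta j) * P i j).
  transitivity (\sum_(l < n) \sum_(j < n | j != l) eta l * Phi z -
                \sum_(l < n) \sum_(j < n | j != l) eta l * P l j).
    rewrite -sumrB; apply: eq_bigr => l _; rewrite -sumrB; apply: eq_bigr => j _; ring.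
  congr (_ - _); last first.
    rewrite psum_offdiag; apply: eq_psum => i j _; rewrite [P j i]Ps; ring.
  rewrite /csum big_distrr /= big_distrl /=; apply: eq_bigr => l _.
  by rewrite sumr_const cardC1 card_ord /= -[LHS]mulr_natl mulrA.
rewrite /dPhi e1 opprK e2 e3 mulrBr.
have e4 : psum (fun i j => (eta j - eta i) * (Phi z - Phi (sw i j z)) / (1 - z j / z i)) =
   - psum (fun i j => eta i * P i j) + psum (fun i j => (eta i + eta j) * P i j)
   + psum (fun i j => (- eta i * z i - - eta j * z j) / (z i - z j) * P i j).
  rewrite -psumN -!psumD; apply: eq_psum => i j ij.
  have zi : z i != 0 by apply/eqP => h; have := z0 i; rewrite h cRe0 ltxx.
  have zij : z i - z j != 0 by rewrite subr_eq0 zd// -val_eqE neq_ltn ij.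
  have q1 : 1 - z j / z i = (z i - z j) / z i by rewrite mulrBl divff.
  rewrite q1 -/(P i j); move: (P i j) => p; field.
  by rewrite zij zi.
rewrite e4 /mu_of_weight toCD toCM toC_nat -/P; ring.
Qed.

Lemma Psi_chdir zeta eta : box zeta -> redistinct zeta -> chdir k lam Psi zeta eta.
Proof.
move=> zb zd.
have ha i : cderiv (fun s => along zeta eta s i) 0 (eta i).
  apply: cderiv_eq (cderivD (cderiv_cst (zeta i) 0) (cderivM (@cderiv_id R 0) (cderiv_cst (eta i) 0))) _.
  by rewrite add0r mul1r mulr0 addr0.
have hz i : cderiv (fun s => expN (along zeta eta s) i) 0 (- eta i * expN zeta i).
  have := cderiv_cexp (cderivN (ha i)); rewrite along0; exact.
have h1 : cderiv (fun s => Phi (expN (along zeta eta s))) 0 (dPhi (expN zeta) (fun i => - eta i * expN zeta i)).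
  have := @Phi_cderiv (fun s => expN (along zeta eta s)) _ hz; rewrite along0; apply.
    exact: expN_Re.
  exact: expN_distinct.
have h2 : cderiv (fun s => cexp (- (toC mu_of_weight * csum (along zeta eta s)))) 0
   (- (toC mu_of_weight * csum eta) * cexp (- (toC mu_of_weight * csum zeta))).
  have := cderiv_cexp (cderivN (cderivZ (toC mu_of_weight) (@cderiv_sum _ _ (index_enum 'I_n) xpredT _ _ _ (fun i _ => ha i)))).
  by rewrite along0.
apply: cderiv_eq (cderivM h1 h2) _; rewrite along0 dPhi_cherednik; [|exact: expN_Re|exact: expN_distinct].
rewrite /chrhs /Psi.
have -> : psum (fun i j => (eta j - eta i) * (Phi (expN zeta) * cexp (- (toC mu_of_weight * csum zeta)) -
     Phi (expN (sw i j zeta)) * cexp (- (toC mu_of_weight * csum (sw i j zeta)))) / (1 - cexp (- (zeta j - zeta i)))) =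
   cexp (- (toC mu_of_weight * csum zeta)) * psum (fun i j => (eta j - eta i) *
     (Phi (expN zeta) - Phi (sw i j (expN zeta))) / (1 - expN zeta j / expN zeta i)).
  rewrite -psumZ; apply: eq_psum => i j _; rewrite csum_sw expN_sw /expN -[(cexp (- zeta i))^-1]cexpN opprK -cexpD.
  by rewrite opprB (addrC (zeta i)); ring.
ring.
Qed.

Lemma Psi_chsol : chsol k lam Psi.
Proof. by split=> [|z xi|z xi zb zd _]; [exact: Psi_path|exact: Psi_chdir|exact: Psi_chdir]. Qed.

Lemma Phi_formula z : (forall i, 0 < Re (z i)) ->
  Phi z = Phi (cvconst 1) * calG G0 lam (cvinv z) * Deltapow z (- toC mu_of_weight).
Proof.
move=> z0; pose zeta : Cn := fun i => - cLog (z i).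
have zb : box zeta by move=> i; rewrite /zeta cImN normrN Im_cLog.
have := chsol_unique k0 Psi_chsol (chsol_G lam hG) (G_at0 hG lam (fun _ => erefl)) zb.
rewrite /Psi; have -> : expN zeta = z by apply/funext => i; rewrite /expN /zeta opprK cLogK.
have -> : expN (@cvzero R n) = cvconst 1 by apply/funext => i; rewrite /expN /cvzero oppr0 cexp0.
have -> : csum (@cvzero R n) = 0 by rewrite /csum big1.
rewrite mulr0 oppr0 cexp0 mulr1 => h.
have -> : calG G0 lam (cvinv z) = Gker G0 lam zeta.
  by rewrite /calG; congr (Gker _ _ _); apply/funext => i; rewrite /cvlog /cvinv cLogV.
rewrite -h /Deltapow -mulrA -cexpD (_ : _ + _ = 0) ?cexp0 ?mulr1//.
by rewrite /csum /zeta sumrN; ring.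
Qed.

End LaplaceChar.

(** * Exponential moments and their asymptotics *)

Section Tame.
Variables (R : realType) (n : nat).
Local Notation C := R[i].
Local Notation Rn := (vec R n).

(** A class containing coordinates, [vsum] and calG and closed under products, on which the
    exponential moments exist and are linear. *)
Definition tame (f : Rn -> C) := sepcont f /\ polybd f.

Lemma tame_cst c : tame (fun _ => c).
Proof. by split; [exact: sepcont_cst|exact: polybd_cst]. Qed.
Lemma tameD f g : tame f -> tame g -> tame (fun x => f x + g x).
Proof. by move=> [s p] [s' p']; split; [exact: sepcontD|exact: polybdD]. Qed.
Lemma tameM f g : tame f -> tame g -> tame (fun x => f x * g x).
Proof. by move=> [s p] [s' p']; split; [exact: sepcontM|exact: polybdM]. Qed.
Lemma tameZ c f : tame f -> tame (fun x => c * f x).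
Proof. by move=> h; apply: tameM => //; exact: tame_cst. Qed.
Lemma tameN f : tame f -> tame (fun x => - f x).
Proof. by move=> /(tameZ (-1)); rewrite (_ : (fun x => _) = (fun x => - f x))//; apply/funext => x; rewrite mulN1r. Qed.
Lemma tameB f g : tame f -> tame g -> tame (fun x => f x - g x).
Proof. by move=> hf hg; apply: tameD => //; exact: tameN. Qed.
Lemma tame_sum I (r : seq I) (P : pred I) (F : I -> Rn -> C) :
  (forall i, tame (F i)) -> tame (fun x => \sum_(i <- r | P i) F i x).
Proof.
move=> h; split; first by apply: sepcont_sum => i _; case: (h i).
by apply: polybd_sum => i _; case: (h i).
Qed.
Lemma tame_prod I (r : seq I) (P : pred I) (F : I -> Rn -> C) :
  (forall i, tame (F i)) -> tame (fun x => \prod_(i <- r | P i) F i x).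
Proof.
move=> h; split; first by apply: sepcont_prod => i _; case: (h i).
by apply: polybd_prod => i _; case: (h i).
Qed.
Lemma tame_vperm (w : 'S_n) f : tame f -> tame (fun x => f (vperm w x)).
Proof. by move=> [s p]; split; [exact: sepcont_vperm|exact: polybd_vperm]. Qed.
Lemma tame_coord (l : 'I_n) : tame (fun x => toC (x l)).
Proof. by split; [exact: sepcont_coord|exact: polybd_coord]. Qed.
Lemma tameX f q : tame f -> tame (fun x => f x ^+ q).
Proof.
move=> h; elim: q => [|q IH].
  by rewrite (_ : (fun x => _) = (fun _ => 1)); [exact: tame_cst|apply/funext].
rewrite (_ : (fun x => _) = (fun x => f x * f x ^+ q)); first exact: tameM.
by apply/funext => x; rewrite exprS.
Qed.
Lemma tame_vsum : tame (fun x => toC (vsum x)).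
Proof.
rewrite (_ : (fun x => _) = (fun x : Rn => \sum_(i < n) toC (x i))); last first.
  by apply/funext => x; rewrite toC_sum.
by apply: tame_sum => i; exact: tame_coord.
Qed.

Lemma cI_real (u : Rn -> R) : cI (fun x => toC (u x)) = toC (rI u).
Proof.
rewrite /cI /toC; congr (_ +i* _).
by have := congr1 (@complex.Re R) (@cI0 R n).
Qed.

End Tame.

Section ExponentialMoments.
Variables (R : realType) (m : nat) (k : R).
Hypothesis k0 : 0 <= k.
Local Notation C := R[i].
Local Notation Re := (@complex.Re R).
Local Notation n := m.+1.
Local Notation Rn := (vec R n).
Local Notation D := (@vpos R n).
Local Notation S x := (toC (vsum x)).

Definition exp_vsum p (x : vec R p) : C := toC (expR (- vsum x)).
Definition betaI p a (f : vec R p -> C) : C := cI (fun x => exp_vsum x * f x * toC (Wr k a x)).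

Lemma vsum_upd (x : Rn) l t : vsum (upd x l t) = vsum x - x l + t.
Proof.
rewrite /vsum (bigD1 l)//= [in RHS](bigD1 l)//= /upd eqxx.
rewrite (eq_bigr x) => [|i /negPf -> //]; rewrite -/(upd _ _ _); lra.
Qed.

Lemma sepcont_eS p : sepcont (@exp_vsum p).
Proof.
move=> x l xp; apply: ccont_real.
apply: (@continuous_comp R R R (fun t : R => - vsum (upd x l t)) (@expR R)); last exact: continuous_expR.
by apply: cvgN; apply: continuous_bigsum => i; exact: upd_cont.
Qed.

Lemma expbd_eS p : expbd (@exp_vsum p).
Proof. by exists 1, 1; split=> // x _; rewrite /exp_vsum cnorm_toC ger0_norm ?expR_ge0// mulN1r mul1r. Qed.

Lemma eS_vperm p w (x : vec R p) : exp_vsum (vperm w x) = exp_vsum x.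
Proof. by rewrite /exp_vsum vsum_vperm. Qed.

Lemma vsum_deriv (x : Rn) l : is_derive (x l) (1 : R) (fun t => vsum (upd x l t)) 1.
Proof.
rewrite (_ : (fun t => _) = (fun t => (vsum x - x l) + t)); last by apply/funext => t; rewrite vsum_upd.
by apply: (is_derive_eq (is_deriveD (is_derive_cst _ _ _) (is_derive_id _ _))); rewrite add0r.
Qed.

Lemma dform_sym (f : Rn -> C) l d : (forall w x, f (vperm w x) = f x) ->
  (forall x, D x -> cderiv (fun t => f (upd x l t)) (x l) (d x)) ->
  dform k l f (fun x => toC (x l) * d x).
Proof.
move=> fs fd x xp xd; apply: cderiv_eq (fd x xp) _.
have xl0 : toC (x l) != 0 by rewrite toC_eq0 gt_eqF// xp.
rewrite big1 => [|j _]; last by rewrite /vsw fs subrr mul0r.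
by rewrite mulr0 subr0 mulrAC mulfV ?mul1r.
Qed.

Lemma dform_eS l : dform k l (@exp_vsum n) (fun x => -1 * toC (x l) * exp_vsum x).
Proof.
have := @dform_sym (@exp_vsum n) l (fun x => - exp_vsum x) (@eS_vperm n).
rewrite (_ : (fun x : Rn => toC (x l) * - exp_vsum x) = (fun x => -1 * toC (x l) * exp_vsum x)); last first.
  by apply/funext => x; ring.
apply=> x xp; rewrite (_ : - exp_vsum x = toC (- expR (- vsum x))); last by rewrite toCN.
apply: cderiv_real.
have := @is_derive1_comp _ (@expR R) (fun t => - vsum (upd x l t)) (x l) _ _ (is_derive_expR _) (is_deriveN (vsum_deriv x l)).
by rewrite upd_id mulrN1.
Qed.

Section Functional.
Variable a : R.
Hypothesis a0 : 0 < a.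

Lemma ci_b p (f : vec R p -> C) : tame f -> ci (fun x => exp_vsum x * f x * toC (Wr k a x)).
Proof.
move=> [sf pf]; apply: ci_good => //.
  by apply: sepcontM => //; exact: sepcont_eS.
by apply: expbdM => //; exact: expbd_eS.
Qed.

Lemma bI_real p (u : vec R p -> R) :
  betaI a (fun x => toC (u x)) = toC (rI (fun x => expR (- vsum x) * u x * Wr k a x)).
Proof. by rewrite -cI_real; apply: cI_eq => x _; rewrite !toCM. Qed.

Lemma rint_b p (u : vec R p -> R) : tame (fun x => toC (u x)) ->
  rint (fun x => expR (- vsum x) * u x * Wr k a x).
Proof.
move=> tu; have [h _] := ci_b tu; apply: rint_eq h => x _.
by rewrite /exp_vsum -!toCM.
Qed.

Lemma bI_eq p (f g : vec R p -> C) : (forall x, vpos x -> f x = g x) -> betaI a f = betaI a g.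
Proof. by move=> h; apply: cI_eq => x xp; rewrite h. Qed.

Lemma bID p (f g : vec R p -> C) : tame f -> tame g -> betaI a (fun x => f x + g x) = betaI a f + betaI a g.
Proof.
move=> hf hg; rewrite /betaI -cI_D; [|exact: ci_b|exact: ci_b].
by apply: cI_eq => x _; rewrite mulrDr mulrDl.
Qed.

Lemma bIZ p c (f : vec R p -> C) : tame f -> betaI a (fun x => c * f x) = c * betaI a f.
Proof.
move=> hf; rewrite /betaI -cI_Z; last exact: ci_b.
by apply: cI_eq => x _; ring.
Qed.

Lemma bIB p (f g : vec R p -> C) : tame f -> tame g -> betaI a (fun x => f x - g x) = betaI a f - betaI a g.
Proof.
move=> hf hg; rewrite -[- betaI a g]mulN1r -bIZ// -bID//; last exact: tameZ.
by apply: bI_eq => x _; rewrite mulN1r.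
Qed.

Lemma bI_sum p I (r : seq I) (P : pred I) (F : I -> vec R p -> C) : (forall i, tame (F i)) ->
  betaI a (fun x => \sum_(i <- r | P i) F i x) = \sum_(i <- r | P i) betaI a (F i).
Proof.
move=> hF; rewrite /betaI -cI_sum; last by move=> i _; exact: ci_b.
by apply: cI_eq => x _; rewrite big_distrr big_distrl.
Qed.

Lemma bI_vperm p w (f : vec R p -> C) : tame f -> betaI a (fun x => f (vperm w x)) = betaI a f.
Proof.
move=> hf; rewrite /betaI -[RHS](cI_vperm w (ci_b hf)).
by apply: cI_eq => x _; rewrite eS_vperm Wr_vperm.
Qed.

(** In [ibp] with the symmetric kernel exp(-vsum x), each of the m swapped integrals equals the
    unswapped one, which gives k m. *)
Lemma bI_rec l (f h : Rn -> C) : tame f -> tame h -> dform k l f h ->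
  betaI a (fun x => toC (x l) * f x) = betaI a h + toC (a + k * m%:R) * betaI a f.
Proof.
move=> tf [sh ph] df; have [sf pf] := tf.
have := ibp k0 a0 (@sepcont_eS n) (@expbd_eS n) sf pf sh ph (@dform_eS l) df.
rewrite opprK mul1r -/(betaI a h) -/(betaI a f).
rewrite (eq_bigr (fun=> betaI a f)); last by move=> j _; rewrite -/(betaI a (fun x => f (vsw l j x))) bI_vperm.
rewrite sumr_const cardC1 card_ord /= -[betaI a f *+ m]mulr_natl => h1.
rewrite toCD toCM toC_nat mulrDl -mulrA addrA -h1.
by apply: cI_eq => x _; rewrite mulrCA.
Qed.

End Functional.

Section Shift.
Variables (g : Rn -> C) (theta : 'I_n -> C).
Hypothesis tg : tame g.
Hypothesis dg : forall l : 'I_n,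
  dform k l g (fun x => theta l * g x + toC k * \sum_(j < n | (l < j)%N) (g x - g (vsw l j x))).

(** Partial products lead from g to Delta g one coordinate at a time. P l is invariant under s_lj
    for j > l, which suits the one-sided reflection sum in the equation of g. *)
Let P (l : nat) (x : Rn) : C := \prod_(i < n | (i < l)%N) toC (x i).

Lemma tame_P l : tame (P l).
Proof. by apply: tame_prod => i; exact: tame_coord. Qed.

Lemma P_gt (l j : 'I_n) x : (l < j)%N -> P l (vsw l j x) = P l x.
Proof.
move=> lj; apply: eq_bigr => i il; rewrite /vsw /vperm tpermD//.
  by rewrite -val_eqE gtn_eqF.
by rewrite -val_eqE gtn_eqF// (ltn_trans il).
Qed.

Lemma P_lt (l j : 'I_n) x : (j < l)%N -> D x -> P l (vsw l j x) = P l x * toC (x l) / toC (x j).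
Proof.
move=> jl xp; have xj0 : toC (x j) != 0 by rewrite toC_eq0 gt_eqF// xp.
rewrite /P (bigD1 j)//= [in RHS](bigD1 j)//= /vsw /vperm tpermR.
rewrite [X in _ * X = _](eq_bigr (fun i => toC (x i))); last first.
  move=> i /andP[il ij]; rewrite tpermD// eq_sym//.
  by rewrite -val_eqE ltn_eqF.
by move: (\prod_(i < n | _) _) (toC (x l)) => p y; field.
Qed.

Lemma P_upd (l : 'I_n) x t : P l (upd x l t) = P l x.
Proof.
apply: eq_bigr => i il; rewrite /upd ifF//; apply/negP => /eqP e.
by rewrite e ltnn in il.
Qed.

Lemma sum_ord_ltC (l : 'I_n) (c : C) : \sum_(i < n | (i < l)%N) c = l%:R * c.
Proof. by rewrite (big_ord_narrow (ltnW (ltn_ord l))) sumr_const card_ord -[LHS]mulr_natl. Qed.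

(** For j < l the swap multiplies P l by x_l/x_j; the resulting defect cancels the denominator x_l -
    x_j and leaves a regular term. *)
Lemma dform_Pg (l : 'I_n) : dform k l (fun x => P l x * g x)
  (fun x => P l x * (theta l * g x + toC k * \sum_(j < n | (l < j)%N) (g x - g (vsw l j x)))
     - toC k * \sum_(j < n | (j < l)%N) P l (vsw l j x) * g (vsw l j x)).
Proof.
move=> x xp xd.
have := cderivZ (P l x) (dg l xp xd).
rewrite (_ : (fun s => _) = (fun t => P l (upd x l t) * g (upd x l t))); last first.
  by apply/funext => t; rewrite P_upd.
move=> h; apply: cderiv_eq h _.
have xl0 : toC (x l) != 0 by rewrite toC_eq0 gt_eqF// xp.
move: (theta l * g x + _) => hg.
have e1 : \sum_(j < n | (j < l)%N) P l (vsw l j x) * g (vsw l j x) / toC (x l) =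
   \sum_(j < n | j != l) (if (j < l)%N then P l (vsw l j x) * g (vsw l j x) / toC (x l) else 0).
  rewrite -big_mkcondr /=; apply: eq_bigl => j.
  by case: ltngtP => //= jl; rewrite ?andbF ?andbT// -val_eqE /= ltn_eqF.
have e2 : \sum_(j < n | j != l) (P l x * g x - P l (vsw l j x) * g (vsw l j x)) / toC (x l - x j) =
  P l x * (\sum_(j < n | j != l) (g x - g (vsw l j x)) / toC (x l - x j))
  - \sum_(j < n | (j < l)%N) P l (vsw l j x) * g (vsw l j x) / toC (x l).
  rewrite e1 big_distrr -sumrB /=; apply: eq_bigr => j jl.
  have xj0 : toC (x j) != 0 by rewrite toC_eq0 gt_eqF// xp.
  have xlj : toC (x l) - toC (x j) != 0 by rewrite -toCB toC_eq0 subr_eq0 xd// eq_sym.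
  rewrite toCB; case: ifP => h; last first.
    have lj : (l < j)%N by rewrite ltn_neqAle eq_sym val_eqE jl /= leqNgt h.
    by rewrite P_gt// subr0; ring.
  rewrite P_lt//; move: (toC (x l)) (toC (x j)) xl0 xj0 xlj (P l x) (g x) (g _) => u v u0 v0 uv p q r.
  by field; rewrite uv v0 u0.
rewrite e2 -mulr_suml; move: (\sum_(j < n | j != l) _) (\sum_(j < n | (j < l)%N) _) (P l x) => s1 s2 p.
by field.
Qed.

(** By invariance of the functional the terms j > l integrate to zero, and each of the l terms j < l
    contributes -k, which turns a + k m into a + k (m - l). *)
Lemma bI_step a (l : 'I_n) : 0 < a ->
  betaI a (fun x => P l.+1 x * g x) = (theta l + toC a + toC (k * (m%:R - l%:R))) * betaI a (fun x => P l x * g x).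
Proof.
move=> a0.
have tPg := tameM (tame_P l) tg.
have tgs j : tame (fun x => g x - g (vsw l j x)) by apply: tameB => //; exact: (tame_vperm (tperm l j)).
have ts1 : tame (fun x => \sum_(j < n | (l < j)%N) (g x - g (vsw l j x))) by exact: tame_sum.
have t1 : tame (fun x => P l x * (theta l * g x + toC k * \sum_(j < n | (l < j)%N) (g x - g (vsw l j x)))).
  by apply: tameM; [exact: tame_P|apply: tameD; exact: tameZ].
have tf j : tame (fun x => P l (vsw l j x) * g (vsw l j x)) by exact: (tame_vperm (tperm l j) tPg).
have t2 : tame (fun x => \sum_(j < n | (j < l)%N) P l (vsw l j x) * g (vsw l j x)) by exact: tame_sum.
have := bI_rec a0 tPg (tameB t1 (tameZ (toC k) t2)) (@dform_Pg l).
have -> : betaI a (fun x => toC (x l) * (P l x * g x)) = betaI a (fun x => P l.+1 x * g x).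
  apply: bI_eq => x _; rewrite mulrA; congr (_ * _); rewrite /P [RHS](bigD1 l)//=; congr (_ * _).
  by apply: eq_bigl => i; rewrite ltnS ltn_neqAle andbC.
rewrite bIB//; last exact: tameZ.
rewrite bIZ// bI_sum//.
rewrite (eq_bigr (fun=> betaI a (fun x => P l x * g x))); last first.
  by move=> j _; rewrite (bI_vperm a0 (tperm l j) tPg).
rewrite sum_ord_ltC => ->.
have -> : betaI a (fun x => P l x * (theta l * g x + toC k * \sum_(j < n | (l < j)%N) (g x - g (vsw l j x)))) =
   theta l * betaI a (fun x => P l x * g x).
  rewrite (@bI_eq a _ _ (fun x => theta l * (P l x * g x) + toC k * \sum_(j < n | (l < j)%N)
     (P l x * g x - P l (vsw l j x) * g (vsw l j x)))); last first.
    move=> x _; rewrite mulrDr mulrCA; congr (_ + _); rewrite mulrCA; congr (_ * _).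
    by rewrite big_distrr; apply: eq_bigr => j lj /=; rewrite P_gt// mulrBr.
  have tB j : tame (fun x => P l x * g x - P l (vsw l j x) * g (vsw l j x)) by exact: tameB.
  have tsB : tame (fun x => \sum_(j < n | (l < j)%N) (P l x * g x - P l (vsw l j x) * g (vsw l j x))) by exact: tame_sum.
  rewrite bID//; [|exact: tameZ|exact: tameZ].
  rewrite !bIZ// bI_sum// big1 ?mulr0 ?addr0// => j _.
  by rewrite bIB// (bI_vperm a0 (tperm l j) tPg) subrr.
rewrite !(toCD, toCM, toCB, toC_nat); ring.
Qed.

(** After n steps all coordinates have been collected, and their product raises the exponent of the
    weight by 1. *)
Lemma bI_shift a : 0 < a ->
  betaI (a + 1) g = (\prod_(l < n) (theta l + toC a + toC (k * (m%:R - l%:R)))) * betaI a g.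
Proof.
move=> a0.
have H j : (j <= n)%N -> betaI a (fun x => P j x * g x) =
    (\prod_(l < n | (l < j)%N) (theta l + toC a + toC (k * (m%:R - l%:R)))) * betaI a g.
  elim: j => [_|j IH jn].
    rewrite big_pred0// mul1r; apply: bI_eq => x _.
    by rewrite /P big_pred0// mul1r.
  rewrite (bI_step (Ordinal jn) a0) /= IH ?(ltnW jn)//.
  rewrite [in RHS](bigD1 (Ordinal jn))//= mulrA; congr (_ * _ * _).
  by apply: eq_bigl => i; rewrite ltnS ltn_neqAle andbC.
have := H n (leqnn n).
rewrite (eq_bigl xpredT); last by move=> i; rewrite ltn_ord.
move=> <-; apply: cI_eq => x xp; rewrite /Wr.
have -> : a + 1 - 1 = (a - 1) + 1 by ring.
have -> : P n x = toC (\prod_(i < n) x i).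
  by rewrite toC_prod /P; apply: eq_bigl => i; rewrite ltn_ord.
rewrite mulrDl expRD mul1r expR_sum.
rewrite (_ : \prod_i expR (ln (x i)) = \prod_(i < n) x i); last by apply: eq_bigr => i _; rewrite lnK// posrE xp.
rewrite !toCM; ring.
Qed.

End Shift.

End ExponentialMoments.

Lemma toCX (R : realType) (x : R) q : toC (x ^+ q) = toC x ^+ q.
Proof. exact: (rmorphXn (@real_complex R)). Qed.

Section Moments.
Variables (R : realType) (m : nat) (k : R).
Hypothesis k0 : 0 <= k.
Local Notation C := R[i].
Local Notation Re := (@complex.Re R).
Local Notation n := m.+1.
Local Notation Rn := (vec R n).
Local Notation D := (@vpos R n).
Local Notation S x := (toC (vsum x)).
Local Notation betaI := (betaI k).
Local Notation b a := (betaI a (fun _ : Rn => 1)).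

Let tS q : tame (fun x : Rn => S x ^+ q).
Proof. by apply: tameX; exact: tame_vsum. Qed.
Let tx l : tame (fun x : Rn => toC (x l)) := @tame_coord R n l.
Let txS l q : tame (fun x : Rn => toC (x l) * S x ^+ q).
Proof. exact: tameM. Qed.
Let txxS l q : tame (fun x : Rn => toC (x l) * (toC (x l) * S x ^+ q)).
Proof. exact: tameM. Qed.

Lemma cderiv_vsumX (x : Rn) l q :
  cderiv (fun t => S (upd x l t) ^+ q) (x l) (q%:R * S x ^+ q.-1).
Proof.
have d1 : cderiv (fun t => S (upd x l t)) (x l) 1 by exact: (cderiv_real (vsum_deriv x l)).
elim: q => [|q IH].
  by rewrite (_ : (fun t => _) = (fun _ => 1)) ?mul0r; [exact: cderiv_cst|apply/funext].
rewrite (_ : (fun t => _) = (fun t => S (upd x l t) * S (upd x l t) ^+ q)); last by apply/funext => t; rewrite exprS.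
apply: cderiv_eq (cderivM d1 IH) _; rewrite upd_id /=.
case: q {IH} => [|q] /=; first by rewrite expr0; ring.
by rewrite -[q.+2%:R]natr1 exprS; ring.
Qed.

Section FixedWeight.
Variable a : R.
Hypothesis a0 : 0 < a.

Lemma bI_xS_step l q : betaI a (fun x : Rn => toC (x l) * S x ^+ q) =
  q%:R * betaI a (fun x : Rn => toC (x l) * S x ^+ q.-1) + toC (a + k * m%:R) * betaI a (fun x : Rn => S x ^+ q).
Proof.
have df : dform k l (fun x : Rn => S x ^+ q) (fun x => toC (x l) * (q%:R * S x ^+ q.-1)).
  apply: (@dform_sym R m k (fun x : Rn => S x ^+ q) l (fun x => q%:R * S x ^+ q.-1)).
    by move=> w x; rewrite vsum_vperm.
  by move=> x xp; exact: cderiv_vsumX.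
rewrite (bI_rec k0 a0 (tS q) _ df); last by apply: tameM => //; exact: tameZ.
by rewrite -(bIZ k0 a0 q%:R (txS l q.-1)); congr (_ + _); apply: bI_eq => x _; ring.
Qed.

Lemma bI_sum_xS q : \sum_(l < n) betaI a (fun x : Rn => toC (x l) * S x ^+ q) = betaI a (fun x : Rn => S x ^+ q.+1).
Proof.
rewrite -(bI_sum k0 a0)//; apply: bI_eq => x _.
by rewrite exprS /vsum toC_sum big_distrl.
Qed.

Lemma bI_S q : betaI a (fun x : Rn => S x ^+ q.+1) =
  (q%:R + n%:R * toC (a + k * m%:R)) * betaI a (fun x : Rn => S x ^+ q).
Proof.
rewrite -bI_sum_xS (eq_bigr _ (fun l _ => bI_xS_step l q)) big_split /= -big_distrr /= bI_sum_xS.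
rewrite sumr_const card_ord -[X in _ + X]mulr_natl mulrDl mulrA; congr (_ + _).
by case: q => [|q] //=; rewrite !mul0r.
Qed.

Lemma bI_xS l q : n%:R * betaI a (fun x : Rn => toC (x l) * S x ^+ q) = betaI a (fun x : Rn => S x ^+ q.+1).
Proof.
rewrite -bI_sum_xS (eq_bigr (fun=> betaI a (fun x : Rn => toC (x l) * S x ^+ q))); last first.
  move=> j _; rewrite -(bI_vperm k0 a0 (tperm j l) (txS j q)).
  by apply: bI_eq => x _; rewrite /vperm tpermL -/(vperm _ _) vsum_vperm.
by rewrite sumr_const card_ord -[RHS]mulr_natl.
Qed.

(** For f = x_l S^q every reflection quotient equals S^q, and this adds a second k m to the one from
    [bI_rec]. *)
Lemma bI_xxS l q : n%:R * betaI a (fun x : Rn => toC (x l) * (toC (x l) * S x ^+ q)) =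
  q%:R * (n%:R * betaI a (fun x : Rn => toC (x l) * (toC (x l) * S x ^+ q.-1)))
  + toC (1 + a + 2 * (k * m%:R)) * betaI a (fun x : Rn => S x ^+ q.+1).
Proof.
pose h (x : Rn) : C := toC (x l) * (S x ^+ q + q%:R * (toC (x l) * S x ^+ q.-1) + toC (k * m%:R) * S x ^+ q).
have th : tame h.
  by apply: tameM => //; apply: tameD; [apply: tameD => //; exact: tameZ|exact: tameZ].
have df : dform k l (fun x : Rn => toC (x l) * S x ^+ q) h.
  move=> x xp xd.
  have d0 : cderiv (fun t => toC (upd x l t l)) (x l) 1.
    by rewrite (_ : (fun t => _) = @toC R); [exact: cderiv_id|apply/funext => t; rewrite /upd eqxx].
  apply: cderiv_eq (cderivM d0 (cderiv_vsumX x l q)) _; rewrite upd_id.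
  have xl0 : toC (x l) != 0 by rewrite toC_eq0 gt_eqF// xp.
  rewrite (eq_bigr (fun=> S x ^+ q)); last first.
    move=> j jl; rewrite /vsw vsum_vperm /vperm tpermL -mulrBl -toCB mulrAC mulfV ?mul1r//.
    by rewrite toC_eq0 subr_eq0 xd// eq_sym.
  rewrite sumr_const cardC1 card_ord /= -[S x ^+ q *+ m]mulr_natl /h toCM toC_nat.
  move: (toC (x l)) xl0 (S x ^+ q) (S x ^+ q.-1) (q%:R) (m%:R) => u u0 s t q' m'; field.
  by rewrite u0.
have := bI_rec k0 a0 (txS l q) th df => ->.
have -> : betaI a h = betaI a (fun x : Rn => toC (x l) * S x ^+ q)
    + q%:R * betaI a (fun x : Rn => toC (x l) * (toC (x l) * S x ^+ q.-1))
    + toC (k * m%:R) * betaI a (fun x : Rn => toC (x l) * S x ^+ q).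
  have t1 := tameZ q%:R (txxS l q.-1); have t2 := tameZ (toC (k * m%:R)) (txS l q).
  rewrite -(bIZ k0 a0 q%:R (txxS l q.-1)) -(bIZ k0 a0 (toC (k * m%:R)) (txS l q)).
  rewrite -(bID k0 a0 (txS l q) t1) -(bID k0 a0 (tameD (txS l q) t1) t2).
  by apply: bI_eq => x _; rewrite /h; ring.
rewrite -(bI_xS l q) !(toCD, toCM, toC1, toC_nat); ring.
Qed.

End FixedWeight.

Section Asymptotics.
Variable a : R.
Hypothesis a0 : 0 < a.

Definition shiftN N : R := a + N%:R.
Lemma A_gt0 N : 0 < shiftN N. Proof. by rewrite ltr_wpDr. Qed.

Lemma invA_cvg : (fun N => (shiftN N)^-1) @ \oo --> (0 : R).
Proof.
apply/cvgrPdist_lt => e e0; near=> N.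
rewrite sub0r normrN gtr0_norm ?invr_gt0 ?A_gt0//.
rewrite invf_plt ?posrE ?A_gt0//.
have : e^-1 < N%:R by near: N; exact: nbhs_infty_gtr.
by move=> h; apply: lt_le_trans h _; rewrite /shiftN lerDr ltW.
Unshelve. all: by end_near. Qed.

(** After division by powers of [shiftN], the factor in the recursion [bI_S] tends to n: the
    coordinate sum behaves like n times [shiftN]. *)
Lemma moment_S q : exists2 u : nat -> R, u @ \oo --> (n%:R ^+ q : R) &
  forall N, betaI (shiftN N) (fun x : Rn => S x ^+ q) = toC (u N * shiftN N ^+ q) * b (shiftN N).
Proof.
elim: q => [|q [u cu hu]].
  exists (fun _ => 1); first by rewrite expr0; exact: cvg_cst.
  by move=> N; rewrite expr0 mulr1 mul1r; apply: bI_eq => x _; rewrite expr0.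
exists (fun N => (q%:R * (shiftN N)^-1 + n%:R * (1 + k * m%:R * (shiftN N)^-1)) * u N).
  rewrite exprS; apply: cvgM => //.
  have e : n%:R = q%:R * 0 + n%:R * (1 + k * m%:R * 0) :> R by rewrite !mulr0 add0r addr0 mulr1.
  rewrite [X in _ --> X]e.
  have c := invA_cvg.
  by apply: cvgD; [exact: cvgMr|apply: cvgMr; apply: cvgD; [exact: cvg_cst|exact: cvgMr]].
move=> N; rewrite (bI_S (A_gt0 N)) hu mulrA; congr (_ * _).
rewrite -[q%:R](toC_nat R) -[n%:R](toC_nat R) -toCM -toCD -toCM; congr toC.
have := A_gt0 N; move: (shiftN N) => A A0; have A1 : A != 0 by rewrite gt_eqF.
rewrite exprS; move: (A ^+ q) => Aq; field.
by rewrite A1.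
Qed.

Lemma moment_xxS (l : 'I_n) q : exists2 v : nat -> R, v @ \oo --> (n%:R ^+ q : R) &
  forall N, betaI (shiftN N) (fun x : Rn => toC (x l) * (toC (x l) * S x ^+ q)) = toC (v N * shiftN N ^+ q.+2) * b (shiftN N).
Proof.
have n0 : (n%:R : R) != 0 by rewrite pnatr_eq0.
have nC0 : (n%:R : C) != 0 by rewrite pnatr_eq0.
have [u0 cu0 hu0] := moment_S 1.
have c := invA_cvg.
have step q' (w u : nat -> R) (cw : R) : w @ \oo --> cw -> u @ \oo --> (n%:R ^+ q'.+1 : R) ->
  (fun N => q'%:R * (shiftN N)^-1 * w N + (1 + (1 + 2 * (k * m%:R)) * (shiftN N)^-1) * (u N / n%:R)) @ \oo --> (n%:R ^+ q' : R).
  move=> hw hu.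
  have e : (n%:R : R) ^+ q' = q'%:R * 0 * cw + (1 + (1 + 2 * (k * m%:R)) * 0) * (n%:R ^+ q'.+1 / n%:R).
    by rewrite !mulr0 mul0r add0r addr0 mul1r exprS mulrAC mulfV ?mul1r.
  rewrite [X in _ --> X]e.
  apply: cvgD; first by apply: cvgM => //; exact: cvgMr.
  by apply: cvgM; [apply: cvgD; [exact: cvg_cst|exact: cvgMr]|apply: cvgM => //; exact: cvg_cst].
elim: q => [|q [v cv hv]].
  (* At q = 0 the preceding sequence enters with coefficient 0, so the zero sequence is supplied for
     it. *)
  have := step 0%N (fun _ => 0) u0 0 (cvg_cst _) cu0; set v := (X in X @ \oo --> _) => cv.
  exists v; first exact: cv.
  move=> N; apply: (mulfI nC0); rewrite (bI_xxS (A_gt0 N)) mul0r add0r hu0 /v.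
  rewrite !mulrA; congr (_ * _).
  rewrite -[n%:R](toC_nat R) -!toCM; congr toC.
  have := A_gt0 N; move: (shiftN N) => A A0; have A1 : A != 0 by rewrite gt_eqF.
  by rewrite !exprS expr0; field; rewrite ?A1 -?(natrD R 1 m) ?n0.
have [u cu hu] := moment_S q.+2.
have := step q.+1 v u _ cv cu; set v' := (X in X @ \oo --> _) => cv'.
exists v'; first exact: cv'.
move=> N; apply: (mulfI nC0); rewrite (bI_xxS (A_gt0 N)) [q.+1.-1]/= hv hu /v'.
have key (q1 n1 c1 c2 d2 : R) (B : C) : toC q1 * (toC n1 * (toC c1 * B)) + toC c2 * (toC d2 * B)
   = toC (q1 * (n1 * c1) + c2 * d2) * B by rewrite !(toCD, toCM); ring.
rewrite -[n%:R](toC_nat R) -[q.+1%:R](toC_nat R) key [RHS]mulrA -toCM; congr (toC _ * _).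
have := A_gt0 N; move: (shiftN N) => A A0; have A1 : A != 0 by rewrite gt_eqF.
move: (q.+1%:R) (n%:R) n0 => q' n' n0'.
by rewrite !exprS; move: (A ^+ q) => Aq; field; rewrite A1 n0'.
Qed.

Lemma tame_dev l p (A : R) : tame (fun x : Rn => toC ((x l / A - 1) ^+ 2 * (vsum x / A) ^+ p)).
Proof.
rewrite (_ : (fun x => _) = (fun x : Rn => (toC A^-1 * toC (x l) - 1) ^+ 2 * (toC A^-1 * S x) ^+ p)); last first.
  apply/funext => x; rewrite -toC1 -!toCM -toCB -!toCX -toCM.
  by rewrite ![A^-1 * _]mulrC.
apply: tameM; apply: tameX; last by apply: tameZ; exact: tame_vsum.
by apply: tameB; [exact: tameZ|exact: tame_cst].
Qed.

(** A second moment bound in the spirit of Chebyshev: the limits of the three terms of the square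
    cancel as n^p - 2 n^p + n^p. The factor with the power q prepares for functions of polynomial
    growth. *)
Lemma moment_conc q : exists2 w : nat -> R, w @ \oo --> (0 : R) & forall N,
  betaI (shiftN N) (fun x : Rn => toC (\sum_(l < n) (x l / shiftN N - 1) ^+ 2 * (1 + (vsum x / shiftN N) ^+ q))) =
  toC (w N) * b (shiftN N).
Proof.
have n0 : (n%:R : R) != 0 by rewrite pnatr_eq0.
have nC0 : (n%:R : C) != 0 by rewrite pnatr_eq0.
have H p l : exists2 w : nat -> R, w @ \oo --> (0 : R) & forall N,
   betaI (shiftN N) (fun x : Rn => toC ((x l / shiftN N - 1) ^+ 2 * (vsum x / shiftN N) ^+ p)) = toC (w N) * b (shiftN N).
  have [v cv hv] := moment_xxS l p; have [u cu hu] := moment_S p; have [u1 cu1 hu1] := moment_S p.+1.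
  exists (fun N => v N - 2 * (u1 N / n%:R) + u N).
    have e : 0 = n%:R ^+ p - 2 * (n%:R ^+ p.+1 / n%:R) + n%:R ^+ p :> R.
      by rewrite exprS mulrAC mulfV// mul1r; ring.
    rewrite [X in _ --> X]e; apply: cvgD => //; apply: cvgB => //; apply: cvgMr; apply: cvgM => //; exact: cvg_cst.
  move=> N; have A0 := A_gt0 N; have A1 : shiftN N != 0 by rewrite gt_eqF.
  have AC : toC (shiftN N) != 0 by rewrite toC_eq0.
  transitivity (betaI (shiftN N) (fun x : Rn => toC ((shiftN N ^+ p.+2)^-1) * (toC (x l) * (toC (x l) * S x ^+ p))
     + (toC (- (2 / shiftN N ^+ p.+1)) * (toC (x l) * S x ^+ p) + toC ((shiftN N ^+ p)^-1) * S x ^+ p))).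
    apply: bI_eq => x _.
    rewrite -toCX -!toCM -!toCD; congr toC.
    rewrite expr_div_n !exprS; move: (shiftN N ^+ p) (expf_neq0 p A1) (vsum x ^+ p) => Ap Ap0 s.
    by field; rewrite A1 Ap0.
  rewrite (bID k0 A0 (tameZ _ (txxS l p)) (tameD (tameZ _ (txS l p)) (tameZ _ (tS p)))).
  rewrite (bID k0 A0 (tameZ _ (txS l p)) (tameZ _ (tS p))).
  rewrite !bIZ// hv hu.
  have -> : betaI (shiftN N) (fun x : Rn => toC (x l) * S x ^+ p) = toC (u1 N / n%:R * shiftN N ^+ p.+1) * b (shiftN N).
    by apply: (mulfI nC0); rewrite (bI_xS A0) hu1 mulrA -[n%:R](toC_nat R) -toCM; congr (toC _ * _); field; rewrite -?(natrD R 1 m).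
  have key (c1 d1 c2 d2 c3 d3 : R) (B : C) : toC c1 * (toC d1 * B) + (toC c2 * (toC d2 * B) + toC c3 * (toC d3 * B))
      = toC (c1 * d1 + (c2 * d2 + c3 * d3)) * B by rewrite !(toCD, toCM); ring.
  rewrite key; congr (toC _ * _).
  rewrite !exprS; move: (shiftN N ^+ p) (expf_neq0 p A1) => Ap Ap0; field.
  by rewrite -?(natrD R 1 m) ?n0 ?A1 ?Ap0.
have HH l : exists w : nat -> R, w @ \oo --> (0 : R) /\ forall N,
   betaI (shiftN N) (fun x : Rn => toC ((x l / shiftN N - 1) ^+ 2 * (1 + (vsum x / shiftN N) ^+ q))) = toC (w N) * b (shiftN N).
  have [w0 c0 h0] := H 0%N l; have [wq cq hq] := H q l.
  exists (fun N => w0 N + wq N); split; first by rewrite -[X in _ --> X]addr0; exact: cvgD.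
  move=> N; rewrite toCD mulrDl -h0 -hq -bID ?A_gt0//; [|exact: tame_dev|exact: tame_dev].
  by apply: bI_eq => x _; rewrite -toCD; congr toC; rewrite expr0; ring.
have [w hw] := boolp.choice HH.
exists (fun N => \sum_(l < n) w l N).
  rewrite (_ : (fun N => _) = \sum_(l < n) w l); last by apply/funext => N; rewrite fct_sumE.
  rewrite [X in _ --> X](_ : 0 = \sum_(l < n) (0 : R)); last by rewrite big1.
  apply: (big_ind2 (fun (f : nat -> R) (c : R) => f @ \oo --> c)); first exact: cvg_cst.
    by move=> f c f' c' hf hf'; exact: cvgD.
  by move=> l _; case: (hw l).
move=> N; rewrite toC_sum big_distrl /= (eq_bigr _ (fun l _ => esym ((hw l).2 N))).
rewrite -bI_sum ?A_gt0//; last first.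
  move=> l; rewrite (_ : (fun x => _) = (fun x : Rn => toC ((x l / shiftN N - 1) ^+ 2 * (vsum x / shiftN N) ^+ 0)
     + toC ((x l / shiftN N - 1) ^+ 2 * (vsum x / shiftN N) ^+ q))); first by apply: tameD; exact: tame_dev.
  by apply/funext => x; rewrite -toCD; congr toC; rewrite expr0; ring.
by apply: bI_eq => x _; rewrite toC_sum.
Qed.

End Asymptotics.
End Moments.

(** * Limits of ratios and concentration at (1, ..., 1) *)

Section LimitOne.
Variable R : realType.
Local Notation C := R[i].

Lemma cvg_lt_near (u : nat -> R) e : u @ \oo --> (0 : R) -> 0 < e -> \forall N \near \oo, u N < e.
Proof. by move=> h e0; near=> N; near: N; exact: (cvgr_lt _ h). Unshelve. all: by end_near. Qed.

Definition cto1 (u : nat -> C) := (fun N => cnorm (u N - 1)) @ \oo --> (0 : R).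

Lemma cto1P u : (forall e : R, 0 < e -> \forall N \near \oo, cnorm (u N - 1) < e) -> cto1 u.
Proof.
move=> h; apply/cvgrPdist_lt => e e0; apply: filterS (h e e0) => N hN.
by rewrite sub0r normrN ger0_norm ?cnorm_ge0.
Qed.

Lemma cto1M u v : cto1 u -> cto1 v -> cto1 (fun N => u N * v N).
Proof.
move=> hu hv.
have h : (fun N => cnorm (u N - 1) * cnorm (v N - 1) + cnorm (u N - 1) + cnorm (v N - 1)) @ \oo --> (0 : R).
  have e : 0 = 0 * 0 + 0 + 0 :> R by rewrite mul0r !addr0.
  rewrite [X in _ --> X]e; apply: cvgD => //; apply: cvgD => //; exact: cvgM.
apply: cto1P => e e0; have := cvg_lt_near h e0; apply: filterS => N; apply: le_lt_trans.
have -> : u N * v N - 1 = (u N - 1) * (v N - 1) + (u N - 1) + (v N - 1) by ring.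
by apply: (le_trans (cnormD _ _)); rewrite lerD2r -cnormM cnormD.
Qed.

Lemma cto1_prod I (r : seq I) (u : I -> nat -> C) : (forall i, cto1 (u i)) -> cto1 (fun N => \prod_(i <- r) u i N).
Proof.
move=> h; elim: r => [|i r IH].
  apply: cto1P => e e0; apply: nearW => N; by rewrite big_nil subrr cnorm0.
rewrite (_ : (fun N => _) = (fun N => u i N * \prod_(j <- r) u j N)); first exact: cto1M.
by apply/funext => N; rewrite big_cons.
Qed.

(** Since al v = be u, the difference al - be equals be (u - 1) - al (v - 1), which tends to 0. *)
Lemma cto1_proportional u v (X : nat -> C) (al be : C) : cto1 u -> cto1 v ->
  (forall N, u N = al * X N) -> (forall N, v N = be * X N) -> al = be.
Proof.
move=> hu hv eu ev; apply/eqP; rewrite -subr_eq0 -cnorm_eq0; apply/negPn/negP => nz.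
have c0 : 0 < cnorm (al - be) by rewrite lt_def nz cnorm_ge0.
have h : (fun N => cnorm al * cnorm (v N - 1) + cnorm be * cnorm (u N - 1)) @ \oo --> (0 : R).
  have e : 0 = cnorm al * 0 + cnorm be * 0 :> R by rewrite !mulr0 addr0.
  by rewrite [X in _ --> X]e; apply: cvgD; exact: cvgMr.
have /filter_ex[N] := cvg_lt_near h c0.
rewrite -!cnormM; apply/negP; rewrite -leNgt.
have -> : al - be = - (al * (v N - 1)) + be * (u N - 1) by rewrite eu ev; ring.
by apply: (le_trans (cnormD _ _)); rewrite cnormN.
Qed.

End LimitOne.

Section Concentration.
Variables (R : realType) (m : nat) (k : R).
Hypothesis k0 : 0 <= k.
Local Notation C := R[i].
Local Notation Re := (@complex.Re R).
Local Notation n := m.+1.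
Local Notation Rn := (vec R n).
Local Notation D := (@vpos R n).
Local Notation betaI := (betaI k).
Local Notation b a := (betaI a (fun _ : Rn => 1)).
Variable a : R.
Hypothesis a0 : 0 < a.
Hypothesis b_neq0 : forall a', 0 < a' -> b a' != 0.
Local Notation shiftN := (shiftN a).

Variables (g : Rn -> C) (d : C).
Hypothesis tg : tame g.
Hypothesis g_homog : forall r x, 0 < r -> D x -> g (rsc r x) = cexp (toC (ln r) * d) * g x.
Hypothesis g_near1 : forall e, 0 < e -> exists2 dl, 0 < dl & forall y, D y ->
  (forall i, `|y i - 1| < dl) -> cnorm (g y - 1) < e.

Definition dev q (y : Rn) : R := \sum_(l < n) (y l - 1) ^+ 2 * (1 + vsum y ^+ q).

Lemma dev_ge0 q y : D y -> 0 <= dev q y.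
Proof.
by move=> yp; apply: sumr_ge0 => l _; rewrite mulr_ge0 ?sqr_ge0// addr_ge0// exprn_ge0// vsum_ge0.
Qed.

(** Either all coordinates of y are close to 1 and g is close to 1, or some |y_l - 1| >= dl and
    [dev] absorbs the polynomial bound of g. *)
Lemma dev_bound e : 0 < e -> exists K q, 0 <= K /\ forall y, D y -> cnorm (g y - 1) <= e + K * dev q y.
Proof.
move=> e0; have [dl dl0 hdl] := g_near1 e0; have [_ [B [q [B0 hB]]]] := tg.
have K0 : 0 <= (B + 1) / dl ^+ 2 by rewrite divr_ge0 ?sqr_ge0// addr_ge0.
exists ((B + 1) / dl ^+ 2), q; split=> // y yp.
have S0 := vsum_ge0 yp; have d0 := dev_ge0 q yp.
have [hy|] := pselect (forall i, `|y i - 1| < dl).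
  by apply: (le_trans (ltW (hdl y yp hy))); rewrite lerDl mulr_ge0.
move=> /existsNP[l /negP]; rewrite -leNgt => hl.
apply: (@le_trans _ _ ((B + 1) * (1 + vsum y ^+ q))).
  apply: (le_trans (cnormB _ _)); rewrite cnorm1 mulrDl mul1r lerD//; first exact: hB.
  by rewrite lerDl exprn_ge0.
apply: (@le_trans _ _ ((B + 1) / dl ^+ 2 * dev q y)); last by rewrite lerDr ltW.
rewrite -mulrA ler_wpM2l ?addr_ge0// mulrC ler_pdivlMr ?exprn_gt0//.
rewrite /dev (bigD1 l)//= [X in _ <= X + _]mulrC -[leLHS]addr0 lerD//.
  rewrite ler_wpM2l ?addr_ge0 ?exprn_ge0//.
  by rewrite -[leRHS]real_normK ?num_real// lerXn2r ?nnegrE ?(ltW dl0).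
by apply: sumr_ge0 => j _; rewrite mulr_ge0 ?sqr_ge0// addr_ge0// exprn_ge0.
Qed.

Lemma tame_devsc q (A : R) : tame (fun x : Rn => toC (\sum_(l < n) (x l / A - 1) ^+ 2 * (1 + (vsum x / A) ^+ q))).
Proof.
rewrite (_ : (fun x => _) = (fun x : Rn => \sum_(l < n) (toC ((x l / A - 1) ^+ 2 * (vsum x / A) ^+ 0)
   + toC ((x l / A - 1) ^+ 2 * (vsum x / A) ^+ q)))); last first.
  apply/funext => x; rewrite toC_sum; apply: eq_bigr => l _; rewrite -toCD; congr toC; rewrite expr0; ring.
by apply: tame_sum => l; apply: tameD; exact: tame_dev.
Qed.

(** Homogeneity writes g(x) as A^d g(x/A) with A = [shiftN a N], and [moment_conc] bounds the mean
    deviation of x/A from 1. *)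
Lemma concentration : cto1 (fun N => betaI (shiftN N) g / (cexp (toC (ln (shiftN N)) * d) * b (shiftN N))).
Proof.
(* One quarter for g near 1 and one for the deviation; their sum is doubled by [cI_norm]. *)
apply: cto1P => e e0; have e4 : 0 < e / 4 by rewrite divr_gt0.
have [K [q [K0 hK]]] := dev_bound e4.
have [w cw hw] := moment_conc m k0 a0 q.
have hKw : (fun N => K * w N) @ \oo --> (0 : R) by rewrite -[X in _ --> X](mulr0 K); exact: cvgMr.
have := cvg_lt_near hKw e4; apply: filterS => N hN.
have A0 := A_gt0 a0 N; move: (shiftN N) A0 (hw N) => A A0 {}hw.
set ka := cexp (toC (ln A) * d).
have ka0 : ka != 0 by exact: cexp_neq0.
pose be := rI (fun x : Rn => expR (- vsum x) * 1 * Wr k A x).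
have bE : b A = toC be by rewrite -bI_real.
have be_ge0 : 0 <= be by apply: Rintegral_ge0 => x _; apply: mulr_ge0; [rewrite mulr1 expR_ge0|exact: Wr_ge0].
have be0 : be != 0 by rewrite -toC_eq0 -bE b_neq0.
have -> : betaI A g / (ka * b A) - 1 = (betaI A g - ka * b A) / (ka * b A).
  by rewrite mulrBl divff// mulf_neq0// b_neq0.
have bB : betaI A g - ka * b A = betaI A (fun x => g x - ka).
  rewrite bIB//; last exact: tame_cst.
  rewrite -bIZ//; last exact: tame_cst.
  by congr (_ - _); apply: bI_eq => x _; rewrite mulr1.
pose M (x : Rn) : R := cnorm ka * (e / 4 + K * \sum_(l < n) (x l / A - 1) ^+ 2 * (1 + (vsum x / A) ^+ q)).
have tM : tame (fun x => toC (M x)).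
  rewrite (_ : (fun x => _) = (fun x : Rn => toC (cnorm ka) * (toC (e / 4) + toC K *
     toC (\sum_(l < n) (x l / A - 1) ^+ 2 * (1 + (vsum x / A) ^+ q))))); last first.
    by apply/funext => x; rewrite -toCM -toCD -toCM.
  by apply: tameZ; apply: tameD; [exact: tame_cst|apply: tameZ; exact: tame_devsc].
have IM : rI (fun x => expR (- vsum x) * M x * Wr k A x) = cnorm ka * (e / 4 + K * w N) * be.
  apply: toC_inj; rewrite -bI_real.
  rewrite (@bI_eq _ _ _ _ _ (fun x : Rn => toC (cnorm ka * (e / 4)) * 1 + toC (cnorm ka * K) *
     toC (\sum_(l < n) (x l / A - 1) ^+ 2 * (1 + (vsum x / A) ^+ q)))); last first.
    by move=> x _; rewrite mulr1 -toCM -toCD; congr toC; rewrite /M; ring.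
  rewrite bID//; [|by apply: tameZ; exact: tame_cst|by apply: tameZ; exact: tame_devsc].
  rewrite !bIZ//; [|exact: tame_devsc|exact: tame_cst].
  by rewrite hw bE -!toCM -toCD; congr toC; ring.
have bnd : cnorm (betaI A g - ka * b A) <= 2 * (cnorm ka * (e / 4 + K * w N) * be).
  rewrite bB -IM; apply: cI_norm; last 1 first.
  - move=> x xp; rewrite [cnorm (_ * _)]cnormM [cnorm (exp_vsum x * _)]cnormM !cnorm_toC.
    rewrite [`|Wr k A x|]ger0_norm ?Wr_ge0// ler_wpM2r ?Wr_ge0// ger0_norm ?expR_ge0// ler_wpM2l ?expR_ge0//.
    have yp : D (rsc A^-1 x) by apply: vpos_rsc => //; rewrite invr_gt0.
    have -> : g x = ka * g (rsc A^-1 x).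
      by rewrite -g_homog// rsc_rsc mulfV ?gt_eqF// rsc1.
    rewrite -{2}[ka]mulr1 -mulrBr cnormM /M ler_wpM2l ?cnorm_ge0//.
    apply: (le_trans (hK _ yp)); rewrite lerD2l ler_wpM2l// /dev vsum_rsc [A^-1 * _]mulrC.
    by apply: ler_sum => l _; rewrite /rsc [A^-1 * _]mulrC.
  - by apply: ci_b => //; apply: tameB => //; exact: tame_cst.
  - exact: rint_b.
rewrite cnormM cnormV ltr_pdivrMr; last by rewrite cnorm_gt0 mulf_neq0// b_neq0.
apply: (le_lt_trans bnd); rewrite cnormM bE cnorm_toC (ger0_norm be_ge0).
have be1 : 0 < be by rewrite lt_def be0.
have P0 : 0 < cnorm ka * be by rewrite mulr_gt0// cnorm_gt0.
rewrite [ltLHS](_ : _ = (2 * (e / 4 + K * w N)) * (cnorm ka * be)); last by ring.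
rewrite ltr_pM2r//; move: hN; move: (K * w N) => v hv; lra.
Qed.

End Concentration.

(** * Link with iterated integrals; powers and the Gamma function *)

Section Link.
Variables (R : realType) (n : nat) (k a : R).
Hypothesis k0 : 0 <= k.
Hypothesis a0 : 0 < a.
Local Notation C := R[i].
Local Notation Rn := (vec R n).
Local Notation D := (@vpos R n).

Lemma cintegral_cI (f h : Rn -> C) : sepcont h -> expbd h ->
  (forall x, D x -> f x = h x * toC (Wr k a x)) -> cintegrable f /\ cintegral f = cI f.
Proof.
move=> sh eh fh.
have cf : ci f by apply: ci_eq (ci_good k0 a0 sh eh) => x xp; rewrite fh.
have [mRe mIm] := ci_meas cf.
have [A A0 hA] := Wr_dom k0 a0 eh.
have bf x : D x -> cnorm (f x) <= A * \prod_(i < n) udom a (x i) by move=> xp; rewrite fh//; exact: hA.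
have mu : measurable_fun (@Rpos R) (udom a) by apply: measurable_cont_pos => t t0; exact: udom_cont.
have u0 (t : R) : 0 < t -> 0 <= udom a t by move=> _; exact: udom_ge0.
have ui := udom_int a0.
split; last first.
  rewrite /cintegral /cI; congr (_ +i* _).
    apply: (iint_realE mu u0 ui mRe) => x xp; exact: le_trans (Re_le_cnorm _) (bf x xp).
  apply: (iint_realE mu u0 ui mIm) => x xp; exact: le_trans (Im_le_cnorm _) (bf x xp).
have sc : sepcont (fun x => toC (cnorm (h x * toC (Wr k a x)))).
  have sM := sepcontM sh (@sepcont_Wr R n k k0 a).
  by move=> x l xp; apply: ccont_real; apply: ccont_cnorm; exact: (sM x l xp).
have [mc _] := cmeas_sepcont sc.
have mf : measurable_fun D (fun x => cnorm (f x)).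
  by apply: eq_measurable_fun mc => x /set_mem xp; rewrite fh.
have /integrableP[_ hi] : rint (fun x => cnorm (f x)).
  apply: (integrable_dominated mf (rintZ A (rint_udom n a0))) => x xp.
  by rewrite ger0_norm ?cnorm_ge0//; exact: bf.
rewrite /cintegrable iint_nnegE//.
- rewrite (eq_integral (fun x => `|(EFin \o (fun x => cnorm (f x))) x|)%E)//.
  by move=> x _ /=; rewrite ger0_norm ?cnorm_ge0.
- exact/measurable_EFinP.
- by move=> x _; rewrite lee_fin cnorm_ge0.
Qed.

End Link.

Section Powers.
Variables (R : realType) (m : nat).
Local Notation C := R[i].
Local Notation Re := (@complex.Re R).
Local Notation n := m.+1.
Local Notation Rn := (vec R n).
Local Notation D := (@vpos R n).

Definition logdet (x : Rn) : R := \sum_(i < n) ln (x i).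
Definition detpow (s : C) (x : Rn) : C := cexp (s * toC (logdet x)).

Lemma detpow0 x : detpow 0 x = 1. Proof. by rewrite /detpow mul0r cexp0. Qed.

Lemma tame_pw s : 0 <= Re s -> tame (detpow s).
Proof.
move=> s0; split.
  move=> x l xp; apply: ccont_cexp; apply: ccontM; first exact: ccont_cst.
  apply: ccont_real; apply: continuous_bigsum => i.
  apply: (@continuous_comp _ _ _ (fun t => upd x l t i) (@ln R)); first exact: upd_cont.
  by apply: continuous_ln; rewrite upd_id; exact: xp.
pose M := Num.bound (Re s * n%:R).
exists 1, M; split=> // x xp; rewrite mul1r cnorm_cexp cReM cIm_toC mulr0 subr0 cRe_toC.
have S0 := vsum_ge0 xp.
apply: (@le_trans _ _ (expR ((Re s * n%:R) * ln (vsum x)))).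
  rewrite ler_expR -mulrA ler_wpM2l// /logdet.
  have -> : n%:R * ln (vsum x) = \sum_(i < n) ln (vsum x) by rewrite sumr_const card_ord mulr_natl.
  apply: ler_sum => i _; rewrite ler_ln ?posrE; [exact: le_vsum|exact: xp|].
  by apply: lt_le_trans (le_vsum i xp); exact: xp.
apply: powln_le => //; rewrite mulr_ge0//=.
by apply: ltW; apply: archi_boundP; rewrite mulr_ge0.
Qed.

Lemma pw_vperm s w x : detpow s (vperm w x) = detpow s x.
Proof. by rewrite /detpow /logdet; congr (cexp (_ * toC _)); rewrite [RHS](reindex_inj (@perm_inj _ w)). Qed.

Lemma pw_deriv s x l : D x -> cderiv (fun t => detpow s (upd x l t)) (x l) (s * toC (x l)^-1 * detpow s x).
Proof.
move=> xp.
have dl : is_derive (x l) (1 : R) (fun t => logdet (upd x l t)) (x l)^-1.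
  rewrite (_ : (fun t => _) = (fun t => ln t + (logdet x - ln (x l)))); last first.
    apply/funext => t; rewrite /logdet (bigD1 l)//= [in RHS](bigD1 l)//= /upd eqxx.
    rewrite (eq_bigr (fun i => ln (x i))) => [|i /negPf -> //]; rewrite -/(upd _ _ _); lra.
  by apply: (is_derive_eq (is_deriveD (is_derive1_ln (xp l)) (is_derive_cst _ _ _))); rewrite addr0.
have := cderiv_cexp (cderivZ s (cderiv_real dl)).
by rewrite upd_id.
Qed.

(** The reflection sum vanishes by symmetry; it is kept to match the form of the equation required
    by [bI_shift]. *)
Lemma dform_pw k s l : dform k l (detpow s)
  (fun x => s * detpow s x + toC k * \sum_(j < n | (l < j)%N) (detpow s x - detpow s (vsw l j x))).
Proof.
move=> x xp xd.
have H := @dform_sym R m k (detpow s) l (fun x => s * toC (x l)^-1 * detpow s x) (pw_vperm s)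
  (fun x xp => pw_deriv s l xp).
apply: cderiv_eq (H x xp xd) _.
rewrite [X in s * detpow s x + _ * X]big1 => [|j _]; last by rewrite /vsw pw_vperm subrr.
rewrite mulr0 addr0 toCV; congr (_ / _ - _).
by rewrite mulrA mulrCA mulfV ?mulr1// toC_eq0 gt_eqF// xp.
Qed.

Lemma pw_homog s r x : 0 < r -> D x -> detpow s (rsc r x) = cexp (toC (ln r) * (n%:R * s)) * detpow s x.
Proof.
move=> r0 xp; rewrite /detpow -cexpD; congr cexp.
have -> : logdet (rsc r x) = n%:R * ln r + logdet x.
  rewrite /logdet (eq_bigr (fun i => ln r + ln (x i))); last by move=> i _; rewrite /rsc lnM// posrE xp.
  by rewrite big_split /= sumr_const card_ord mulr_natl.
by rewrite toCD toCM toC_nat; ring.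
Qed.

Lemma ln_near1 e : 0 < e -> exists2 dl : R, 0 < dl & forall y : R, `|y - 1| < dl -> `|ln y| < e.
Proof.
move=> e0; have /cvgrPdist_lt/(_ _ e0)/nbhs_ballP[dl /= dl0 h] := @continuous_ln R 1 ltr01.
exists dl => // y hy; have := h y; rewrite /ball /= ln1 sub0r normrN; apply.
by rewrite distrC.
Qed.

Lemma pw_near1 s e : 0 < e -> exists2 dl : R, 0 < dl & forall y, D y ->
  (forall i, `|y i - 1| < dl) -> cnorm (detpow s y - 1) < e.
Proof.
move=> e0.
have c : ccont (fun u => cexp (s * toC u)) (0 : R).
  by apply: ccont_cexp; apply: ccontM; [exact: ccont_cst|apply: ccont_real; exact: cvg_id].
have /nbhs_ballP[d1 /= d10 hd1] := ccont_dist e0 c.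
have [dl dl0 hdl] := @ln_near1 (d1 / n%:R) (divr_gt0 d10 (ltr0Sn _ _)).
exists dl => // y yp hy; have := hd1 (logdet y); rewrite mulr0 cexp0; apply.
rewrite /ball /= sub0r normrN; apply: (le_lt_trans (ler_norm_sum _ _ _)).
have -> : d1 = \sum_(i < n) d1 / n%:R.
  by rewrite sumr_const card_ord -[RHS]mulr_natr mulfVK// pnatr_eq0.
by apply: ltr_sum => [|i _]; [apply/hasP; exists ord0; rewrite ?mem_index_enum|exact: hdl].
Qed.

Lemma bI_pw k a t : betaI k a (detpow (toC t)) = betaI k (a + t) (fun _ : Rn => 1).
Proof.
apply: cI_eq => x xp; rewrite /detpow -toCM cexp_toC mulr1 -mulrA -toCM /Wr -/(logdet x).
congr (_ * toC _); rewrite mulrA -expRD; congr (expR _ * _); ring.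
Qed.

End Powers.

Section GammaFunction.
Variable R : realType.
Local Notation C := R[i].
Local Notation Re := (@complex.Re R).

(** In one variable omega is an empty product, so Euler's integral is an exponential moment with k =
    0. Splitting off a > 0 leaves a power with Re s >= 0, which is tame. *)
Lemma cGamma_bI (s : C) a : 0 <= Re s -> 0 < a -> cGamma (s + toC a) = betaI 0 a (@detpow R 0 s).
Proof.
move=> s0 a0; have E (x : vec R 1) : cexp ((s + toC a - 1) * toC (ln (x ord0))) * toC (expR (- x ord0)) =
    exp_vsum x * detpow s x * toC (Wr 0 a x).
  have -> : Wr 0 a x = expR ((a - 1) * ln (x ord0)).
    by rewrite /Wr /omega !big_ord1 big_pred0 ?mulr1//; case=> [[]].
  rewrite /exp_vsum /vsum /detpow /logdet !big_ord1 -cexp_toC -[toC (expR (_ * _))]cexp_toC -!cexpD.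
  by congr cexp; rewrite toCM toCB toC1 toCN; ring.
have [sp pp] := @tame_pw R 0 s s0.
have [_ H] := @cintegral_cI R 1 0 a (lexx 0) a0 _ _ (sepcontM (@sepcont_eS R 1) sp) (expbdM (@expbd_eS R 1) pp) (fun x _ => E x).
by rewrite /cGamma H; apply: cI_eq => x _; exact: E.
Qed.

Hypothesis gam_neq0 : forall a : R, 0 < a -> cGamma (toC a) != 0.

Lemma b1_neq0 a : 0 < a -> betaI 0 a (fun _ : vec R 1 => 1) != 0.
Proof.
move=> a0; have := gam_neq0 a0; rewrite -[toC a]add0r cGamma_bI//; congr (_ != 0).
by apply: bI_eq => x _; rewrite detpow0.
Qed.

(** The functional equation of the Gamma function is the one-variable case of [bI_shift]. *)
Lemma cGamma_shift (s : C) a N : 0 <= Re s -> 0 < a ->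
  cGamma (s + toC (shiftN a N)) = (\prod_(i < N) (s + toC (shiftN a i))) * cGamma (s + toC a).
Proof.
move=> s0 a0; elim: N => [|N IH]; first by rewrite big_ord0 mul1r /shiftN addr0.
have An := A_gt0 a0 N.
have e : shiftN a N.+1 = shiftN a N + 1 by rewrite /shiftN -natr1 addrA.
rewrite big_ord_recr /= e (cGamma_bI s0 (ltr_wpDr ler01 An)).
rewrite (bI_shift (lexx 0) (@tame_pw R 0 s s0) (fun l => @dform_pw R 0 0 s l) An) big_ord1.
rewrite -(cGamma_bI s0 An) IH mul0r addr0; ring.
Qed.

Lemma cGamma_conc (s : C) a : 0 <= Re s -> 0 < a ->
  cto1 (fun N => cGamma (s + toC (shiftN a N)) / (cexp (toC (ln (shiftN a N)) * s) * cGamma (toC (shiftN a N)))).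
Proof.
move=> s0 a0.
have := concentration (lexx 0) a0 b1_neq0 (@tame_pw R 0 s s0) (@pw_homog R 0 s) (@pw_near1 R 0 s).
congr cto1; apply/funext => N; have An := A_gt0 a0 N.
rewrite -cGamma_bI// mul1r; congr (_ / (_ * _)).
rewrite -[toC (shiftN a N)]add0r cGamma_bI//; by apply: bI_eq => x _; rewrite detpow0.
Qed.

End GammaFunction.

Section Ratio.
Variables (R : realType) (m : nat) (k : R).
Hypothesis k0 : 0 <= k.
Local Notation C := R[i].
Local Notation Re := (@complex.Re R).
Local Notation n := m.+1.
Local Notation Rn := (vec R n).
Local Notation D := (@vpos R n).
Local Notation betaI := (betaI k).
Local Notation b a := (betaI a (fun _ : Rn => 1)).
Hypothesis gam_neq0 : forall a : R, 0 < a -> cGamma (toC a) != 0.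
Hypothesis b_neq0 : forall a, 0 < a -> b a != 0.
Variables (g : Rn -> C) (theta : 'I_n -> C).
Hypothesis tg : tame g.
Hypothesis dg : forall l : 'I_n,
  dform k l g (fun x => theta l * g x + toC k * \sum_(j < n | (l < j)%N) (g x - g (vsw l j x))).
Hypothesis g_homog : forall r x, 0 < r -> D x -> g (rsc r x) = cexp (toC (ln r) * \sum_(l < n) theta l) * g x.
Hypothesis g_near1 : forall e, 0 < e -> exists2 dl, 0 < dl & forall y, D y ->
  (forall i, `|y i - 1| < dl) -> cnorm (g y - 1) < e.
(** Up to the exponent of the weight, [tt] holds the linear factors of [bI_shift] for the constant
    function 1, and [ss] those for g. *)
Let tt (l : 'I_n) : C := toC (k * (m%:R - l%:R)).
Let ss l : C := theta l + tt l.
Hypothesis ss0 : forall l, 0 <= Re (ss l).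

Let tt0 l : 0 <= Re (tt l).
Proof. by rewrite /tt /= mulr_ge0// subr_ge0 ler_nat -ltnS. Qed.

Lemma bI_shiftN (f : Rn -> C) (th : 'I_n -> C) a N : 0 < a -> tame f ->
  (forall l : 'I_n, dform k l f (fun x => th l * f x + toC k * \sum_(j < n | (l < j)%N) (f x - f (vsw l j x)))) ->
  betaI (shiftN a N) f = (\prod_(i < N) \prod_(l < n) (th l + tt l + toC (shiftN a i))) * betaI a f.
Proof.
move=> a0 tf df; elim: N => [|N IH]; first by rewrite big_ord0 mul1r /shiftN addr0.
have e : shiftN a N.+1 = shiftN a N + 1 by rewrite /shiftN -natr1 addrA.
rewrite e (bI_shift k0 tf df (A_gt0 a0 N)) IH [in RHS]big_ord_recr /=.
rewrite (eq_bigr (fun l => th l + tt l + toC (shiftN a N))); last by move=> l _; rewrite addrAC.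
by rewrite mulrCA mulrA.
Qed.

(** Passing from a to a + N multiplies both sides by the same product of linear factors. The
    normalised sequences tend to 1 by [concentration] and [cGamma_conc], so [cto1_proportional]
    identifies the constants. *)
Lemma bI_ratio a : 0 < a ->
  betaI a g * \prod_(l < n) cGamma (tt l + toC a) = b a * \prod_(l < n) cGamma (ss l + toC a).
Proof.
move=> a0.
pose PS N := \prod_(i < N) \prod_(l < n) (ss l + toC (shiftN a i)).
pose PT N := \prod_(i < N) \prod_(l < n) (tt l + toC (shiftN a i)).
pose dn (s : C) N := cexp (toC (ln (shiftN a N)) * s).
pose Ga N := cGamma (toC (shiftN a N)).
pose p (s : C) N := cGamma (s + toC (shiftN a N)) / (dn s N * Ga N).
have Ga0 N : Ga N != 0 by rewrite gam_neq0// A_gt0.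
have dn0 s N : dn s N != 0 by exact: cexp_neq0.
have one_dform (l : 'I_n) : dform k l (fun _ : Rn => 1) (fun x => 0 * 1 + toC k * \sum_(j < n | (l < j)%N) (1 - 1 : C)).
  have := @dform_pw R m k 0 l; rewrite (_ : detpow 0 = (fun _ : Rn => 1))//.
  by apply/funext => x; rewrite detpow0.
have bN N : b (shiftN a N) = PT N * b a.
  rewrite (bI_shiftN N a0 (@tame_cst R n 1) one_dform); congr (_ * _).
  by apply: eq_bigr => i _; apply: eq_bigr => l _; rewrite add0r.
have PT0 N : PT N != 0.
  by have := b_neq0 (A_gt0 a0 N); rewrite bN mulf_eq0 negb_or => /andP[].
have prodG (u : 'I_n -> C) N : (forall l, 0 <= Re (u l)) -> \prod_(l < n) p (u l) N =
   (\prod_(i < N) \prod_(l < n) (u l + toC (shiftN a i))) * \prod_(l < n) cGamma (u l + toC a)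
    / (dn (\sum_(l < n) u l) N * Ga N ^+ n).
  move=> u0; rewrite /p big_split /= prodfV; congr (_ / _).
    rewrite exchange_big /= -big_split /=; apply: eq_bigr => l _.
    by rewrite cGamma_shift.
  by rewrite /dn big_distrr /= cexp_sum big_split /= prodr_const card_ord.
have cs : cto1 (fun N => \prod_(l < n) p (ss l) N) by apply: cto1_prod => l; exact: cGamma_conc.
have ct : cto1 (fun N => \prod_(l < n) p (tt l) N) by apply: cto1_prod => l; exact: cGamma_conc.
have cq := concentration k0 a0 b_neq0 tg g_homog g_near1.
pose X N := PS N / (dn (\sum_(l < n) ss l) N * Ga N ^+ n).
have b0 := b_neq0 a0.
have H := @cto1_proportional R _ _ X (betaI a g * \prod_(l < n) cGamma (tt l + toC a) / b a)
   (\prod_(l < n) cGamma (ss l + toC a)) (cto1M cq ct) cs.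
rewrite -H; first by rewrite [RHS]mulrC divfK.
  move=> N; rewrite prodG// (bI_shiftN N a0 tg dg) bN -/(PT N) /X.
  have -> : \sum_(l < n) ss l = \sum_(l < n) theta l + \sum_(l < n) tt l by rewrite -big_split.
  have -> : dn (\sum_(l < n) theta l + \sum_(l < n) tt l) N = dn (\sum_(l < n) theta l) N * dn (\sum_(l < n) tt l) N.
    by rewrite /dn mulrDr cexpD.
  rewrite -/(PS N) -/(dn _ N).
  move: (dn0 (\sum_(l < n) theta l) N) (dn0 (\sum_(l < n) tt l) N) (expf_neq0 n (Ga0 N)) (PT0 N) b0.
  move: (dn _ N) (dn _ N) (Ga N ^+ n) (PT N) (b a) (PS N) (betaI a g) (\prod_(l < n) _) => d1 d2 gn pt b' ps c gt h1 h2 h3 h4 h5.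
  by field; rewrite h5 h4 h3 h2 h1.
by move=> N; rewrite prodG// /X -/(PS N); ring.
Qed.

End Ratio.

(** * The constant *)

Section Boundary.
Variables (R : realType) (m : nat) (k : R).
Hypothesis k0 : 0 <= k.
Local Notation C := R[i].
Local Notation Re := (@complex.Re R).
Local Notation Im := (@complex.Im R).
Local Notation n := m.+1.
Local Notation Rn := (vec R n).
Local Notation D := (@vpos R n).
Local Notation mu := (@lebesgue_measure R).
Local Notation l := (@ord0 m).

Lemma omega_vins0 (y : vec R m) t :
  omega k (vins l t y : Rn) = (\prod_(j < m) `|t - y j| `^ (2 * k)) * omega k y.
Proof.
rewrite /omega big_ord_recl; congr (_ * _).
  rewrite big_mkcond big_ord_recl /= mul1r; apply: eq_bigr => j _.
  by rewrite vins_l -[lift ord0 j]/(lift l j) vins_lift.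
apply: eq_bigr => i _; rewrite big_mkcond big_ord_recl /= mul1r -big_mkcond /=.
by apply: eq_big => j //; rewrite -[lift ord0 j]/(lift l j) -[lift ord0 i]/(lift l i) !vins_lift.
Qed.

Lemma vsum_vins0 (y : vec R m) t : vsum (vins l t y : Rn) = t + vsum y.
Proof.
rewrite /vsum big_ord_recl vins_l; congr (_ + _); apply: eq_bigr => j _.
by rewrite -[lift ord0 j]/(lift l j) vins_lift.
Qed.

Lemma Wr1 p (x : vec R p) : Wr k 1 x = omega k x.
Proof. by rewrite /Wr subrr mul0r expR0 mul1r. Qed.

(** Unlike the flux in [ibp] this one has no factor x_0, and at a = 1 no power of x_0 either, so it
    keeps a boundary value at x_0 = 0. *)
Let Q (x : Rn) : C := exp_vsum x * toC (Wr k 1 x).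
Let dQ (x : Rn) : C := - Q x + \sum_(j < n | j != l) 2 * sterm k 1 0 l j (@exp_vsum R n) x.

Lemma Q_deriv x : D x -> vdistinct x -> cderiv (fun t => Q (upd x l t)) (x l) (dQ x).
Proof.
move=> xp xd.
have dE : cderiv (fun t => exp_vsum (upd x l t)) (x l) (- exp_vsum x).
  have := @dform_eS R m k l x xp xd; rewrite big1 ?mulr0 ?subr0; last first.
    by move=> j _; rewrite /vsw eS_vperm subrr mul0r.
  by move=> h; apply: cderiv_eq h _; rewrite mulN1r mulNr mulNr mulrAC mulfV ?mul1r// toC_eq0 gt_eqF// xp.
apply: cderiv_eq (cderivM dE (Wr_deriv k 1 l xp xd)) _; rewrite !upd_id /dQ /Q mulNr; congr (_ + _).
rewrite subrr toC0 mul0r add0r !mulrA mulr_sumr; apply: eq_bigr => j _.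
rewrite /sterm mul0r expR0 toC1 toCM toC_nat mul1r; ring.
Qed.

Let sE : sepcont (@exp_vsum R n) := @sepcont_eS R n.
Let eE : expbd (@exp_vsum R n) := @expbd_eS R n.

Lemma ci_sterm_eS (j : 'I_n) : j != l -> ci (sterm k 1 0 l j (@exp_vsum R n)).
Proof. by move=> jl; apply: ci_sterm => //; rewrite subrr addr0. Qed.

(** The term is antisymmetric under the exchange of x_l and x_j, and the measure is invariant. *)
Lemma cI_sterm_eS (j : 'I_n) : j != l -> cI (sterm k 1 0 l j (@exp_vsum R n)) = 0.
Proof.
move=> jl; have i1 := ci_sterm_eS jl.
have : cI (fun x => sterm k 1 0 l j (@exp_vsum R n) (vperm (tperm l j) x)) = cI (fun x => - sterm k 1 0 l j (@exp_vsum R n) x).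
  apply: cI_eq => x _; rewrite /sterm !mul0r eS_vperm Wr_vperm /vperm tpermL tpermR -opprB toCN invrN; ring.
rewrite cI_vperm// cI_N// => h; have h2 : cI (sterm k 1 0 l j (@exp_vsum R n)) *+ 2 == 0.
  by rewrite mulr2n {2}h subrr.
by apply/eqP; move: h2; rewrite mulrn_eq0.
Qed.

Lemma ci_Q : ci Q. Proof. exact: ci_good. Qed.

Lemma ci_dQ1 : ci dQ.
Proof.
apply: ciD; first by apply: ciN; exact: ci_Q.
by apply: ci_sum => j jl; apply: ciZ; exact: ci_sterm_eS.
Qed.

Lemma cI_dQ1 : cI dQ = - cI Q.
Proof.
have is_ j : j != l -> ci (fun x => 2 * sterm k 1 0 l j (@exp_vsum R n) x) by move=> jl; apply: ciZ; exact: ci_sterm_eS.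
rewrite /dQ cI_D; [|by apply: ciN; exact: ci_Q|exact: ci_sum].
rewrite cI_N; last exact: ci_Q.
rewrite cI_sum// big1 ?addr0// => j jl.
by rewrite cI_Z ?cI_sterm_eS ?mulr0//; exact: ci_sterm_eS.
Qed.

Let F (y : vec R m) (t : R) : R := expR (- (t + vsum y)) * ((\prod_(j < m) `|t - y j| `^ (2 * k)) * omega k y).

Lemma Q_vins y t : Q (vins l t y) = toC (F y t).
Proof. by rewrite /Q /exp_vsum Wr1 omega_vins0 vsum_vins0 /F -toCM. Qed.

Lemma F_cont y t : {for t, continuous (F y)}.
Proof.
apply: (@cvgM _ _ _ (nbhs_filter t)).
  apply: (@continuous_comp R R R (fun s : R => - (s + vsum y)) (@expR R)); last exact: continuous_expR.
  by apply: cvgN; apply: cvgD; [exact: cvg_id|exact: cst_continuous].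
suff H : {for t, continuous (fun s => \prod_(j < m) `|s - y j| `^ (2 * k))}.
  by apply: (@cvgM _ _ _ (nbhs_filter t)); [exact: H|exact: cst_continuous].
rewrite (_ : (fun s => _) = \prod_(j < m) (fun s : R => `|s - y j| `^ (2 * k))); last first.
  by apply/funext => s; rewrite fct_prodE.
apply: (big_ind (fun f : R -> R => {for t, continuous f})).
- exact: cst_continuous.
- by move=> f g cf cg; exact: continuousM.
- move=> j _; apply: (@continuous_comp R R R (fun s : R => s - y j) (fun s => `|s| `^ (2 * k))).
    by apply: continuousB; [exact: cvg_id|exact: cst_continuous].
  by apply: cont_abs_powR; rewrite mulr_ge0.
Qed.

(** At t = 0 the factors |t - y_j|^(2k) become y_j^(2k), which raises the exponent parameter from 1
    to 1 + 2k. *)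
Lemma F_at0 y : vpos y -> F y 0 = expR (- vsum y) * 1 * Wr k (1 + 2 * k) y.
Proof.
move=> yp; rewrite /F add0r mulr1; congr (_ * _); rewrite /Wr; congr (_ * _).
rewrite (addrC 1) addrK expR_sumln; apply: eq_bigr => j _.
by rewrite sub0r normrN gtr0_norm ?yp// /powR gt_eqF// yp.
Qed.

Lemma F_infty y : vpos y -> F y @ +oo --> (0 : R).
Proof.
move=> yp; have [A [e [A0 e0 hA]]] := expbdM eE (@polybd_omega R n k k0).
have S0 := vsum_ge0 yp.
have hF (t : R) : 0 < t -> `|F y t| <= A * expR (- e * t).
  move=> t0; rewrite -cnorm_toC -Q_vins /Q Wr1.
  apply: (le_trans (hA _ _)); first by apply/vpos_vins.
  rewrite ler_wpM2l// ler_expR vsum_vins0 !mulNr lerN2 mulrDr lerDl mulr_ge0 ?(ltW e0)//.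
apply/cvgrPdist_lt => d d0; near=> t.
rewrite sub0r normrN.
have t0 : 0 < t by near: t; exact: nbhs_pinfty_gt.
have ht : A / (e * d) < t by near: t; apply: nbhs_pinfty_gt; exact: num_real.
apply: (le_lt_trans (hF t t0)); rewrite mulNr expRN ltr_pdivrMr ?expR_gt0//.
apply: (@lt_trans _ _ (d * (e * t))).
  have h : A < t * (e * d) by rewrite -ltr_pdivrMr ?mulr_gt0.
  by rewrite [ltRHS](_ : _ = t * (e * d))//; ring.
rewrite ltr_pM2l//; apply: lt_le_trans (expR_ge1Dx _); by rewrite ltrDr.
Unshelve. all: by end_near. Qed.

Lemma ccont_dQ1 x : D x -> vdistinct x -> ccont (fun t => dQ (upd x l t)) (x l).
Proof.
move=> xp xd.
have sW := sepcont_Wr k0 1 (n := n).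
have sQ : sepcont Q by exact: sepcontM.
apply: ccontD; first by apply: ccontN; exact: (sQ x l xp).
apply: ccont_sum => j jl; apply: ccontM; first exact: ccont_cst.
apply: ccontM; first exact: ccont_cst.
apply: ccontM; last exact: (sW x l xp).
apply: ccontM; last exact: (sE l xp).
apply: ccontM.
  rewrite (_ : (fun s => _) = (fun=> 1)); first exact: ccont_cst.
  by apply/funext => s; rewrite mul0r expR0.
apply: ccontV_real; first by apply: continuousB; exact: upd_cont.
by rewrite upd_id subr_eq0; apply: xd; rewrite eq_sym.
Qed.

(** The derivative of Q integrates to -cI Q, its singular terms vanishing by antisymmetry; slice by
    slice it integrates to minus the boundary value F y 0. *)
Lemma bI_boundary : betaI k 1 (fun _ : Rn => 1) = betaI k (1 + 2 * k) (fun _ : vec R m => 1).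
Proof.
have k1 : 0 < 1 + 2 * k by rewrite ltr_wpDr// mulr_ge0.
pose v (y : vec R m) : R := - (expR (- vsum y) * 1 * Wr k (1 + 2 * k) y).
have tv : ci (fun y : vec R m => exp_vsum y * 1 * toC (Wr k (1 + 2 * k) y)).
  by apply: ci_b => //; exact: tame_cst.
have vE y : - v y = Re (exp_vsum y * 1 * toC (Wr k (1 + 2 * k) y)).
  by rewrite opprK mulr1 [exp_vsum y * 1]mulr1 /exp_vsum -toCM.
have mv : measurable_fun (@vpos R m) v.
  have [h _] := ci_meas (ciN tv); apply: eq_measurable_fun h => y _.
  by rewrite cReN -vE opprK.
have [i1 _] := ci_dQ1.
have H : rI (fun x => Re (dQ x)) = rI v.
  apply: (slice_eq (l := l) i1 mv) => y yp yd ii.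
  have vE' (u : Rn -> C) t : (fun s => u (vins l s y)) = (fun s => u (upd (vins l t y) l s)).
    by apply/funext => s; rewrite upd_vins.
  have FE : F y = (fun t => Re (Q (vins l t y))) by apply/funext => t; rewrite Q_vins.
  rewrite /v -(F_at0 yp) -[RHS]add0r.
  apply: (@FTC_pos R (F y) (fun t => Re (dQ (vins l t y))) [seq y i | i <- enum 'I_m] (F y 0) 0) => //.
  - by move=> t _; exact: F_cont.
  - move=> t t0 ts; rewrite FE; have := @Q_deriv (vins l t y); rewrite vins_l -(vE' Q t).
    by case=> //; [apply/vpos_vins|exact: vdistinct_vins].
  - move=> t t0 ts; have := @ccont_dQ1 (vins l t y); rewrite vins_l -(vE' dQ t).
    by case=> //; [apply/vpos_vins|exact: vdistinct_vins].
  - by apply: cvg_at_right_filter; exact: F_cont.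
  - exact: F_infty.
have h1 : rI (fun x => Re (dQ x)) = - Re (cI Q) by rewrite -cReN -cI_dQ1.
have h2 : rI v = - rI (fun y : vec R m => expR (- vsum y) * 1 * Wr k (1 + 2 * k) y).
  rewrite -[RHS]mulN1r -rI_Z; first by apply: rI_eq => y _; rewrite mulN1r.
  by apply: (@rint_b R k k0 _ k1 m (fun _ => 1)); exact: tame_cst.
rewrite !(@bI_real R k _ _ (fun _ => 1)); congr toC.
have -> : rI (fun x : Rn => expR (- vsum x) * 1 * Wr k 1 x) = Re (cI Q).
  by apply: rI_eq => x _; rewrite /Q /exp_vsum -toCM mulr1.
by apply: oppr_inj; rewrite -h1 -h2.
Qed.

End Boundary.

Section BetaConstant.
Variable R : realType.
Local Notation C := R[i].
Local Notation Re := (@complex.Re R).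

Lemma bI_vec0 k a : betaI k a (fun _ : vec R 0 => 1) = 1.
Proof.
rewrite (@bI_real R k a _ (fun _ => 1)) -toC1; congr toC.
rewrite (@rI_eq R 0 _ (fun _ => 1)); last first.
  by move=> x _; rewrite /vsum /Wr /omega !big_ord0 oppr0 expR0 mulr0 expR0 !mulr1.
by rewrite /rI /Rintegral vmeas0_integral//= => x; rewrite lee_fin.
Qed.

(** The integrand is nonnegative, so a zero integral makes it zero almost everywhere, and changing
    the exponent only multiplies it by another function. *)
Lemma bI_eq0 n k a a' : 0 <= k -> 0 < a -> 0 < a' ->
  betaI k a (fun _ : vec R n => 1) = 0 -> betaI k a' (fun _ : vec R n => 1) = 0.
Proof.
move=> k0 a0 a'0.
pose u b (x : vec R n) := expR (- vsum x) * 1 * Wr k b x.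
have ru b : 0 < b -> rint (u b) by move=> b0; apply: (@rint_b R k k0 b b0 n (fun _ => 1)); exact: tame_cst.
have u0 b x : 0 <= u b x by rewrite /u mulr1 mulr_ge0 ?expR_ge0 ?Wr_ge0.
have mD := @measurable_vpos R n.
have aeE b : 0 < b -> rI (u b) = 0 <-> ae_eq (vmeas R n) (@vpos R n) (EFin \o u b) (cst 0%E).
  move=> b0; have /integrableP[mb ib] := ru b b0.
  rewrite -(ae_eq_integral_abs _ mD mb) /rI /Rintegral.
  have -> : (\int[vmeas R n]_(x in @vpos R n) (u b x)%:E = \int[vmeas R n]_(x in @vpos R n) `|(EFin \o u b) x|)%E.
    by apply: eq_integral => x _ /=; rewrite ger0_norm.
  split=> [h|->//].
  by rewrite -[LHS]fineK ?h// ge0_fin_numE//; exact: integral_ge0.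
rewrite !(@bI_real R k _ n (fun _ => 1)) => h.
have {}h : rI (u a) = 0 by apply: toC_inj.
rewrite -toC0; congr toC; rewrite -/(u a'); apply/(aeE a' a'0); move/(aeE a a0) : h.
apply: filterS => x h xp; have := h xp => /= -[hx]; congr EFin.
have -> : u a' x = expR ((a' - a) * \sum_(i < n) ln (x i)) * u a x; last by rewrite hx mulr0.
have e : expR ((a' - 1) * \sum_(i < n) ln (x i)) =
    expR ((a' - a) * \sum_(i < n) ln (x i)) * expR ((a - 1) * \sum_(i < n) ln (x i)).
  by rewrite -expRD; congr expR; ring.
rewrite /u /Wr e; ring.
Qed.

(** By [bI_eq0] the exponent can be moved to 1, where [bI_boundary] removes one variable; the
    induction ends at the one-point space. *)
Lemma bI_neq0 n k a : 0 <= k -> 0 < a -> betaI k a (fun _ : vec R n => 1) != 0.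
Proof.
move=> k0; elim: n a => [|n IH] a a0; first by rewrite bI_vec0 oner_eq0.
apply/eqP => /(bI_eq0 k0 a0 ltr01); rewrite bI_boundary// => /eqP; apply/negP; apply: IH.
by rewrite ltr_wpDr// mulr_ge0.
Qed.

Lemma cGamma_real (a : R) : 0 < a -> cGamma (toC a) = betaI 0 a (fun _ : vec R 1 => 1).
Proof.
move=> a0; rewrite -[toC a]add0r cGamma_bI//; by apply: bI_eq => x _; rewrite detpow0.
Qed.

Lemma cGamma_neq0 (a : R) : 0 < a -> cGamma (toC a) != 0.
Proof. by move=> a0; rewrite cGamma_real// bI_neq0. Qed.

Lemma cGamma1 : cGamma (toC (1 : R)) = 1.
Proof. by rewrite cGamma_real// bI_boundary// bI_vec0. Qed.

Variable k : R.
Hypothesis k0 : 0 <= k.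

Definition gprod n (a : R) : C := \prod_(j < n) cGamma (toC (k * j%:R) + toC a).

Local Opaque cGamma.

Lemma gprod_rev m a : \prod_(l < m.+1) cGamma (toC (k * (m%:R - l%:R)) + toC a) = gprod m.+1 a.
Proof.
rewrite (reindex_inj rev_ord_inj) /=; apply: eq_bigr => j _.
have -> // : (m%:R - (m.+1 - j.+1)%:R : R) = j%:R.
by rewrite subSS natrB ?opprB 1?addrC ?subrK// -ltnS.
Qed.

Lemma gprod_neq0 n a : 0 < a -> gprod n a != 0.
Proof.
by move=> a0; apply/prodf_neq0 => j _; rewrite -toCD cGamma_neq0// ltr_wpDl// mulr_ge0.
Qed.

(** This is [bI_ratio] for the power Delta^t, which [bI_pw] absorbs into the weight. *)
Lemma bI_gprod_shift m a t : 0 < a -> 0 <= t ->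
  betaI k (a + t) (fun _ : vec R m.+1 => 1) * gprod m.+1 a = betaI k a (fun _ : vec R m.+1 => 1) * gprod m.+1 (a + t).
Proof.
move=> a0 t0.
have hom (r : R) (x : vec R m.+1) : 0 < r -> vpos x ->
    detpow (toC t) (rsc r x) = cexp (toC (ln r) * \sum_(l < m.+1) toC t) * detpow (toC t) x.
  by move=> r0 xp; rewrite pw_homog// sumr_const card_ord -[X in _ = cexp (_ * X) * _]mulr_natl.
have s0 (l : 'I_m.+1) : 0 <= Re (toC t + toC (k * (m%:R - l%:R))).
  by rewrite -toCD cRe_toC addr_ge0// mulr_ge0// subr_ge0 ler_nat -ltnS.
have tp : 0 <= Re (toC t) by [].
have H := bI_ratio k0 cGamma_neq0 (fun a => @bI_neq0 m.+1 k a k0) (@tame_pw R m (toC t) tp) (@dform_pw R m k (toC t)) hom (@pw_near1 R m (toC t)) s0 a0.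
rewrite -bI_pw -gprod_rev H; congr (_ * _).
rewrite -gprod_rev; apply: eq_bigr => l _; congr cGamma; rewrite [toC (a + t)]toCD; ring.
Qed.

Lemma bI_one n a : 0 < a -> betaI k a (fun _ : vec R n => 1) = dnk n k * gprod n a.
Proof.
elim: n a => [|m IH] a a0; first by rewrite bI_vec0 /dnk /gprod !big_ord0 mul1r.
have k1 : 0 < 1 + k by rewrite ltr_wpDr.
have b1 : betaI k 1 (fun _ : vec R m.+1 => 1) = dnk m.+1 k * gprod m.+1 1.
  rewrite bI_boundary// IH; last by rewrite ltr_wpDr// mulr_ge0.
  rewrite /dnk big_ord_recr /= -mulrA; congr (_ * _).
  (* In the product of Gamma(1 + k j) over j <= m+1 the first factor is 1, the second cancels
     against the denominator in [dnk], and the others form [gprod m (1 + 2 * k)]. *)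
  have e1 : gprod m.+1 1 * cGamma (toC (1 + m.+1%:R * k)) = \prod_(j < m.+2) cGamma (toC (k * j%:R) + toC 1).
    by rewrite big_ord_recr /=; congr (_ * cGamma _); rewrite -toCD addrC mulrC.
  rewrite mulrAC [_ * gprod _ _]mulrC e1 !big_ord_recl.
  have -> : cGamma (toC (k * (@ord0 m.+1 : nat)%:R) + toC 1) = 1 by rewrite mulr0 add0r cGamma1.
  have -> : cGamma (toC (k * (lift (@ord0 m.+1) (@ord0 m) : nat)%:R) + toC 1) = cGamma (toC (1 + k)).
    by rewrite /= /bump /= mulr1 -toCD addrC.
  rewrite mul1r mulrAC mulfV ?mul1r ?cGamma_neq0//.
  apply: eq_bigr => j _; congr cGamma; rewrite -!toCD; congr toC.
  by rewrite /= /bump /= !add1n -!natr1; ring.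
(* [bI_gprod_shift] only raises the exponent, so it starts from the smaller of 1 and a. *)
have [a1|a1] := leP 1 a.
  have := @bI_gprod_shift m 1 (a - 1) ltr01; rewrite subr_ge0 => /(_ a1).
  rewrite addrC subrK b1 => h; apply: (mulIf (gprod_neq0 m.+1 ltr01)); rewrite h; ring.
have := @bI_gprod_shift m a (1 - a) a0; rewrite subr_ge0 => /(_ (ltW a1)).
rewrite addrC subrK b1 => h; apply: (mulIf (gprod_neq0 m.+1 ltr01)); rewrite -h; ring.
Qed.

End BetaConstant.

Section KernelAtOne.
Variables (R : realType) (m : nat) (k : R) (G0 : Cn R m.+1 -> Cn R m.+1 -> R[i]).
Hypothesis k0 : 0 <= k.
Hypothesis hG : is_cherednik0 k G0.
Local Notation C := R[i].
Local Notation Re := (@complex.Re R).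
Local Notation Im := (@complex.Im R).
Local Notation n := m.+1.
Local Notation Rn := (vec R n).
Local Notation Cn := (Cn R n).
Local Notation D := (@vpos R n).

Lemma gG_near1 lam e : 0 < e -> exists2 dl : R, 0 < dl & forall y : Rn, D y ->
  (forall i, `|y i - 1| < dl) -> cnorm (gG G0 lam y - 1) < e.
Proof.
move=> e0.
(* In u v - 1 = (u - 1)(v - 1) + (u - 1) + (v - 1) each term is then at most e/3, the cap by 1 being
   used for the product. *)
pose e' := Num.min 1 (e / 3).
have e'0 : 0 < e' by rewrite lt_min ltr01 divr_gt0.
have e'1 : e' <= 1 by rewrite ge_min lexx.
have e'3 : e' <= e / 3 by rewrite ge_min lexx orbT.
have c : ccont (fun u => cexp (n%:R^-1 * toC u * csum lam)) (0 : R).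
  apply: ccont_cexp; apply: ccontM; last exact: ccont_cst.
  by apply: ccontM; [exact: ccont_cst|apply: ccont_real; exact: cvg_id].
have /nbhs_ballP[d1 /= d10 hd1] := ccont_dist e'0 c.
have U : in_C0 (cproj lam) /\ in_tube0 (@cvzero R n).
  split; first exact: csum_cproj.
  split; first by rewrite /in_C0 big1.
  by move=> i j _; rewrite /cvzero subrr normr0 pi_gt0.
have [d2 d20 hd2] := hG.1.1 _ _ U e' e'0.
have h0 : 0 < Num.min (d1 / n%:R) (d2 / 2) by rewrite lt_min !divr_gt0.
have [dl dl0 hdl] := ln_near1 h0.
exists dl => // y yp hy.
have hl i : `|ln (y i)| < d1 / n%:R by apply: (lt_le_trans (hdl _ (hy i))); rewrite ge_min lexx.
have hl2 i : `|ln (y i)| < d2 / 2 by apply: (lt_le_trans (hdl _ (hy i))); rewrite ge_min lexx orbT.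
have sumlt d : (forall i : 'I_n, `|ln (y i)| < d) -> `|\sum_(i < n) ln (y i)| < n%:R * d.
  move=> h; apply: (le_lt_trans (ler_norm_sum _ _ _)).
  have -> : n%:R * d = \sum_(i < n) d by rewrite sumr_const card_ord mulr_natl.
  by apply: ltr_sum => [|i _]; [apply/hasP; exists ord0; rewrite ?mem_index_enum|exact: h].
pose z : Cn := toCn (vln y).
have zs : csum z = toC (\sum_(i < n) ln (y i)) by rewrite toC_sum.
have a1 : cnorm (cexp (n%:R^-1 * csum z * csum lam) - 1) < e'.
  have := hd1 (\sum_(i < n) ln (y i)); rewrite toC0 mulr0 mul0r cexp0 -zs; apply.
  rewrite /ball /= sub0r normrN; apply: (lt_le_trans (sumlt _ hl)).
  by rewrite mulrC divfK// pnatr_eq0.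
have a2 : cnorm (G0 (cproj lam) (cproj z) - 1) < e'.
  rewrite -(hG.2.1 (cproj lam) (csum_cproj _)); apply: hd2.
  - split; first exact: csum_cproj.
    split; first exact: csum_cproj.
    by apply: imV_cproj => i j _; rewrite /z /toCn !cIm_toC subrr normr0 pi_gt0.
  - by move=> i; rewrite subrr cnorm0.
  - move=> i; rewrite /cvzero subr0 cprojE zs -[n%:R](toC_nat R) -toCV -toCM -toCB cnorm_toC.
    apply: (le_lt_trans (ler_normB _ _)); rewrite normrM normfV normr_nat.
    rewrite [d2](_ : _ = d2 / 2 + d2 / 2); last by rewrite -splitr.
    by apply: ltrD; [exact: hl2|rewrite ltr_pdivrMl ?ltr0n//; exact: sumlt].
rewrite /gG GkerE -/z.
move: (cexp _) (G0 _ _) a1 a2 => u v a1 a2.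
have -> : u * v - 1 = (u - 1) * (v - 1) + (u - 1) + (v - 1) by ring.
apply: (le_lt_trans (cnormD _ _)); apply: (@lt_le_trans _ _ (e' * 1 + e' + e')); last lra.
apply: ltrD => //; apply: (le_lt_trans (cnormD _ _)); apply: ler_ltD => //.
by rewrite cnormM ler_pM ?cnorm_ge0 ?ltW// (lt_le_trans a2).
Qed.

(** The value is the same for all l and nonnegative when k >= 0, which gives the condition on real
    parts in [bI_ratio]. *)
Lemma rho_shift (l : 'I_n) : @rho R n k l + k * (m%:R - l%:R) = k / 2 * m%:R.
Proof. by rewrite /rho /=; field. Qed.

Lemma tame_gG lam : (forall i, 0 <= Re (lam i)) -> tame (gG G0 lam).
Proof. by move=> lam0; split; [exact: (sepcont_g hG lam)|exact: (polybd_g k0 hG lam0)]. Qed.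

(** The Gamma product for the constant function 1 in [bI_ratio] cancels against the value from
    [bI_one], leaving [dnk] times the Gamma product of calG. *)
Lemma bI_gG lam a : 0 < a -> (forall i, 0 <= Re (lam i)) ->
  betaI k a (gG G0 lam) = dnk n k *
    \prod_(l < n) cGamma (lam l + toC (@rho R n k l) + toC (k * (m%:R - l%:R)) + toC a).
Proof.
move=> a0 lam0.
have s0 (l : 'I_n) : 0 <= Re (lam l + toC (@rho R n k l) + toC (k * (m%:R - l%:R))).
  by rewrite -addrA -toCD rho_shift cReD cRe_toC addr_ge0// !mulr_ge0.
have hom (r : R) (x : Rn) : 0 < r -> D x -> gG G0 lam (rsc r x) =
    cexp (toC (ln r) * \sum_(l < n) (lam l + toC (@rho R n k l))) * gG G0 lam x.
  by move=> r0 xp; rewrite gG_homog// big_split /= -toC_sum rho_sum0 addr0.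
have := bI_ratio k0 (@cGamma_neq0 R) (fun a => @bI_neq0 R n k a k0) (tame_gG lam0) (dform_gG hG lam) hom (@gG_near1 lam) s0 a0.
rewrite gprod_rev bI_one// -mulrA [gprod _ _ _ * _]mulrC mulrA => h.
exact: (mulIf (gprod_neq0 k0 n a0)).
Qed.

End KernelAtOne.

Section DunklAtOne.
Variables (R : realType) (n : nat) (k : R) (E : Cn R n -> Cn R n -> R[i]).
Hypothesis k0 : 0 <= k.
Hypothesis hE : is_dunkl_kernel k E.
Local Notation C := R[i].
Local Notation Rn := (vec R n).

(** Both functions solve the radial system with spectral parameter (-1, ..., -1) and equal 1 at the
    origin. Distinct coordinates are enough, since the equality is used under an integral. *)
Lemma Er_one (y : Rn) : vdistinct y -> Er E (cvopp (cvconst 1)) y = exp_vsum y.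
Proof.
move=> yd; apply/eqP; rewrite -subr_eq0; apply/eqP.
have vE (x : Rn) s : vsum (rsc s x) = s * vsum x by rewrite /vsum mulr_sumr.
have rS : raycont (@exp_vsum R n).
  move=> x t; apply: ccont_real.
  apply: (@continuous_comp R R R (fun s : R => - vsum (rsc s x)) (@expR R)); last exact: continuous_expR.
  rewrite (_ : (fun s : R => - vsum (rsc s x)) = (fun s : R => - (s * vsum x))); last by apply/funext => s; rewrite vE.
  by apply: cvgN; apply: cvgMl; exact: cvg_id.
have sS : radsol k (cvopp (cvconst 1)) (@exp_vsum R n) (fun _ => 0).
  move=> x _; rewrite /psum big1 ?mulr0 ?subr0 ?addr0; last first.
    by move=> i _; rewrite big1// => j _; rewrite /vsw eS_vperm subrr.
  have -> : cdot (cvopp (cvconst 1)) (toCn x) = toC (- vsum x).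
    rewrite toCN /vsum toC_sum -sumrN; apply: eq_bigr => i _.
    by rewrite /cvopp /cvconst mulN1r.
  rewrite (_ : (fun s => _) = (fun s => cexp (toC (s * - vsum x)))); last first.
    by apply/funext => s; rewrite /exp_vsum vE cexp_toC mulrN.
  have d : is_derive (1 : R) (1 : R) (fun s : R => s * - vsum x) (- vsum x).
    have h := is_deriveM (is_derive_id (1 : R) (1 : R)) (is_derive_cst (- vsum x) (1 : R) (1 : R)).
    by apply: (is_derive_eq h); rewrite /GRing.scale /= mulr0 add0r mulr1.
  apply: cderiv_eq (cderiv_cexp (cderiv_real d)) _.
  by rewrite mul1r cexp_toC.
apply: (radsol_unique k0 (lam := cvopp (cvconst 1)) (f := fun y => Er E (cvopp (cvconst 1)) y - exp_vsum y)) => //.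
- by move=> x t; apply: ccontB; [exact: Er_raycont hE _ x t|exact: rS].
- by apply: radsol_ext (radsolB (Er_radsol hE _) sS) => // x; rewrite subr0.
- by rewrite (Er0 hE) /exp_vsum /vsum big1 ?oppr0 ?expR0 ?subrr.
Qed.

End DunklAtOne.

(** * The theorem *)

Section MainFormula.
Variables (R : realType) (m : nat) (k : R) (E G0 : Cn R m.+1 -> Cn R m.+1 -> R[i]).
Hypothesis k0 : 0 <= k.
Hypothesis hE : is_dunkl_kernel k E.
Hypothesis hG : is_cherednik0 k G0.
Local Notation C := R[i].
Local Notation Re := (@complex.Re R).
Local Notation Im := (@complex.Im R).
Local Notation n := m.+1.
Local Notation Rn := (vec R n).
Local Notation Cn := (Cn R n).
Local Notation D := (@vpos R n).
Local Notation K z := (Er E (cvopp z)).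
Local Notation G := (Gker G0).

(** The projection [cproj] removes the shift, so only the exponential factor sees it. *)
Lemma G_lam_shift lam s z : G (fun i => lam i + s) z = cexp (s * csum z) * G lam z.
Proof.
have n0 : (n%:R : C) != 0 by rewrite pnatr_eq0.
rewrite !GkerE csumD csum_cst mulrA -cexpD; congr (cexp _ * G0 _ _).
  by move: (n%:R : C) n0 => N N0; field.
by apply/funext => i; rewrite !cprojE csumD csum_cst; move: (n%:R : C) n0 => N N0; field.
Qed.

Lemma Phi_one lam a : 0 < a -> (forall i, 0 <= Re (lam i)) ->
  Phi k a E G0 lam (cvconst 1) = betaI k a (gG G0 lam).
Proof.
move=> a0 lam0; have tg := tame_gG k0 hG lam0.
apply: cI_ae; [|exact: ci_b|by move=> x xp xd; rewrite (Er_one k0 hE)].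
have [sg pg] := tg; by apply: (ci_Kf k0 a0 hE) => // i.
Qed.

Variables (mu : C) (lam z : Cn).
Hypothesis hmu : k * m%:R < Re mu.
Hypothesis lam0 : forall i, 0 <= Re (lam i).
Hypothesis z0 : forall i, 0 < Re (z i).
Let a : R := Re mu - k * m%:R.
Let s : C := mu - toC (Re mu).
Let lam' : Cn := fun i => lam i + s.

Let a0 : 0 < a. Proof. by rewrite subr_gt0. Qed.
Let s0 : Re s = 0. Proof. by rewrite /s cReD cReN cRe_toC subrr. Qed.
Let lam'0 i : 0 <= Re (lam' i). Proof. by rewrite /lam' cReD s0 addr0. Qed.

Lemma Deltapow_toCn (x : Rn) w : D x -> Deltapow (toCn x) w = cexp (w * toC (\sum_(i < n) ln (x i))).
Proof.
move=> xp; rewrite /Deltapow toC_sum; congr (cexp (_ * _)); apply: eq_bigr => i _.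
by rewrite /toCn cLog_toC// xp.
Qed.

Lemma weightE (x : Rn) : D x ->
  cexp (s * toC (\sum_(i < n) ln (x i))) * toC (Wr k a x) =
  Deltapow (toCn x) (mu - toC (k * m%:R) - 1) * toC (omega k x).
Proof.
move=> xp; rewrite Deltapow_toCn// /Wr; set L := \sum_(i < n) ln (x i).
rewrite (toCM (expR ((a - 1) * L)) (omega k x)) mulrA -(cexp_toC ((a - 1) * L)) -cexpD (toCM (a - 1) L).
rewrite -(mulrDl s); have -> // : s + toC (a - 1) = mu - toC (k * m%:R) - 1.
by rewrite /s /a (toCB _ 1) (toCB (Re mu)) toC1; ring.
Qed.

Lemma gG_lam' (x : Rn) : gG G0 lam' x = cexp (s * toC (\sum_(i < n) ln (x i))) * gG G0 lam x.
Proof. by rewrite /gG /lam' G_lam_shift /csum toC_sum. Qed.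

Definition gamma_product : C := \prod_(l < n) cGamma (lam l + toC (@rho R n k l) + mu - toC (k * l%:R)).

Lemma Phi_final (w : Cn) : (forall i, 0 < Re (w i)) ->
  Phi k a E G0 lam' w = dnk n k * gamma_product * calG G0 lam (cvinv w) * Deltapow w (- mu).
Proof.
move=> w0; rewrite (Phi_formula k0 a0 hE hG lam'0)// Phi_one// bI_gG//.
have -> : \prod_(l < n) cGamma (lam' l + toC (@rho R n k l) + toC (k * (m%:R - l%:R)) + toC a) = gamma_product.
  apply: eq_bigr => l _; have -> // : lam' l + toC (@rho R n k l) + toC (k * (m%:R - l%:R)) + toC a =
    lam l + toC (@rho R n k l) + mu - toC (k * l%:R).
  by rewrite /lam' /s /a mulrBr !toCB; ring.
have -> : calG G0 lam' (cvinv w) = cexp (- (s * csum (cvlog w))) * calG G0 lam (cvinv w).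
  rewrite /calG /lam' G_lam_shift; congr (cexp _ * _).
  rewrite -mulrN /csum -sumrN; congr (_ * _); apply: eq_bigr => i _.
  by rewrite /cvlog /cvinv cLogV.
have -> : Deltapow w (- mu) = cexp (- (s * csum (cvlog w))) * Deltapow w (- toC (mu_of_weight m k a)).
  rewrite /Deltapow -cexpD; congr cexp; rewrite /csum /mu_of_weight /a subrK /s.
  by rewrite -/(cvlog _); ring.
ring.
Qed.

Lemma sepcont_K w : sepcont (K w). Proof. exact: (sepcont_Er hE (cvopp w)). Qed.

Lemma laplace_calG : let f1 := fun x : Rn =>
    E (cvopp z) (toCn x) * calG G0 lam (toCn x)
      * Deltapow (toCn x) (mu - toC (k * m%:R) - 1) * toC (omega k x) in
  cintegrable f1 /\
  cintegral f1 = dnk n k * gamma_product * calG G0 lam (cvinv z) * Deltapow z (- mu).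
Proof.
move=> f1; have [sg pg] := tame_gG k0 hG lam'0.
have fE x : D x -> f1 x = K z x * gG G0 lam' x * toC (Wr k a x).
  move=> xp; rewrite /f1 calG_gG// gG_lam' -mulrA -weightE// /Er; ring.
have [] := cintegral_cI k0 a0 (sepcontM (sepcont_K z) sg) (expbdM (expbd_K k0 hE z0) pg) fE.
move=> h1 h2; split=> //; rewrite h2 -Phi_final//; exact: cI_eq.
Qed.

Lemma K_vperm w x : K z (vperm w x) = K (pact (w^-1)%g z) x.
Proof.
rewrite -(Er_equi k0 hE (cvopp z) w^-1) -[in LHS]/(vperm w x).
by congr (Er _ _ _); apply/funext => i; rewrite /vperm permKV.
Qed.

(** The symmetrised [FS] is invariant, so the n! integrals containing E(-z, w x) agree and cancel
    one factor 1/n!. In the remaining integral equivariance moves the permutations of g to z, where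
    part (1) applies. *)
Lemma laplace_calF : let f2 := fun x : Rn =>
    Jker E (cvopp z) (toCn x) * calF G0 lam (toCn x)
      * Deltapow (toCn x) (mu - toC (k * m%:R) - 1) * toC (omega k x) in
  cintegrable f2 /\
  cintegral f2 = dnk n k * gamma_product * calF G0 lam (cvinv z) * Deltapow z (- mu).
Proof.
move=> f2; have [sg pg] := tame_gG k0 hG lam'0.
pose c : C := (n`!%:R)^-1.
have c0 : c * n`!%:R = 1 by rewrite mulVf// pnatr_eq0 -lt0n fact_gt0.
pose J (x : Rn) := \sum_(w : 'S_n) K z (vperm w x).
pose FS (x : Rn) := \sum_(w : 'S_n) gG G0 lam' (vperm w x).
have FSs v x : FS (vperm v x) = FS x.
  rewrite /FS [RHS](reindex_inj (mulIg v)) /=; apply: eq_bigr => w _.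
  by rewrite vperm_vperm.
have tF : tame FS by apply: tame_sum => w; exact: (tame_vperm w (conj sg pg)).
have sJ : sepcont J by apply: sepcont_sum => w _; exact: (sepcont_vperm w (sepcont_K z)).
have eJ : expbd J.
  have [A [e [A0 e0 hA]]] := expbd_K k0 hE z0.
  exists (#|{: 'S_n}|%:R * A), e; split=> //; first by rewrite mulr_ge0.
  move=> x xp; apply: (le_trans (cnorm_sum _ _ _)).
  rewrite -mulrA mulr_natl -sumr_const; apply: ler_sum => w _.
  by rewrite -(vsum_vperm w x); apply: hA; apply/vpos_vperm.
have sumln w (x : Rn) : \sum_(i < n) ln (vperm w x i) = \sum_(i < n) ln (x i).
  by rewrite [RHS](reindex_inj (@perm_inj _ w)).
have fE x : D x -> f2 x = (c * c) * (J x * FS x) * toC (Wr k a x).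
  move=> xp; rewrite /f2 /Jker /calF /Fker -/c -[LHS]mulrA -weightE//.
  have -> : \sum_(w : 'S_n) E (cvopp z) (pact w (toCn x)) = J x by [].
  have -> : FS x = cexp (s * toC (\sum_(i < n) ln (x i))) * \sum_(w : 'S_n) Gker G0 lam (pact w (cvlog (toCn x))).
    rewrite big_distrr /=; apply: eq_bigr => w _; rewrite gG_lam' sumln; congr (_ * _).
    rewrite -calG_gG; last exact/vpos_vperm.
    by rewrite /calG.
  ring.
have sJF := sepcontM sJ tF.1; have eJF := expbdM eJ tF.2.
have [] := cintegral_cI k0 a0 (sepcontZ (c * c) sJF) (expbdZ (c * c) eJF) fE.
move=> h1 h2; split=> //; rewrite h2.
have iKF : ci (fun x => K z x * FS x * toC (Wr k a x)).
  by apply: (ci_Kf k0 a0 hE z0); [exact: tF.1|exact: tF.2].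
have iKF' w : ci (fun x => K z (vperm w x) * FS x * toC (Wr k a x)).
  by apply: ci_eq (ci_vperm w iKF) => x _; rewrite FSs Wr_vperm.
have iKg w : ci (fun x => K z x * gG G0 lam' (vperm w x) * toC (Wr k a x)).
  have tw := tame_vperm w (conj sg pg).
  by apply: (ci_Kf k0 a0 hE z0); [exact: tw.1|exact: tw.2].
have -> : cI f2 = c * c * (n`!%:R * cI (fun x => K z x * FS x * toC (Wr k a x))).
  rewrite (cI_eq (g := fun x => (c * c) * \sum_(w : 'S_n) (K z (vperm w x) * FS x * toC (Wr k a x)))); last first.
    by move=> x xp; rewrite fE// -[LHS]mulrA; congr (_ * _); rewrite /J big_distrl big_distrl.
  rewrite cI_Z; last by apply: ci_sum.
  rewrite cI_sum//; congr (_ * _).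
  rewrite (eq_bigr (fun=> cI (fun x => K z x * FS x * toC (Wr k a x)))); last first.
    move=> w _; rewrite -[RHS](cI_vperm w iKF); apply: cI_eq => x _.
    by rewrite FSs Wr_vperm.
  by rewrite sumr_const card_Sn -[LHS]mulr_natl.
have -> : cI (fun x => K z x * FS x * toC (Wr k a x)) = \sum_(w : 'S_n) Phi k a E G0 lam' (pact w z).
  rewrite (cI_eq (g := fun x => \sum_(w : 'S_n) K z x * gG G0 lam' (vperm w x) * toC (Wr k a x))); last first.
    by move=> x xp; rewrite /FS big_distrr big_distrl.
  rewrite cI_sum; last by move=> w _; exact: iKg.
  apply: eq_bigr => w _.
  rewrite -[LHS](cI_vperm (w^-1)%g (iKg w)); apply: cI_eq => x _.
  rewrite K_vperm invgK Wr_vperm vperm_vperm; congr (_ * gG _ _ _ * _).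
  by rewrite mulgV vperm1.
rewrite (eq_bigr (fun w => dnk n k * gamma_product * Deltapow z (- mu) * Gker G0 lam (pact w (cvlog (cvinv z))))); last first.
  move=> w _; rewrite Phi_final//; last by move=> i; exact: z0.
  have -> : Deltapow (pact w z) (- mu) = Deltapow z (- mu).
    by rewrite /Deltapow; congr (cexp (_ * _)); rewrite [RHS](reindex_inj (@perm_inj _ w)).
  have -> : calG G0 lam (cvinv (pact w z)) = Gker G0 lam (pact w (cvlog (cvinv z))) by [].
  ring.
rewrite -big_distrr /= /calF /Fker -/c.
move: (\sum_(w : 'S_n) _) => SS; rewrite -[c * c * _]mulrA [c * (n`!%:R * _)]mulrA c0; ring.
Qed.

End MainFormula.

Theorem theorem5p3 (R : realType) (n : nat) (k : R)
    (E G0 : Cn R n -> Cn R n -> R[i]) (mu : R[i]) (lam z : Cn R n) :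
  0 <= k ->
  is_dunkl_kernel k E ->
  is_cherednik0 k G0 ->
  k * (n%:R - 1) < complex.Re mu ->
  (forall i, 0 <= complex.Re (lam i)) ->
  (forall i, 0 < complex.Re (z i)) ->
  let mu0 := k * (n%:R - 1) in
  let lrm : Cn R n := fun j => lam j + toC (@rho R n k j) + mu in
  let f1 := fun x : Rn R n =>
    E (cvopp z) (toCn x) * calG G0 lam (toCn x)
      * Deltapow (toCn x) (mu - toC mu0 - 1) * toC (omega k x) in
  let f2 := fun x : Rn R n =>
    Jker E (cvopp z) (toCn x) * calF G0 lam (toCn x)
      * Deltapow (toCn x) (mu - toC mu0 - 1) * toC (omega k x) in
  (cintegrable f1 /\
   cintegral f1 = Gamma_n k lrm * calG G0 lam (cvinv z) * Deltapow z (- mu))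
  /\
  (cintegrable f2 /\
   cintegral f2 = Gamma_n k lrm * calF G0 lam (cvinv z) * Deltapow z (- mu)).
Proof.
move=> k0; case: n E G0 lam z => [|m] E G0 lam z hE hG hmu lam0 z0 mu0 lrm f1 f2.
  (* In dimension zero there is a single point: the integrals are values at it, and apart from the
     Cherednik kernel every factor is 1. *)
  have v0 (u v : Cn R 0) : u = v by apply/funext; case.
  have ci1 (f : Rn R 0 -> R[i]) : cintegrable f /\ cintegral f = f (fun=> 0).
    by split; [exact: ltry|rewrite /cintegral /=; case: (f _)].
  have E1 u : E (cvopp z) u = 1 by rewrite (v0 u (@cvzero R 0)) hE.2.1.
  have D1 (u : Cn R 0) w : Deltapow u w = 1 by rewrite /Deltapow big_ord0 mulr0 cexp0.
  have G1 : Gamma_n k lrm = 1 by rewrite /Gamma_n /dnk !big_ord0 mulr1.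
  have o1 x : toC (@omega R 0 k x) = 1 by rewrite /omega big_ord0.
  split; (split; first exact: (ci1 _).1); rewrite (ci1 _).2 G1 D1 ?/f1 ?/f2 D1 o1 !mulr1 mul1r.
    by rewrite E1 mul1r (v0 (toCn _) (cvinv z)).
  rewrite (v0 (toCn (fun=> 0)) (cvinv z)) /Jker (eq_bigr (fun=> 1)) => [|w _]; last exact: E1.
  by rewrite sumr_const card_Sn mulVf ?mul1r// pnatr_eq0.
have mE : mu0 = k * m%:R by rewrite /mu0 -natr1 addrK.
have GE : Gamma_n k lrm = dnk m.+1 k * gamma_product k mu lam by [].
rewrite GE; move: hmu; rewrite -/mu0 mE => hmu.
have := laplace_calG k0 hE hG hmu lam0 z0; have := laplace_calF k0 hE hG hmu lam0 z0.
by rewrite /f1 /f2 mE.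
Qed.
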